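(* Assume in addition $\mathbb E X_0^3<\infty$ and $\mathbb E\varepsilon_1^3<\infty$. Then $$\begin{bmatrix}\sqrt n(\hat\alpha_n-\alpha)\\ \sqrt n(\hat\mu_{\varepsilon,n}-\mu_\varepsilon)\end{bmatrix}\to\mathcal N\Big(\begin{bmatrix}0\\0\end{bmatrix},B_{\alpha,\varepsilon}\Big)$$ in distribution as $n\to\infty$. Moreover, conditionally on the values $(Y_{s-1},Y_{s+1})$, $$\sqrt n\Big(\hat\theta_n-\Big(Y_s-\frac{\alpha}{1+\alpha^2}(Y_{s-1}+Y_{s+1})-\frac{1-\alpha}{1+\alpha^2}\mu_\varepsilon\Big)\Big)\to\mathcal N\big(0,d_{\alpha,\varepsilon}^\top B_{\alpha,\varepsilon}d_{\alpha,\varepsilon}\big),$$ where $d_{\alpha,\varepsilon}=\frac{1}{(1+\alpha^2)^2}\begin{bmatrix}(\alpha^2-1)(Y_{s-1}+Y_{s+1})+(2\alpha+1-\alpha^2)\mu_\varepsilon\\-(1+\alpha^2)(1-\alpha)\end{bmatrix}$.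
   Context: INAR(1) process: Let $\alpha\in(0,1)$. Let $(\varepsilon_k)_{k\in\mathbb N}$ be i.i.d. non-negative integer-valued random variables with $\mathbb E\varepsilon_1^2<\infty$ and $\mathbb P(\varepsilon_1\ne 0)>0$; write $\mu_\varepsilon=\mathbb E\varepsilon_1$ and $\sigma_\varepsilon^2=\operatorname{Var}\varepsilon_1$. For each $k\in\mathbb N$ let $(\xi_{k,j})_{j\in\mathbb N}$ be i.i.d. Bernoulli random variables with mean $\alpha$, these sequences being mutually independent and independent of $(\varepsilon_k)$. Let $X_0$ be a non-negative integer-valued random variable with $\mathbb E X_0^2<\infty$, independent of all $\xi_{k,j}$ and $\varepsilon_k$, and set $X_k=\sum_{j=1}^{X_{k-1}}\xi_{k,j}+\varepsilon_k$ for $k\in\mathbb N$. This Markov chain has a unique stationary distribution; $\tilde X$ denotes a random variable with that distribution, and $$A_{\alpha,\varepsilon}=\alpha(1-\alpha)\begin{bmatrix}\mathbb E\tilde X^3&\mathbb E\tilde X^2\\ \mathbb E\tilde X^2&\mathbb E\tilde X\end{bmatrix}+\sigma_\varepsilon^2\begin{bmatrix}\mathbb E\tilde X^2&\mathbb E\tilde X\\ \mathbb E\tilde X&1\end{bmatrix},\qquad B_{\alpha,\varepsilon}=\begin{bmatrix}\mathbb E\tilde X^2&\mathbb E\tilde X\\ \mathbb E\tilde X&1\end{bmatrix}^{-1}A_{\alpha,\varepsilon}\begin{bmatrix}\mathbb E\tilde X^2&\mathbb E\tilde X\\ \mathbb E\tilde X&1\end{bmatrix}^{-1}.$$ Additive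 outlier: fix a known time $s\in\mathbb N$ and size $\theta\in\mathbb N$, and let $Y_k=X_k+\delta_{k,s}\theta$, $k\in\mathbb Z_+$; $\mathbf Y_n=(Y_0,\dots,Y_n)$. For $n\ge\max(3,s+1)$, $$Q_n(\mathbf y_n;\alpha',\mu'_\varepsilon,\theta')=\sum_{\substack{k=1\\k\notin\{s,s+1\}}}^n(y_k-\alpha'y_{k-1}-\mu'_\varepsilon)^2+(y_s-\alpha'y_{s-1}-\mu'_\varepsilon-\theta')^2+(y_{s+1}-\alpha'y_s-\mu'_\varepsilon+\alpha'\theta')^2,$$ and $(\hat\alpha_n,\hat\mu_{\varepsilon,n},\hat\theta_n)$ is the unique global minimizer over $\mathbb R^3$ of $(\alpha',\mu'_\varepsilon,\theta')\mapsto Q_n(\mathbf Y_n;\alpha',\mu'_\varepsilon,\theta')$ when it exists uniquely, and $(0,0,0)$ otherwise. Conditional convergence: for random variables $\zeta_n$ and a random vector $\eta$ with values in $\mathbb Z_+^d$, ''conditionally on the values $\eta$, $\zeta_n\to\mathcal N(0,v(\eta))$'' means: for every $m$ with $\mathbb P(\eta=m)>0$, the conditional distribution of $\zeta_n$ given $\{\eta=m\}$ converges weakly to $\mathcal N(0,v(m))$. *)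

(* Defs.v *)
From HB Require Import structures.
From mathcomp Require Import all_boot all_order all_algebra.
From mathcomp Require Import all_classical all_reals all_analysis.
Set Implicit Arguments. Unset Strict Implicit. Unset Printing Implicit Defensive.
Import Order.TTheory GRing.Theory Num.Theory.
Import numFieldNormedType.Exports.
Local Open Scope classical_set_scope.
Local Open Scope ring_scope.

Section INAR.
Context {R : realType} {d : measure_display} {T : measurableType d}.
Variable P : probability T R.

Definition nat_measurable (Z : T -> nat) :=
  forall v : nat, measurable (Z @^-1` [set v]).

Definition mutually_independent (I : eqType) (Z : I -> T -> nat) :=
  forall (s : seq I) (v : I -> nat), uniq s ->
    P (\bigcap_(i in [set i | i \in s]) (Z i @^-1` [set v i])) =
    (\prod_(i <- s) P (Z i @^-1` [set v i]))%E.

Definition inar_family (X0 : T -> nat) (eps : nat -> T -> nat)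
  (xi : nat -> nat -> T -> nat) : option (nat + (nat * nat)) -> T -> nat :=
  fun i => match i with
           | None => X0
           | Some (inl k) => eps k.+1
           | Some (inr kj) => xi kj.1.+1 kj.2.+1
           end.

Definition inar_assumptions (alpha : R) (X0 : T -> nat) (eps : nat -> T -> nat)
  (xi : nat -> nat -> T -> nat) : Prop :=
  (0 < alpha < 1) /\
  (forall i, nat_measurable (inar_family X0 eps xi i)) /\
  mutually_independent (inar_family X0 eps xi) /\
  (forall k v, P (eps k.+1 @^-1` [set v]) = P (eps 1%N @^-1` [set v])) /\
  (forall k j, P (xi k.+1 j.+1 @^-1` [set 1%N]) = alpha%:E /\
               P (xi k.+1 j.+1 @^-1` [set 0%N]) = (1 - alpha)%:E) /\
  (\int[P]_t (((eps 1%N t)%:R : R) ^+ 2)%:E < +oo)%E /\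
  (0 < P (eps 1%N @^-1` [set~ 0%N]))%E /\
  (\int[P]_t (((X0 t)%:R : R) ^+ 2)%:E < +oo)%E.

Fixpoint Xproc (X0 : T -> nat) (eps : nat -> T -> nat)
  (xi : nat -> nat -> T -> nat) (k : nat) (t : T) : nat :=
  match k with
  | 0 => X0 t
  | k'.+1 => (\sum_(j < Xproc X0 eps xi k' t) xi k'.+1 j.+1 t + eps k'.+1 t)%N
  end.

Definition Yproc X0 eps xi (s theta : nat) (k : nat) (t : T) : nat :=
  (Xproc X0 eps xi k t + (k == s) * theta)%N.

Definition mu_eps (eps : nat -> T -> nat) : R :=
  fine (\int[P]_t ((eps 1%N t)%:R : R)%:E).
Definition sigma2_eps (eps : nat -> T -> nat) : R :=
  fine (\int[P]_t ((((eps 1%N t)%:R : R) - mu_eps eps) ^+ 2)%:E).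

Definition eps_pmf (eps : nat -> T -> nat) (l : nat) : R :=
  fine (P (eps 1%N @^-1` [set l])).

End INAR.

Section Stationary.
Context {R : realType}.

(* One-step transition probabilities of the INAR(1) chain:
   binomial(n, alpha) thinning plus an independent innovation with pmf p. *)
Definition inar_kernel (alpha : R) (p : nat -> R) (n m : nat) : R :=
  \sum_(i < (minn n m).+1)
     ('C(n, i)%:R * alpha ^+ i * (1 - alpha) ^+ (n - i) * p (m - i)%N).

Definition stationary_dist (alpha : R) (p : nat -> R) (pi_ : nat -> R) : Prop :=
  [/\ (forall n, 0 <= pi_ n),
      (fun N => \sum_(n < N) pi_ n) @ \oo --> (1 : R) &
      (forall m, (fun N => \sum_(n < N) pi_ n * inar_kernel alpha p n m) @ \oo
                   --> pi_ m)].

Definition moment (pi_ : nat -> R) (k : nat) : R :=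
  limn (fun N => \sum_(n < N) ((n%:R : R) ^+ k * pi_ n)).

Definition mx2 (a b c e : R) : 'M[R]_2 :=
  \matrix_(i < 2, j < 2)
    if (i : nat) == 0%N then (if (j : nat) == 0%N then a else b)
    else (if (j : nat) == 0%N then c else e).

Definition Amat (alpha sigma2 : R) (pi_ : nat -> R) : 'M[R]_2 :=
  (alpha * (1 - alpha)) *: mx2 (moment pi_ 3) (moment pi_ 2) (moment pi_ 2) (moment pi_ 1)
  + sigma2 *: mx2 (moment pi_ 2) (moment pi_ 1) (moment pi_ 1) 1.

Definition Bmat (alpha sigma2 : R) (pi_ : nat -> R) : 'M[R]_2 :=
  let M := mx2 (moment pi_ 2) (moment pi_ 1) (moment pi_ 1) 1 in
  invmx M *m Amat alpha sigma2 pi_ *m invmx M.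

End Stationary.

Section CLS.
Context {R : realType}.

Definition Qn (n s : nat) (y : nat -> R) (a m th : R) : R :=
  \sum_(1 <= k < n.+1 | (k != s) && (k != s.+1)) (y k - a * y k.-1 - m) ^+ 2
  + (y s - a * y s.-1 - m - th) ^+ 2
  + (y s.+1 - a * y s + a * th - m) ^+ 2.

Definition Qmin_set (n s : nat) (y : nat -> R) : set (R * R * R) :=
  [set p | forall q : R * R * R, Qn n s y p.1.1 p.1.2 p.2 <= Qn n s y q.1.1 q.1.2 q.2].

Definition cls_est (n s : nat) (y : nat -> R) : R * R * R :=
  if `[< exists! p, Qmin_set n s y p >] then xget (0, 0, 0) (Qmin_set n s y)
  else (0, 0, 0).

End CLS.

Section Gauss.
Context {R : realType}.

Definition bounded_continuous {U : topologicalType} (f : U -> R) : Prop :=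
  continuous f /\ exists M : R, forall x, `|f x| <= M.

Definition colv (x : R * R) : 'cV[R]_2 :=
  \col_(i < 2) (if (i : nat) == 0%N then x.1 else x.2).

Definition gauss2_pdf (B : 'M[R]_2) (x : R * R) : R :=
  expR (- ((colv x)^T *m invmx B *m colv x) ord0 ord0 / 2)
  / (2 * pi * Num.sqrt (\det B)).

Definition cvg_dist_normal2 {d} {T : measurableType d} (P : probability T R)
  (Z : nat -> T -> R * R) (B : 'M[R]_2) : Prop :=
  forall f : R * R -> R, bounded_continuous f ->
    (fun n => \int[P]_t (f (Z n t))%:E)%E @ \oo -->
    (\int[(@lebesgue_measure R \x @lebesgue_measure R)%E]_x (f x * gauss2_pdf B x)%:E)%E.

Definition cond_cvg_dist_normal {d} {T : measurableType d} (P : probability T R)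
  (E : set T) (W : nat -> T -> R) (v : R) : Prop :=
  forall g : R -> R, bounded_continuous g ->
    (fun n => (\int[P]_(t in E) (g (W n t))%:E) * ((fine (P E))^-1)%:E)%E @ \oo -->
    (\int[normal_prob 0 (Num.sqrt v)]_x (g x)%:E)%E.

End Gauss.

(* Main.v *)
(* Minimising [Q_n] over [theta'] first leaves the ordinary least-squares sum over
   [k <> s, s+1] plus one term [N^2 / (1 + alpha'^2)] with [N] polynomial in
   [(alpha', mu')].  In the coordinates [sqrt n (alpha' - alpha, mu' - mu)] this is a
   quadratic form converging to [M = [[E X^2, E X], [E X, 1]]], a linear form given by
   the normalised score, and a perturbation whose gradient and Hessian vanish as
   [n -> oo]; hence with probability tending to one the minimiser exists, is unique and
   lies within [o(1)] of [M^-1 score / sqrt n].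

   The score is a martingale.  For bounded [u] decided at a fixed time,
   [E (u cos (c . score / sqrt n + phi))] tends to [E u exp (- c^T A c / 2) cos phi]: each
   step is expanded to third order (only third moments are available, so the remainder
   is treated by truncating the chain), and the conditional variances, polynomials in the
   chain, are averaged through the Poisson equation, which has polynomial solutions.
   Bernstein polynomials in [(1 + sin (lambda x)) / 2] then pass from cosines to bounded
   continuous test functions.  The statement for [theta] is the case where [u] is the
   indicator of [Y_{s-1} = k1, Y_{s+1} = k2], the estimate of [theta] being a smooth
   explicit function of the other two. *)
Require Import Defs.
From HB Require Import structures.
From mathcomp Require Import all_boot all_order all_algebra.
From mathcomp Require Import all_classical all_reals all_analysis.
From mathcomp Require Import measurable_realfun.
From mathcomp Require Import ring lra zify.
Set Implicit Arguments. Unset Strict Implicit. Unset Printing Implicit Defensive.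
Import Order.TTheory GRing.Theory Num.Theory.
Import numFieldNormedType.Exports.
Local Open Scope classical_set_scope.
Local Open Scope ring_scope.

(** * Binomial thinning and the law of the path *)

(** Third moments leave no room: the conditional variance of the score is a cubic polynomial of the
    chain, of which only first moments are under control. Two properties of thinning make up for
    this. It acts triangularly on polynomials, with diagonal entries alpha^j, so the Poisson
    equation is solved coefficient by coefficient; and it shrinks increments of functions by the
    factor alpha, so truncated cubes have geometrically converging means. Comparing the two gives
    uniform integrability of X_k^3 in Cesaro mean ([cube_tail]), the source of the truncations. The
    telescoping used for cosines, applied to sqrt(1 + x^2) instead, also yields the law of large
    numbers for the Hessian and the tightness of the score. Conditioning is handled by the starting
    time: dropping the residuals at s and s+1 leaves a score whose second block starts from X_{s+1},
    when Y_{s-1} and Y_{s+1} are already decided, while the finite first block disappears after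
    division by sqrt n. Hence the linear part of the errors has the same Gaussian limit on every
    event {Y_{s-1} = k1, Y_{s+1} = k2}, and the Fourier argument is run for unnormalised
    measures. *)

Section Thinning.
Context {R : realType}.
Implicit Types (a : R) (f g : nat -> R).

(* The expectation of [f] under the binomial law with parameters [n] and [a]. *)
Fixpoint thin a n f : R :=
  if n is n'.+1 then a * thin a n' (f \o S) + (1 - a) * thin a n' f else f 0%N.

Lemma eq_thin a n f g : f =1 g -> thin a n f = thin a n g.
Proof. by elim: n f g => [|n IH] f g fg //=; rewrite (IH f g)// (IH (f \o S) (g \o S))// => i /=. Qed.

Lemma thinE a n f :
  thin a n f = \sum_(i < n.+1) 'C(n, i)%:R * a ^+ i * (1 - a) ^+ (n - i) * f i.
Proof.
elim: n f => [|n IH] f /=; first by rewrite big_ord1 bin0 subnn !expr0 !mul1r.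
rewrite big_ord_recl bin0 expr0 subn0 !mul1r.
under [X in _ = _ + X]eq_bigr => i _ do
  rewrite lift0 binS natrD subSS !mulrDl.
rewrite big_split /= addrCA addrA addrC !IH; congr (_ + _).
  rewrite mulr_sumr; apply: eq_bigr => i _ /=; rewrite exprS; ring.
rewrite [in RHS]big_ord_recr /= bin_small// !mul0r addr0 addrC.
rewrite big_ord_recl bin0 expr0 subn0 !mul1r mulrDr mulrA -exprS; congr (_ + _).
rewrite mulr_sumr; apply: eq_bigr => i _.
rewrite lift0 (_ : n - i = (n - i.+1).+1)%N; last by rewrite subnSK.
rewrite (exprS (1 - a)); ring.
Qed.

Lemma thinD a n f g : thin a n (fun i => f i + g i) = thin a n f + thin a n g.
Proof. by rewrite !thinE -big_split; apply: eq_bigr => i _; rewrite mulrDr. Qed.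

Lemma thinZ a n (c : R) f : thin a n (fun i => c * f i) = c * thin a n f.
Proof. rewrite !thinE mulr_sumr; apply: eq_bigr => i _; ring. Qed.

Lemma thin_cst a n (c : R) : thin a n (fun=> c) = c.
Proof. by elim: n => [|n IH] //=; rewrite -/(thin a n (fun=> c)) IH; ring. Qed.

Lemma le_thin a n f g : 0 <= a <= 1 -> (forall i, f i <= g i) -> thin a n f <= thin a n g.
Proof.
move=> a01; elim: n f g => [|n IH] f g fg //=.
by rewrite lerD// ler_wpM2l ?IH//; [lra|move=> i /=; exact: fg|lra].
Qed.

Lemma thin_ge0 a n f : 0 <= a <= 1 -> (forall i, 0 <= f i) -> 0 <= thin a n f.
Proof. by move=> a01 f0; rewrite -(thin_cst a n 0) le_thin. Qed.

Lemma ler_norm_thin a n f g : 0 <= a <= 1 -> (forall i, `|f i| <= g i) ->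
  `|thin a n f| <= thin a n g.
Proof.
move=> a01 fg; rewrite ler_norml -mulN1r -thinZ !le_thin// => i.
  by rewrite (le_trans (ler_norm _)).
by rewrite mulN1r; have := fg i; rewrite ler_norml => /andP[].
Qed.

Lemma thin_id a n : thin a n (fun i => i%:R) = a * n%:R.
Proof.
elim: n => [|n IH] /=; first by rewrite mulr0.
rewrite (@eq_thin _ _ _ (fun i => i%:R + 1)); last by move=> i /=; rewrite -natr1.
rewrite thinD thin_cst IH -natr1; ring.
Qed.

Lemma thin_sqr a n : thin a n (fun i => i%:R ^+ 2) = a ^+ 2 * n%:R ^+ 2 + a * (1 - a) * n%:R.
Proof.
elim: n => [|n IH] /=; first by ring.
rewrite (@eq_thin _ _ (_ \o _) (fun i => i%:R ^+ 2 + (2 * i%:R + 1))); last first.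
  by move=> i /=; rewrite -natr1; ring.
rewrite !thinD thinZ thin_cst thin_id IH -natr1; ring.
Qed.

Lemma thin_cube a n : thin a n (fun i => i%:R ^+ 3) =
  a ^+ 3 * n%:R ^+ 3 + 3 * a ^+ 2 * (1 - a) * n%:R ^+ 2 + a * (1 - a) * (1 - 2 * a) * n%:R.
Proof.
elim: n => [|n IH] /=; first by ring.
rewrite (@eq_thin _ _ (_ \o _) (fun i => i%:R ^+ 3 + (3 * i%:R ^+ 2 + (3 * i%:R + 1)))); last first.
  by move=> i /=; rewrite -natr1; ring.
rewrite !thinD !thinZ thin_cst thin_id thin_sqr IH -natr1; ring.
Qed.

(** The guard matters: with truncated subtraction alone every i > m would pick up the mass [p 0]. *)
Definition shiftp (p : nat -> R) (m i : nat) : R := if (i <= m)%N then p (m - i)%N else 0.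

Lemma inar_kernelE a p n m : inar_kernel a p n m = thin a n (shiftp p m).
Proof.
rewrite thinE /inar_kernel.
rewrite (big_ord_widen n.+1 (fun i => 'C(n, i)%:R * a ^+ i * (1 - a) ^+ (n - i) * p (m - i)%N));
  last by rewrite ltnS geq_minl.
rewrite big_mkcond /=; apply: eq_bigr => i _; rewrite /shiftp ltnS leq_min -ltnS ltn_ord /=.
by case: ifP => // _; rewrite mulr0.
Qed.

Lemma inar_kernel0 a p m : inar_kernel a p 0 m = p m.
Proof. by rewrite inar_kernelE /= /shiftp subn0. Qed.

(** One more individual either survives, taking one unit of the target, or dies. [prob_step] follows
    the same recursion on the probability space. *)
Lemma inar_kernelS a p n m : inar_kernel a p n.+1 m =
  a * (if m is m'.+1 then inar_kernel a p n m' else 0) + (1 - a) * inar_kernel a p n m.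
Proof.
rewrite !inar_kernelE /=; congr (a * _ + _); case: m => [|m].
  by rewrite -[RHS](thin_cst a n); apply: eq_thin.
by rewrite inar_kernelE; apply: eq_thin => i; rewrite /shiftp /= ltnS.
Qed.

Lemma inar_kernel_ge0 a p n m : 0 <= a <= 1 -> (forall l, 0 <= p l) -> 0 <= inar_kernel a p n m.
Proof. by move=> a01 p0; rewrite inar_kernelE thin_ge0// => i; rewrite /shiftp; case: ifP. Qed.

End Thinning.

(** * Events independent of a set of coordinates *)

Section Independence.
Context {R : realType} {d : measure_display} {T : measurableType d} (P : probability T R).

Lemma nat_measurableS (f : T -> nat) (A : set nat) : nat_measurable f -> measurable (f @^-1` A).
Proof.
move=> mf; rewrite (_ : _ @^-1` _ = \bigcup_(a in A) (f @^-1` [set a])).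
  by apply: bigcup_measurable => a _; exact: mf.
by apply/seteqP; split=> [t At|t [a Aa /= ->]//]; exists (f t).
Qed.

Lemma nat_measurable_comp2 (f g : T -> nat) (h : nat -> nat -> nat) :
  nat_measurable f -> nat_measurable g -> nat_measurable (fun t => h (f t) (g t)).
Proof.
move=> mf mg v.
rewrite (_ : _ @^-1` _ = \bigcup_a ((f @^-1` [set a]) `&` (g @^-1` (h a @^-1` [set v])))).
  by apply: bigcupT_measurable => a; apply: measurableI; exact: nat_measurableS.
by apply/seteqP; split=> [t hv|t [a _ [/= <-]]//]; exists (f t).
Qed.

Lemma nat_measurable_sum (f : nat -> T -> nat) n :
  (forall j, nat_measurable (f j)) -> nat_measurable (fun t => \sum_(j < n) f j t)%N.
Proof.
move=> mf; elim: n => [|n IH].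
  by under eq_fun do rewrite big_ord0; move=> v; rewrite preimage_cst; case: ifP.
by under eq_fun do rewrite big_ord_recr; apply: nat_measurable_comp2.
Qed.

Lemma nat_measurable_dep (f : T -> nat) (g : nat -> T -> nat) :
  nat_measurable f -> (forall j, nat_measurable (g j)) -> nat_measurable (fun t => g (f t) t).
Proof.
move=> mf mg v.
rewrite (_ : _ @^-1` _ = \bigcup_a ((f @^-1` [set a]) `&` (g a @^-1` [set v]))).
  by apply: bigcupT_measurable => a; apply: measurableI; [exact: mf|exact: mg].
by apply/seteqP; split=> [t hv|t [a _ [/= <-]]//]; exists (f t).
Qed.

Section Family.
Context (I : eqType) (Z : I -> T -> nat).
Hypothesis mZ : forall i, nat_measurable (Z i).

Definition cylinder (s : seq I) (v : I -> nat) :=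
  \bigcap_(i in [set i | i \in s]) (Z i @^-1` [set v i]).

Lemma cylinder_nil v : cylinder [::] v = setT.
Proof. by apply/seteqP; split=> // t _ i; rewrite /= in_nil. Qed.

Lemma cylinder_cons i s v : cylinder (i :: s) v = (Z i @^-1` [set v i]) `&` cylinder s v.
Proof.
apply/seteqP; split=> t.
  move=> h; split; first by apply: h; rewrite /= mem_head.
  by move=> j js; apply: h; rewrite /= in_cons js orbT.
by move=> [h1 h2] j; rewrite /= in_cons => /predU1P[->//|]; exact: h2.
Qed.

Lemma eq_cylinder s v w : {in s, v =1 w} -> cylinder s v = cylinder s w.
Proof.
by move=> vw; apply/seteqP; split=> t h i si; have := h i si; rewrite /= vw.
Qed.

Lemma measurable_cylinder s v : measurable (cylinder s v).
Proof.
elim: s => [|i s IH]; first by rewrite cylinder_nil.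
by rewrite cylinder_cons; apply: measurableI => //; exact: mZ.
Qed.

(** J is the stock of coordinates still independent of A. Each time a coordinate is absorbed into A
    it is removed from J, so a chain of conditionings is a chain of subtractions from J. *)
Definition indep_of (A : set T) (J : pred I) := forall s v, uniq s -> all J s ->
  P (A `&` cylinder s v) = (P A * \prod_(i <- s) P (Z i @^-1` [set v i]))%E.

Lemma indep_of_prob A J i v : indep_of A J -> J i ->
  P (A `&` Z i @^-1` [set v]) = (P A * P (Z i @^-1` [set v]))%E.
Proof.
move=> AJ Ji; have := AJ [:: i] (fun=> v) isT; rewrite /= Ji big_seq1 cylinder_cons.
by rewrite cylinder_nil setIT => ->.
Qed.

Lemma indep_ofI A J i v : indep_of A J -> J i ->
  indep_of (A `&` Z i @^-1` [set v]) (predD1 J i).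
Proof.
move=> AJ Ji s w us sJ.
(* As i is not in s, overriding w at i leaves the cylinder over s unchanged and turns the event on i
   into one more factor of the cylinder over i :: s. *)
pose w' j := if j == i then v else w j.
have iNs : i \notin s by apply/negP => /(allP sJ); rewrite /= eqxx.
have ww' : {in s, w =1 w'}.
  by move=> j js; rewrite /w'; case: eqVneq => // ji; rewrite -ji js in iNs.
have := AJ (i :: s) w'; rewrite /= iNs us Ji => -/(_ isT) h.
rewrite (eq_cylinder ww') -setIA.
have -> : Z i @^-1` [set v] = Z i @^-1` [set w' i] by rewrite /w' eqxx.
rewrite -cylinder_cons h; last by apply/allP => j /(allP sJ) /andP[].
rewrite big_cons muleA -(indep_of_prob _ AJ Ji); congr (_ * _)%E.
rewrite big_seq [RHS]big_seq; apply: eq_bigr => j js; by rewrite ww'.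
Qed.

Lemma indep_of_cylinder A J s v : uniq s -> all J s -> indep_of A J ->
  indep_of (A `&` cylinder s v) [predD J & s].
Proof.
move=> us sJ AJ r w ur rJ.
pose u j := if j \in s then v j else w j.
have vu : {in s, v =1 u} by move=> j js; rewrite /u js.
have wu : {in r, w =1 u}.
  by move=> j /(allP rJ); rewrite /u !inE => /andP[/negbTE ->].
rewrite (eq_cylinder vu) (eq_cylinder wu) -setIA.
have -> : cylinder s u `&` cylinder r u = cylinder (s ++ r) u.
  elim: (s) => [|i q IH]; first by rewrite cylinder_nil setTI.
  by rewrite cat_cons !cylinder_cons -setIA IH.
rewrite AJ; last 2 first.
- rewrite cat_uniq us ur andbT; apply/hasPn => j /(allP rJ).
  by rewrite !inE => /andP[].
- by rewrite all_cat sJ; apply/allP => j /(allP rJ); rewrite !inE => /andP[].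
rewrite AJ// big_cat /= muleA; congr (_ * _)%E.
by rewrite big_seq [RHS]big_seq; apply: eq_bigr => j js; rewrite wu.
Qed.

Lemma sub_indep_of A (J J' : pred I) : subpred J' J -> indep_of A J -> indep_of A J'.
Proof. by move=> sJ AJ s v us sJ'; apply: AJ => //; exact: sub_all sJ'. Qed.

End Family.

(** The values 0 and 1 carry total mass one, so the other values of U form a null set. *)
Lemma prob_split01 (B : set T) (U : T -> nat) (a : R) : measurable B -> nat_measurable U ->
  P (U @^-1` [set 1%N]) = a%:E -> P (U @^-1` [set 0%N]) = (1 - a)%:E ->
  P B = (P (B `&` U @^-1` [set 1%N]) + P (B `&` U @^-1` [set 0%N]))%E.
Proof.
move=> mB mU U1 U0.
have d10 : U @^-1` [set 1%N] `&` U @^-1` [set 0%N] = set0.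
  by apply/seteqP; split=> // t [/= ->].
set C := U @^-1` [set 1%N] `|` U @^-1` [set 0%N].
have mC : measurable C by apply: measurableU; exact: mU.
have PC : P C = 1%E.
  by rewrite measureU//; rewrite /= U1 U0 -EFinD addrC subrK.
have PCc : P (~` C) = 0%E by rewrite probability_setC// PC subee.
have -> : P B = P (B `&` C).
  rewrite -(setIT B) -{1}(setUv C) setIUr measureU ?setIT//; last 3 first.
  - exact: measurableI.
  - by apply: measurableI => //; exact: measurableC.
  - by rewrite setIACA setICr setI0.
  rewrite [X in (_ + X)%E](_ : _ = 0%E) ?adde0//.
  apply/eqP; rewrite eq_le measure_ge0 andbT -PCc.
  by apply: le_measure => //; rewrite inE; [apply: measurableI => //; exact: measurableC|exact: measurableC].
rewrite setIUr measureU//; last by rewrite setIACA d10 setI0.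
all: by apply: measurableI => //; exact: mU.
Qed.

End Independence.

(** * Transition probabilities along a path *)

Section PathLaw.
Context {R : realType} {d : measure_display} {T : measurableType d} (P : probability T R).
Context (alpha : R) (X0 : T -> nat) (eps : nat -> T -> nat) (xi : nat -> nat -> T -> nat).
Hypothesis H : inar_assumptions P alpha X0 eps xi.

Let Z := inar_family X0 eps xi.
Let X := Xproc X0 eps xi.
Let ker := inar_kernel alpha (eps_pmf P eps).

Let mZ i : nat_measurable (Z i). Proof. by case: H => _ [h _]; exact: h. Qed.

Let step k x t := (\sum_(j < x) xi k.+1 j.+1 t + eps k.+1 t)%N.

Lemma nat_measurable_step k x : nat_measurable (step k x).
Proof.
apply: nat_measurable_comp2; last exact: (mZ (Some (inl k))).
apply: (@nat_measurable_sum _ _ (fun j => xi k.+1 j.+1)) => j.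
exact: (mZ (Some (inr (k, j)))).
Qed.

Lemma nat_measurable_Xproc k : nat_measurable (X k).
Proof.
elim: k => [|k IH]; first exact: (mZ None).
exact: (nat_measurable_dep IH (nat_measurable_step k)).
Qed.

(** Induction on the population x, with A and J general: the last thinning variable is split
    according to its value, absorbed into A and removed from J, which reproduces [inar_kernelS]. *)
Lemma prob_step k A J x m : measurable A -> indep_of P Z A J ->
  J (Some (inl k)) -> (forall j, (j < x)%N -> J (Some (inr (k, j)))) ->
  P (A `&` step k x @^-1` [set m]) = (P A * (ker x m)%:E)%E.
Proof.
have [_ [_ [_ [eqd [bern _]]]]] := H.
elim: x A J m => [|x IH] A J m mA AJ Je Jx.
  have -> : step k 0 = Z (Some (inl k)).
    by apply/funext => t; rewrite /step big_ord0.
  rewrite (indep_of_prob _ AJ Je) /ker inar_kernel0 /eps_pmf fineK; first by rewrite -(eqd k).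
  exact: fin_num_measure (mZ (Some (inl 0%N)) m).
have [b1 b0] := bern k x.
pose U := Z (Some (inr (k, x))).
have mU : nat_measurable U by exact: mZ.
have mAU b : measurable (A `&` U @^-1` [set b]) by apply: measurableI => //; exact: mU.
have AJU b := indep_ofI b AJ (Jx x (ltnSn x)).
have PAU b : P (A `&` U @^-1` [set b]) = (P A * P (U @^-1` [set b]))%E.
  exact: indep_of_prob AJ (Jx x (ltnSn x)).
rewrite (@prob_split01 _ _ _ P _ U alpha) //; last first.
  by apply: measurableI => //; exact: nat_measurable_step.
have E b : A `&` step k x.+1 @^-1` [set m] `&` U @^-1` [set b] =
    (A `&` U @^-1` [set b]) `&` [set t | (step k x t + b)%N = m].
  apply/seteqP; split=> t; rewrite /step /= big_ord_recr /=.
    by move=> [[At] + <-]; rewrite addnAC.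
  by move=> [[At] <-]; rewrite addnAC.
rewrite !E.
have E0 : [set t | (step k x t + 0)%N = m] = step k x @^-1` [set m].
  by apply/seteqP; split=> t; rewrite /= addn0.
have IHb b m' : P (A `&` U @^-1` [set b] `&` step k x @^-1` [set m']) =
   (P A * P (U @^-1` [set b]) * (ker x m')%:E)%E.
  rewrite (IH _ _ _ (mAU b) (AJU b)) ?PAU//=.
  by move=> j jx; rewrite Jx ?(ltnW jx)// ?andbT; [apply/eqP => -[]; lia|lia].
rewrite E0 IHb /ker inar_kernelS -/ker.
have PA : P A \is a fin_num by exact: fin_num_measure.
rewrite -(fineK PA).
case: m E E0 => [|m] E E0.
  rewrite (_ : [set t | (step k x t + 1)%N = 0%N] = set0); last first.
    by apply/seteqP; split=> t //=; rewrite addn1.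
  rewrite setI0 measure0 add0e mulr0 add0r b0 -!EFinM; congr EFin; ring.
rewrite (_ : [set t | (step k x t + 1)%N = m.+1] = step k x @^-1` [set m]); last first.
  by apply/seteqP; split=> t /=; rewrite addn1; [case|move=> ->].
rewrite IHb b1 b0 -(fineK PA) -!EFinM -EFinD; congr EFin; rewrite /=; ring.
Qed.

Definition path_event (k : nat) (p : nat -> nat) : set T :=
  [set t | forall i, (i <= k)%N -> X i t = p i].

Lemma path_event0 p : path_event 0 p = X0 @^-1` [set p 0%N].
Proof.
apply/seteqP; split=> t; first by move=> /(_ 0%N isT).
by move=> h i; rewrite leqn0 => /eqP ->.
Qed.

Lemma path_eventS k p :
  path_event k.+1 p = path_event k p `&` step k (p k) @^-1` [set p k.+1].
Proof.
apply/seteqP; split=> t.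
  move=> h; split; first by move=> i ik; apply: h; rewrite leqW.
  by have := h k.+1 (leqnn _); rewrite /X /= -/X h// leqnSn.
move=> [h1 h2] i; rewrite leq_eqVlt => /predU1P[->|]; last by rewrite ltnS; exact: h1.
by move: h2; rewrite /step /= -/X -h1.
Qed.

Lemma measurable_path_event k p : measurable (path_event k p).
Proof.
elim: k => [|k IH]; first by rewrite path_event0; exact: (mZ None).
by rewrite path_eventS; apply: measurableI => //; exact: nat_measurable_step.
Qed.

(** The time at which a coordinate enters the recursion; the path up to time k reads only
    coordinates with [itime] at most k. *)
Definition itime (i : option (nat + (nat * nat))) : nat :=
  match i with None => 0 | Some (inl k) => k.+1 | Some (inr kj) => kj.1.+1 end.

Lemma path_event_indep k p : indep_of P Z (path_event k p) (fun i => (k < itime i)%N).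
Proof.
have [_ [_ [ind _]]] := H.
elim: k => [|k IH].
  have h : indep_of P Z setT xpredT.
    by move=> s v us _; rewrite setTI probability_setT mul1e; exact: ind.
  rewrite path_event0 -[X in indep_of _ _ X]setTI.
  apply: sub_indep_of (indep_ofI (p 0%N) h (i := None) isT).
  by case.
have mpe := measurable_path_event k p.
move=> s v us sk.
have sk' : all (fun i => k < itime i)%N s by apply: sub_all sk => i; exact: ltnW.
(* The future cylinder is absorbed into the conditioning event and its coordinates are withdrawn
   before the step is taken; a second use of [prob_step], without the cylinder, then recovers the
   product. *)
rewrite path_eventS setIAC.
rewrite (@prob_step k _ [predD (fun i => (k < itime i)%N) & s]); first last.
- move=> j _; apply/andP; split => /=; last exact: ltnSn.
  by apply/negP => /(allP sk) /=; rewrite ltnn.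
- apply/andP; split => /=; last exact: ltnSn.
  by apply/negP => /(allP sk) /=; rewrite ltnn.
- exact: indep_of_cylinder.
- by apply: measurableI => //; exact: measurable_cylinder.
rewrite IH// (@prob_step k _ (fun i => (k < itime i)%N))//=.
by rewrite muleAC.
Qed.

Lemma path_event_transition k p m :
  P (path_event k p `&` X k.+1 @^-1` [set m]) = (P (path_event k p) * (ker (p k) m)%:E)%E.
Proof.
rewrite -(@prob_step k _ (fun i => (k < itime i)%N))//; first last.
- exact: path_event_indep.
- exact: measurable_path_event.
congr (P _); apply/seteqP; split=> t [h1 h2]; split=> //; move: h2; rewrite /X /= -/X h1//.
Qed.

End PathLaw.

(** * Expectations of integer-valued variables as series *)

Section Series.
Context {R : realType}.

Lemma nneseries_pick (f : nat -> R) n : (forall m, 0 <= f m) ->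
  (\sum_(m <oo) (f m * (n == m)%:R)%:E = (f n)%:E)%E.
Proof.
move=> f0; rewrite (@nneseriesD1 _ _ n xpredT)//; last first.
  by move=> k _; rewrite lee_fin mulr_ge0.
rewrite eqxx mulr1 eseries0 ?adde0// => i _ /=.
by rewrite eq_sym => /negbTE ->; rewrite mulr0.
Qed.

End Series.

Section Expectation.
Context {R : realType} {d : measure_display} {T : measurableType d} (P : probability T R).

Lemma nat_measurable_fun d' (U : measurableType d') (C : T -> nat) (f : nat -> U) :
  nat_measurable C -> measurable_fun setT (fun t => f (C t)).
Proof. by move=> mC _ B _; rewrite setTI; exact: (nat_measurableS (f @^-1` B) mC). Qed.

Lemma expect_nat (A : set T) (C : T -> nat) (f : nat -> R) : measurable A ->
  nat_measurable C -> (forall m, 0 <= f m) ->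
  (\int[P]_(t in A) (f (C t))%:E = \sum_(m <oo) ((f m)%:E * P (A `&` C @^-1` [set m])))%E.
Proof.
move=> mA mC f0.
under eq_integral => t _ do rewrite -(nneseries_pick (C t) f0).
have mI m : measurable_fun A (fun t => (f m * (C t == m)%:R)%:E).
  apply/measurable_EFinP; apply: measurable_funTS.
  pose g (c : nat) : R := f m * (c == m)%:R.
  exact: (@nat_measurable_fun _ _ C g mC).
rewrite integral_nneseries//; last first.
  by move=> n x _; rewrite lee_fin mulr_ge0.
apply: eq_eseriesr => m _.
under eq_integral do rewrite EFinM.
rewrite ge0_integralZl//=.
- congr (_ * _)%E; rewrite setIC -integral_indic//.
  apply: eq_integral => u _; rewrite indicE; congr ((nat_of_bool _)%:R)%:E.
  by apply/idP/idP; rewrite inE => /eqP.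
- apply/measurable_EFinP; apply: measurable_funTS.
  pose g (c : nat) : R := (c == m)%:R.
  exact: (@nat_measurable_fun _ _ C g mC).
- by rewrite lee_fin.
Qed.

End Expectation.

Section Kernel.
Context {R : realType} {d : measure_display} {T : measurableType d} (P : probability T R).

Lemma nneseries_thin (a : R) x (f : nat -> R) (g : nat -> nat -> R) (e : nat -> R) :
  0 <= a <= 1 -> (forall m, 0 <= f m) -> (forall i m, 0 <= g i m) ->
  (forall i, (\sum_(m <oo) (f m * g i m)%:E)%E = (e i)%:E) ->
  (\sum_(m <oo) (f m * thin a x (g^~ m))%:E = (thin a x e)%:E)%E.
Proof.
move=> a01 f0; elim: x g e => [|x IH] g e g0 ge //=.
rewrite EFinD !EFinM -(IH (fun i => g i.+1) (e \o S)) -?(IH g e)//.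
have t0 (h : nat -> nat -> R) m : (forall i m, 0 <= h i m) -> 0 <= f m * thin a x (h^~ m).
  by move=> h0; rewrite mulr_ge0// thin_ge0.
rewrite -!nneseriesZl; last 2 first.
- by move=> i _; rewrite lee_fin t0.
- by move=> i _; rewrite lee_fin (t0 (fun i => g i.+1)).
rewrite -nneseriesD; last 2 first.
- by move=> i _ _; rewrite -EFinM lee_fin mulr_ge0 ?(t0 (fun i => g i.+1))//; lra.
- by move=> i _ _; rewrite -EFinM lee_fin mulr_ge0 ?t0//; lra.
by apply: eq_eseriesr => m _; rewrite -!EFinM -EFinD; congr EFin; ring.
Qed.

(** Exchanging the series over targets with the finite thinning sum turns a kernel expectation into
    the thinning of an expectation over one innovation. *)
Lemma nneseries_kernel (U : T -> nat) (a : R) x (f : nat -> R) (e : nat -> R) :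
  nat_measurable U -> 0 <= a <= 1 -> (forall m, 0 <= f m) ->
  (forall i, (\int[P]_t (f (i + U t)%N)%:E = (e i)%:E)%E) ->
  (\sum_(m <oo) (f m * inar_kernel a (fun l => fine (P (U @^-1` [set l]))) x m)%:E
   = (thin a x e)%:E)%E.
Proof.
move=> mU a01 f0 fe.
under eq_eseriesr do rewrite inar_kernelE.
set p := (fun l => fine _).
apply: (@nneseries_thin a x f (fun i m => shiftp p m i)) => //.
  by move=> i m; rewrite /shiftp; case: ifP => // _; rewrite fine_ge0.
move=> i; rewrite -fe.
have mV : nat_measurable (fun t => (i + U t)%N).
  apply: (@nat_measurable_comp2 _ _ (fun=> i) U addn) => // v.
  by rewrite preimage_cst; case: ifP.
rewrite (@expect_nat _ _ _ P setT (fun t => (i + U t)%N))//.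
apply: eq_eseriesr => m _; rewrite EFinM; congr (_ * _)%E; rewrite setTI /shiftp.
case: leqP => im.
  rewrite fineK; last exact: fin_num_measure (mU _).
  congr (P _); apply/seteqP; split=> t /= => [->|<-]; first by rewrite subnKC.
  by rewrite addKn.
rewrite (_ : _ @^-1` _ = set0) ?measure0//.
by apply/seteqP; split=> // t /= h; move: im; rewrite -h ltnNge leq_addr.
Qed.

End Kernel.

(** * The Markov property as an identity between integrals *)

Section MarkovChain.
Context {R : realType} {d : measure_display} {T : measurableType d} (P : probability T R).
Variables (X : nat -> T -> nat) (ker : nat -> nat -> R).
Hypothesis mX : forall k, nat_measurable (X k).
Hypothesis ker_ge0 : forall x m, 0 <= ker x m.
Hypothesis trans : forall k (p : nat -> nat) m,
  let A := [set t | forall i, (i <= k)%N -> X i t = p i] in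
  P (A `&` X k.+1 @^-1` [set m]) = (P A * (ker (p k) m)%:E)%E.

(** Being a function of the path up to time k. The paths up to k form a countable set, so this
    already implies measurability ([adapted_measurable]). *)
Definition adapted (U : Type) (k : nat) (f : T -> U) :=
  forall t t', (forall i, (i <= k)%N -> X i t = X i t') -> f t = f t'.

Lemma adaptedW U k k' (f : T -> U) : (k <= k')%N -> adapted k f -> adapted k' f.
Proof. by move=> kk' af t t' h; apply: af => i ik; apply: h; exact: leq_trans kk'. Qed.

(* A countable encoding of the path up to time [k], which turns conditioning on the
   path into countable sums. *)
Fixpoint code (k : nat) (t : T) : nat :=
  if k is k'.+1 then pickle (code k' t, X k t) else X 0 t.

Lemma nat_measurable_code k : nat_measurable (code k).
Proof.
elim: k => [|k IH]; first exact: mX.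
exact: (@nat_measurable_comp2 _ _ (code k) (X k.+1) (fun a b => pickle (a, b))).
Qed.

Lemma codeP k t t' : code k t = code k t' <-> (forall i, (i <= k)%N -> X i t = X i t').
Proof.
elim: k => [|k IH]; split => /=.
- by move=> h i; rewrite leqn0 => /eqP ->.
- exact.
- move=> /(pcan_inj pickleK)[/IH h1 h2] i; rewrite leq_eqVlt => /predU1P[->//|].
  by rewrite ltnS; exact: h1.
- move=> h; rewrite h//; congr (pickle (_, _)); apply/IH => i ik; apply: h.
  by rewrite leqW.
Qed.

Lemma adapted_factor (U : Type) (u0 : U) k (f : T -> U) : adapted k f ->
  exists F : nat -> U, forall t, f t = F (code k t).
Proof.
move=> af.
have h n : exists u, forall t, code k t = n -> f t = u.
  have [[t tn]|Nt] := pselect (exists t, code k t = n).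
    by exists (f t) => t' t'n; apply: af; apply/codeP; rewrite t'n.
  (* [u0] is the value at codes that no path attains. *)
  by exists u0 => t tn; exfalso; apply: Nt; exists t.
have [F FE] := choice h.
by exists F => t; exact: FE.
Qed.

Lemma adapted_measurable d' (U : measurableType d') k (f : T -> U) : adapted k f ->
  measurable_fun setT f.
Proof.
move=> af _ B _; rewrite setTI.
rewrite (_ : f @^-1` B = code k @^-1` (code k @` (f @^-1` B))).
  exact: nat_measurableS (@nat_measurable_code k).
apply/seteqP; split=> [t Bt|t [t' Bt' /codeP/af ff']]; first by exists t.
by rewrite /= -ff'.
Qed.

Lemma trans_code k n m :
  P (code k @^-1` [set n] `&` X k.+1 @^-1` [set m]) =
  (\int[P]_(t in code k @^-1` [set n]) (ker (X k t) m)%:E)%E.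
Proof.
have mC : measurable (code k @^-1` [set n]) by exact: nat_measurable_code.
have [[t tn]|Nt] := pselect (exists t, code k t = n); last first.
  rewrite (_ : code k @^-1` [set n] = set0) ?set0I ?measure0 ?integral_set0//.
  by apply/seteqP; split=> // t tn; apply: Nt; exists t.
have CE : code k @^-1` [set n] = [set t' | forall i, (i <= k)%N -> X i t' = X i t].
  by apply/seteqP; split=> t' /=; rewrite -tn codeP.
rewrite (eq_integral (fun=> (ker (X k t) m)%:E)); last first.
  by move=> t'; rewrite inE /= -tn => /codeP h; rewrite h.
by rewrite integral_cst// muleC CE trans.
Qed.

(** Extended-valued, so that it can be formed for nonnegative f before its mean is known to be
    finite. *)
Definition KE (f : nat -> R) (x : nat) : \bar R := (\sum_(m <oo) (f m * ker x m)%:E)%E.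

Lemma integral_code k (w : T -> \bar R) : measurable_fun setT w ->
  (forall t, 0 <= w t)%E ->
  (\int[P]_t w t = \sum_(n <oo) \int[P]_(t in code k @^-1` [set n]) w t)%E.
Proof.
move=> mw w0.
have CT : \bigcup_n (code k @^-1` [set n]) = setT.
  by apply/seteqP; split=> // t _; exists (code k t).
rewrite -[in LHS]CT ge0_integral_bigcup//.
- by move=> n; exact: nat_measurable_code.
- by rewrite CT.
- by move=> i j _ _ [t [/= <- <-]].
Qed.

(** Both sides are series over the next state m. For each m the sample space is cut along the fibres
    of [code k], on which w is constant and [trans_code] applies. *)
Lemma markov_ge0 k (w : T -> R) (f : nat -> R) : adapted k w ->
  (forall t, 0 <= w t) -> (forall m, 0 <= f m) ->
  (\int[P]_t (w t * f (X k.+1 t))%:E = \int[P]_t ((w t)%:E * KE f (X k t)))%E.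
Proof.
move=> aw w0 f0.
have mw : measurable_fun setT w by exact: adapted_measurable aw.
have mfX (g : nat -> R) j : measurable_fun setT (fun t => g (X j t)).
  exact: (@nat_measurable_fun _ _ _ _ (X j) g (mX j)).
transitivity (\sum_(m <oo) (f m)%:E * \int[P]_t (w t * ker (X k t) m)%:E)%E; last first.
  rewrite -(eq_eseriesr (f := fun m => (\int[P]_t ((f m)%:E * (w t * ker (X k t) m)%:E))%E)); last first.
    move=> m _; rewrite ge0_integralZl//.
    - by apply/measurable_EFinP/measurable_funM => //; exact: (mfX (fun x => ker x m)).
    - by move=> t _; rewrite lee_fin mulr_ge0.
    - by rewrite lee_fin.
  rewrite -integral_nneseries//.
  - apply: eq_integral => t _; rewrite /KE -nneseriesZl.
      by apply: eq_eseriesr => m _; rewrite -!EFinM; congr EFin; ring.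
    by move=> m _; rewrite lee_fin mulr_ge0.
  - move=> m; apply: emeasurable_funM => //.
    by apply/measurable_EFinP/measurable_funM => //; exact: (mfX (fun x => ker x m)).
  - by move=> m t _; rewrite -EFinM lee_fin !mulr_ge0.
rewrite (eq_integral (fun t => \sum_(m <oo) (w t)%:E * (f m * (X k.+1 t == m)%:R)%:E)%E); last first.
  move=> t _; rewrite nneseriesZl; last by move=> m _; rewrite lee_fin mulr_ge0.
  by rewrite nneseries_pick// EFinM.
rewrite integral_nneseries//; last 2 first.
- move=> m; apply: emeasurable_funM; first exact/measurable_EFinP.
  by apply/measurable_EFinP; exact: (mfX (fun x => f m * (x == m)%:R)).
- by move=> m t _; rewrite -EFinM lee_fin !mulr_ge0.
apply: eq_eseriesr => m _.
under eq_integral => t _ do rewrite -EFinM mulrCA EFinM.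
rewrite ge0_integralZl//; last 3 first.
- apply/measurable_EFinP/measurable_funM => //; exact: (mfX (fun x => (x == m)%:R)).
- by move=> t _; rewrite lee_fin mulr_ge0.
- by rewrite lee_fin.
congr (_ * _)%E.
rewrite [LHS](integral_code k)//; last 2 first.
- apply/measurable_EFinP/measurable_funM => //; exact: (mfX (fun x => (x == m)%:R)).
- by move=> t; rewrite lee_fin mulr_ge0.
rewrite [RHS](integral_code k)//; last 2 first.
- apply/measurable_EFinP/measurable_funM => //; exact: (mfX (fun x => ker x m)).
- by move=> t; rewrite lee_fin mulr_ge0.
apply: eq_eseriesr => n _.
have mC : measurable (code k @^-1` [set n]) by exact: nat_measurable_code.
have [W WE] := adapted_factor 0 aw.
have Wn t : t \in code k @^-1` [set n] -> w t = W n by rewrite inE /= WE => ->.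
rewrite (eq_integral (fun t => (W n)%:E * ((X k.+1 t == m)%:R)%:E)%E); last first.
  by move=> t /Wn ->; rewrite EFinM.
rewrite [RHS](eq_integral (fun t => (W n)%:E * (ker (X k t) m)%:E)%E); last first.
  by move=> t /Wn ->; rewrite EFinM.
have [[t tn]|Nt] := pselect (exists t, code k t = n); last first.
  rewrite (_ : code k @^-1` [set n] = set0) ?integral_set0//.
  by apply/seteqP; split=> // t tn; apply: Nt; exists t.
have W0 : 0 <= W n by rewrite -(Wn t) ?inE//.
have Zl (g : T -> R) : measurable_fun setT g -> (forall t, 0 <= g t) ->
    (\int[P]_(t in code k @^-1` [set n]) ((W n)%:E * (g t)%:E) =
     (W n)%:E * \int[P]_(t in code k @^-1` [set n]) (g t)%:E)%E.
  move=> mg g0; rewrite ge0_integralZl//.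
  - by apply/measurable_EFinP; exact: measurable_funTS.
  - by move=> *; rewrite lee_fin.
rewrite (Zl (fun t => (X k.+1 t == m)%:R))//; last exact: (mfX (fun x => (x == m)%:R)).
rewrite (Zl (fun t => ker (X k t) m))//; last exact: (mfX (fun x => ker x m)).
congr (_ * _)%E; rewrite -trans_code setIC -integral_indic//; last exact: mX.
apply: eq_integral => u _; rewrite indicE; congr ((nat_of_bool _)%:R)%:E.
by apply/idP/idP; rewrite inE => /eqP.
Qed.

Definition int (f : T -> R) := P.-integrable setT (EFin \o f).

Lemma adapted_int k (f : T -> R) (g : T -> R) : adapted k f -> int g ->
  (forall t, `|f t| <= g t) -> int f.
Proof.
move=> af ig fg; apply: le_integrable ig => //.
  by apply/measurable_EFinP; exact: adapted_measurable af.
by move=> t _; rewrite /= lee_fin (le_trans (fg t))// ler_norm.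
Qed.

(** The signed weight is split into positive and negative parts while f stays nonnegative.
    Integrability passes from the later time to the earlier one, because the two nonnegative
    integrals agree. *)
Lemma markov k (w : T -> R) (f Kf : nat -> R) : adapted k w ->
  (forall m, 0 <= f m) -> (forall x, KE f x = (Kf x)%:E) ->
  int (fun t => w t * f (X k.+1 t)) ->
  int (fun t => w t * Kf (X k t)) /\
  \int[P]_t (w t * f (X k.+1 t)) = \int[P]_t (w t * Kf (X k t)).
Proof.
move=> aw f0 KfE iwf.
have Kf0 x : 0 <= Kf x.
  by rewrite -lee_fin -KfE; apply: nneseries_ge0 => m _ _; rewrite lee_fin mulr_ge0.
have aXk (U : Type) j (g : nat -> U) : adapted j (fun t => g (X j t)).
  by move=> t t' ->.
have key (v : T -> R) : adapted k v -> (forall t, 0 <= v t) -> (forall t, v t <= `|w t|) ->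
    [/\ int (fun t => v t * f (X k.+1 t)), int (fun t => v t * Kf (X k t)) &
    \int[P]_t (v t * f (X k.+1 t)) = \int[P]_t (v t * Kf (X k t))].
  move=> av v0 vw.
  have E : (\int[P]_t (v t * f (X k.+1 t))%:E = \int[P]_t (v t * Kf (X k t))%:E)%E.
    by rewrite markov_ge0//; apply: eq_integral => t _; rewrite KfE EFinM.
  have i1 : int (fun t => v t * f (X k.+1 t)).
    apply: (@adapted_int k.+1 _ (fun t => `|w t * f (X k.+1 t)|)).
    - by move=> t t' h; rewrite h// (av _ t')// => i ik; rewrite h// leqW.
    - exact: integrable_norm.
    - by move=> t; rewrite !normrM (ger0_norm (v0 t)) ler_wpM2r.
  split=> //; last by rewrite /Rintegral E.
  apply/integrableP; split.
    apply/measurable_EFinP; apply: (@adapted_measurable _ _ k).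
    by move=> t t' h; rewrite h// (av _ t').
  under eq_integral => t _ do rewrite /= ger0_norm ?mulr_ge0//.
  rewrite -E; case/integrableP : i1 => _.
  by under eq_integral => t _ do rewrite /= ger0_norm ?mulr_ge0//.
pose wp t := Num.max (w t) 0; pose wn t := Num.max (- w t) 0.
have wE t : w t = wp t - wn t.
  rewrite /wp /wn; case: (lerP 0 (w t)) => h.
    by rewrite max_r ?subr0 ?oppr_le0.
  by rewrite max_l ?sub0r ?opprK// oppr_ge0 ltW.
have [] := key wp.
- by move=> t t' h; rewrite /wp (aw t t').
- by move=> t; rewrite /wp le_max lexx orbT.
- by move=> t; rewrite /wp ge_max ler_norm normr_ge0.
move=> p1 p2 p3; have [] := key wn.
- by move=> t t' h; rewrite /wn (aw t t').
- by move=> t; rewrite /wn le_max lexx orbT.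
- by move=> t; rewrite /wn ge_max -normrN ler_norm normr_ge0.
move=> n1 n2 n3.
have E2 (g : nat -> R) j : (fun t => w t * g (X j t)) =
    (fun t => wp t * g (X j t) - wn t * g (X j t)).
  by apply/funext => t; rewrite wE mulrBl.
rewrite !E2; split.
  exact: (@integrableB _ _ _ P setT measurableT _ _ p2 n2).
by rewrite !RintegralB// p3 n3.
Qed.

End MarkovChain.

(** * Rules for real-valued integrals under a probability *)

Section RintegralProb.
Context {R : realType} {d : measure_display} {T : measurableType d} (P : probability T R).
Implicit Types f g : T -> R.

Local Notation int := (int P).

Lemma int_cst (c : R) : int (fun=> c).
Proof. exact: finite_measure_integrable_cst. Qed.

Lemma intD f g : int f -> int g -> int (fun t => f t + g t).
Proof. by move=> fi gi; exact: (@integrableD _ _ _ P setT measurableT _ _ fi gi). Qed.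

Lemma intB f g : int f -> int g -> int (fun t => f t - g t).
Proof. by move=> fi gi; exact: (@integrableB _ _ _ P setT measurableT _ _ fi gi). Qed.

Lemma intZ (c : R) f : int f -> int (fun t => c * f t).
Proof. by move=> fi; exact: (@integrableZl _ _ _ P setT measurableT c _ fi). Qed.

Lemma int_norm f : int f -> int (fun t => `|f t|).
Proof. exact: integrable_norm. Qed.

Lemma int_sum n (F : nat -> T -> R) : (forall i, int (F i)) ->
  int (fun t => \sum_(i < n) F i t).
Proof.
move=> iF; elim: n => [|n IH].
  by rewrite (_ : (fun t => _) = fun=> 0); [exact: int_cst|apply/funext => t; rewrite big_ord0].
rewrite (_ : (fun t => _) = fun t => \sum_(i < n) F i t + F n t).
  exact: intD.
by apply/funext => t; rewrite big_ord_recr.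
Qed.

Lemma le_int f g : measurable_fun setT f -> int g -> (forall t, `|f t| <= g t) -> int f.
Proof.
move=> mf ig fg; apply: le_integrable ig => //; first exact/measurable_EFinP.
by move=> t _; rewrite /= lee_fin (le_trans (fg t))// ler_norm.
Qed.

Lemma Rint_cst (c : R) : \int[P]_t c = c.
Proof. by rewrite Rintegral_cst// [X in fine X](_ : _ = 1%E) ?mulr1//; exact: probability_setT. Qed.

Lemma RintD f g : int f -> int g -> \int[P]_t (f t + g t) = \int[P]_t f t + \int[P]_t g t.
Proof. by move=> *; exact: RintegralD. Qed.

Lemma RintB f g : int f -> int g -> \int[P]_t (f t - g t) = \int[P]_t f t - \int[P]_t g t.
Proof. by move=> *; exact: RintegralB. Qed.

Lemma RintZ (c : R) f : int f -> \int[P]_t (c * f t) = c * \int[P]_t f t.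
Proof. by move=> *; exact: RintegralZl. Qed.

Lemma le_Rint f g : int f -> int g -> (forall t, f t <= g t) ->
  \int[P]_t f t <= \int[P]_t g t.
Proof. by move=> *; exact: le_Rintegral. Qed.

Lemma ler_norm_Rint f g : int f -> int g -> (forall t, `|f t| <= g t) ->
  `|\int[P]_t f t| <= \int[P]_t g t.
Proof.
move=> fi gi fg; rewrite (le_trans (le_normr_Rintegral _ _))//.
by apply: le_Rint => //; exact: int_norm.
Qed.

Lemma EFin_Rint f : int f -> (\int[P]_t (f t)%:E)%E = (\int[P]_t f t)%:E.
Proof. by move=> fi; rewrite /Rintegral fineK//; exact: (@integrable_fin_num _ _ _ _ _ _ (EFin \o f)). Qed.

Lemma nat_mfun (C : T -> nat) (g : nat -> R) : nat_measurable C ->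
  measurable_fun setT (fun t => g (C t)).
Proof. exact: nat_measurable_fun. Qed.

End RintegralProb.

Ltac int_auto lem := repeat first [exact: int_cst | exact: lem
  | apply: intD | apply: intB | apply: intZ].

(** * Moments along the chain *)

Section InarMoments.
Context {R : realType} {d : measure_display} {T : measurableType d} (P : probability T R).
Context (alpha : R) (X0 : T -> nat) (eps : nat -> T -> nat) (xi : nat -> nat -> T -> nat).
Hypothesis H : inar_assumptions P alpha X0 eps xi.
Hypothesis H3X : (\int[P]_t (((X0 t)%:R : R) ^+ 3)%:E < +oo)%E.
Hypothesis H3e : (\int[P]_t (((eps 1%N t)%:R : R) ^+ 3)%:E < +oo)%E.

Local Notation int := (int P).
Local Notation X := (Xproc X0 eps xi).
Local Notation ker := (inar_kernel alpha (eps_pmf P eps)).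
Local Notation U := (eps 1%N).
Local Notation adapted := (adapted X).

Lemma alpha_bounds : 0 < alpha < 1. Proof. by case: H. Qed.

Let a01 : 0 <= alpha <= 1. Proof. by have := alpha_bounds; lra. Qed.

Let mX k : nat_measurable (X k). Proof. exact: nat_measurable_Xproc H k. Qed.

Let mU : nat_measurable U. Proof. by case: H => _ [h _]; exact: (h (Some (inl 0%N))). Qed.

Lemma ker_ge0 x m : 0 <= ker x m.
Proof. by apply: inar_kernel_ge0 => // l; rewrite fine_ge0. Qed.

Let transX := @path_event_transition _ _ _ P _ _ _ _ H.

Let MG k w f := @markov_ge0 _ _ _ P X ker mX ker_ge0 transX k w f.
Let MR k w f := @markov _ _ _ P X ker mX ker_ge0 transX k w f.

Lemma adapted_mfun (f : T -> R) k : adapted k f -> measurable_fun setT f.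
Proof. exact: adapted_measurable. Qed.

(** The transition operator in real numbers, with the innovation averaged inside and the thinning
    outside: its action on polynomials and on increments is then read off from [thin]. *)
Definition Kop (f : nat -> R) (x : nat) : R :=
  thin alpha x (fun i => \int[P]_t f (i + U t)%N).

Lemma KE_Kop (f : nat -> R) x : (forall m, 0 <= f m) ->
  (forall i, int (fun t => f (i + U t)%N)) -> KE ker f x = (Kop f x)%:E.
Proof.
move=> f0 fi; apply: nneseries_kernel => // i.
by rewrite EFin_Rint.
Qed.

Lemma le_natX3 (m j : nat) : (j <= 3)%N -> (m%:R : R) ^+ j <= 1 + m%:R ^+ 3.
Proof.
move=> j3; case: m => [|m].
  by rewrite !expr0n; case: (j == 0)%N; rewrite ?addr0 ?ler01 ?lexx//= addr0.
by rewrite ler_wpDl// ler_weXn2l// ler1n.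
Qed.

Lemma int_epsX j : (j <= 3)%N -> int (fun t => (U t)%:R ^+ j).
Proof.
move=> j3.
have mUf (g : nat -> R) : measurable_fun setT (fun t => g (U t)).
  exact: (nat_mfun g mU).
have i3 : int (fun t => (U t)%:R ^+ 3).
  apply/integrableP; split; first by apply/measurable_EFinP; exact: (mUf (fun m => m%:R ^+ 3)).
  by under eq_integral => t _ do rewrite /= ger0_norm ?exprn_ge0//.
apply: (le_int (mUf (fun m => m%:R ^+ j)) (intD (int_cst P 1) i3)) => t.
by rewrite ger0_norm ?exprn_ge0// le_natX3.
Qed.

Definition emom j : R := \int[P]_t (U t)%:R ^+ j.

Lemma emom1 : emom 1 = mu_eps P eps.
Proof. by []. Qed.

Lemma emom2 : emom 2 = sigma2_eps P eps + mu_eps P eps ^+ 2.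
Proof.
rewrite /sigma2_eps -emom1.
have -> : fine (\int[P]_t (((U t)%:R - emom 1) ^+ 2)%:E) =
   \int[P]_t ((U t)%:R ^+ 2 - (2 * emom 1 * (U t)%:R ^+ 1 - emom 1 ^+ 2)).
  by apply: eq_Rintegral => t _; ring.
rewrite RintB ?RintB ?RintZ ?Rint_cst ?int_epsX//.
- by rewrite -/(emom 1) -/(emom 2); ring.
all: by int_auto int_epsX.
Qed.

Lemma int_shift_epsX i j : (j <= 3)%N -> int (fun t => (i + U t)%:R ^+ j).
Proof.
move=> j3; apply: (le_int (nat_mfun (fun m => (i + m)%:R ^+ j) mU)
  (intD (int_cst P (1 + 4 * i%:R ^+ 3)) (intZ 4 (int_epsX (leqnn 3))))) => t.
rewrite ger0_norm ?exprn_ge0// (le_trans (le_natX3 _ j3))// natrD.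
set a : R := i%:R; set b : R := (U t)%:R.
have a0 : 0 <= a by []. have b0 : 0 <= b by [].
(* 4 (a^3 + b^3) - (a + b)^3 = 3 (a + b) (a - b)^2. *)
have : 0 <= (a + b) * (a - b) ^+ 2 by rewrite mulr_ge0 ?sqr_ge0// addr_ge0.
by nra.
Qed.

Lemma Kop1 x : Kop (fun m => m%:R) x = alpha * x%:R + emom 1.
Proof.
rewrite /Kop (@eq_thin _ _ _ _ (fun i => i%:R + emom 1)).
  by rewrite thinD thin_id thin_cst.
move=> i; under eq_Rintegral do rewrite natrD -[X in _ + X]expr1.
by rewrite RintD ?Rint_cst//; [exact: int_cst|exact: int_epsX].
Qed.

Lemma Kop2 x : Kop (fun m => m%:R ^+ 2) x =
  alpha ^+ 2 * x%:R ^+ 2 + (alpha * (1 - alpha) + 2 * alpha * emom 1) * x%:R + emom 2.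
Proof.
rewrite /Kop (@eq_thin _ _ _ _ (fun i => i%:R ^+ 2 + (2 * emom 1 * i%:R + emom 2))).
  by rewrite !thinD thin_sqr thinZ thin_id thin_cst; ring.
move=> i; rewrite (@eq_Rintegral _ _ _ _ _ (fun t => i%:R ^+ 2 + (2 * i%:R * (U t)%:R ^+ 1 + (U t)%:R ^+ 2))); last first.
  by move=> t _; rewrite natrD; ring.
rewrite RintD ?RintD ?RintZ ?Rint_cst ?int_epsX//.
- by rewrite -/(emom 1) -/(emom 2); ring.
all: by int_auto int_epsX.
Qed.

Definition q32 := 3 * alpha ^+ 2 * (1 - alpha) + 3 * alpha ^+ 2 * emom 1.
Definition q31 := alpha * (1 - alpha) * (1 - 2 * alpha) + 3 * alpha * (1 - alpha) * emom 1
  + 3 * alpha * emom 2.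

Lemma Kop3 x : Kop (fun m => m%:R ^+ 3) x =
  alpha ^+ 3 * x%:R ^+ 3 + q32 * x%:R ^+ 2 + q31 * x%:R + emom 3.
Proof.
rewrite /Kop (@eq_thin _ _ _ _ (fun i => i%:R ^+ 3 + (3 * emom 1 * i%:R ^+ 2 + (3 * emom 2 * i%:R + emom 3)))).
  by rewrite !thinD thin_cube !thinZ thin_sqr thin_id thin_cst /q32 /q31; ring.
move=> i; rewrite (@eq_Rintegral _ _ _ _ _ (fun t => i%:R ^+ 3 + (3 * i%:R ^+ 2 * (U t)%:R ^+ 1
  + (3 * i%:R * (U t)%:R ^+ 2 + (U t)%:R ^+ 3)))); last first.
  by move=> t _; rewrite natrD; ring.
rewrite !RintD ?RintZ ?Rint_cst ?int_epsX//.
- by rewrite -/(emom 1) -/(emom 2) -/(emom 3); ring.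
all: by int_auto int_epsX.
Qed.

Lemma KE_pow j x : (j <= 3)%N -> KE ker (fun m => m%:R ^+ j) x = (Kop (fun m => m%:R ^+ j) x)%:E.
Proof.
by move=> j3; apply: KE_Kop => [m|i]; [rewrite exprn_ge0|exact: int_shift_epsX].
Qed.

Lemma emom_ge0 j : 0 <= emom j.
Proof. by apply: Rintegral_ge0 => t _; rewrite exprn_ge0. Qed.

(** A Foster-Lyapunov drift condition. The leading coefficient alpha^3 is smaller than alpha, and
    the gap absorbs the lower-order terms for large x. *)
Lemma cube_drift : exists C : R, 0 <= C /\
  forall x, Kop (fun m => m%:R ^+ 3) x <= alpha * x%:R ^+ 3 + C.
Proof.
have [al0 al1] := andP alpha_bounds.
pose g : R := alpha - alpha ^+ 3.
have g0 : 0 < g by rewrite /g (_ : _ - _ = alpha * (1 - alpha) * (1 + alpha)); [rewrite !mulr_gt0//; lra|ring].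
pose B : R := `|q32| + `|q31| + emom 3.
have B0 : 0 <= B by rewrite !addr_ge0 ?normr_ge0 ?emom_ge0.
(* For y >= K >= 1 one has y^2 + y + 1 <= 3 y^2 and 3 B <= g y, so the lower-order terms are at most
   g y^3; below K they are at most a constant. *)
pose K : R := 1 + 3 * B / g.
have K1 : 1 <= K by rewrite lerDl divr_ge0// ?(ltW g0)// mulr_ge0.
have Kg : K * g = g + 3 * B by rewrite /K mulrDl mul1r divfK ?gt_eqF.
clearbody K; have K0 : 0 <= K by lra.
have KK0 : 0 <= K ^+ 2 + K + 1 by rewrite !addr_ge0 ?sqr_ge0.
exists (B * (K ^+ 2 + K + 1)); split; first by rewrite mulr_ge0.
move=> x; rewrite Kop3; set y : R := x%:R.
have y0 : 0 <= y by [].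
have h1 : q32 * y ^+ 2 + q31 * y + emom 3 <= B * (y ^+ 2 + y + 1).
  have e2 : q32 * y ^+ 2 <= `|q32| * y ^+ 2 by rewrite ler_wpM2r ?sqr_ge0 ?ler_norm.
  have e1 : q31 * y <= `|q31| * y by rewrite ler_wpM2r ?ler_norm.
  have n2 := normr_ge0 q32; have n1 := normr_ge0 q31; have n0 := emom_ge0 3.
  rewrite (le_trans (lerD (lerD e2 e1) (lexx _)))// /B.
  have y2 : 0 <= y ^+ 2 by rewrite sqr_ge0.
  have := mulr_ge0 n2 y0; have := mulr_ge0 n1 y2; have := mulr_ge0 n0 y0.
  have := mulr_ge0 n0 y2; lra.
suff : B * (y ^+ 2 + y + 1) <= g * y ^+ 3 + B * (K ^+ 2 + K + 1).
  by rewrite /g; lra.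
have [yK|Ky] := leP y K.
  rewrite -[X in X <= _]add0r lerD//; first by rewrite mulr_ge0 ?exprn_ge0// ltW.
  by rewrite ler_wpM2l// !lerD// ler_pXn2r// ?nnegrE//; lra.
rewrite -[X in X <= _]addr0 lerD//; last by rewrite mulr_ge0.
have gy : 3 * B <= g * y.
  have : K * g <= y * g by rewrite ler_wpM2r// ltW.
  lra.
have y1 : 1 <= y by lra.
apply: (@le_trans _ _ (3 * B * y ^+ 2)).
  rewrite (_ : 3 * B * y ^+ 2 = B * (3 * y ^+ 2)); last by ring.
  by rewrite ler_wpM2l//; nra.
by rewrite (_ : g * y ^+ 3 = g * y * y ^+ 2); [rewrite ler_wpM2r ?sqr_ge0|ring].
Qed.

Lemma integral_pow_step k j : (j <= 3)%N ->
  (\int[P]_t ((X k.+1 t)%:R ^+ j)%:E = \int[P]_t (Kop (fun m => m%:R ^+ j) (X k t))%:E)%E.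
Proof.
move=> j3.
have := @MG k (fun=> 1) (fun m => m%:R ^+ j).
under eq_integral do rewrite mul1r.
move=> ->//.
by apply: eq_integral => t _; rewrite mul1e KE_pow.
Qed.

Lemma bounded_cube_moments : exists C : R, 1 <= C /\
  forall k, int (fun t => (X k t)%:R ^+ 3) /\ \int[P]_t (X k t)%:R ^+ 3 <= C.
Proof.
have [al0 al1] := andP alpha_bounds.
have [C [C0 drift]] := cube_drift.
have mX3 k : measurable_fun setT (fun t => (X k t)%:R ^+ 3 : R).
  exact: (nat_mfun (fun m => m%:R ^+ 3) (mX k)).
pose e0 := fine (\int[P]_t (((X0 t)%:R : R) ^+ 3)%:E)%E.
have e0E : (\int[P]_t (((X0 t)%:R : R) ^+ 3)%:E = e0%:E)%E.
  rewrite /e0 fineK// ge0_fin_numE//.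
  by apply: integral_ge0 => t _; rewrite lee_fin exprn_ge0.
have e00 : 0 <= e0 by rewrite fine_ge0// integral_ge0// => t _; rewrite lee_fin exprn_ge0.
(* C / (1 - alpha) is the fixed point of the drift recursion, so this bound is preserved by a step.
   The induction runs in extended reals, since finiteness is part of what it proves. *)
pose C3 := e0 + C / (1 - alpha).
have C30 : 0 <= C3 by rewrite addr_ge0// divr_ge0//; lra.
have key k : (\int[P]_t ((X k t)%:R ^+ 3)%:E <= C3%:E)%E.
  elim: k => [|k IH].
    by rewrite /= e0E lee_fin lerDl divr_ge0//; lra.
  rewrite integral_pow_step//.
  apply: (@le_trans _ _ (\int[P]_t (alpha%:E * ((X k t)%:R ^+ 3)%:E + C%:E))%E).
    apply: ge0_le_integral => //.
    - move=> t _; rewrite lee_fin; apply: thin_ge0 => // i; apply: Rintegral_ge0 => u _.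
      by rewrite exprn_ge0.
    - apply/measurable_EFinP; exact: (nat_mfun (Kop (fun m => m%:R ^+ 3)) (mX k)).
    - apply: emeasurable_funD => //; apply: emeasurable_funM => //.
      exact/measurable_EFinP.
    - by move=> t _; rewrite -EFinM -EFinD lee_fin drift.
  rewrite ge0_integralD//; last 2 first.
  - by move=> t _; rewrite -EFinM lee_fin mulr_ge0 ?exprn_ge0// ltW.
  - by apply: emeasurable_funM => //; exact/measurable_EFinP.
  rewrite ge0_integralZl//; last 2 first.
  - exact/measurable_EFinP.
  - by rewrite lee_fin ltW.
  rewrite integral_cst// [X in (_ + C%:E * X)%E](_ : _ = 1%E); last exact: probability_setT.
  rewrite mule1.
  apply: (@le_trans _ _ (alpha%:E * C3%:E + C%:E)%E).
    by rewrite leeD2r// lee_wpmul2l// lee_fin ltW.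
  rewrite -EFinM -EFinD lee_fin /C3.
  have : C = (1 - alpha) * (C / (1 - alpha)) by rewrite mulrCA divff ?mulr1// subr_eq0 gt_eqF.
  set D := C / (1 - alpha) => CE.
  have D0 : 0 <= D by rewrite divr_ge0//; lra.
  by rewrite {1}CE; have := mulr_ge0 (ltW al0) e00; nra.
exists (C3 + 1); split; first by lra.
move=> k.
have ik : int (fun t => (X k t)%:R ^+ 3).
  apply/integrableP; split; first exact/measurable_EFinP.
  under eq_integral => t _ do rewrite /= ger0_norm ?exprn_ge0//.
  by rewrite (le_lt_trans (key k))// ltry.
split=> //; rewrite -lee_fin -EFin_Rint// (le_trans (key k))// lee_fin; lra.
Qed.

Lemma int_X3 k : int (fun t => (X k t)%:R ^+ 3).
Proof. by have [C [_ h]] := bounded_cube_moments; case: (h k). Qed.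

Lemma adapted_int3 k i (f : T -> R) (c : R) : adapted k f ->
  (forall t, `|f t| <= c * (1 + (X i t)%:R ^+ 3)) -> int f.
Proof.
move=> af fc; apply: (le_int (adapted_mfun af) _ fc).
by apply/intZ/intD; [exact: int_cst|exact: int_X3].
Qed.

Lemma int_XX k j : (j <= 3)%N -> int (fun t => (X k t)%:R ^+ j).
Proof.
move=> j3; apply: (@adapted_int3 k k _ 1).
  by move=> t t' ->.
by move=> t; rewrite mul1r ger0_norm ?exprn_ge0// le_natX3.
Qed.

(** No constant term: constants are fixed by the transition operator and would cancel in the Poisson
    equation. *)
Definition poly3 (a b c : R) (x : nat) : R := a * x%:R + b * x%:R ^+ 2 + c * x%:R ^+ 3.

Definition Kpoly3 (a b c : R) (x : nat) : R := a * Kop (fun m => m%:R ^+ 1) x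
  + b * Kop (fun m => m%:R ^+ 2) x + c * Kop (fun m => m%:R ^+ 3) x.

(** The transition operator maps x^j to alpha^j x^j plus lower degrees, so the coefficients are
    found from the top degree down, dividing by 1 - alpha^j. The leftover constant m is identified
    in [poisson_moment]. *)
Lemma poisson_poly3 g1 g2 g3 : exists a b c m : R, forall x,
  poly3 g1 g2 g3 x - m = poly3 a b c x - Kpoly3 a b c x.
Proof.
have [al0 al1] := andP alpha_bounds.
have n1 : 1 - alpha != 0 by rewrite subr_eq0 gt_eqF.
have n2 : 1 - alpha ^+ 2 != 0.
  by rewrite (_ : _ - _ = (1 - alpha) * (1 + alpha)); [rewrite mulf_neq0// gt_eqF//; lra|ring].
have n3 : 1 - alpha ^+ 3 != 0.
  rewrite (_ : _ - _ = (1 - alpha) * (1 + alpha + alpha ^+ 2)); last by ring.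
  by rewrite mulf_neq0// gt_eqF// !addr_gt0// exprn_gt0.
pose c := g3 / (1 - alpha ^+ 3).
pose b := (g2 + c * q32) / (1 - alpha ^+ 2).
pose a := (g1 + c * q31 + b * (alpha * (1 - alpha) + 2 * alpha * emom 1)) / (1 - alpha).
have cE : c * (1 - alpha ^+ 3) = g3 by rewrite /c divfK.
have bE : b * (1 - alpha ^+ 2) = g2 + c * q32 by rewrite /b divfK.
have aE : a * (1 - alpha) = g1 + c * q31 + b * (alpha * (1 - alpha) + 2 * alpha * emom 1) by rewrite /a divfK.
exists a, b, c, (a * emom 1 + b * emom 2 + c * emom 3) => x.
rewrite /poly3 /Kpoly3 Kop3 Kop2; rewrite (_ : Kop _ x = alpha * x%:R + emom 1); last exact: Kop1.
have -> : g1 = a * (1 - alpha) - c * q31 - b * (alpha * (1 - alpha) + 2 * alpha * emom 1) by rewrite aE; ring.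
have -> : g2 = b * (1 - alpha ^+ 2) - c * q32 by rewrite bE; ring.
rewrite -cE; ring.
Qed.

Lemma poly3_le a b c x : `|poly3 a b c x| <= (`|a| + `|b| + `|c|) * (1 + x%:R ^+ 3).
Proof.
rewrite /poly3 (le_trans (ler_normD _ _))//.
rewrite (le_trans (lerD (ler_normD _ _) (lexx _)))//.
rewrite (normrM a) (normrM b) (normrM c) !mulrDl.
have h j : (j <= 3)%N -> `|x%:R ^+ j| <= 1 + x%:R ^+ 3 :> R.
  by move=> j3; rewrite ger0_norm ?exprn_ge0// le_natX3.
by rewrite !lerD// ler_wpM2l//; [exact: (h 1%N)|exact: h|exact: h].
Qed.

Lemma markov_pow k (w : T -> R) C j : (j <= 3)%N -> adapted k w ->
  (forall t, `|w t| <= C) ->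
  [/\ int (fun t => w t * (X k.+1 t)%:R ^+ j),
     int (fun t => w t * Kop (fun m => m%:R ^+ j) (X k t)) &
    \int[P]_t (w t * (X k.+1 t)%:R ^+ j) = \int[P]_t (w t * Kop (fun m => m%:R ^+ j) (X k t))].
Proof.
move=> j3 aw wC.
have iw : int (fun t => w t * (X k.+1 t)%:R ^+ j).
  apply: (@adapted_int3 k.+1 k.+1 _ C).
    by move=> t t' h; rewrite h// (aw t t')// => i ik; rewrite h// leqW.
  move=> t; rewrite normrM ler_pM// ger0_norm ?exprn_ge0//; exact: le_natX3.
by have [] := MR aw (fun m => exprn_ge0 j (ler0n R m)) (fun x => KE_pow x j3) iw.
Qed.

Lemma markov_poly3 k (w : T -> R) C a b c : adapted k w -> (forall t, `|w t| <= C) ->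
  [/\ int (fun t => w t * poly3 a b c (X k.+1 t)),
     int (fun t => w t * Kpoly3 a b c (X k t)) &
    \int[P]_t (w t * poly3 a b c (X k.+1 t)) = \int[P]_t (w t * Kpoly3 a b c (X k t))].
Proof.
move=> aw wC.
have [i1 j1 e1] := markov_pow (j := 1) isT aw wC.
have [i2 j2 e2] := markov_pow (j := 2) isT aw wC.
have [i3 j3 e3] := markov_pow (j := 3) isT aw wC.
have E1 : (fun t => w t * poly3 a b c (X k.+1 t)) = (fun t => a * (w t * (X k.+1 t)%:R ^+ 1)
   + b * (w t * (X k.+1 t)%:R ^+ 2) + c * (w t * (X k.+1 t)%:R ^+ 3)).
  by apply/funext => t; rewrite /poly3; ring.
have E2 : (fun t => w t * Kpoly3 a b c (X k t)) = (fun t => a * (w t * Kop (fun m => m%:R ^+ 1) (X k t))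
   + b * (w t * Kop (fun m => m%:R ^+ 2) (X k t)) + c * (w t * Kop (fun m => m%:R ^+ 3) (X k t))).
  by apply/funext => t; rewrite /Kpoly3; ring.
rewrite !E1 !E2.
have I f g h : int f -> int g -> int h -> int (fun t => a * f t + b * g t + c * h t).
  by move=> *; do 2 (apply: intD; last exact: intZ); exact: intZ.
have E f g h : int f -> int g -> int h -> \int[P]_t (a * f t + b * g t + c * h t) =
    a * \int[P]_t f t + b * \int[P]_t g t + c * \int[P]_t h t.
  move=> fi gi hi; rewrite RintD ?RintD ?RintZ//; [exact: intZ|exact: intZ| |exact: intZ].
  by apply: intD; exact: intZ.
by split; [exact: I|exact: I|rewrite !E// e1 e2 e3].
Qed.

(** * Contraction of increments by the transition operator *)

Section Contraction.

Lemma int_shift_bounded (f : nat -> R) M i : (forall m, `|f m| <= M) -> int (fun t => f (i + U t)%N).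
Proof.
move=> fM; apply: (le_int (nat_mfun (fun m => f (i + m)%N) mU) (int_cst P M)).
by move=> t; exact: fM.
Qed.

Lemma Kop_bounded (f : nat -> R) M : (forall m, 0 <= f m <= M) -> forall x, 0 <= Kop f x <= M.
Proof.
move=> fM x.
have fi i : int (fun t => f (i + U t)%N).
  by apply: (@int_shift_bounded _ M) => m; rewrite ger0_norm; have := fM m; lra.
rewrite thin_ge0//=; last first.
  by move=> i; apply: Rintegral_ge0 => t _; have := fM (i + U t)%N; lra.
rewrite -[leRHS](thin_cst alpha x); apply: le_thin => // i.
rewrite -[leRHS](Rint_cst P); apply: le_Rint => //; first exact: int_cst.
by move=> t; have := fM (i + U t)%N; lra.
Qed.

(** One extra individual survives with probability alpha, so the increment of [Kop f] is alpha times
    an average of increments of f. *)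
Lemma Kop_lip (f : nat -> R) M L : (forall m, 0 <= f m <= M) ->
  (forall m, `|f m.+1 - f m| <= L) -> forall x, `|Kop f x.+1 - Kop f x| <= alpha * L.
Proof.
move=> fM fL x.
have fi i : int (fun t => f (i + U t)%N).
  by apply: (@int_shift_bounded _ M) => m; rewrite ger0_norm; have := fM m; lra.
rewrite /Kop /=; set e := fun i => _.
have -> : alpha * thin alpha x (e \o S) + (1 - alpha) * thin alpha x e - thin alpha x e =
   alpha * thin alpha x (fun i => e i.+1 + -1 * e i).
  by rewrite thinD thinZ; set u := thin _ _ (_ \o _); rewrite -/u; ring.
have al0 : 0 <= alpha by have := a01; lra.
rewrite normrM ger0_norm// ler_wpM2l//.
rewrite -[leRHS](thin_cst alpha x); apply: ler_norm_thin => // i.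
rewrite mulN1r -RintB// -[leRHS](Rint_cst P); apply: ler_norm_Rint.
- exact: intB.
- exact: int_cst.
- by move=> t; rewrite addSn.
Qed.

Lemma iter_Kop (f : nat -> R) M L k : (forall m, 0 <= f m <= M) ->
  (forall m, `|f m.+1 - f m| <= L) ->
  (forall x, 0 <= iter k Kop f x <= M) /\
  (forall x, `|iter k Kop f x.+1 - iter k Kop f x| <= alpha ^+ k * L).
Proof.
move=> fM fL; elim: k => [|k [IH1 IH2]]; first by rewrite expr0 mul1r.
split; first by move=> x; exact: Kop_bounded IH1 x.
by move=> x; rewrite exprS -mulrA; exact: Kop_lip IH1 IH2 x.
Qed.

Lemma iter_Kop_near0 (f : nat -> R) M L k x : (forall m, 0 <= f m <= M) ->
  (forall m, `|f m.+1 - f m| <= L) ->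
  `|iter k Kop f x - iter k Kop f 0%N| <= alpha ^+ k * L * x%:R.
Proof.
move=> fM fL; have [_ h] := iter_Kop k fM fL.
elim: x => [|x IH]; first by rewrite subrr normr0 mulr0.
rewrite (_ : _ - _ = (iter k Kop f x.+1 - iter k Kop f x) + (iter k Kop f x - iter k Kop f 0%N)); last by ring.
by rewrite (le_trans (ler_normD _ _))// -natr1 mulrDr mulr1 addrC lerD.
Qed.

Lemma integral_iter_Kop (f : nat -> R) M k : (forall m, 0 <= f m <= M) ->
  (\int[P]_t (f (X k t))%:E = \int[P]_t (iter k Kop f (X0 t))%:E)%E.
Proof.
elim: k f => [//|k IH] f fM.
have := @MG k (fun=> 1) f.
under eq_integral do rewrite mul1r.
move=> ->//; last by move=> m; have := fM m; lra.
rewrite -[iter k.+1 _ _]/(Kop (iter k Kop f)) -iterS iterSr -IH; last exact: Kop_bounded.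
apply: eq_integral => t _; rewrite mul1e KE_Kop//; first by move=> m; have := fM m; lra.
by move=> i; apply: (@int_shift_bounded _ M) => m; rewrite ger0_norm; have := fM m; lra.
Qed.

(** [iter k Kop f 0] is the mean at time k for the chain started from zero. Each unit of the initial
    state moves it by at most alpha^k L, and this is integrated over X0. *)
Lemma expect_contraction (f : nat -> R) M L k : (forall m, 0 <= f m <= M) ->
  (forall m, `|f m.+1 - f m| <= L) ->
  `|\int[P]_t f (X k t) - iter k Kop f 0%N| <= alpha ^+ k * L * \int[P]_t (X0 t)%:R.
Proof.
move=> fM fL; have [h1 h2] := iter_Kop k fM fL.
have L0 : 0 <= L by apply: le_trans (fL 0%N).
have al0 : 0 <= alpha by have := a01; lra.
have ig (g : nat -> R) : (forall m, 0 <= g m <= M) -> int (fun t => g (X0 t)).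
  move=> gM; apply: (le_int _ (int_cst P M)).
    exact: (nat_mfun g (mX 0%N)).
  by move=> t; rewrite ger0_norm; have := gM (X0 t); lra.
have i0 : int (fun t => (X0 t)%:R) by exact: (@int_XX 0 1 isT).
rewrite /Rintegral (integral_iter_Kop k fM) -/(Rintegral P setT (fun t => iter k Kop f (X0 t))).
rewrite -(Rint_cst P (iter k Kop f 0%N)) -RintB; [|exact: ig|exact: int_cst].
rewrite -RintZ//; apply: ler_norm_Rint.
- by apply: intB; [exact: ig|exact: int_cst].
- exact: intZ.
- by move=> t; exact: iter_Kop_near0 fM fL.
Qed.

End Contraction.
End InarMoments.

Section SeriesReal.
Context {R : realType}.

Lemma eseries_cvg (a : nat -> R) l : (fun N => \sum_(n < N) a n) @ \oo --> l ->
  (\sum_(n <oo) (a n)%:E = l%:E)%E.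
Proof.
move=> al; apply: cvg_lim => //.
rewrite (_ : (fun _ => _) = (fun N => (\sum_(n < N) a n)%:E)).
  by apply: cvg_EFin; [exact: nearW|].
by apply/funext => N; rewrite sumEFin big_mkord.
Qed.

Lemma cvg_eseries (a : nat -> R) l : (forall n, 0 <= a n) ->
  (\sum_(n <oo) (a n)%:E = l%:E)%E -> (fun N => \sum_(n < N) a n) @ \oo --> l.
Proof.
move=> a0 al.
have h : cvgn (fun N => \sum_(0 <= n < N) (a n)%:E)%E.
  by apply: is_cvg_nneseries => n _ _; rewrite lee_fin.
have : (fun N => \sum_(0 <= n < N) (a n)%:E)%E @ \oo --> l%:E by rewrite -al.
move/fine_cvg; apply: cvg_trans; apply: near_eq_cvg; apply: nearW => N /=.
by rewrite sumEFin /= big_mkord.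
Qed.

End SeriesReal.

(** * Moments of the stationary distribution *)

Section Stationary.
Context {R : realType} {d : measure_display} {T : measurableType d} (P : probability T R).
Context (alpha : R) (X0 : T -> nat) (eps : nat -> T -> nat) (xi : nat -> nat -> T -> nat).
Context (pi_ : nat -> R).
Hypothesis H : inar_assumptions P alpha X0 eps xi.
Hypothesis H3X : (\int[P]_t (((X0 t)%:R : R) ^+ 3)%:E < +oo)%E.
Hypothesis H3e : (\int[P]_t (((eps 1%N t)%:R : R) ^+ 3)%:E < +oo)%E.
Hypothesis Hpi : stationary_dist alpha (eps_pmf P eps) pi_.

Local Notation int := (int P).
Local Notation X := (Xproc X0 eps xi).
Local Notation ker := (inar_kernel alpha (eps_pmf P eps)).
Local Notation Kop := (Kop P alpha eps).
Local Notation m_ := (moment pi_).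

Let pi_ge0 n : 0 <= pi_ n. Proof. by case: Hpi. Qed.

Let al0 : 0 < alpha. Proof. by have /andP[] := alpha_bounds H. Qed.
Let al1 : alpha < 1. Proof. by have /andP[] := alpha_bounds H. Qed.

Let ker0 x m : 0 <= ker x m. Proof. exact: (ker_ge0 H). Qed.

(** A relation rather than a value, so that the existence of the stationary mean is part of each
    statement. *)
Definition pisum (f : nat -> R) (l : R) := (fun N => \sum_(n < N) f n * pi_ n) @ \oo --> l.

Lemma pisum_eseries (f : nat -> R) l : pisum f l -> (\sum_(n <oo) (f n * pi_ n)%:E = l%:E)%E.
Proof. exact: (@eseries_cvg _ (fun n => f n * pi_ n)). Qed.

Lemma pisum_unique f l l' : pisum f l -> pisum f l' -> l = l'.
Proof.
by move=> h h'; rewrite -(cvg_lim (@Rhausdorff R) h) -(cvg_lim (@Rhausdorff R) h').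
Qed.

Lemma eq_pisum f g l : f =1 g -> pisum f l -> pisum g l.
Proof. by move=> /funext ->. Qed.

Lemma pisum1 : pisum (fun=> 1) 1.
Proof.
case: Hpi => _ h _; rewrite /pisum; apply: cvg_trans h; apply: near_eq_cvg.
by apply: nearW => N; apply: eq_bigr => n _; rewrite mul1r.
Qed.

Lemma pisumD f g l l' : pisum f l -> pisum g l' -> pisum (fun n => f n + g n) (l + l').
Proof.
move=> h h'; rewrite /pisum.
rewrite (_ : (fun N => _) = (fun N => \sum_(n < N) f n * pi_ n + \sum_(n < N) g n * pi_ n)).
  exact: cvgD.
by apply/funext => N; rewrite -big_split; apply: eq_bigr => n _; rewrite mulrDl.
Qed.

Lemma pisumZ c f l : pisum f l -> pisum (fun n => c * f n) (c * l).
Proof.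
move=> h; rewrite /pisum.
rewrite (_ : (fun N => _) = (fun N => c * \sum_(n < N) f n * pi_ n)).
  by apply: cvgM => //; exact: cvg_cst.
by apply/funext => N; rewrite mulr_sumr; apply: eq_bigr => n _; rewrite mulrA.
Qed.
Arguments pisumZ c {f l}.

Lemma pisum_ge (f : nat -> R) l n : (forall x, 0 <= f x) -> pisum f l -> \sum_(x < n) f x * pi_ x <= l.
Proof.
move=> f0 h; have fp m : 0 <= f m * pi_ m by rewrite mulr_ge0.
rewrite -(cvg_lim (@Rhausdorff R) h); apply: limr_ge; first by apply/cvg_ex; exists l.
near=> N; have nN : (n <= N)%N by near: N; exact: nbhs_infty_ge.
rewrite -(subnKC nN) big_split_ord /= lerDl.
by apply: sumr_ge0 => i _; exact: fp.
Unshelve. all: by end_near. Qed.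

Lemma pisum_ge1 (f : nat -> R) l n : (forall x, 0 <= f x) -> pisum f l -> f n * pi_ n <= l.
Proof.
move=> f0 h; apply: le_trans (pisum_ge n.+1 f0 h).
by rewrite big_ord_recr /= lerDr sumr_ge0// => i _; rewrite mulr_ge0.
Qed.

Lemma pi_kernel m : (\sum_(n <oo) (pi_ n * ker n m)%:E = (pi_ m)%:E)%E.
Proof. by case: Hpi => _ _ /(_ m) h; exact: eseries_cvg. Qed.

Lemma pi_KE (f : nat -> R) : (forall m, 0 <= f m) ->
  (\sum_(n <oo) ((pi_ n)%:E * KE ker f n) = \sum_(m <oo) (f m * pi_ m)%:E)%E.
Proof.
move=> f0; rewrite /KE.
have E n : ((pi_ n)%:E * \sum_(m <oo) (f m * ker n m)%:E = \sum_(m <oo) (pi_ n * (f m * ker n m))%:E)%E.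
  by rewrite -nneseriesZl; [apply: eq_eseriesr|move=> m _; rewrite lee_fin mulr_ge0].
under eq_eseriesr do rewrite E.
rewrite nneseries_interchange; last by move=> i j; rewrite lee_fin !mulr_ge0.
apply: eq_eseriesr => m _; rewrite EFinM -pi_kernel -nneseriesZl; last first.
  by move=> n _; rewrite lee_fin mulr_ge0.
by apply: eq_eseriesr => n _; rewrite -EFinM; congr EFin; ring.
Qed.

Lemma pisum_Kop (f : nat -> R) l : (forall m, 0 <= f m) -> (forall i, int (fun t => f (i + eps 1%N t)%N)) ->
  pisum f l -> pisum (Kop f) l.
Proof.
move=> f0 fi h.
have K0 n : 0 <= Kop f n.
  rewrite -lee_fin -(KE_Kop H)//; apply: nneseries_ge0 => m _ _.
  by rewrite lee_fin mulr_ge0.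
apply: (@cvg_eseries _ (fun n => Kop f n * pi_ n)); first by move=> n; rewrite mulr_ge0.
rewrite -(pisum_eseries h) -pi_KE//; apply: eq_eseriesr => n _.
by rewrite (KE_Kop H)// -EFinM mulrC.
Qed.

Lemma pisum_bounded (f : nat -> R) M : (forall m, 0 <= f m <= M) -> exists2 l, pisum f l & 0 <= l <= M.
Proof.
move=> fM.
have f0 m : 0 <= f m by have := fM m; lra.
have M0 : 0 <= M by have := fM 0%N; lra.
have s0 : (0 <= \sum_(n <oo) (f n * pi_ n)%:E)%E.
  by apply: nneseries_ge0 => n _ _; rewrite lee_fin mulr_ge0.
have sM : (\sum_(n <oo) (f n * pi_ n)%:E <= M%:E)%E.
  have := pisum_eseries (pisumZ M pisum1); rewrite mulr1 => <-.
  apply: lee_nneseries => n _; first by rewrite lee_fin mulr_ge0.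
  by rewrite lee_fin ler_wpM2r//; have := fM n; lra.
have sf : (\sum_(n <oo) (f n * pi_ n)%:E)%E \is a fin_num.
  by rewrite ge0_fin_numE// (le_lt_trans sM)// ltry.
exists (fine (\sum_(n <oo) (f n * pi_ n)%:E)%E).
  by apply: (@cvg_eseries _ (fun n => f n * pi_ n)); [move=> n; rewrite mulr_ge0|rewrite fineK].
by rewrite -!lee_fin fineK// s0.
Qed.

Lemma le_pisum (f g : nat -> R) l l' : (forall n, f n <= g n) -> pisum f l -> pisum g l' -> l <= l'.
Proof.
move=> fg h h'; rewrite -subr_ge0.
have := pisumD h' (pisumZ (-1) h); rewrite mulN1r => h2.
have := @pisum_ge (fun n => g n + -1 * f n) _ 0 _ h2.
by rewrite big_ord0; apply => n; have := fg n; lra.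
Qed.

(** Stationarity cannot be applied to x^3 before its mean is known to be finite. It is applied to V
    = min(x^3, N): the drift gives [Kop V] <= W = min(alpha x^3 + C, N), so V - W + C is nonnegative
    with stationary mean at most C, and it equals (1 - alpha) x^3 wherever neither minimum
    truncates. *)
Lemma pi_cube_bounded : exists C, forall N, \sum_(n < N) n%:R ^+ 3 * pi_ n <= C.
Proof.
have [C [C0 drift]] := cube_drift H H3e.
exists (C / (1 - alpha)) => n0.
rewrite ler_pdivlMr ?subr_gt0//.
(* Large enough that neither minimum is active at the states below n0. *)
pose N : R := n0%:R ^+ 3 + alpha * n0%:R ^+ 3 + C.
have N0 : 0 <= N by rewrite !addr_ge0// ?mulr_ge0// ?exprn_ge0// ltW.
pose V (x : nat) : R := Num.min (x%:R ^+ 3) N.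
have VN x : 0 <= V x <= N.
  by rewrite /V le_min exprn_ge0//= N0 ge_min lexx orbT.
pose W (x : nat) : R := Num.min (alpha * x%:R ^+ 3 + C) N.
have WN x : 0 <= W x <= N.
  by rewrite /W le_min ge_min lexx orbT N0 andbT/= andbT addr_ge0 ?mulr_ge0 ?exprn_ge0// ltW.
have iV i : int (fun t => V (i + eps 1%N t)%N).
  by apply: (int_shift_bounded H (M := N)) => m; rewrite ger0_norm; have := VN m; lra.
have KVW x : Kop V x <= W x.
  rewrite /W le_min; apply/andP; split; last by have := Kop_bounded H VN x; lra.
  apply: le_trans (drift x); apply: le_thin => [|i]; first by rewrite (ltW al0) (ltW al1).
  apply: le_Rint => //; first exact: (int_shift_epsX H H3e).
  by move=> t; rewrite /V ge_min lexx.
have [v hv _] := pisum_bounded VN.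
have [w hw _] := pisum_bounded WN.
have vw : v <= w by apply: (le_pisum KVW) hw; apply: pisum_Kop => //; move=> m; have := VN m; lra.
have hD : pisum (fun x => V x + -1 * W x + C * 1) (v + -1 * w + C * 1).
  by apply: pisumD; [apply: pisumD => //; exact: pisumZ|exact: pisumZ pisum1].
have D0 x : 0 <= V x + -1 * W x + C * 1.
  rewrite mulN1r mulr1 /V /W.
  have y0 : 0 <= (x%:R : R) ^+ 3 by rewrite exprn_ge0.
  have ay : alpha * x%:R ^+ 3 <= x%:R ^+ 3 by rewrite ler_piMl// ltW.
  have : Num.min (alpha * x%:R ^+ 3 + C) N <= Num.min (x%:R ^+ 3) N + C.
    rewrite -lerBlDr le_min; apply/andP; split.
      have : Num.min (alpha * x%:R ^+ 3 + C) N <= alpha * x%:R ^+ 3 + C by rewrite ge_min lexx.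
      by lra.
    have : Num.min (alpha * x%:R ^+ 3 + C) N <= N by rewrite ge_min lexx orbT.
    by lra.
  by lra.
apply: le_trans (_ : v + -1 * w + C * 1 <= _); last by lra.
apply: le_trans (pisum_ge n0 D0 hD).
rewrite mulr_suml; apply: ler_sum => i _.
rewrite (_ : V i + -1 * W i + C * 1 = (1 - alpha) * i%:R ^+ 3); first by rewrite -mulrA mulrC -mulrA [pi_ i * _]mulrC mulrA.
have i3 : (i%:R : R) ^+ 3 <= n0%:R ^+ 3 by rewrite ler_pXn2r ?nnegrE// ler_nat ltnW.
have ai3 : alpha * i%:R ^+ 3 <= alpha * n0%:R ^+ 3 by rewrite ler_wpM2l// ltW.
have an : 0 <= alpha * n0%:R ^+ 3 by rewrite mulr_ge0 ?exprn_ge0// ltW.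
have nn : 0 <= (n0%:R : R) ^+ 3 by rewrite exprn_ge0.
rewrite /V /W !min_l; [ring|rewrite /N; lra|rewrite /N; lra].
Qed.

Lemma pisum_pow j : (j <= 3)%N -> pisum (fun n => n%:R ^+ j) (m_ j).
Proof.
move=> j3; have [C hC] := pi_cube_bounded.
have : cvgn (fun N => \sum_(n < N) (n%:R : R) ^+ j * pi_ n).
  apply: nondecreasing_is_cvgn.
    apply/nondecreasing_seqP => N; rewrite big_ord_recr /= lerDl.
    by rewrite mulr_ge0 ?exprn_ge0.
  exists (1 + C) => _ [N _ <-].
  apply: (@le_trans _ _ (\sum_(n < N) (1 * pi_ n + n%:R ^+ 3 * pi_ n))).
    by apply: ler_sum => n _; rewrite -mulrDl ler_wpM2r// le_natX3.
  rewrite big_split /= lerD// ?hC//.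
  exact: (@pisum_ge (fun=> 1) 1 N (fun=> ler01) pisum1).
by [].
Qed.

Lemma moment_Kop j : (j <= 3)%N -> pisum (Kop (fun m => m%:R ^+ j)) (m_ j).
Proof.
move=> j3; apply: pisum_Kop; last exact: pisum_pow.
- by move=> m; rewrite exprn_ge0.
- by move=> i; exact: (int_shift_epsX H H3e).
Qed.

(** Averaging the Poisson equation over the stationary law cancels its right-hand side, so the
    constant is the stationary mean. *)
Lemma poisson_moment g1 g2 g3 : exists a b c : R, forall x,
  poly3 g1 g2 g3 x - (g1 * m_ 1 + g2 * m_ 2 + g3 * m_ 3) =
  poly3 a b c x - Kpoly3 P alpha eps a b c x.
Proof.
have [a [b [c [m h]]]] := poisson_poly3 H H3e g1 g2 g3.
exists a, b, c => x; rewrite -h; congr (_ - _).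
have P3 u v w : pisum (poly3 u v w) (u * m_ 1 + v * m_ 2 + w * m_ 3).
  by do 2 (apply: pisumD; last by apply: pisumZ; exact: pisum_pow); apply: pisumZ; exact: (@pisum_pow 1).
have K3 u v w : pisum (Kpoly3 P alpha eps u v w) (u * m_ 1 + v * m_ 2 + w * m_ 3).
  by do 2 (apply: pisumD; last by apply: pisumZ; exact: moment_Kop); apply: pisumZ; exact: (@moment_Kop 1).
have h1 := pisumD (P3 g1 g2 g3) (pisumZ (- m) pisum1).
have h2 := pisumD (P3 a b c) (pisumZ (-1) (K3 a b c)).
have {}h1 := eq_pisum (g := fun n => poly3 a b c n + -1 * Kpoly3 P alpha eps a b c n) _ h1.
have := pisum_unique (h1 _) h2; move=> /(_ (fun n => _)) h3.
suff : g1 * m_ 1 + g2 * m_ 2 + g3 * m_ 3 + - m * 1 =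
  a * m_ 1 + b * m_ 2 + c * m_ 3 + -1 * (a * m_ 1 + b * m_ 2 + c * m_ 3) by lra.
by apply: h3 => n; have := h n; lra.
Qed.

Lemma moment1E : m_ 1 * (1 - alpha) = mu_eps P eps.
Proof.
have h1 := moment_Kop (j := 1) isT.
have h2 : pisum (Kop (fun m => m%:R ^+ 1)) (alpha * m_ 1 + emom P eps 1 * 1).
  rewrite (_ : Kop _ = (fun n => alpha * n%:R ^+ 1 + emom P eps 1 * 1)).
    by apply: pisumD; apply: pisumZ; [exact: pisum_pow|exact: pisum1].
  by apply/funext => x; rewrite (_ : Kop _ x = Kop (fun m => m%:R) x)// (Kop1 H H3e) mulr1.
by have := pisum_unique h1 h2; rewrite emom1; lra.
Qed.

Lemma moment2E : m_ 2 * (1 - alpha ^+ 2) =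
  (alpha * (1 - alpha) + 2 * alpha * mu_eps P eps) * m_ 1 + sigma2_eps P eps + mu_eps P eps ^+ 2.
Proof.
have h1 := moment_Kop (j := 2) isT.
have h2 : pisum (Kop (fun m => m%:R ^+ 2)) (alpha ^+ 2 * m_ 2 +
   (alpha * (1 - alpha) + 2 * alpha * emom P eps 1) * m_ 1 + emom P eps 2 * 1).
  rewrite (_ : Kop _ = (fun n => alpha ^+ 2 * n%:R ^+ 2 +
      (alpha * (1 - alpha) + 2 * alpha * emom P eps 1) * n%:R ^+ 1 + emom P eps 2 * 1)).
    apply: pisumD; last exact: pisumZ pisum1.
    by apply: pisumD; apply: pisumZ; exact: pisum_pow.
  by apply/funext => x; rewrite (Kop2 H H3e) mulr1.
by have := pisum_unique h1 h2; rewrite emom1 (emom2 H H3e); lra.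
Qed.

Lemma sigma2_ge0 : 0 <= sigma2_eps P eps.
Proof.
by rewrite /sigma2_eps fine_ge0// integral_ge0// => t _; rewrite lee_fin sqr_ge0.
Qed.

Lemma eps_support : exists2 e : nat, (0 < e)%N & 0 < eps_pmf P eps e.
Proof.
have mU : nat_measurable (eps 1%N) by case: H => _ [h _]; exact: (h (Some (inl 0%N))).
have [_ [_ [_ [_ [_ [_ [Hp _]]]]]]] := H.
apply: contrapT => Ne.
have p0 e : (0 < e)%N -> P (eps 1%N @^-1` [set e]) = 0%E.
  move=> e0; apply/eqP; rewrite eq_le measure_ge0 andbT leNgt; apply/negP => h.
  apply: Ne; exists e => //; rewrite /eps_pmf fine_gt0// h/=.
  by rewrite (le_lt_trans (probability_le1 _ (mU e)))// ltry.
move: Hp; rewrite (_ : eps 1%N @^-1` [set~ 0%N] = \bigcup_e (eps 1%N @^-1` [set e.+1])).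
  rewrite measure_bigcup//=.
  - by rewrite eseries0 ?ltxx// => i _ _; rewrite p0.
  - by apply/trivIsetP => i j _ _ ij; apply/seteqP; split => // t [/= ->] [] ji; rewrite ji eqxx in ij.
apply/seteqP; split=> t /=.
  by case E : (eps 1%N t) => [|e]// _; exists e.
by move=> [e _ /= ->].
Qed.

Lemma mu_gt0 : 0 < mu_eps P eps.
Proof.
have mU : nat_measurable (eps 1%N) by case: H => _ [h _]; exact: (h (Some (inl 0%N))).
have [e e0 pe] := eps_support.
have i1 : int (fun t => (eps 1%N t)%:R) by exact: (int_epsX H H3e (j := 1)).
have mI : measurable (eps 1%N @^-1` [set e]) by exact: mU.
rewrite -[mu_eps P eps]/(\int[P]_t (eps 1%N t)%:R).
apply: (@lt_le_trans _ _ (\int[P]_t (\1_(eps 1%N @^-1` [set e]) t : R))).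
  by rewrite /Rintegral integral_indic// setIT.
apply: le_Rint => //.
  apply: (le_int _ (int_cst P 1)); first exact: measurable_indic.
  by move=> t; rewrite indicE; case: (_ \in _); rewrite ?normr1 ?normr0.
move=> t; rewrite indicE; case: (boolP (t \in eps 1%N @^-1` [set e])) => [|_]; last by [].
by rewrite inE /= => ->; rewrite ler1n.
Qed.

(** All n individuals survive and e new ones arrive, a transition of probability at least alpha^n
    times [eps_pmf P eps e]. *)
Lemma pi_reach n e : 0 < pi_ n -> 0 < eps_pmf P eps e -> 0 < pi_ (n + e)%N.
Proof.
move=> pn pe; case: Hpi => _ _ /(_ (n + e)%N) h.
have kp : 0 < ker n (n + e)%N.
  rewrite inar_kernelE thinE big_ord_recr /= ltr_wpDl//.
    apply: sumr_ge0 => i _; rewrite !mulr_ge0// ?exprn_ge0 ?subr_ge0 ?(ltW al0) ?(ltW al1)//.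
    by rewrite /shiftp; case: ifP => // _; rewrite fine_ge0.
  by rewrite binn subnn expr0 mul1r mulr1 mulr_gt0 ?exprn_gt0// /shiftp leq_addr addKn.
have f0 x : 0 <= ker x (n + e)%N by exact: ker0.
apply: lt_le_trans (mulr_gt0 kp pn) _.
apply: (pisum_ge1 n f0); rewrite /pisum; apply: cvg_trans h; apply: near_eq_cvg.
by apply: nearW => N; apply: eq_bigr => i _; rewrite mulrC.
Qed.

Lemma pi_two_points : exists x y : nat, [/\ (0 < x)%N, (x < y)%N, 0 < pi_ x & 0 < pi_ y].
Proof.
have [n pn] : exists n, 0 < pi_ n.
  apply: contrapT => Nn.
  have pz n : pi_ n = 0.
    by apply/eqP; rewrite eq_le pi_ge0 andbT leNgt; apply/negP => h; apply: Nn; exists n.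
  have : pisum (fun=> 1) 0.
    rewrite /pisum (_ : (fun N => _) = fun=> 0); first exact: cvg_cst.
    by apply/funext => N; rewrite big1// => i _; rewrite pz mulr0.
  by move/(pisum_unique pisum1)/eqP; rewrite oner_eq0.
have [e e0 pe] := eps_support.
have p1 := pi_reach pn pe; have p2 := pi_reach p1 pe.
by exists (n + e)%N, (n + e + e)%N; split => //; lia.
Qed.

(** This is the stationary mean of X (c1 X + c2)^2. A nonzero affine function vanishes at most once,
    and the stationary law charges two distinct positive states. *)
Lemma quad_moment_gt0 (c1 c2 : R) : (c1 != 0) || (c2 != 0) ->
  0 < c1 ^+ 2 * m_ 3 + 2 * c1 * c2 * m_ 2 + c2 ^+ 2 * m_ 1.
Proof.
move=> cn0; have [x [y [x0 xy px py]]] := pi_two_points.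
pose f (n : nat) : R := n%:R * (c1 * n%:R + c2) ^+ 2.
have f0 n : 0 <= f n by rewrite mulr_ge0 ?sqr_ge0.
have hf : pisum f (c1 ^+ 2 * m_ 3 + 2 * c1 * c2 * m_ 2 + c2 ^+ 2 * m_ 1).
  have := pisumD (pisumD (pisumZ (c1 ^+ 2) (pisum_pow (leqnn 3)))
    (pisumZ (2 * c1 * c2) (pisum_pow (j := 2) isT))) (pisumZ (c2 ^+ 2) (pisum_pow (j := 1) isT)).
  rewrite (_ : (fun n => _) = f)//.
  by apply/funext => n; rewrite /f; ring.
have x0R : 0 < (x%:R : R) by rewrite ltr0n.
have xyR : (x%:R : R) < y%:R by rewrite ltr_nat.
have [z|z0] := eqVneq (c1 * x%:R + c2) 0; last first.
  apply: lt_le_trans (pisum_ge1 x f0 hf).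
  by rewrite /f mulr_gt0// mulr_gt0// exprn_even_gt0.
apply: lt_le_trans (pisum_ge1 y f0 hf).
rewrite mulr_gt0// mulr_gt0//; first lra.
rewrite exprn_even_gt0//=.
have c1n : c1 != 0.
  apply/negP => /eqP c10; move: cn0 z; rewrite c10 eqxx/= mul0r add0r => /negP h /eqP; exact: h.
by rewrite (_ : _ + _ = c1 * (y%:R - x%:R)); [rewrite mulf_neq0// subr_eq0 gt_eqF|lra].
Qed.

(** The stationary variance times 1 - alpha^2 equals alpha (1 - alpha) E X + sigma^2, and E X > 0.
    It is also the determinant of the limiting Hessian. *)
Lemma var_moment_gt0 : 0 < m_ 2 - m_ 1 ^+ 2.
Proof.
have e1 := moment1E; have e2 := moment2E; have s0 := sigma2_ge0.
have mu0 := mu_gt0.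
have m1 : 0 < m_ 1 by rewrite -(@pmulr_lgt0 _ (1 - alpha)) ?e1 ?subr_gt0.
have D : 0 < 1 - alpha ^+ 2.
  by rewrite (_ : _ - _ = (1 - alpha) * (1 + alpha)); [rewrite mulr_gt0 ?subr_gt0 ?addr_gt0|ring].
rewrite -(pmulr_lgt0 _ D) mulrBl e2 -e1.
rewrite (_ : _ - _ = alpha * (1 - alpha) * m_ 1 + sigma2_eps P eps); last by ring.
by rewrite ltr_wpDr// !mulr_gt0// subr_gt0.
Qed.

Lemma telescope_moment (g1 g2 g3 : R) : exists C : R, forall n,
  `|\sum_(k < n) \int[P]_t poly3 g1 g2 g3 (X k t) - n%:R * (g1 * m_ 1 + g2 * m_ 2 + g3 * m_ 3)| <= C.
Proof.
have [a [b [c h]]] := poisson_moment g1 g2 g3.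
have [C [C1 hC]] := bounded_cube_moments H H3X H3e.
pose D := `|a| + `|b| + `|c|.
have D0 : 0 <= D by rewrite !addr_ge0.
have i1 k u v w : int (fun t => poly3 u v w (X k t)).
  by apply: (adapted_int3 H H3X H3e (k := k) (i := k) (c := `|u| + `|v| + `|w|)) => [t t' ->//|t]; exact: poly3_le.
pose e k := \int[P]_t poly3 a b c (X k t).
have eD k : `|e k| <= D * (1 + C).
  apply: (le_trans (ler_norm_Rint (g := fun t => D * (1 + (X k t)%:R ^+ 3)) _ _ _)) => //.
  - by apply/intZ/intD; [exact: int_cst|exact: (int_X3 H H3X H3e)].
  - by move=> t; exact: poly3_le.
  - have i3 := int_X3 H H3X H3e k.
    rewrite RintZ ?RintD ?Rint_cst//; try exact: int_cst; last by apply: intD => //; exact: int_cst.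
    by rewrite ler_wpM2l// lerD2l; case: (hC k).
exists (D * (1 + C) + D * (1 + C)) => n.
suff -> : \sum_(k < n) \int[P]_t poly3 g1 g2 g3 (X k t) - n%:R * (g1 * m_ 1 + g2 * m_ 2 + g3 * m_ 3)
   = e 0%N - e n.
  by rewrite (le_trans (ler_normB _ _))// lerD.
elim: n => [|n IH]; first by rewrite big_ord0 mul0r !subrr.
rewrite big_ord_recr /= -natr1 mulrDl mul1r opprD addrACA IH.
have aw : adapted X n (fun=> 1 : R) by [].
have w1 (t : T) : `|1 : R| <= 1 by rewrite normr1.
have [_ j2 j3] := markov_poly3 H H3X H3e a b c aw w1.
set G := g1 * _ + _ + _ in h *.
have : \int[P]_t (poly3 g1 g2 g3 (X n t) - G) =
    \int[P]_t (poly3 a b c (X n t) - 1 * Kpoly3 P alpha eps a b c (X n t)).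
  by apply: eq_Rintegral => t _; rewrite mul1r h.
rewrite !RintB//; last exact: int_cst.
rewrite Rint_cst -j3 (_ : \int[P]_t (1 * _) = e n.+1); last first.
  by apply: eq_Rintegral => t _; rewrite mul1r.
by rewrite -/(e n) => ->; ring.
Qed.

(** Uniform integrability of X_k^3 in Cesaro mean. The averages of E X_k^3 tend to the stationary
    third moment by the Poisson equation; those of the truncated cube f tend, by contraction, to a
    value within e / 8 of it. Hence the average of X_k^3 - f(X_k) is small, and it controls the
    tail. *)
Lemma cube_tail (e : R) : 0 < e -> exists L N : nat, forall n, (N <= n)%N ->
  \sum_(k < n) \int[P]_t ((X k t)%:R ^+ 3 * (L <= X k t)%:R) <= e * n%:R.
Proof.
move=> e0; have [C hC] := telescope_moment 0 0 1.
have hC3 n : `|\sum_(k < n) \int[P]_t (X k t)%:R ^+ 3 - n%:R * m_ 3| <= C.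
  have := hC n; rewrite !mul0r !add0r mul1r (eq_bigr (fun k : 'I_n => \int[P]_t (X k t)%:R ^+ 3))//.
  by move=> k _; apply: eq_Rintegral => t _; rewrite /poly3; ring.
have C0 : 0 <= C by apply: le_trans (hC 0%N).
have e8 : 0 < e / 8 by lra.
have [N0 hN0] : exists N0 : nat, m_ 3 - e / 8 <= \sum_(x < N0) x%:R ^+ 3 * pi_ x.
  have h3 := pisum_pow (leqnn 3).
  have /cvgrPdist_le /(_ _ e8)[N0 _ h] := h3.
  exists N0; have := h N0 (leqnn _); rewrite ler_norml => /andP[_].
  by lra.
pose L := N0.+1.
pose f (x : nat) : R := (minn x L)%:R ^+ 3.
pose M : R := L%:R ^+ 3.
have M0 : 0 <= M by rewrite exprn_ge0.
have fM x : 0 <= f x <= M.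
  by rewrite exprn_ge0//= ler_pXn2r ?nnegrE// ler_nat geq_minr.
have fL x : `|f x.+1 - f x| <= M.
  by rewrite ler_norml; have := fM x; have := fM x.+1; lra.
have [l hl _] := pisum_bounded fM.
have lm3 : m_ 3 - e / 8 <= l.
  apply: (le_trans hN0); apply: (le_trans _ (pisum_ge N0 _ hl)); last by move=> x; have := fM x; lra.
  apply: ler_sum => x _; rewrite ler_wpM2r// /f (minn_idPl _)//.
  by rewrite /L ltnW// ltnS ltnW.
pose E0 := \int[P]_t (X0 t)%:R.
have E00 : 0 <= E0 by apply: Rintegral_ge0.
have m10 : 0 <= m_ 1.
  have := @pisum_ge (fun n => n%:R ^+ 1) _ 0 (fun n => exprn_ge0 1 (ler0n _ n)) (pisum_pow (j := 1) isT).
  by rewrite big_ord0.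
(* Both the law of X_k and the stationary law are compared with the chain started from zero; the two
   errors are proportional to E X0 and to the stationary mean. *)
have close k : `|\int[P]_t f (X k t) - l| <= alpha ^+ k * (M * (E0 + m_ 1)).
  have c1 := expect_contraction H H3X H3e k fM fL.
  have hk : pisum (iter k Kop f) l.
    elim: k {c1} => [//|k IH] /=; have [h1 _] := iter_Kop H k fM fL.
    apply: pisum_Kop => // [m|i]; first by have := h1 m; lra.
    by apply: (int_shift_bounded H (M := M)) => m; rewrite ger0_norm; have := h1 m; lra.
  set z := iter k Kop f 0%N in c1 *.
  have near0 x := iter_Kop_near0 H k x fM fL.
  have ak : 0 <= alpha ^+ k * M by rewrite mulr_ge0// exprn_ge0// ltW.
  have hz := pisumZ z pisum1.
  have hx := pisumZ (alpha ^+ k * M) (pisum_pow (j := 1) isT).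
  have u1 : l <= z * 1 + alpha ^+ k * M * m_ 1.
    apply: le_pisum hk (pisumD hz hx) => x /=.
    by have := near0 x; rewrite -/z ler_norml expr1 => /andP[]; lra.
  have u2 : z * 1 <= l + alpha ^+ k * M * m_ 1.
    apply: le_pisum hz (pisumD hk hx) => x /=.
    by have := near0 x; rewrite -/z ler_norml expr1 => /andP[]; lra.
  move: c1; rewrite -/E0 !ler_norml => /andP[c1 c2]; apply/andP; split; lra.
pose D := M * (E0 + m_ 1) / (1 - alpha).
have D0 : 0 <= D by rewrite divr_ge0 ?subr_ge0 ?(ltW al1)// mulr_ge0// addr_ge0.
have csum n : `|\sum_(k < n) \int[P]_t f (X k t) - n%:R * l| <= D.
  have -> : \sum_(k < n) \int[P]_t f (X k t) - n%:R * l = \sum_(k < n) (\int[P]_t f (X k t) - l).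
    by rewrite sumrB sumr_const card_ord mulr_natl.
  rewrite (le_trans (ler_norm_sum _ _ _))//.
  rewrite (le_trans (ler_sum _ (fun (k : 'I_n) _ => close k)))//.
  rewrite -mulr_suml /D mulrC ler_wpM2l ?mulr_ge0 ?addr_ge0//.
  rewrite -div1r ler_pdivlMr ?subr_gt0//.
  have h := subrX1 alpha n; have p0 : 0 <= alpha ^+ n by rewrite exprn_ge0// ltW.
  by move: h; set S := \sum_(i < n) _ => h; lra.
have [N1 hN1] : exists N1 : nat, 8 * (C + D) / e <= N1%:R.
  by exists (Num.truncn (8 * (C + D) / e)).+1; rewrite ltW// truncnS_gt.
(* The level is doubled because x >= 2 L gives x^3 <= 2 (x^3 - L^3). *)
exists (2 * L)%N, N1 => n nN1.
have nR : 8 * (C + D) <= e * n%:R.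
  by rewrite -ler_pdivrMl// mulrC (le_trans hN1)// ler_nat.
apply: (@le_trans _ _ (\sum_(k < n) 2 * (\int[P]_t (X k t)%:R ^+ 3 - \int[P]_t f (X k t)))).
  apply: ler_sum => k _.
  have ifk : int (fun t => f (X k t)).
    apply: (le_int _ (int_cst P M)); first exact: (nat_mfun f (nat_measurable_Xproc H k)).
    by move=> t; rewrite ger0_norm; have := fM (X k t); lra.
  have i3 := int_X3 H H3X H3e k.
  rewrite -RintB// -RintZ//; last exact: intB.
  apply: le_Rint.
  - apply: (le_int (nat_mfun (fun x => x%:R ^+ 3 * (2 * L <= x)%N%:R) (nat_measurable_Xproc H k)) i3) => t.
    rewrite ger0_norm ?mulr_ge0 ?exprn_ge0// ler_piMr ?exprn_ge0//.
    by case: (_ <= _)%N.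
  - by apply/intZ/intB.
  - move=> t; rewrite /f; set x := X k t; case: (boolP (2 * L <= x)%N) => Lx; last first.
      rewrite mulr0 mulr_ge0// subr_ge0 ler_pXn2r ?nnegrE// ler_nat geq_minl.
      by [].
    have /minn_idPr -> : (L <= x)%N by apply: leq_trans Lx; exact: leq_pmull.
    rewrite mulr1.
    have : (2 * L%:R : R) <= x%:R by rewrite -natrM ler_nat.
    have L0 : 0 <= (L%:R : R) by [].
    move=> Lx'; have : (2 * L%:R : R) ^+ 3 <= x%:R ^+ 3 by rewrite ler_pXn2r ?nnegrE// mulr_ge0.
    by rewrite exprMn; have := exprn_ge0 3 L0; nra.
rewrite -mulr_sumr sumrB.
have := hC3 n; have := csum n; rewrite !ler_norml => /andP[a1 a2] /andP[b1 b2].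
have nl : n%:R * (m_ 3 - e / 8) <= n%:R * l by rewrite ler_wpM2l.
have n0 : 0 <= (n%:R : R) by [].
by lra.
Qed.

End Stationary.

(** * Elementary eventual bounds *)

Section Eventually.
Context {R : realType}.

Lemma eventually_nat (c e : R) : 0 < e -> exists N : nat, forall n, (N <= n)%N -> c <= e * n%:R.
Proof.
move=> e0; exists (Num.truncn (c / e)).+1 => n Nn.
by rewrite -ler_pdivrMl// mulrC ltW// (lt_le_trans (truncnS_gt _))// ler_nat.
Qed.

Lemma eventually_sqrt (c e : R) : 0 <= c -> 0 < e -> exists N : nat, (0 < N)%N /\
  forall n, (N <= n)%N -> c / Num.sqrt n%:R <= e.
Proof.
move=> c0 e0; have [N hN] := eventually_nat ((c / e) ^+ 2) ltr01.
exists N.+1; split=> // n Nn.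
have n0 : 0 < (n%:R : R) by rewrite ltr0n; exact: leq_trans Nn.
have sn : 0 < Num.sqrt (n%:R : R) by rewrite sqrtr_gt0.
rewrite ler_pdivrMr// mulrC -ler_pdivrMr//.
rewrite -(ler_pXn2r (n := 2))// ?nnegrE ?divr_ge0 ?(ltW e0) ?(ltW sn)//.
by rewrite sqr_sqrtr ?(ltW n0)//; have := hN n (ltnW Nn); rewrite mul1r.
Qed.

Lemma ler_sum_shift (F : nat -> R) k0 n : (forall k, 0 <= F k) ->
  \sum_(k0 <= k < n) F k.+1 <= \sum_(k < n.+1) F k.
Proof.
move=> F0; rewrite -(big_mkord xpredT F) big_nat_recl//= ler_wpDl//.
have [k0n|nk0] := leqP k0 n; last by rewrite (big_geq (ltnW nk0)) sumr_ge0.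
by rewrite (big_cat_nat (n := k0) (m := 0))//= ler_wpDl// sumr_ge0.
Qed.

Lemma ler_sum_from (F : nat -> R) k0 n : (forall k, 0 <= F k) ->
  \sum_(k0 <= k < n) F k <= \sum_(k < n) F k.
Proof.
move=> F0; rewrite -(big_mkord xpredT F).
have [k0n|nk0] := leqP k0 n; last by rewrite (big_geq (ltnW nk0)) sumr_ge0.
by rewrite [leRHS](big_cat_nat (n := k0) (m := 0))//= ler_wpDl// sumr_ge0.
Qed.

End Eventually.

(** * Averaging against slowly varying adapted weights *)

Section Limit.
Context {R : realType} {d : measure_display} {T : measurableType d} (P : probability T R).
Context (alpha : R) (X0 : T -> nat) (eps : nat -> T -> nat) (xi : nat -> nat -> T -> nat).
Context (pi_ : nat -> R).
Hypothesis H : inar_assumptions P alpha X0 eps xi.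
Hypothesis H3X : (\int[P]_t (((X0 t)%:R : R) ^+ 3)%:E < +oo)%E.
Hypothesis H3e : (\int[P]_t (((eps 1%N t)%:R : R) ^+ 3)%:E < +oo)%E.
Hypothesis Hpi : stationary_dist alpha (eps_pmf P eps) pi_.

Local Notation int := (int P).
Local Notation X := (Xproc X0 eps xi).
Local Notation ker := (inar_kernel alpha (eps_pmf P eps)).
Local Notation Kop := (Kop P alpha eps).
Local Notation Kpoly3 := (Kpoly3 P alpha eps).
Local Notation adapted := (adapted X).
Local Notation m_ := (moment pi_).
Local Notation mu := (mu_eps P eps).
Local Notation sigma2 := (sigma2_eps P eps).

Let al0 : 0 < alpha. Proof. by have /andP[] := alpha_bounds H. Qed.
Let al1 : alpha < 1. Proof. by have /andP[] := alpha_bounds H. Qed.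
Let mX k : nat_measurable (X k). Proof. exact: nat_measurable_Xproc H k. Qed.
Let iX3 k : int (fun t => (X k t)%:R ^+ 3). Proof. exact: int_X3 H H3X H3e k. Qed.
Let amf (f : T -> R) k : adapted k f -> measurable_fun setT f.
Proof. exact: (adapted_mfun H). Qed.

Lemma int_dom3 (f : T -> R) k i j (c : R) : adapted k f ->
  (forall t, `|f t| <= c * (1 + (X i t)%:R ^+ 3 + (X j t)%:R ^+ 3)) -> int f.
Proof.
move=> af fc; apply: (le_int (amf af) _ fc).
by apply: intZ; do 2 (apply: intD => //); exact: int_cst.
Qed.

Lemma adapted_tail_int k (L : nat) : int (fun t => (X k t)%:R ^+ 3 * (L <= X k t)%:R).
Proof.
apply: (le_int (nat_mfun (fun x => x%:R ^+ 3 * (L <= x)%N%:R) (mX k)) (iX3 k)) => t.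
rewrite ger0_norm ?mulr_ge0 ?exprn_ge0// ler_piMr ?exprn_ge0//.
by case: (_ <= _)%N.
Qed.

(** A positive level forces X^3 >= 1 on the tail event, so that 1 + X^3 is at most 2 X^3 there. *)
Lemma cube_tail1 (e : R) : 0 < e -> exists L N : nat, (0 < L)%N /\ forall n, (N <= n)%N ->
  \sum_(k < n) \int[P]_t ((X k t)%:R ^+ 3 * (L <= X k t)%:R) <= e * n%:R.
Proof.
move=> /(cube_tail H H3X H3e Hpi)[L [N h]]; exists L.+1, N; split=> // n Nn.
apply: le_trans (h n Nn); apply: ler_sum => k _; apply: le_Rint; try exact: adapted_tail_int.
move=> t; rewrite ler_wpM2l ?exprn_ge0// ler_nat.
by case: (boolP (L < _)%N) => // /ltnW ->.
Qed.

(** Summation by parts through the Poisson solution h: E w_k (h(X_k) - K h(X_k)) = E w_k h(X_k) - E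
    w_k h(X_{k+1}), which telescopes up to the increments of w. D depends only on the polynomial and
    the chain, so the weights may change with n. *)
Lemma averaging_bound (g1 g2 g3 : R) : exists D : R, 0 <= D /\
  forall (w : nat -> T -> R) (B : R) k0 n, (k0 <= n)%N -> 0 <= B ->
  (forall k, (k0 <= k <= n)%N -> adapted k (w k)) ->
  (forall k t, (k0 <= k <= n)%N -> `|w k t| <= B) ->
  `|\sum_(k0 <= k < n) \int[P]_t (w k t * (poly3 g1 g2 g3 (X k t) - (g1 * m_ 1 + g2 * m_ 2 + g3 * m_ 3)))|
  <= D * B + D * \sum_(k0 <= k < n) \int[P]_t (`|w k.+1 t - w k t| * (1 + (X k.+1 t)%:R ^+ 3)).
Proof.
have [a [b [c h]]] := poisson_moment H H3e Hpi g1 g2 g3.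
have [C [C1 hC]] := bounded_cube_moments H H3X H3e.
set G := g1 * _ + _ + _ in h *.
pose D := `|a| + `|b| + `|c|.
have D0 : 0 <= D by rewrite !addr_ge0.
pose K := D * (1 + C).
have K0 : 0 <= K by rewrite mulr_ge0//; lra.
exists (K + K + D); split; first by rewrite !addr_ge0.
move=> w B k0 n k0n B0 aw wB.
have iwh k j : (k0 <= k <= n)%N -> (k <= j)%N -> int (fun t => w k t * poly3 a b c (X j t)).
  move=> k0k kj; apply: (@int_dom3 _ j j j (B * D)).
    by move=> t t' hh; rewrite hh// (aw _ k0k t t')// => i ik; apply: hh; exact: leq_trans kj.
  move=> t; rewrite normrM -mulrA ler_pM// ?wB//; apply: le_trans (poly3_le _ _ _ _) _.
  by rewrite ler_wpM2l// ler_wpDr// exprn_ge0.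
have i13 j : int (fun t => 1 + (X j t)%:R ^+ 3 : R) by apply: intD => //; exact: int_cst.
have i13C j : \int[P]_t (1 + (X j t)%:R ^+ 3) <= 1 + C.
  by rewrite RintD ?Rint_cst//; [rewrite lerD2l; case: (hC j)|exact: int_cst].
pose e k := \int[P]_t (w k t * poly3 a b c (X k t)).
have eD k : (k0 <= k <= n)%N -> `|e k| <= K * B.
  move=> k0k.
  apply: (@le_trans _ _ (\int[P]_t (B * D * (1 + (X k t)%:R ^+ 3)))).
    apply: ler_norm_Rint; [exact: iwh|exact: intZ|] => t.
    by rewrite normrM -mulrA ler_pM// ?wB//; exact: poly3_le.
  have -> : K * B = B * D * (1 + C) by rewrite /K; ring.
  by rewrite RintZ// ler_wpM2l ?mulr_ge0.
have sE k : (k0 <= k < n)%N -> \int[P]_t (w k t * (poly3 g1 g2 g3 (X k t) - G)) =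
    - (e k.+1 - e k) + \int[P]_t ((w k.+1 t - w k t) * poly3 a b c (X k.+1 t)).
  move=> /andP[k0k kn].
  have k1 : (k0 <= k <= n)%N by rewrite k0k ltnW.
  have k2 : (k0 <= k.+1 <= n)%N by rewrite kn ltnW.
  have [j1 j2 j3] := markov_poly3 H H3X H3e a b c (aw k k1) (fun t => wB k t k1).
  rewrite (@eq_Rintegral _ _ _ _ _ (fun t => w k t * poly3 a b c (X k t) - w k t * Kpoly3 a b c (X k t))); last first.
    by move=> t _; rewrite h mulrBr.
  rewrite RintB//; last exact: iwh.
  rewrite [X in _ = _ + X](@eq_Rintegral _ _ _ _ _ (fun t => w k.+1 t * poly3 a b c (X k.+1 t) - w k t * poly3 a b c (X k.+1 t))); last first.
    by move=> t _; rewrite mulrBl.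
  rewrite RintB//; last exact: iwh.
  rewrite -/(e k) -/(e k.+1) j3; ring.
rewrite (eq_big_nat _ _ sE) big_split /= sumrN telescope_sumr//.
rewrite mulrDl -addrA (le_trans (ler_normD _ _))//.
have -> : (K + K) * B + (D * B + (K + K + D) * \sum_(k0 <= k < n)
   \int[P]_t (`|w k.+1 t - w k t| * (1 + (X k.+1 t)%:R ^+ 3))) =
   (K * B + K * B) + (D * B + (K + K + D) * \sum_(k0 <= k < n)
   \int[P]_t (`|w k.+1 t - w k t| * (1 + (X k.+1 t)%:R ^+ 3))) by ring.
rewrite lerD//.
  by rewrite normrN (le_trans (ler_normB _ _))// lerD// eD// leqnn k0n.
rewrite ler_wpDl ?mulr_ge0//.
set W := \sum_(k0 <= k < n) \int[P]_t (`|_| * _).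
have W0 : 0 <= W.
  by apply: sumr_ge0 => k _; apply: Rintegral_ge0 => t _; rewrite mulr_ge0// addr_ge0// exprn_ge0.
apply: (@le_trans _ _ (D * W)); last by rewrite ler_wpM2r// ler_wpDl// addr_ge0.
rewrite (le_trans (ler_norm_sum _ _ _))// mulr_sumr; apply: ler_sum_nat => k /andP[k0k kn].
have k1 : (k0 <= k <= n)%N by rewrite k0k ltnW.
have k2 : (k0 <= k.+1 <= n)%N by rewrite kn ltnW.
have iww : int (fun t => `|w k.+1 t - w k t| * (1 + (X k.+1 t)%:R ^+ 3)).
  apply: (@int_dom3 _ k.+1 k.+1 k.+1 (B + B)).
    move=> t t' hh; rewrite (aw _ k2 t t')// (aw _ k1 t t') ?hh// => i ik.
    by apply: hh; exact: leqW.
  move=> t; rewrite normrM normr_id ler_pM//.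
    by rewrite (le_trans (ler_normB _ _))// lerD// wB.
  by rewrite ger0_norm ?addr_ge0 ?exprn_ge0// ler_wpDr// exprn_ge0.
rewrite -RintZ//; apply: ler_norm_Rint.
- rewrite (_ : (fun t => _) = (fun t => w k.+1 t * poly3 a b c (X k.+1 t) - w k t * poly3 a b c (X k.+1 t))).
    by apply: intB; exact: iwh.
  by apply/funext => t; rewrite mulrBl.
- exact: intZ.
- move=> t; rewrite normrM mulrCA ler_wpM2l//; exact: poly3_le.
Qed.

(* The weights vary slowly in the mean, while [h(X)] (the Poisson solution) is only
   uniformly integrable: the product is split at a high level [L] of the chain. *)
Lemma averaging_cvg (g1 g2 g3 B K e : R) : 0 <= B -> 0 <= K -> 0 < e -> exists N : nat,
  forall n, (N <= n)%N -> forall k0 (w dd : nat -> T -> R), (k0 <= n)%N ->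
  (forall k, (k0 <= k <= n)%N -> adapted k (w k)) ->
  (forall k t, (k0 <= k <= n)%N -> `|w k t| <= B) ->
  (forall k, (k0 <= k < n)%N -> int (dd k) /\ \int[P]_t dd k t <= K / Num.sqrt n%:R) ->
  (forall k t, (k0 <= k < n)%N -> `|w k.+1 t - w k t| <= dd k t) ->
  `|\sum_(k0 <= k < n) \int[P]_t (w k t * (poly3 g1 g2 g3 (X k t) - (g1 * m_ 1 + g2 * m_ 2 + g3 * m_ 3)))|
  <= e * n%:R.
Proof.
move=> B0 K0 e0; have [D [D0 hD]] := averaging_bound g1 g2 g3.
(* The tail of the chain costs 8 D B e1 n in the end: increments of w are at most 2 B, 1 + X^3 <= 2
   X^3 on the tail, and n + 1 <= 2 n. This is at most a third of e n. *)
pose e1 := e / (24 * (D * B + 1)).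
have DB : 0 < D * B + 1 by rewrite ltr_wpDl// mulr_ge0.
have e10 : 0 < e1 by rewrite divr_gt0// mulr_gt0.
have e1E : 24 * D * B * e1 <= e.
  rewrite /e1 mulrA ler_pdivrMr ?mulr_gt0// mulrC ler_wpM2l ?(ltW e0)//; lra.
have [L [N1 [L0 hL]]] := cube_tail1 e10.
pose Q := D * (1 + L%:R ^+ 3) * K.
have Q0 : 0 <= Q by rewrite !mulr_ge0// addr_ge0// exprn_ge0.
have [N2 [N20 hN2]] := eventually_sqrt Q0 (divr_gt0 e0 (ltr0n R 3) : 0 < e / 3).
have [N3 hN3] := eventually_nat (D * B) (divr_gt0 e0 (ltr0n R 3) : 0 < e / 3).
exists (maxn N1 (maxn N2 N3)) => n; rewrite !geq_max => /and3P[n1 n2 n3] k0 w dd k0n aw wB hdd wdd.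
apply: (le_trans (hD w B k0 n k0n B0 aw wB)).
have n0 : (0 < n)%N by exact: leq_trans n2.
set r := K / Num.sqrt n%:R in hdd.
pose F k := \int[P]_t ((X k t)%:R ^+ 3 * (L <= X k t)%:R).
have F0 k : 0 <= F k by apply: Rintegral_ge0 => t _; rewrite mulr_ge0// exprn_ge0.
have step k : (k0 <= k < n)%N -> \int[P]_t (`|w k.+1 t - w k t| * (1 + (X k.+1 t)%:R ^+ 3)) <=
    4 * B * F k.+1 + (1 + L%:R ^+ 3) * r.
  move=> kn; have [i1 h1] := hdd k kn.
  have /andP[k0k kn'] := kn.
  have k1 : (k0 <= k <= n)%N by rewrite k0k ltnW.
  have k2 : (k0 <= k.+1 <= n)%N by rewrite kn' ltnW.
  have c0 : 0 <= 1 + (L%:R : R) ^+ 3 by rewrite addr_ge0// exprn_ge0.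
  apply: (@le_trans _ _ (\int[P]_t (4 * B * ((X k.+1 t)%:R ^+ 3 * (L <= X k.+1 t)%:R) + (1 + L%:R ^+ 3) * dd k t))); last first.
    rewrite RintD ?RintZ//; [|exact: adapted_tail_int|by apply: intZ; exact: adapted_tail_int|exact: intZ].
    by rewrite lerD2l ler_wpM2l.
  have wBB t : `|w k.+1 t - w k t| <= B + B.
    by rewrite (le_trans (ler_normB _ _))// lerD// wB.
  apply: le_Rint.
  - apply: (@int_dom3 _ k.+1 k.+1 k.+1 (B + B)).
      move=> t t' hh; rewrite (aw _ k2 t t')// (aw _ k1 t t') ?hh// => i ik.
      by apply: hh; exact: leqW.
    move=> t; rewrite normrM normr_id ler_pM//.
    by rewrite ger0_norm ?addr_ge0 ?exprn_ge0// ler_wpDr// exprn_ge0.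
  - by apply: intD; apply: intZ => //; exact: adapted_tail_int.
  - move=> t; have hw := wdd k t kn.
    have dd0 : 0 <= dd k t by apply: le_trans hw.
    case: (boolP (L <= X k.+1 t)%N) => hX.
      rewrite mulr1 ler_wpDr ?mulr_ge0//.
      have x1 : 1 <= ((X k.+1 t)%:R : R) ^+ 3 by rewrite exprn_ege1// ler1n (leq_trans L0).
      have a0 := normr_ge0 (w k.+1 t - w k t); have := wBB t.
      by set A := `|_| in a0 *; set x := _ ^+ 3 in x1 *; nra.
    rewrite mulr0 mulr0 add0r mulrC ler_pM// ?addr_ge0 ?exprn_ge0// lerD2l ler_pXn2r ?nnegrE// ler_nat.
    by move: hX; rewrite -ltnNge => /ltnW.
have sumF : \sum_(k0 <= k < n) F k.+1 <= e1 * (2 * n%:R).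
  apply: (le_trans (ler_sum_shift k0 n F0)); apply: (le_trans (hL n.+1 _)); first exact: leqW.
  have n1R : (1 : R) <= n%:R by rewrite ler1n.
  by rewrite ler_wpM2l ?(ltW e10)// -natr1; lra.
have sum2 : \sum_(k0 <= k < n) \int[P]_t (`|w k.+1 t - w k t| * (1 + (X k.+1 t)%:R ^+ 3)) <=
    4 * B * (e1 * (2 * n%:R)) + (1 + L%:R ^+ 3) * r * n%:R.
  apply: (le_trans (ler_sum_nat step)); rewrite big_split /= -mulr_sumr lerD//.
    by rewrite ler_wpM2l// mulr_ge0.
  rewrite sumr_const_nat -[leLHS]mulr_natr ler_wpM2l//; last by rewrite ler_nat leq_subr.
  by rewrite mulr_ge0 ?addr_ge0 ?exprn_ge0// divr_ge0// sqrtr_ge0.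
have nn : 0 <= (n%:R : R) by [].
have h2 : Q / Num.sqrt n%:R * n%:R <= e / 3 * n%:R by rewrite ler_wpM2r// hN2.
have h1 := ler_wpM2r nn e1E.
have h3 := hN3 n n3.
apply: (le_trans (lerD (lexx _) (ler_wpM2l D0 sum2))).
have -> : D * (4 * B * (e1 * (2 * n%:R)) + (1 + L%:R ^+ 3) * r * n%:R) =
  (24 * D * B * e1 * n%:R) / 3 + Q / Num.sqrt n%:R * n%:R by rewrite /Q /r; field; rewrite sqrtr_eq0 -ltNge ltr0n.
by lra.
Qed.

End Limit.

(** * Score increments and their conditional variance *)

Section ConditionalVariance.
Context {R : realType} {d : measure_display} {T : measurableType d} (P : probability T R).
Context (alpha : R) (X0 : T -> nat) (eps : nat -> T -> nat) (xi : nat -> nat -> T -> nat).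
Hypothesis H : inar_assumptions P alpha X0 eps xi.
Hypothesis H3X : (\int[P]_t (((X0 t)%:R : R) ^+ 3)%:E < +oo)%E.
Hypothesis H3e : (\int[P]_t (((eps 1%N t)%:R : R) ^+ 3)%:E < +oo)%E.

Local Notation int := (int P).
Local Notation X := (Xproc X0 eps xi).
Local Notation U := (eps 1%N).
Local Notation ker := (inar_kernel alpha (eps_pmf P eps)).
Local Notation Kop := (Kop P alpha eps).
Local Notation adapted := (adapted X).
Local Notation mu := (mu_eps P eps).
Local Notation sigma2 := (sigma2_eps P eps).

Let al0 : 0 < alpha. Proof. by have /andP[] := alpha_bounds H. Qed.
Let al1 : alpha < 1. Proof. by have /andP[] := alpha_bounds H. Qed.
Let mX k : nat_measurable (X k). Proof. exact: nat_measurable_Xproc H k. Qed.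
Let amf (f : T -> R) k : adapted k f -> measurable_fun setT f.
Proof. exact: (adapted_mfun H). Qed.
Let kge0 x m : 0 <= ker x m. Proof. exact: ker_ge0 H x m. Qed.

(** The integrand may mix the past with the next state, as the squared centred increment does. *)
Lemma markov2_ge0 k (F : T -> nat -> R) : (forall m, adapted k (F^~ m)) ->
  (forall t m, 0 <= F t m) ->
  (\int[P]_t (F t (X k.+1 t))%:E = \int[P]_t \sum_(m <oo) (F t m * ker (X k t) m)%:E)%E.
Proof.
move=> aF F0.
rewrite (eq_integral (fun t => \sum_(m <oo) (F t m * (X k.+1 t == m)%:R)%:E)%E); last first.
  by move=> t _; rewrite nneseries_pick.
have mF m : measurable_fun setT (fun t => (F t m * (X k.+1 t == m)%:R)).
  apply: (@amf _ k.+1) => t t' h; rewrite h// (aF m t t')// => i ik.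
  by apply: h; exact: leqW.
have mK m : measurable_fun setT (fun t => F t m * ker (X k t) m).
  by apply: (@amf _ k) => t t' h; rewrite h// (aF m t t').
rewrite integral_nneseries//; last 2 first.
- by move=> m; apply/measurable_EFinP.
- by move=> m t _; rewrite lee_fin mulr_ge0.
rewrite integral_nneseries//; last 2 first.
- by move=> m; apply/measurable_EFinP.
- by move=> m t _; rewrite lee_fin mulr_ge0.
apply: eq_eseriesr => m _.
rewrite (@markov_ge0 _ _ _ P X ker mX kge0 (path_event_transition H) k (F^~ m) (fun x => (x == m)%:R))//.
apply: eq_integral => t _; rewrite EFinM; congr (_ * _)%E.
rewrite -(nneseries_pick m (kge0 (X k t))); apply: eq_eseriesr => j _.
by rewrite mulrC eq_sym.
Qed.

Lemma Kop_center a x :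
  Kop (fun m => (m%:R - a) ^+ 2) x = Kop (fun m => m%:R ^+ 2) x - 2 * a * Kop (fun m => m%:R) x + a ^+ 2.
Proof.
rewrite /Kop -mulNr -thinZ -(thin_cst alpha x (a ^+ 2)) -!thinD; apply: eq_thin => i.
rewrite (@eq_Rintegral _ _ _ _ _ (fun t => (i + U t)%:R ^+ 2 + (- (2 * a) * (i + U t)%:R ^+ 1 + a ^+ 2))); last first.
  by move=> t _; ring.
have s1 : int (fun t => (i + U t)%:R ^+ 1) by exact: (int_shift_epsX H H3e i (j := 1) isT).
have s2 : int (fun t => (i + U t)%:R ^+ 2) by exact: (int_shift_epsX H H3e i (j := 2) isT).
rewrite RintD ?RintD ?RintZ ?Rint_cst//; first by rewrite addrA.
all: by int_auto s1.
Qed.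

(** Binomial variance plus innovation variance: the conditional variance of the next state given
    x. *)
Definition cvar (x : nat) : R := alpha * (1 - alpha) * x%:R + sigma2.

Lemma KE_center x : KE ker (fun m => (m%:R - (alpha * x%:R + mu)) ^+ 2) x = (cvar x)%:E.
Proof.
rewrite (KE_Kop H).
- rewrite Kop_center (Kop2 H H3e) (Kop1 H H3e) emom1 (emom2 H H3e) /cvar; congr EFin; ring.
- by move=> m; rewrite sqr_ge0.
- move=> i; set a := alpha * _ + _.
  have s1 : int (fun t => (i + U t)%:R ^+ 1) by exact: (int_shift_epsX H H3e i (j := 1) isT).
  have s2 : int (fun t => (i + U t)%:R ^+ 2) by exact: (int_shift_epsX H H3e i (j := 2) isT).
  rewrite (_ : (fun t => _) = (fun t => (i + U t)%:R ^+ 2 + (- (2 * a) * (i + U t)%:R ^+ 1 + a ^+ 2))).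
    by apply: intD => //; apply: intD; [exact: intZ|exact: int_cst].
  by apply/funext => t; ring.
Qed.

Lemma cvar_ge0 x : 0 <= cvar x.
Proof. by rewrite addr_ge0 ?sigma2_ge0// !mulr_ge0// ?subr_ge0 ltW. Qed.

Variables c1 c2 : R.

Definition vlin (x : nat) : R := c1 * x%:R + c2.

(* The increment of the score in the direction [(c1, c2)]. *)
Definition dS (k : nat) (t : T) : R :=
  vlin (X k t) * ((X k.+1 t)%:R - (alpha * (X k t)%:R + mu)).

Lemma dSE k t : dS k t = vlin (X k t) * ((X k.+1 t)%:R - (alpha * (X k t)%:R + mu)).
Proof. by []. Qed.

(** The conditional variance of [dS], a polynomial of degree at most three in the state; this is
    where the third moments enter. *)
Definition cvS (x : nat) : R := vlin x ^+ 2 * cvar x.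

Lemma adapted_dS k j : (k < j)%N -> adapted j (dS k).
Proof. by move=> kj t t' h; rewrite /dS !h// ltnW. Qed.

Lemma cvSE x : cvS x = poly3 (2 * c1 * c2 * sigma2 + c2 ^+ 2 * (alpha * (1 - alpha)))
  (c1 ^+ 2 * sigma2 + 2 * c1 * c2 * (alpha * (1 - alpha))) (c1 ^+ 2 * (alpha * (1 - alpha))) x
  + c2 ^+ 2 * sigma2.
Proof. by rewrite /cvS /vlin /cvar /poly3; ring. Qed.

Lemma cvS_ge0 x : 0 <= cvS x.
Proof. by rewrite mulr_ge0 ?sqr_ge0 ?cvar_ge0. Qed.

Lemma cvS_le : exists C : R, 0 <= C /\ forall x, cvS x <= C * (1 + x%:R ^+ 3).
Proof.
set a := 2 * c1 * c2 * sigma2 + c2 ^+ 2 * (alpha * (1 - alpha)).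
set b := c1 ^+ 2 * sigma2 + 2 * c1 * c2 * (alpha * (1 - alpha)).
set c := c1 ^+ 2 * (alpha * (1 - alpha)).
exists (`|a| + `|b| + `|c| + c2 ^+ 2 * sigma2); split.
  by rewrite !addr_ge0// mulr_ge0 ?sqr_ge0 ?sigma2_ge0.
move=> x; rewrite cvSE -/a -/b -/c mulrDl lerD//.
  by apply: le_trans (ler_norm _) _; exact: poly3_le.
have s0 : 0 <= c2 ^+ 2 * sigma2 by rewrite mulr_ge0 ?sqr_ge0 ?sigma2_ge0.
by rewrite ler_peMr// lerDl exprn_ge0.
Qed.

Lemma int_cvS k : int (fun t => cvS (X k t)).
Proof.
have [C [C0 hC]] := cvS_le.
apply: (adapted_int3 H H3X H3e (k := k) (i := k) (c := C)); first by move=> t t' ->.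
by move=> t; rewrite ger0_norm ?cvS_ge0.
Qed.

(** Expanding the square would produce terms of degree four in the chain, whose means are not
    controlled. The square is kept whole: as a nonnegative integral it equals that of u times [cvS],
    which is finite. *)
Lemma markov_dS_sq k (w : T -> R) B : adapted k w -> (forall t, `|w t| <= B) ->
  int (fun t => w t * dS k t ^+ 2) /\
  \int[P]_t (w t * dS k t ^+ 2) = \int[P]_t (w t * cvS (X k t)).
Proof.
have adS u : adapted k u -> adapted k.+1 (fun t => u t * dS k t ^+ 2 : R).
  move=> au t t' h; rewrite (adapted_dS (ltnSn k) h) (au t t')// => i ik.
  by apply: h; exact: leqW.
have key (u : T -> R) C : adapted k u -> (forall t, 0 <= u t <= C) ->
    int (fun t => u t * dS k t ^+ 2) /\ int (fun t => u t * cvS (X k t)) /\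
    \int[P]_t (u t * dS k t ^+ 2) = \int[P]_t (u t * cvS (X k t)).
  move=> au uC.
  have u0 t : 0 <= u t by have := uC t; lra.
  have E : (\int[P]_t (u t * dS k t ^+ 2)%:E = \int[P]_t (u t * cvS (X k t))%:E)%E.
    rewrite (@markov2_ge0 k (fun t m => u t * (vlin (X k t) * (m%:R - (alpha * (X k t)%:R + mu))) ^+ 2)); last 2 first.
    - by move=> m t t' h; rewrite (au t t')// h.
    - by move=> t m; rewrite mulr_ge0// sqr_ge0.
    apply: eq_integral => t _.
    rewrite /cvS mulrA EFinM -KE_center /KE -nneseriesZl; last first.
      by move=> m _; rewrite lee_fin mulr_ge0// sqr_ge0.
    by apply: eq_eseriesr => m _; rewrite -EFinM; congr EFin; ring.
  have i2 : int (fun t => u t * cvS (X k t)).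
    apply: (le_int _ (intZ C (int_cvS k))).
      by apply: (@amf _ k) => t t' h; rewrite (au t t')// h.
    move=> t; rewrite normrM (ger0_norm (u0 t)) (ger0_norm (cvS_ge0 _)) ler_wpM2r ?cvS_ge0//.
    by have := uC t; lra.
  split; last by split=> //; rewrite /Rintegral E.
  apply/integrableP; split; first by apply/measurable_EFinP; apply: (@amf _ k.+1); exact: adS.
  rewrite (eq_integral (fun t => (u t * dS k t ^+ 2)%:E)); last first.
    by move=> t _; rewrite /= ger0_norm//; exact: mulr_ge0 (u0 t) (sqr_ge0 _).
  by rewrite E EFin_Rint// ltry.
move=> aw wB.
have B0 : 0 <= B by apply: le_trans (wB point).
(* A signed weight is written as (w + B) - B, a difference of nonnegative bounded adapted
   weights. *)
have aw' : adapted k (fun t => w t + B) by move=> t t' h; rewrite (aw t t').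
have [p1 [p2 p3]] := key _ (B + B) aw' (fun t => ltac:(have := wB t; rewrite ler_norml; lra)).
have [q1 [q2 q3]] := key (fun=> B) B (fun _ _ _ => erefl) (fun t => ltac:(by rewrite B0 lexx)).
have E (f : T -> R) : (fun t => w t * f t) = (fun t => (w t + B) * f t - B * f t).
  by apply/funext => t; ring.
rewrite !E; split; first exact: intB.
by rewrite !RintB// p3 q3.
Qed.

Lemma int_dS_sq k : int (fun t => dS k t ^+ 2).
Proof.
have [] := @markov_dS_sq k (fun=> 1) 1 (fun _ _ _ => erefl) (fun t => ltac:(by rewrite normr1)).
by rewrite (_ : (fun t => 1 * _) = (fun t => dS k t ^+ 2))//; apply/funext => t; rewrite mul1r.
Qed.

Lemma int_dS k : int (dS k).
Proof.
apply: (le_int (amf (adapted_dS (ltnSn k))) (intD (int_cst P 1) (int_dS_sq k))) => t.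
by rewrite -(real_normK (num_real (dS k t))); have := sqr_ge0 (`|dS k t| - 1); have := normr_ge0 (dS k t); nra.
Qed.

(** Here the products have degree two, so they are integrable term by term and the centring
    cancels. *)
Lemma markov_dS k (w : T -> R) B : adapted k w -> (forall t, `|w t| <= B) ->
  int (fun t => w t * dS k t) /\ \int[P]_t (w t * dS k t) = 0.
Proof.
move=> aw wB.
have B0 : 0 <= B by apply: le_trans (wB point).
have awv : adapted k (fun t => w t * vlin (X k t)) by move=> t t' h; rewrite (aw t t')// h.
have iwd : int (fun t => w t * dS k t).
  apply: (le_int _ (intZ B (int_norm (int_dS k)))).
    apply: (@amf _ k.+1) => t t' h; rewrite (adapted_dS (ltnSn k) h) (aw t t')// => i ik.
    by apply: h; exact: leqW.
  by move=> t; rewrite normrM ler_wpM2r.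
split=> //.
have [C [C1 hC]] := bounded_cube_moments H H3X H3e.
have bnd j : (k <= j)%N -> int (fun t => w t * vlin (X k t) * (X j t)%:R).
  move=> kj; apply: (@int_dom3 _ _ _ P alpha X0 eps xi H H3X H3e _ j k j (B * (`|c1| + `|c2|) * 2)).
    move=> t t' h; rewrite h// (aw t t') ?h// => i ik; apply: h; exact: leq_trans kj.
  move=> t; rewrite !normrM -mulrA -mulrA -mulrA ler_pM// ?mulr_ge0//.
  rewrite /vlin; set x := (X k t)%:R; set y := (X j t)%:R.
  have x0 : 0 <= x :> R by []. have y0 : 0 <= y :> R by [].
  have h1 : `|c1 * x + c2| <= (`|c1| + `|c2|) * (1 + x).
    rewrite (le_trans (ler_normD _ _))// normrM (ger0_norm x0).
    by have := normr_ge0 c1; have := normr_ge0 c2; nra.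
  rewrite (ger0_norm y0); apply: (le_trans (ler_wpM2r y0 h1)).
  rewrite -!mulrA ler_wpM2l ?addr_ge0//.
  have e1 : x ^+ 1 <= 1 + x ^+ 3 by exact: le_natX3.
  have e2 : y ^+ 1 <= 1 + y ^+ 3 by exact: le_natX3.
  have e3 : y ^+ 2 <= 1 + y ^+ 3 by exact: le_natX3.
  have e4 : x ^+ 2 <= 1 + x ^+ 3 by exact: le_natX3.
  have := sqr_ge0 (x - y); have := sqr_ge0 (y - 1); nra.
have [i2 e2] := @markov _ _ _ P X ker mX kge0 (path_event_transition H) k _ (fun m => m%:R) (fun x => alpha * x%:R + mu)
  awv (fun m => ler0n R m) (fun x => ltac:(by rewrite (KE_pow H H3e x (j := 1) isT) (Kop1 H H3e) emom1)) (bnd k.+1 (leqnSn k)).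
rewrite (@eq_Rintegral _ _ _ _ _ (fun t => w t * vlin (X k t) * (X k.+1 t)%:R - w t * vlin (X k t) * (alpha * (X k t)%:R + mu))).
  by rewrite RintB ?e2 ?subrr//; exact: bnd.
by move=> t _; rewrite /dS; ring.
Qed.

End ConditionalVariance.

(** * Taylor bounds for the cosine and for a smooth absolute value *)

Section TrigBounds.
Context {R : realType}.
Implicit Types x y u v : R.

Lemma sin_lip0 x : `|sin x| <= `|x|.
Proof.
wlog x0 : x / 0 < x.
  move=> h; have [|x0|<-] := ltgtP 0 x; [exact: h| |by rewrite sin0].
  by have := h (- x); rewrite oppr_gt0 => /(_ x0); rewrite sinN !normrN.
have [|c _] := @MVT R sin cos 0 x x0 (fun y _ => is_derive_sin y).
  by apply: continuous_subspaceT; exact: continuous_sin.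
rewrite sin0 !subr0 => ->; rewrite normrM ler_piMl// ?cos_max//.
Qed.

Lemma cos_sub1 x : cos x - 1 = - (2 * sin (x / 2) ^+ 2).
Proof.
have -> : cos x = cos (x / 2 + x / 2) by congr cos; field.
rewrite cosD -!expr2 cos2sin2; ring.
Qed.

Lemma norm_cos_sub1 x : `|cos x - 1| <= x ^+ 2 / 2.
Proof.
rewrite cos_sub1 normrN ger0_norm; last by rewrite mulr_ge0// sqr_ge0.
have h := sin_lip0 (x / 2).
have : `|sin (x / 2)| ^+ 2 <= `|x / 2| ^+ 2 by rewrite ler_pXn2r ?nnegrE.
by rewrite !real_normK ?num_real// => h2; lra.
Qed.

Lemma sin_sub_cube x : `|sin x - x| <= `|x| ^+ 3 / 2.
Proof.
wlog x0 : x / 0 < x.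
  move=> h; have [|x0|<-] := ltgtP 0 x; [exact: h| |].
    have := h (- x); rewrite oppr_gt0 => /(_ x0).
    by rewrite sinN -opprD !normrN.
  by rewrite sin0 subr0 normr0 mulr_ge0// exprn_ge0.
have dF y : is_derive y 1 (fun z => sin z - z) (cos y - 1) by apply: is_deriveB.
have [|c] := @MVT R (fun z => sin z - z) (fun z => cos z - 1) 0 x x0 (fun y _ => dF y).
  apply: continuous_subspaceT => z; apply: continuousB; [exact: continuous_sin|exact: cvg_id].
rewrite in_itv/= => /andP[c0 cx]; rewrite sin0 !subr0 => ->.
rewrite normrM (gtr0_norm x0).
have : c ^+ 2 <= x ^+ 2 by rewrite ler_pXn2r ?nnegrE ?(ltW c0) ?(ltW cx) ?(ltW x0).
have := norm_cos_sub1 c; set a := `|_ - 1| => h1 h2.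
have : a <= x ^+ 2 / 2 by lra.
by move=> /(ler_wpM2r (ltW x0)); rewrite exprS; lra.
Qed.

Lemma cos_lip x y : `|cos x - cos y| <= `|x - y|.
Proof.
wlog xy : x y / y < x.
  move=> h; have [xy|yx|->] := ltgtP y x; [exact: h| |by rewrite !subrr].
  by rewrite distrC (distrC x); exact: h.
have [|c _] := @MVT R cos (fun z => - sin z) y x xy (fun z _ => is_derive_cos z).
  by apply: continuous_subspaceT; exact: continuous_cos.
by move=> ->; rewrite normrM normrN ler_piMl// sin_max.
Qed.

(** The remainder of the second-order Taylor expansion of the cosine at u. *)
Definition cosrem u v := cos (u + v) - cos u + sin u * v + cos u * v ^+ 2 / 2.

Lemma cosremE u v : cosrem u v = cos u * (cos v - 1 + v ^+ 2 / 2) - sin u * (sin v - v).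
Proof. by rewrite /cosrem cosD; ring. Qed.

Lemma cos_sub_sqr v : `|cos v - 1 + v ^+ 2 / 2| <= v ^+ 2 / 2 /\
  `|cos v - 1 + v ^+ 2 / 2| <= `|v| ^+ 3 / 2.
Proof.
have h1 : 0 <= cos v - 1 + v ^+ 2 / 2.
  by have := norm_cos_sub1 v; rewrite ler_norml => /andP[]; lra.
have h2 : cos v - 1 <= 0 by rewrite cos_sub1 oppr_le0 mulr_ge0// sqr_ge0.
rewrite ger0_norm//; split; first lra.
have [v4|v4] := leP `|v| 2; last first.
  have : v ^+ 2 <= `|v| ^+ 3.
    rewrite -(real_normK (num_real v)) exprS ler_peMl ?exprn_ge0//; lra.
  lra.
rewrite cos_sub1.
have -> : - (2 * sin (v / 2) ^+ 2) + v ^+ 2 / 2 = 2 * ((v / 2 - sin (v / 2)) * (v / 2 + sin (v / 2))).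
  by field.
have a1 := sin_sub_cube (v / 2); have a2 := sin_lip0 (v / 2).
have a3 : `|v / 2| = `|v| / 2 by rewrite normrM [X in _ * X]ger0_norm.
rewrite a3 in a1 a2.
have a4 : `|v / 2 + sin (v / 2)| <= `|v|.
  by rewrite (le_trans (ler_normD _ _))// a3; lra.
have : `|(v / 2 - sin (v / 2)) * (v / 2 + sin (v / 2))| <= (`|v| / 2) ^+ 3 / 2 * `|v|.
  by rewrite normrM ler_pM// distrC.
move=> h; have := ler_norm ((v / 2 - sin (v / 2)) * (v / 2 + sin (v / 2))).
have n0 := normr_ge0 v; have n3 : 0 <= `|v| ^+ 3 by rewrite exprn_ge0.
move: h; set Z := (_ * _); set z := `|Z|; set a := `|v| in n0 n3 v4 *.
have : a ^+ 3 * a <= a ^+ 3 * 2 by rewrite ler_wpM2l.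
rewrite exprMn; lra.
Qed.

(** Two regimes: the quadratic bound serves when the chain is above the truncation level, the cubic
    one below it. *)
Lemma cosrem_bound u v : `|cosrem u v| <= 2 * v ^+ 2 /\ `|cosrem u v| <= `|v| ^+ 3.
Proof.
have [c1 c2] := cos_sub_sqr v.
have s2 := sin_sub_cube v.
have s1 : `|sin v - v| <= v ^+ 2.
  have [v2|v2] := leP `|v| 2.
    apply: (le_trans s2); rewrite -(real_normK (num_real v)) exprS ler_pdivrMr// mulrC ler_wpM2l ?exprn_ge0//.
  apply: (@le_trans _ _ (2 * `|v|)).
    by rewrite (le_trans (ler_normB _ _))//; have := sin_lip0 v; lra.
  by rewrite -(real_normK (num_real v)) expr2 ler_wpM2r// ltW.
have b : `|cosrem u v| <= `|cos v - 1 + v ^+ 2 / 2| + `|sin v - v|.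
  rewrite cosremE (le_trans (ler_normB _ _))// !normrM lerD// ler_piMl//; [exact: cos_max|exact: sin_max].
by have := sqr_ge0 v; split; lra.
Qed.

Lemma expRN_sub y : 0 <= y -> `|1 - expR (- y) - y| <= y ^+ 2.
Proof.
move=> y0; have h1 := expR_ge1Dx (- y); have h2 := expR_ge1Dx y.
have h3 : expR (- y) <= 1 - y + y ^+ 2.
  rewrite expRN -div1r ler_pdivrMr ?expR_gt0//.
  have p : 0 <= 1 - y + y ^+ 2 by have := sqr_ge0 (y - 1); nra.
  apply: le_trans (ler_wpM2l p h2).
  by have := exprn_ge0 3 y0; lra.
by rewrite ler_norml; apply/andP; split; lra.
Qed.

Lemma expR_sub1_le y : expR y - 1 <= y * expR y.
Proof.
have := expR_ge1Dx (- y); rewrite expRN => h.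
have := ler_wpM2r (expR_ge0 y) h; rewrite mulVf ?gt_eqF ?expR_gt0//; lra.
Qed.

(* [sqrt (1 + x^2)] is a smooth substitute for [|x|]. *)
Definition sq1 x := Num.sqrt (1 + x ^+ 2).

Lemma sq1_sqr x : sq1 x ^+ 2 = 1 + x ^+ 2.
Proof. by rewrite sqr_sqrtr// addr_ge0// sqr_ge0. Qed.

Lemma sq1_ge1 x : 1 <= sq1 x.
Proof. by rewrite -[leLHS]sqrtr1 ler_wsqrtr// lerDl sqr_ge0. Qed.

Lemma sq1_ge x : `|x| <= sq1 x.
Proof. by rewrite -sqrtr_sqr ler_wsqrtr// lerDr. Qed.

Lemma sq1_le x : sq1 x <= 1 + `|x|.
Proof.
have n0 := normr_ge0 x.
rewrite -[leRHS]ger0_norm ?addr_ge0// -sqrtr_sqr ler_wsqrtr// sqrrD expr1n real_normK ?num_real//.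
lra.
Qed.

Lemma sq1_lip x y : `|sq1 x - sq1 y| <= `|x - y|.
Proof.
have a1 := sq1_ge1 x; have b1 := sq1_ge1 y.
have ab : 0 < sq1 x + sq1 y by lra.
rewrite -(ler_pM2r ab) -{1}(gtr0_norm ab) -normrM -subr_sqr !sq1_sqr.
have -> : 1 + x ^+ 2 - (1 + y ^+ 2) = (x - y) * (x + y) by ring.
rewrite normrM ler_wpM2l// (le_trans (ler_normD _ _))// lerD//; exact: sq1_ge.
Qed.

(** x / sq1 x is the derivative of [sq1]. The first bound comes from 2 sq1(x) sq1(x + y) <= sq1(x)^2
    + sq1(x + y)^2, the second from the Lipschitz property; as for [cosrem_bound], they serve below
    and above a truncation level. *)
Lemma sq1_taylor x y : sq1 (x + y) <= sq1 x + x / sq1 x * y + y ^+ 2 /\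
  sq1 (x + y) <= sq1 x + x / sq1 x * y + 2 * `|y|.
Proof.
have a1 := sq1_ge1 x; have b1 := sq1_ge1 (x + y).
have a0 : 0 < sq1 x by lra.
have E : sq1 (x + y) ^+ 2 = sq1 x ^+ 2 + 2 * x * y + y ^+ 2 by rewrite !sq1_sqr; ring.
split.
  rewrite -(ler_pM2r a0).
  have -> : (sq1 x + x / sq1 x * y + y ^+ 2) * sq1 x = sq1 x ^+ 2 + x * y + y ^+ 2 * sq1 x.
    by field; rewrite gt_eqF.
  have : y ^+ 2 <= y ^+ 2 * sq1 x by rewrite ler_peMr// sqr_ge0.
  have := sqr_ge0 (sq1 (x + y) - sq1 x); have := sqr_ge0 y; nra.
have h : `|x / sq1 x| <= 1.
  by rewrite normrM normfV (gtr0_norm a0) ler_pdivrMr// mul1r sq1_ge.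
have := sq1_lip (x + y) x; rewrite ler_norml (_ : x + y - x = y); last by ring.
move=> /andP[_ h2].
have : `|x / sq1 x * y| <= `|y| by rewrite normrM ler_piMl.
by rewrite ler_norml => /andP[]; lra.
Qed.

Lemma sq1_deriv_lip x y : `|x / sq1 x - y / sq1 y| <= 2 * `|x - y|.
Proof.
have a1 := sq1_ge1 x; have b1 := sq1_ge1 y.
have a0 : 0 < sq1 x by lra. have b0 : 0 < sq1 y by lra.
have -> : x / sq1 x - y / sq1 y = (x - y) / sq1 x + (y / sq1 y) * ((sq1 y - sq1 x) / sq1 x).
  by field; rewrite !gt_eqF.
have ai : (sq1 x)^-1 <= 1 by rewrite invf_le1.
have ai0 : 0 <= (sq1 x)^-1 by rewrite invr_ge0 ltW.
rewrite (le_trans (ler_normD _ _))// mulr_natl mulr2n lerD//.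
  by rewrite normrM (ger0_norm ai0) ler_piMr.
rewrite normrM -[leRHS]mul1r ler_pM//.
  by rewrite normrM normfV (gtr0_norm b0) ler_pdivrMr// mul1r sq1_ge.
rewrite normrM (ger0_norm ai0) (le_trans (ler_piMr _ ai))// distrC; exact: sq1_lip.
Qed.

End TrigBounds.

(** * Law of large numbers and central limit theorem *)

Section LimitTheorems.
Context {R : realType} {d : measure_display} {T : measurableType d} (P : probability T R).
Context (alpha : R) (X0 : T -> nat) (eps : nat -> T -> nat) (xi : nat -> nat -> T -> nat).
Context (pi_ : nat -> R).
Hypothesis H : inar_assumptions P alpha X0 eps xi.
Hypothesis H3X : (\int[P]_t (((X0 t)%:R : R) ^+ 3)%:E < +oo)%E.
Hypothesis H3e : (\int[P]_t (((eps 1%N t)%:R : R) ^+ 3)%:E < +oo)%E.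
Hypothesis Hpi : stationary_dist alpha (eps_pmf P eps) pi_.

Local Notation int := (int P).
Local Notation X := (Xproc X0 eps xi).
Local Notation adapted := (adapted X).
Local Notation m_ := (moment pi_).
Local Notation mu := (mu_eps P eps).
Local Notation sigma2 := (sigma2_eps P eps).

Let al0 : 0 < alpha. Proof. by have /andP[] := alpha_bounds H. Qed.
Let al1 : alpha < 1. Proof. by have /andP[] := alpha_bounds H. Qed.
Let mX k : nat_measurable (X k). Proof. exact: nat_measurable_Xproc H k. Qed.
Let amf (f : T -> R) k : adapted k f -> measurable_fun setT f.
Proof. exact: (adapted_mfun H). Qed.
Let iX3 k : int (fun t => (X k t)%:R ^+ 3). Proof. exact: int_X3 H H3X H3e k. Qed.
Let tail_int k L : int (fun t => (X k t)%:R ^+ 3 * (L <= X k t)%:R).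
Proof. exact: adapted_tail_int H H3X H3e k L. Qed.

Definition dev (g1 g2 g3 : R) (k : nat) (t : T) : R :=
  poly3 g1 g2 g3 (X k t) - (g1 * m_ 1 + g2 * m_ 2 + g3 * m_ 3).

Lemma adapted_sum_dev g1 g2 g3 k : adapted k (fun t => \sum_(i < k) dev g1 g2 g3 i t).
Proof. by move=> t t' h; apply: eq_bigr => i _; rewrite /dev h// ltnW. Qed.

(** The deviations have only first moments under control, so Chebyshev with squares is out of reach.
    Instead E sq1(S_n / n) - 1 is telescoped over the partial sums S_k / n: the first-order terms
    are averages against the slowly varying weight sq1'(S_k / n), and the remainders are
    truncated. *)
Lemma law_of_large_numbers (g1 g2 g3 eta e : R) : 0 < eta -> 0 < e -> exists N : nat,
  forall n, (N <= n)%N ->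
  (P [set t | (eta * n%:R <= `|\sum_(k < n) dev g1 g2 g3 k t|)%R] <= e%:E)%E.
Proof.
move=> eta0 e0.
set Z := dev g1 g2 g3.
set G := g1 * m_ 1 + g2 * m_ 2 + g3 * m_ 3.
have [C [C1 hC]] := bounded_cube_moments H H3X H3e.
pose D := `|g1| + `|g2| + `|g3| + `|G|.
have D0 : 0 <= D by rewrite !addr_ge0.
have ZD k t : `|Z k t| <= D * (1 + (X k t)%:R ^+ 3).
  rewrite /Z /dev (le_trans (ler_normB _ _))// mulrDl lerD//; first exact: poly3_le.
  by rewrite ler_peMr// lerDl exprn_ge0.
have aZ k j : (k <= j)%N -> adapted j (Z k) by move=> kj t t' h; rewrite /Z /dev h.
have iZ k : int (Z k).
  by apply: (adapted_int3 H H3X H3e (k := k) (i := k) (c := D)) => //; exact: aZ.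
have i13 j : int (fun t => 1 + (X j t)%:R ^+ 3 : R) by apply: intD => //; exact: int_cst.
have IZ k : \int[P]_t `|Z k t| <= D * (1 + C).
  apply: (@le_trans _ _ (\int[P]_t (D * (1 + (X k t)%:R ^+ 3)))).
    by apply: le_Rint => //; [exact: int_norm|exact: intZ].
  rewrite RintZ// ler_wpM2l// RintD ?Rint_cst//; last exact: int_cst.
  by rewrite lerD2l; case: (hC k).
(* On the event to be bounded, [sq1] of the mean exceeds its minimum 1 by at least c0, so Markov's
   inequality for [sq1] - 1 divides by c0. The allowance c0 e is shared equally by three errors. *)
pose c0 := sq1 eta - 1.
have c00 : 0 < c0.
  by rewrite subr_gt0 -[ltLHS]sqrtr1 ltr_sqrt ?addr_gt0 ?exprn_gt0// ltrDl exprn_gt0.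
pose e1 := c0 * e / 3.
have e10 : 0 < e1 by rewrite !divr_gt0// mulr_gt0.
have K0 : 0 <= 2 * D * (1 + C) by rewrite !mulr_ge0//; lra.
have [N1 hN1] := averaging_cvg H H3X H3e Hpi g1 g2 g3 ler01 K0 e10.
have e20 : 0 < e1 / (4 * D + 1) by rewrite divr_gt0// ltr_wpDl// mulr_ge0.
have [L [N2 [L0 hL]]] := cube_tail1 H H3X H3e Hpi e20.
pose QL := (D * (1 + L%:R ^+ 3)) ^+ 2.
have [N3 hN3] := eventually_nat QL e10.
exists (maxn (maxn N1 N2) (maxn N3 1)) => n; rewrite !geq_max => /andP[/andP[n1 n2] /andP[n3 n0]].
have nR : 0 < (n%:R : R) by rewrite ltr0n.
pose A k t := (\sum_(i < k) Z i t) / n%:R.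
have aA k : adapted k (A k).
  by move=> t t' h; rewrite /A; congr (_ / _); exact: adapted_sum_dev.
have iA k : int (A k).
  rewrite /A (_ : (fun t => _) = (fun t => n%:R^-1 * \sum_(i < k) Z i t)).
    by apply/intZ/int_sum.
  by apply/funext => t; rewrite mulrC.
have AS k t : A k.+1 t = A k t + Z k t / n%:R by rewrite /A big_ord_recr mulrDl.
have isq k : int (fun t => sq1 (A k t)).
  apply: (le_int _ (intD (int_cst P 1) (int_norm (iA k)))).
    by apply: (@amf _ k) => t t' h; rewrite (aA k t t').
  by move=> t; rewrite ger0_norm ?sq1_le// (le_trans ler01)// sq1_ge1.
(* The derivative of [sq1] at A k: an adapted weight bounded by one, with increments of order 1 / n
   in the mean. *)
pose w k t := A k t / sq1 (A k t).
have w1 k t : `|w k t| <= 1.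
  have s0 : 0 < sq1 (A k t) by apply: lt_le_trans (sq1_ge1 _).
  by rewrite normrM normfV (gtr0_norm s0) ler_pdivrMr// mul1r sq1_ge.
have aw k : adapted k (w k) by move=> t t' h; rewrite /w (aA k t t').
have iwZ k : int (fun t => w k t * Z k t).
  apply: (le_int _ (int_norm (iZ k))).
    by apply: (@amf _ k) => t t' h; rewrite (aw k t t')// (aZ k k (leqnn _) t t').
  by move=> t; rewrite normrM ler_piMl.
pose F k := \int[P]_t ((X k t)%:R ^+ 3 * (L <= X k t)%:R).
have F0 k : 0 <= F k by apply: Rintegral_ge0 => t _; rewrite mulr_ge0// exprn_ge0.
have stepE k : \int[P]_t sq1 (A k.+1 t) - \int[P]_t sq1 (A k t) <=
    n%:R^-1 * \int[P]_t (w k t * Z k t) + (4 * D / n%:R * F k + QL / n%:R ^+ 2).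
  rewrite -RintB// -RintZ// -[X in _ + (_ + X)](Rint_cst P) -RintZ//.
  rewrite -RintD -?RintD; last 4 first.
  - exact: intZ.
  - by apply: intD; [exact: intZ|exact: int_cst].
  - exact: intZ.
  - exact: int_cst.
  apply: le_Rint.
  - exact: intB.
  - by apply: intD; [exact: intZ|apply: intD; [exact: intZ|exact: int_cst]].
  move=> t; rewrite AS.
  have [t1 t2] := sq1_taylor (A k t) (Z k t / n%:R).
  have -> : n%:R^-1 * (w k t * Z k t) = A k t / sq1 (A k t) * (Z k t / n%:R) by rewrite /w; ring.
  have Zx := ZD k t.
  case: (boolP (L <= X k t)%N) => hX.
    rewrite mulr1; set x := (X k t)%:R ^+ 3 in Zx *.
    have x1 : 1 <= x by rewrite exprn_ege1// ler1n (leq_trans L0).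
    have q0 : 0 <= QL / n%:R ^+ 2 by rewrite divr_ge0// sqr_ge0.
    have : 2 * `|Z k t / n%:R| <= 4 * D / n%:R * x.
      rewrite normrM normfV (gtr0_norm nR).
      have -> : 4 * D / n%:R * x = 2 * (2 * D * x / n%:R) by ring.
      rewrite ler_wpM2l// ler_wpM2r ?invr_ge0 ?(ltW nR)// (le_trans Zx)//.
      have Dx : D * 1 <= D * x by rewrite ler_wpM2l.
      by lra.
    by move=> h; lra.
  rewrite mulr0 mulr0 add0r.
  have : (Z k t / n%:R) ^+ 2 <= QL / n%:R ^+ 2.
    rewrite expr_div_n ler_wpM2r ?invr_ge0 ?sqr_ge0// /QL -(real_normK (num_real (Z k t))).
    rewrite ler_pXn2r ?nnegrE// ?mulr_ge0 ?addr_ge0 ?exprn_ge0// (le_trans Zx)// ler_wpM2l// lerD2l.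
    by rewrite ler_pXn2r ?nnegrE// ler_nat; move: hX; rewrite -ltnNge => /ltnW.
  by move=> h; lra.
have total : \int[P]_t sq1 (A n t) - 1 <= n%:R^-1 * \sum_(0 <= k < n) \int[P]_t (w k t * Z k t)
    + (4 * D / n%:R * \sum_(k < n) F k + QL / n%:R).
  have E0 : \int[P]_t sq1 (A 0 t) = 1.
    rewrite (@eq_Rintegral _ _ _ _ _ (fun=> 1)) ?Rint_cst// => t _.
    by rewrite /A big_ord0 mul0r /sq1 expr0n addr0 sqrtr1.
  rewrite -[X in _ - X <= _]E0.
  rewrite -(telescope_sumr (fun k => \int[P]_t sq1 (A k t)) (leq0n n)).
  apply: (le_trans (ler_sum_nat (fun k _ => stepE k))).
  rewrite !big_split /= -!mulr_sumr lerD2l !big_mkord lerD2l sumr_const card_ord.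
  rewrite -[_ *+ n]mulr_natr expr2 invfM.
  by rewrite mulfVK ?gt_eqF.
have aver : n%:R^-1 * \sum_(0 <= k < n) \int[P]_t (w k t * Z k t) <= e1.
  rewrite ler_pdivrMl// mulrC; apply: le_trans (ler_norm _) _.
  apply: (hN1 n n1 0%N w (fun k t => 2 * `|Z k t| / n%:R)) => //.
    move=> k _; rewrite (_ : (fun t => 2 * `|Z k t| / n%:R) = (fun t => 2 / n%:R * `|Z k t|)); last first.
      by apply/funext => t; ring.
    have iZn := int_norm (iZ k).
    split; first exact: intZ.
    rewrite RintZ//.
    have sn : 0 < Num.sqrt (n%:R : R) by rewrite sqrtr_gt0.
    have ns : Num.sqrt n%:R <= n%:R :> R.
      rewrite -{2}(sqr_sqrtr (ltW nR)) expr2 ler_peMl ?(ltW sn)//.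
      by rewrite -[leLHS]sqrtr1 ler_wsqrtr// ler1n.
    have -> : 2 * D * (1 + C) / Num.sqrt n%:R = 2 / Num.sqrt n%:R * (D * (1 + C)) by ring.
    have q1 : 0 <= 2 / n%:R :> R by rewrite divr_ge0// ltW.
    have q2 : 0 <= \int[P]_t `|Z k t| by apply: Rintegral_ge0.
    apply: ler_pM => //; first by rewrite ler_wpM2l// lef_pV2.
  move=> k t _; rewrite /w (le_trans (sq1_deriv_lip _ _))// AS.
  have -> : A k t + Z k t / n%:R - A k t = Z k t / n%:R by ring.
  by rewrite normrM normfV (gtr0_norm nR) mulrA.
have tail2 : 4 * D / n%:R * \sum_(k < n) F k <= e1.
  apply: (le_trans (ler_wpM2l _ (hL n n2))); first by rewrite divr_ge0 ?mulr_ge0// ltW.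
  have -> : 4 * D / n%:R * (e1 / (4 * D + 1) * n%:R) = 4 * D / (4 * D + 1) * e1.
    by field; rewrite !gt_eqF// ltr_wpDl// mulr_ge0.
  rewrite ler_piMl ?(ltW e10)// ler_pdivrMr ?ltr_wpDl ?mulr_ge0// mul1r lerDl//.
have q2 : QL / n%:R <= e1 by rewrite ler_pdivrMr// hN3.
have bound : \int[P]_t sq1 (A n t) - 1 <= c0 * e.
  by apply: (le_trans total); rewrite /e1 in aver tail2 q2 *; lra.
set V := [set t | _].
have mV : measurable V.
  rewrite -[V]setTI; apply: measurable_fun_le => //.
  apply: (@amf _ n) => t t' h; congr `|_|; exact: adapted_sum_dev.
have PV : P V \is a fin_num by exact: fin_num_measure.
rewrite -(fineK PV) lee_fin -(ler_pM2l c00); apply: le_trans bound.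
have i1V : int (fun t => \1_V t).
  apply: (le_int _ (int_cst P 1)); first exact: measurable_indic.
  by move=> t; rewrite indicE; case: (_ \in _); rewrite ?normr1 ?normr0.
have -> : fine (P V) = \int[P]_t \1_V t by rewrite /Rintegral integral_indic// setIT.
rewrite -RintZ// -[X in _ - X](Rint_cst P) -RintB//; last exact: int_cst.
apply: le_Rint; [exact: intZ|by apply: intB => //; exact: int_cst|] => t.
rewrite indicE; case: (boolP (t \in V)) => [|_]; last by rewrite mulr0 subr_ge0 sq1_ge1.
rewrite inE /V /= => hV; rewrite mulr1 /c0 lerD2r ler_wsqrtr// lerD2l.
rewrite -(real_normK (num_real (A n t))) ler_pXn2r ?nnegrE ?(ltW eta0)//.
by rewrite /A normrM normfV (gtr0_norm nR) ler_pdivlMr.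
Qed.

Variables c1 c2 : R.

Local Notation dS := (dS P alpha X0 eps xi c1 c2).
Let aDS k j : (k < j)%N -> adapted j (dS k). Proof. exact: adapted_dS. Qed.
Local Notation cvS := (cvS P alpha eps c1 c2).

Definition pS (k0 k : nat) (t : T) : R := \sum_(k0 <= i < k) dS i t.

Lemma adapted_pS k0 k : adapted k (pS k0 k).
Proof.
move=> t t' h; apply: eq_big_nat => i /andP[_ ik].
exact: (aDS ik).
Qed.

(* [c^T A c]. *)
Definition limvar : R := c1 ^+ 2 * (alpha * (1 - alpha) * m_ 3 + sigma2 * m_ 2)
  + 2 * c1 * c2 * (alpha * (1 - alpha) * m_ 2 + sigma2 * m_ 1)
  + c2 ^+ 2 * (alpha * (1 - alpha) * m_ 1 + sigma2).

Let g1 := 2 * c1 * c2 * sigma2 + c2 ^+ 2 * (alpha * (1 - alpha)).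
Let g2 := c1 ^+ 2 * sigma2 + 2 * c1 * c2 * (alpha * (1 - alpha)).
Let g3 := c1 ^+ 2 * (alpha * (1 - alpha)).

Lemma cvS_dev x : cvS x - limvar = poly3 g1 g2 g3 x - (g1 * m_ 1 + g2 * m_ 2 + g3 * m_ 3).
Proof. by rewrite cvSE /limvar /g1 /g2 /g3; ring. Qed.

(* Telescoping of [E (u cos (U_k + phi)) exp (v k / 2n)]: the exponential factor
   compensates the conditional variance of the increments on average. *)
Lemma clt_cos (k0 : nat) (u : T -> R) (phi : R) : 0 <= limvar -> adapted k0 u ->
  (forall t, `|u t| <= 1) ->
  (fun n : nat => \int[P]_t (u t * cos ((Num.sqrt n%:R)^-1 * pS k0 n t + phi))) @ \oo -->
  (\int[P]_t u t) * (expR (- (limvar / 2)) * cos phi).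
Proof.
set v := limvar => v0 au u1.
have [C [C1 hC]] := bounded_cube_moments H H3X H3e.
have [Cv [Cv0 hCv]] := cvS_le P alpha eps c1 c2.
have idS k := int_dS H H3X H3e c1 c2 k.
have idS2 k := int_dS_sq H H3X H3e c1 c2 k.
have i13 j : int (fun t => 1 + (X j t)%:R ^+ 3 : R).
  by apply: intD; [exact: int_cst|exact: iX3].
have EdS k : \int[P]_t dS k t ^+ 2 <= Cv * (1 + C).
  have [_] := markov_dS_sq H H3X H3e c1 c2 (w := fun=> 1) (B := 1) (k := k) (fun _ _ _ => erefl)
    (fun t => ltac:(by rewrite normr1)).
  rewrite (@eq_Rintegral _ _ _ _ _ (fun t => dS k t ^+ 2)) => [->|t _]; last by rewrite mul1r.
  rewrite (@eq_Rintegral _ _ _ _ _ (fun t => cvS (X k t))) => [|t _]; last by rewrite mul1r.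
  apply: (@le_trans _ _ (\int[P]_t (Cv * (1 + (X k t)%:R ^+ 3)))).
    apply: le_Rint => //; [exact: (int_cvS H H3X H3e)|exact: intZ].
  rewrite RintZ// ler_wpM2l// RintD ?Rint_cst//; last exact: int_cst.
  by rewrite lerD2l; case: (hC k).
have EdS1 k : \int[P]_t `|dS k t| <= 1 + Cv * (1 + C).
  apply: (@le_trans _ _ (\int[P]_t (1 + dS k t ^+ 2))).
    apply: le_Rint; [exact: int_norm|by apply: intD => //; exact: int_cst|] => t.
    by rewrite -(real_normK (num_real (dS k t))); have := sqr_ge0 (`|dS k t| - 1); have := normr_ge0 (dS k t); nra.
  by rewrite RintD ?Rint_cst//; [rewrite lerD2l|exact: int_cst].
pose CC := 1 + Cv * (1 + C).
have CC0 : 0 <= CC by rewrite addr_ge0// mulr_ge0//; lra.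
(* It bounds every factor exp(y k) with k <= n + 1, because y (n + 1) = v / 2 + y <= v for y = v /
   (2 n). *)
pose B := expR v.
have B0 : 0 <= B by exact: expR_ge0.
have B1 : 1 <= B by rewrite /B -expR0 ler_expR.
pose K := B * (CC + v).
have K0 : 0 <= K by rewrite mulr_ge0// addr_ge0.
set phi_ := cos phi.
(* The compensated expectations at times n and k0. As k0 is fixed, the exponent v k0 / (2 n)
   vanishes and [T0] tends to E u cos phi. *)
pose Tn n := expR (v / 2) * \int[P]_t (u t * cos ((Num.sqrt n%:R)^-1 * pS k0 n t + phi)).
pose T0 n := expR (v / (2 * n%:R) * k0%:R) * ((\int[P]_t u t) * phi_).
have main (e : R) : 0 < e -> exists N : nat, forall n, (N <= n)%N -> `|Tn n - T0 n| <= e.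
  move=> e0.
  have e3 : 0 < e / 4 by lra.
  have [N1 hN1] := averaging_cvg H H3X H3e Hpi g1 g2 g3 B0 K0 e3.
  (* The tail part of the Taylor remainders will cost 4 B Cv e1, a quarter of e. *)
  pose e1 := e / (16 * (B * Cv + 1)).
  have BC0 : 0 < B * Cv + 1 by rewrite ltr_wpDl// mulr_ge0.
  have e10 : 0 < e1 by rewrite divr_gt0// mulr_gt0.
  have e1E : 16 * (B * Cv) * e1 <= e.
    rewrite /e1 mulrA ler_pdivrMr ?mulr_gt0// mulrC ler_wpM2l ?(ltW e0)//; lra.
  have [L [N2 [L0 hL]]] := cube_tail1 H H3X H3e Hpi e10.
  (* Below the level L the linear factor of the increment is bounded, so the cube of the increment
     costs only a third moment of the next state. *)
  pose VL := (`|c1| * L%:R + `|c2|) ^+ 3.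
  have VL0 : 0 <= VL by rewrite exprn_ge0// addr_ge0// mulr_ge0.
  pose QL := VL * (4 * (C + (L%:R + mu) ^+ 3)).
  have mu0 : 0 <= mu by exact: ltW (mu_gt0 H H3e).
  have QL0 : 0 <= QL by rewrite mulr_ge0// mulr_ge0// addr_ge0 ?exprn_ge0 ?addr_ge0//; lra.
  have BQ0 : 0 <= B * QL by rewrite mulr_ge0.
  have [N3 [N30 hN3]] := eventually_sqrt BQ0 e3.
  have [N4 hN4] := eventually_nat (B * v ^+ 2) e3.
  exists (maxn (maxn N1 N2) (maxn (maxn N3 N4) k0)) => n.
  rewrite !geq_max => /andP[/andP[n1 n2] /andP[/andP[n3 n4] k0n]].
  have n0 : (0 < n)%N by exact: leq_trans n3.
  have nR : 0 < (n%:R : R) by rewrite ltr0n.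
  pose r : R := (Num.sqrt n%:R)^-1.
  have sn : 0 < Num.sqrt (n%:R : R) by rewrite sqrtr_gt0.
  have r0 : 0 < r by rewrite invr_gt0.
  have r2 : r ^+ 2 = n%:R^-1 by rewrite exprVn sqr_sqrtr// ltW.
  have nr : n%:R^-1 <= r.
    rewrite lef_pV2// -{2}(sqr_sqrtr (ltW nR)) expr2 ler_peMl ?(ltW sn)//.
    by rewrite -[leLHS]sqrtr1 ler_wsqrtr// ler1n.
  pose y := v / (2 * n%:R).
  have y0 : 0 <= y by rewrite divr_ge0// mulr_ge0// ltW.
  have yn : y * n%:R = v / 2 by rewrite /y; field; rewrite gt_eqF.
  have y1 : y <= v / 2 by rewrite -yn ler_peMr// ler1n.
  have yr : y <= v * r.
    by rewrite /y invfM mulrA ler_pM// ?invr_ge0 ?(ltW nR)//; [rewrite divr_ge0|rewrite ler_pdivrMr// ler_peMr//; lra].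
  pose th k t := r * pS k0 k t + phi.
  pose W k t := u t * cos (th k t).
  have aW k j : (k0 <= k)%N -> (k <= j)%N -> adapted j (W k).
    move=> k0k kj t t' h; rewrite /W /th (au t t'); last first.
      by move=> i ik; apply: h; rewrite (leq_trans ik)// (leq_trans k0k).
    rewrite (_ : pS k0 k t = pS k0 k t')//.
    by apply: adapted_pS => i ik; apply: h; exact: leq_trans kj.
  have W1 k t : `|W k t| <= 1 by rewrite normrM mulr_ile1// ?cos_max.
  have iW k : (k0 <= k)%N -> int (W k).
    move=> k0k; apply: (le_int _ (int_cst P 1)) => //; exact: amf (aW k k k0k (leqnn _)).
  pose F k := \int[P]_t ((X k t)%:R ^+ 3 * (L <= X k t)%:R).
  have F0 k : 0 <= F k by apply: Rintegral_ge0 => t _; rewrite mulr_ge0// exprn_ge0.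
  pose rem k t := u t * cosrem (th k t) (r * dS k t).
  have pSS k t : (k0 <= k)%N -> pS k0 k.+1 t = pS k0 k t + dS k t.
    by move=> k0k; rewrite /pS big_nat_recr.
  have WS k t : (k0 <= k)%N -> W k.+1 t - W k t =
      - r * (u t * sin (th k t) * dS k t) - r ^+ 2 / 2 * (W k t * dS k t ^+ 2) + rem k t.
    move=> k0k; rewrite /W /rem /cosrem {1}/th pSS//.
    by rewrite (_ : r * (pS k0 k t + dS k t) + phi = th k t + r * dS k t); rewrite /th; ring.
  have dSX k t : (X k t < L)%N -> `|dS k t| ^+ 3 <= VL * (4 * ((X k.+1 t)%:R ^+ 3 + (L%:R + mu) ^+ 3)).
    move=> xL; rewrite dSE normrM exprMn.
    have xLR : (X k t)%:R <= L%:R :> R by rewrite ler_nat ltnW.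
    have x0 : 0 <= (X k t)%:R :> R by [].
    apply: ler_pM; rewrite ?exprn_ge0//.
      rewrite ler_pXn2r ?nnegrE// ?addr_ge0// ?mulr_ge0// /vlin (le_trans (ler_normD _ _))// lerD2r.
      by rewrite normrM (ger0_norm x0) ler_wpM2l.
    set a : R := (X k.+1 t)%:R; set b := L%:R + mu.
    have a0 : 0 <= a by []. have b0 : 0 <= b by rewrite addr_ge0.
    have h : `|a - (alpha * (X k t)%:R + mu)| <= a + b.
      rewrite (le_trans (ler_normB _ _))// (ger0_norm a0) lerD2l ger0_norm; last first.
        by rewrite addr_ge0// mulr_ge0// ltW.
      rewrite lerD2r; apply: le_trans xLR; rewrite ler_piMl//; exact: ltW.
    apply: (@le_trans _ _ ((a + b) ^+ 3)).
      by rewrite ler_pXn2r ?nnegrE// addr_ge0.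
    have : 0 <= (a + b) * (a - b) ^+ 2 by rewrite mulr_ge0 ?sqr_ge0// addr_ge0.
    by nra.
  have irem k : (k0 <= k)%N -> int (rem k).
    move=> k0k; apply: (le_int _ (intZ (2 * r ^+ 2) (idS2 k))).
      apply: (@amf _ k.+1) => t t' h; rewrite /rem /th.
      rewrite (aDS (ltnSn k) h) (_ : pS k0 k t = pS k0 k t'); last first.
        by apply: adapted_pS => i ik; apply: h; exact: leqW.
      by rewrite (au t t')// => i ik; apply: h; rewrite leqW// (leq_trans ik).
    move=> t; rewrite /rem normrM; have [h _] := cosrem_bound (th k t) (r * dS k t).
    apply: (le_trans (ler_piMl _ (u1 t))) => //; apply: (le_trans h).
    by rewrite exprMn mulrA.
  (* Above the level L the quadratic bound is averaged into [cvS], hence into the tail of X_k^3;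
     below it the cubic bound is of order n^(-3/2). *)
  have Erem k : (k0 <= k)%N -> `|\int[P]_t rem k t| <= 4 * Cv / n%:R * F k + r ^+ 3 * QL.
    move=> k0k.
    have a1 : adapted k (fun t => (L <= X k t)%N%:R : R) by move=> t t' h; rewrite h.
    have b1 t : `|(L <= X k t)%N%:R : R| <= 1 by case: (_ <= _)%N; rewrite ?normr1 ?normr0.
    have [j1 j2] := markov_dS_sq H H3X H3e c1 c2 a1 b1.
    have i4 : int (fun t => VL * (4 * ((X k.+1 t)%:R ^+ 3 + (L%:R + mu) ^+ 3))).
      by do 2 apply: intZ; apply: intD => //; exact: int_cst.
    apply: (@le_trans _ _ (\int[P]_t (2 * r ^+ 2 * ((L <= X k t)%N%:R * dS k t ^+ 2)
       + r ^+ 3 * (VL * (4 * ((X k.+1 t)%:R ^+ 3 + (L%:R + mu) ^+ 3)))))).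
      apply: ler_norm_Rint; [exact: irem|by apply: intD; exact: intZ|] => t.
      rewrite /rem normrM; have [h1 h2] := cosrem_bound (th k t) (r * dS k t).
      apply: (le_trans (ler_piMl _ (u1 t))) => //.
      have r3 : 0 <= r ^+ 3 by rewrite exprn_ge0// ltW.
      case: (boolP (L <= X k t)%N) => hX.
        rewrite mul1r; apply: (le_trans h1); rewrite exprMn mulrA ler_wpDr//.
        by rewrite mulr_ge0// !mulr_ge0// addr_ge0 ?exprn_ge0// addr_ge0.
      rewrite mul0r mulr0 add0r; apply: (le_trans h2).
      by rewrite normrM exprMn (gtr0_norm r0) ler_wpM2l// dSX// ltnNge.
    rewrite RintD; [|exact: intZ|exact: intZ].
    rewrite !RintZ//; last 2 first.
    - by apply: intD => //; exact: int_cst.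
    - by apply: intZ; apply: intD => //; exact: int_cst.
    rewrite RintD ?Rint_cst//; last exact: int_cst.
    rewrite lerD//; last first.
      rewrite ler_wpM2l ?exprn_ge0 ?(ltW r0)// /QL ler_wpM2l// ler_wpM2l// lerD2r.
      by case: (hC k.+1).
    rewrite j2 r2.
    have -> : 4 * Cv / n%:R * F k = 2 / n%:R * (2 * Cv * F k) by ring.
    rewrite ler_wpM2l ?divr_ge0 ?(ltW nR)//.
    rewrite /F -RintZ; last exact: tail_int.
    apply: le_Rint.
    - apply: (le_int _ (int_cvS H H3X H3e c1 c2 k)).
        by apply: (@amf _ k) => t t' h; rewrite h.
      by move=> t; rewrite normrM (ger0_norm (cvS_ge0 H _ _ _)) ler_piMl// (cvS_ge0 H).
    - by apply: intZ; exact: tail_int.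
    - move=> t; case: (boolP (L <= X k t)%N) => hX; last by rewrite mul0r !mulr0.
      rewrite mul1r mulr1 (le_trans (hCv _))//.
      have x1 : 1 <= ((X k t)%:R : R) ^+ 3 by rewrite exprn_ege1// ler1n (leq_trans L0).
      by rewrite [2 * Cv]mulrC -mulrA ler_wpM2l//; lra.
  have EW k : (k0 <= k)%N -> \int[P]_t W k.+1 t - \int[P]_t W k t =
     - (n%:R^-1 / 2) * \int[P]_t (W k t * cvS (X k t)) + \int[P]_t rem k t.
    move=> k0k.
    have as_ : adapted k (fun t => u t * sin (th k t)).
      move=> t t' h; rewrite /th (adapted_pS k0 h) (au t t')// => i ik.
      by apply: h; exact: leq_trans k0k.
    have s1 t : `|u t * sin (th k t)| <= 1 by rewrite normrM mulr_ile1// ?sin_max.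
    have [j1 j2] := markov_dS H H3X H3e c1 c2 as_ s1.
    have [l1 l2] := markov_dS_sq H H3X H3e c1 c2 (aW k k k0k (leqnn k)) (W1 k).
    have k0k1 : (k0 <= k.+1)%N by exact: leqW.
    rewrite -RintB ?iW//.
    rewrite (@eq_Rintegral _ _ _ _ _ (fun t => - r * (u t * sin (th k t) * dS k t)
        - r ^+ 2 / 2 * (W k t * dS k t ^+ 2) + rem k t)); last by move=> t _; exact: WS.
    rewrite RintD; [|by apply: intB; exact: intZ|exact: irem].
    rewrite RintB; [|exact: intZ|exact: intZ].
    by rewrite !RintZ// j2 l2 r2; ring.
  pose w k t := expR (y * k.+1%:R) * W k t.
  pose S k := expR (y * k%:R) * \int[P]_t W k t.
  have expB k : (k <= n.+1)%N -> expR (y * k%:R) <= B.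
    move=> kn; rewrite ler_expR.
    apply: (@le_trans _ _ (y * n.+1%:R)); first by rewrite ler_wpM2l// ler_nat.
    by rewrite -natr1 mulrDr mulr1 yn; lra.
  have icv k : int (fun t => cvS (X k t)) by exact: (int_cvS H H3X H3e).
  have iWc k : (k0 <= k)%N -> int (fun t => W k t * cvS (X k t)).
    move=> k0k; apply: (le_int _ (icv k)).
      by apply: (@amf _ k) => t t' h; rewrite h// (aW k k k0k (leqnn k) t t').
    by move=> t; rewrite normrM (ger0_norm (cvS_ge0 H _ _ _)) ler_piMl// (cvS_ge0 H).
  (* The linear part y of 1 - exp(-y) is spent on centring [cvS] at v. What remains is the Taylor
     remainder and an error of order y^2. *)
  pose rho k := expR (y * k.+1%:R) * (\int[P]_t rem k t + (1 - expR (- y) - y) * \int[P]_t W k t).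
  have SS k : (k0 <= k < n)%N -> S k.+1 - S k =
      - (n%:R^-1 / 2) * \int[P]_t (w k t * (poly3 g1 g2 g3 (X k t) - (g1 * m_ 1 + g2 * m_ 2 + g3 * m_ 3)))
      + rho k.
    move=> /andP[k0k kn].
    rewrite /S /rho.
    have -> : expR (y * k%:R) = expR (y * k.+1%:R) * expR (- y).
      by rewrite -expRD; congr expR; rewrite -natr1; ring.
    have -> : \int[P]_t W k.+1 t = \int[P]_t W k t + (- (n%:R^-1 / 2) * \int[P]_t (W k t * cvS (X k t)) + \int[P]_t rem k t).
      by rewrite -EW//; ring.
    have -> : \int[P]_t (w k t * (poly3 g1 g2 g3 (X k t) - (g1 * m_ 1 + g2 * m_ 2 + g3 * m_ 3)))
        = \int[P]_t (expR (y * k.+1%:R) * (W k t * cvS (X k t) - v * W k t)).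
      apply: eq_Rintegral => t _; rewrite -cvS_dev -/v /w; ring.
    rewrite RintZ; last by apply: intB; [exact: iWc|apply: intZ; exact: iW].
    rewrite RintB; [|exact: iWc|by apply: intZ; exact: iW].
    rewrite RintZ; last exact: iW.
    by rewrite /y; field; rewrite gt_eqF.
  have rhoB k : (k0 <= k < n)%N -> `|rho k| <= B * (4 * Cv / n%:R * F k + r ^+ 3 * QL + y ^+ 2).
    move=> /andP[k0k kn]; rewrite /rho normrM (gtr0_norm (expR_gt0 _)) ler_pM ?expR_ge0//.
      by apply: expB; rewrite ltnW.
    rewrite (le_trans (ler_normD _ _))// lerD ?Erem// normrM -[leRHS]mulr1 ler_pM ?expRN_sub//.
    by rewrite -(Rint_cst P 1); apply: ler_norm_Rint => //; [exact: iW|exact: int_cst].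
  have Sn : S n = Tn n by rewrite /S /Tn yn.
  have S0 : S k0 = T0 n.
    rewrite /S /T0 -/y; congr (_ * _).
    rewrite mulrC -RintZ; last first.
      by apply: (le_int _ (int_cst P 1)) => //; exact: amf au.
    apply: eq_Rintegral => t _; rewrite /W /th /pS big_geq// mulr0 add0r mulrC//.
  have -> : Tn n - T0 n = \sum_(k0 <= k < n) (S k.+1 - S k) by rewrite telescope_sumr// Sn S0.
  rewrite (eq_big_nat _ _ SS) big_split /= -mulr_sumr (le_trans (ler_normD _ _))//.
  have part1 : `|- (n%:R^-1 / 2) * \sum_(k0 <= k < n) \int[P]_t (w k t *
     (poly3 g1 g2 g3 (X k t) - (g1 * m_ 1 + g2 * m_ 2 + g3 * m_ 3)))| <= e / 4.
    have n20 : 0 <= n%:R^-1 / 2 :> R by rewrite divr_ge0// invr_ge0 ltW.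
    rewrite normrM normrN (ger0_norm n20).
    apply: (@le_trans _ _ (n%:R^-1 / 2 * (e / 4 * n%:R))); last first.
      rewrite (_ : n%:R^-1 / 2 * (e / 4 * n%:R) = e / 4 / 2); last by field; rewrite gt_eqF.
      by lra.
    rewrite ler_wpM2l//.
    apply: (hN1 n n1 k0 w (fun k t => B * r * (`|dS k t| + v))) => //.
    - move=> k /andP[k0k kn] t t' h; rewrite /w (aW k k k0k (leqnn k) t t')//.
    - move=> k t /andP[k0k kn]; rewrite /w normrM (gtr0_norm (expR_gt0 _)).
      by rewrite -[leRHS]mulr1 ler_pM ?expR_ge0// expB.
    - move=> k /andP[k0k kn].
      have iD : int (fun t => `|dS k t| + v) by apply: intD; [exact: int_norm|exact: int_cst].
      split; first exact: intZ.
      rewrite RintZ// RintD ?Rint_cst//; [|exact: int_norm|exact: int_cst].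
      rewrite /K -/r -!mulrA ler_wpM2l// mulrC ler_wpM2r ?(ltW r0)// lerD2r; exact: EdS1.
    - move=> k t /andP[k0k kn].
      have -> : w k.+1 t - w k t = expR (y * k.+2%:R) * (W k.+1 t - W k t) +
         (expR (y * k.+2%:R) - expR (y * k.+1%:R)) * W k t by rewrite /w; ring.
      have -> : B * r * (`|dS k t| + v) = B * (r * `|dS k t|) + B * (v * r) * 1 by ring.
      rewrite (le_trans (ler_normD _ _))// lerD//.
        rewrite normrM (gtr0_norm (expR_gt0 _)) ler_pM ?expR_ge0//; first exact: expB.
        rewrite /W -mulrBr normrM (le_trans (ler_piMl _ (u1 t)))// (le_trans (cos_lip _ _))// /th pSS//.
        rewrite (_ : _ - _ = r * dS k t); last by ring.
        by rewrite normrM (gtr0_norm r0).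
      rewrite normrM ler_pM//.
      rewrite ger0_norm; last by rewrite subr_ge0 ler_expR ler_wpM2l// ler_nat.
      have -> : expR (y * k.+2%:R) - expR (y * k.+1%:R) = expR (y * k.+1%:R) * (expR y - 1).
        by rewrite mulrBr mulr1 -expRD; congr (expR _ - _); rewrite -(natr1 k.+1); ring.
      apply: (@le_trans _ _ (expR (y * k.+1%:R) * (y * expR y))).
        by rewrite ler_wpM2l ?expR_ge0// expR_sub1_le.
      have -> : expR (y * k.+1%:R) * (y * expR y) = expR (y * k.+2%:R) * y.
        rewrite mulrCA -expRD mulrC; congr (expR _ * _); rewrite -(natr1 k.+1); ring.
      by rewrite ler_pM ?expR_ge0// expB.
  have part2 : `|\sum_(k0 <= k < n) rho k| <= B * (4 * Cv * e1) + B * QL * r + B * (v ^+ 2 / n%:R).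
    rewrite (le_trans (ler_norm_sum _ _ _))// (le_trans (ler_sum_nat rhoB))//.
    rewrite -mulr_sumr !big_split /= -mulr_sumr !sumr_const_nat.
    have nk : ((n - k0)%:R : R) <= n%:R by rewrite ler_nat leq_subr.
    have f1 : 4 * Cv / n%:R * \sum_(k0 <= k < n) F k <= 4 * Cv * e1.
      have -> : 4 * Cv * e1 = 4 * Cv / n%:R * (e1 * n%:R) by field; rewrite gt_eqF.
      rewrite ler_wpM2l ?divr_ge0 ?mulr_ge0 ?(ltW nR)//.
      exact: le_trans (ler_sum_from k0 n F0) (hL n n2).
    have f2 : r ^+ 3 * QL *+ (n - k0) <= QL * r.
      rewrite -mulr_natr; apply: (@le_trans _ _ (r ^+ 3 * QL * n%:R)).
        by rewrite ler_wpM2l// mulr_ge0// exprn_ge0// ltW.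
      have -> : r ^+ 3 * QL * n%:R = (r ^+ 2 * n%:R) * (QL * r) by ring.
      by rewrite r2 mulVf ?gt_eqF// mul1r.
    have f3 : y ^+ 2 *+ (n - k0) <= v ^+ 2 / n%:R.
      rewrite -mulr_natr; apply: (@le_trans _ _ (y ^+ 2 * n%:R)).
        by rewrite ler_wpM2l// sqr_ge0.
      have -> : y ^+ 2 * n%:R = v ^+ 2 / n%:R / 4 by rewrite /y; field; rewrite gt_eqF.
      have : 0 <= v ^+ 2 / n%:R by rewrite divr_ge0 ?sqr_ge0// ltW.
      by lra.
    have -> : B * (4 * Cv * e1) + B * QL * r + B * (v ^+ 2 / n%:R)
      = B * (4 * Cv * e1 + QL * r + v ^+ 2 / n%:R) by ring.
    by rewrite ler_wpM2l// !lerD.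
  have h3 := hN3 n n3.
  have h4 : B * (v ^+ 2 / n%:R) <= e / 4.
    by rewrite mulrA ler_pdivrMr//; exact: hN4.
  apply: (le_trans (lerD part1 part2)).
  by rewrite -/r in h3; lra.
have cvT : (fun n => Tn n - T0 n) @ \oo --> (0 : R).
  apply/cvgrPdist_le => e e0; have [N hN] := main e e0.
  by exists N => // n /= Nn; rewrite sub0r normrN; exact: hN.
have cv0 : T0 @ \oo --> (\int[P]_t u t) * phi_.
  rewrite -[X in _ --> X]mul1r -expR0.
  apply: cvgM; last exact: cvg_cst.
  apply: continuous_cvg; first exact: continuous_expR.
  rewrite -[X in _ --> X](mulr0 (v / 2 * k0%:R)).
  rewrite (_ : (fun n => _) = (fun n : nat => v / 2 * k0%:R * n%:R^-1)); last first.
    by apply/funext => n; rewrite invfM; ring.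
  apply: cvgM; first exact: cvg_cst.
  rewrite -(cvg_shiftS (fun n : nat => n%:R^-1 : R)); exact: cvg_harmonic.
have cvTn : Tn @ \oo --> (\int[P]_t u t) * phi_.
  rewrite (_ : Tn = (fun n => (Tn n - T0 n) + T0 n)); last by apply/funext => n; rewrite subrK.
  by rewrite -[X in _ --> X]add0r; exact: cvgD.
rewrite (_ : (fun n => _) = (fun n => expR (- (v / 2)) * Tn n)); last first.
  by apply/funext => n; rewrite /Tn mulrA -expRD addNr expR0 mul1r.
rewrite (_ : _ * (_ * _) = expR (- (v / 2)) * ((\int[P]_t u t) * phi_)); last by ring.
by apply: cvgM => //; exact: cvg_cst.
Qed.

End LimitTheorems.

(** * Least squares with an outlier *)

Section LeastSquares.
Context {R : realType}.
Implicit Types a m g x y : R.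

(** The two-step prediction error across the contaminated time: y_s is eliminated between the
    residuals at s and s+1. *)
Definition resid (u v a m : R) : R := u - a ^+ 2 * v - (1 + a) * m.

(* What remains of the two terms of [Qn] at [s] and [s+1] after minimising out
   [theta'], with [u = y_{s+1}] and [v = y_{s-1}]. *)
Definition prof (u v a m : R) : R := resid u v a m ^+ 2 / (1 + a ^+ 2).

Definition qform (h2 h1 h0 x y : R) : R := h2 * x ^+ 2 + 2 * h1 * x * y + h0 * y ^+ 2.

Lemma onesqr_ge1 a : 1 <= 1 + a ^+ 2.
Proof. by rewrite lerDl sqr_ge0. Qed.

Lemma onesqr_gt0 a : 0 < 1 + a ^+ 2.
Proof. exact: lt_le_trans ltr01 (onesqr_ge1 a). Qed.

Lemma prof_ge0 u v a m : 0 <= prof u v a m.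
Proof. by rewrite divr_ge0 ?sqr_ge0// ltW// onesqr_gt0. Qed.

Lemma prof_le u v a m : prof u v a m <= resid u v a m ^+ 2.
Proof. by rewrite ler_pdivrMr ?onesqr_gt0// ler_peMr ?sqr_ge0// onesqr_ge1. Qed.

(* [prof] is the supremum over [t] of functions polynomial in [(a, m)], so Lipschitz and
   semiconvexity bounds come from polynomials, without differentiating. *)
Lemma prof_ge_tangent u v a m t : 2 * t * resid u v a m - t ^+ 2 * (1 + a ^+ 2) <= prof u v a m.
Proof.
rewrite /prof ler_pdivlMr ?onesqr_gt0//; have := sqr_ge0 (resid u v a m - t * (1 + a ^+ 2)).
set r := resid _ _ _ _ => h.
have -> : (2 * t * r - t ^+ 2 * (1 + a ^+ 2)) * (1 + a ^+ 2) =
  r ^+ 2 - (r - t * (1 + a ^+ 2)) ^+ 2 by ring.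
by rewrite gerBl.
Qed.

(** The t at which the supremum is attained. *)
Lemma prof_tangent u v a m (t := resid u v a m / (1 + a ^+ 2)) :
  prof u v a m = 2 * t * resid u v a m - t ^+ 2 * (1 + a ^+ 2).
Proof. by rewrite /prof /t; field; rewrite gt_eqF// onesqr_gt0. Qed.

Lemma normM_le (a b A B : R) : `|a| <= A -> `|b| <= B -> `|a * b| <= A * B.
Proof. by move=> h k; rewrite normrM ler_pM. Qed.

Lemma normD_le (a b A B : R) : `|a| <= A -> `|b| <= B -> `|a + b| <= A + B.
Proof. by move=> h k; apply: le_trans (ler_normD _ _) _; rewrite lerD. Qed.

Lemma normB_le (a b A B : R) : `|a| <= A -> `|b| <= B -> `|a - b| <= A + B.
Proof. by move=> h k; apply: normD_le; rewrite ?normrN. Qed.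

Lemma normX_le (a A : R) n : `|a| <= A -> `|a ^+ n| <= A ^+ n.
Proof. by move=> h; rewrite normrX lerXn2r// nnegrE (le_trans _ h). Qed.

Lemma le_expL (L : R) i j : 1 <= L -> (i <= j)%N -> L ^+ i <= L ^+ j.
Proof. by move=> L1 ij; rewrite ler_weXn2l. Qed.

Lemma resid_bound u v a m (L : R) : 1 <= L -> `|u| <= L -> `|v| <= L ->
  `|a| <= 2 * L -> `|m| <= 2 * L -> `|resid u v a m| <= 11 * L ^+ 3.
Proof.
move=> L1 hu hv ha hm.
have h1 : `|a ^+ 2 * v| <= (2 * L) ^+ 2 * L by apply: normM_le => //; exact: normX_le.
have h2 : `|(1 + a) * m| <= (1 + 2 * L) * (2 * L) by apply: normM_le => //; apply: normD_le; rewrite ?normr1.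
apply: (le_trans (normB_le (normB_le hu h1) h2)).
have l2 := le_expL L1 (isT : (2 <= 3)%N).
have l1 := le_expL L1 (isT : (1 <= 3)%N); rewrite expr1 in l1.
have -> : (2 * L) ^+ 2 * L = 4 * L ^+ 3 by ring.
have -> : (1 + 2 * L) * (2 * L) = 2 * L + 4 * L ^+ 2 by ring.
lra.
Qed.

Lemma tangent_bound u v a m (L : R) : 1 <= L -> `|u| <= L -> `|v| <= L ->
  `|a| <= 2 * L -> `|m| <= 2 * L -> `|resid u v a m / (1 + a ^+ 2)| <= 11 * L ^+ 3.
Proof.
move=> L1 hu hv ha hm; apply: le_trans (resid_bound L1 hu hv ha hm).
rewrite normrM normfV [`|1 + _|]gtr0_norm ?onesqr_gt0//.
by rewrite ler_pdivrMr ?onesqr_gt0// ler_peMr// onesqr_ge1.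
Qed.

(** The t optimal at (a, m) is also inserted at (a', m'), which leaves a difference of two
    polynomials. 1364 = 396 + 968, with 396 = 2 * 11 * 18 from the residual and 968 = 11^2 * 8 from
    1 + a^2. *)
Lemma prof_lip u v a m a' m' (L r : R) : 1 <= L -> 0 <= r -> `|u| <= L -> `|v| <= L ->
  `|a| <= 2 * L -> `|m| <= 2 * L -> `|a'| <= 2 * L -> `|m'| <= 2 * L ->
  `|a - a'| <= 2 * r * L -> `|m - m'| <= 2 * r * L ->
  prof u v a m - prof u v a' m' <= 1364 * r * L ^+ 8.
Proof.
move=> L1 r0 hu hv ha hm ha' hm' da dm.
have ht := tangent_bound L1 hu hv ha hm.
have L0 : 0 <= L by lra.
set t := resid u v a m / (1 + a ^+ 2) in ht.
have h := prof_ge_tangent u v a' m' t.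
rewrite prof_tangent -/t.
have e1 : resid u v a m - resid u v a' m' =
  - ((a - a') * (a + a') * v) - (m - m') - (a * (m - m') + m' * (a - a')).
  by rewrite /resid; ring.
have s1 : `|a + a'| <= 4 * L by apply: le_trans (normD_le ha ha') _; lra.
have b1 : `|resid u v a m - resid u v a' m'| <= 18 * r * L ^+ 3.
  have k1 : `|- ((a - a') * (a + a') * v)| <= 2 * r * L * (4 * L) * L.
    by rewrite normrN; apply: normM_le => //; exact: normM_le.
  have k2 : `|a * (m - m') + m' * (a - a')| <= 2 * L * (2 * r * L) + 2 * L * (2 * r * L).
    by apply: normD_le; exact: normM_le.
  rewrite e1; apply: (le_trans (normB_le (normB_le k1 dm) k2)).
  have l2 : r * L ^+ 2 <= r * L ^+ 3 by rewrite ler_wpM2l// le_expL.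
  have l1 : r * L <= r * L ^+ 3 by rewrite -{1}[L]expr1 ler_wpM2l// le_expL.
  have -> : 2 * r * L * (4 * L) * L = 8 * (r * L ^+ 3) by ring.
  have -> : 2 * L * (2 * r * L) = 4 * (r * L ^+ 2) by ring.
  have -> : 2 * r * L = 2 * (r * L) by ring.
  have -> : 18 * r * L ^+ 3 = 18 * (r * L ^+ 3) by ring.
  lra.
have b2 : `|(1 + a ^+ 2) - (1 + a' ^+ 2)| <= 8 * r * L ^+ 2.
  have -> : (1 + a ^+ 2) - (1 + a' ^+ 2) = (a - a') * (a + a') by ring.
  by apply: le_trans (normM_le da s1) _; rewrite le_eqVlt; apply/orP; left; apply/eqP; ring.
have c1 : 2 * t * (resid u v a m - resid u v a' m') <= 396 * (r * L ^+ 6).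
  apply: (le_trans (ler_norm _)); rewrite -mulrA normrM ger0_norm//.
  apply: (@le_trans _ _ (2 * (11 * L ^+ 3 * (18 * r * L ^+ 3)))).
    by rewrite ler_wpM2l// normM_le.
  by rewrite le_eqVlt; apply/orP; left; apply/eqP; ring.
have c2 : - (t ^+ 2 * ((1 + a ^+ 2) - (1 + a' ^+ 2))) <= 968 * (r * L ^+ 8).
  apply: (le_trans (ler_norm _)); rewrite normrN.
  apply: (le_trans (normM_le (normX_le 2 ht) b2)).
  by rewrite le_eqVlt; apply/orP; left; apply/eqP; ring.
have c3 : r * L ^+ 6 <= r * L ^+ 8 by rewrite ler_wpM2l// le_expL.
have -> : 2 * t * resid u v a m - t ^+ 2 * (1 + a ^+ 2) - prof u v a' m' =
  2 * t * (resid u v a m - resid u v a' m') + - (t ^+ 2 * ((1 + a ^+ 2) - (1 + a' ^+ 2)))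
  + (2 * t * resid u v a' m' - t ^+ 2 * (1 + a' ^+ 2) - prof u v a' m') by ring.
rewrite -[1364 * r * _]mulrA.
move: (r * L ^+ 6) (r * L ^+ 8) c1 c2 c3 => w6 w8 c1 c2 c3; lra.
Qed.

(** Semiconvexity: the t optimal at the midpoint is inserted at both ends, and the midpoint defect
    of the resulting polynomial is quadratic in the increments. *)
Lemma prof_midpoint u v a m a' m' (L : R) : 1 <= L -> `|u| <= L -> `|v| <= L ->
  `|a| <= 2 * L -> `|m| <= 2 * L -> `|a'| <= 2 * L -> `|m'| <= 2 * L ->
  prof u v ((a + a') / 2) ((m + m') / 2) - (prof u v a m + prof u v a' m') / 2
  <= 55 * L ^+ 6 * ((a - a') ^+ 2 + (m - m') ^+ 2).
Proof.
move=> L1 hu hv ha hm ha' hm'.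
have L0 : 0 <= L by lra.
have half b b' : `|b| <= 2 * L -> `|b'| <= 2 * L -> `|(b + b') / 2| <= 2 * L.
  by rewrite !ler_norml; lra.
have ht := tangent_bound L1 hu hv (half _ _ ha ha') (half _ _ hm hm').
set t := _ / _ in ht.
have h := prof_ge_tangent u v a m t.
have h' := prof_ge_tangent u v a' m' t.
rewrite prof_tangent -/t.
have e : 2 * t * resid u v ((a + a') / 2) ((m + m') / 2) - t ^+ 2 * (1 + ((a + a') / 2) ^+ 2)
  = ((2 * t * resid u v a m - t ^+ 2 * (1 + a ^+ 2)) +
     (2 * t * resid u v a' m' - t ^+ 2 * (1 + a' ^+ 2))) / 2
  + (t * v * (a - a') ^+ 2 / 2 + t * ((a - a') * (m - m')) / 2 + t ^+ 2 * (a - a') ^+ 2 / 4).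
  by rewrite /resid; field.
set X := (a - a') ^+ 2; set Y := (m - m') ^+ 2; set Z := (a - a') * (m - m').
have X0 : 0 <= X by exact: sqr_ge0.
have Y0 : 0 <= Y by exact: sqr_ge0.
have hZ : `|Z| <= (X + Y) / 2.
  have z1 := sqr_ge0 (a - a' - (m - m')); have z2 := sqr_ge0 (a - a' + (m - m')).
  have y1 : (a - a' - (m - m')) ^+ 2 = X + Y - 2 * Z by rewrite /X /Y /Z; ring.
  have y2 : (a - a' + (m - m')) ^+ 2 = X + Y + 2 * Z by rewrite /X /Y /Z; ring.
  by rewrite ler_norml; lra.
have k1 : t * v * X <= 11 * L ^+ 6 * (X + Y).
  apply: (le_trans (ler_norm _)).
  apply: (le_trans (normM_le (normM_le ht hv) (lexx _))); rewrite ger0_norm//.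
  apply: ler_pM => //; rewrite ?lerDl//; first by rewrite mulr_ge0// mulr_ge0// exprn_ge0.
  by rewrite -mulrA -exprSr ler_wpM2l// le_expL.
have k2 : t * Z <= 11 * L ^+ 6 * (X + Y).
  apply: (le_trans (ler_norm _)); apply: (le_trans (normM_le ht hZ)).
  apply: ler_pM => //; [by rewrite mulr_ge0// exprn_ge0|by lra| |by lra].
  by rewrite ler_wpM2l// le_expL.
have k3 : t ^+ 2 * X <= 121 * L ^+ 6 * (X + Y).
  apply: ler_pM; rewrite ?sqr_ge0 ?lerDl//.
  rewrite -(ger0_norm (sqr_ge0 t)) (le_trans (normX_le 2 ht))//.
  by rewrite le_eqVlt; apply/orP; left; apply/eqP; ring.
have W0 : 0 <= L ^+ 6 * (X + Y) by rewrite mulr_ge0 ?exprn_ge0 ?addr_ge0.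
rewrite e -/X -/Z.
have e2 c : c * L ^+ 6 * (X + Y) = c * (L ^+ 6 * (X + Y)) by rewrite mulrA.
rewrite !e2 in k1 k2 k3 *; lra.
Qed.

(** Determinant over trace bounds the smallest eigenvalue of M from below: by Cayley-Hamilton, trace
    times the form minus determinant times |z|^2 is |M z|^2. *)
Lemma qform_coercive m2 m1 x y : 0 < m2 - m1 ^+ 2 ->
  (m2 - m1 ^+ 2) / (m2 + 1) * (x ^+ 2 + y ^+ 2) <= qform m2 m1 1 x y.
Proof.
move=> dpos; have m20 : 0 < m2 + 1 by have := sqr_ge0 m1; lra.
rewrite mulrAC ler_pdivrMr// -subr_ge0.
have -> : qform m2 m1 1 x y * (m2 + 1) - (m2 - m1 ^+ 2) * (x ^+ 2 + y ^+ 2) =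
  (m2 * x + m1 * y) ^+ 2 + (m1 * x + y) ^+ 2 by rewrite /qform; ring.
by rewrite addr_ge0// sqr_ge0.
Qed.

Lemma qform_near m2 m1 m0 h2 h1 h0 (eta : R) x y :
  `|h2 - m2| <= eta -> `|h1 - m1| <= eta -> `|h0 - m0| <= eta ->
  `|qform h2 h1 h0 x y - qform m2 m1 m0 x y| <= 2 * eta * (x ^+ 2 + y ^+ 2).
Proof.
move=> d2 d1 d0.
have -> : qform h2 h1 h0 x y - qform m2 m1 m0 x y =
  (h2 - m2) * x ^+ 2 + 2 * ((h1 - m1) * (x * y)) + (h0 - m0) * y ^+ 2 by rewrite /qform; ring.
have X0 := sqr_ge0 x; have Y0 := sqr_ge0 y.
have hZ : `|x * y| <= (x ^+ 2 + y ^+ 2) / 2.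
  have z1 := sqr_ge0 (x - y); have z2 := sqr_ge0 (x + y).
  have y1 : (x - y) ^+ 2 = x ^+ 2 + y ^+ 2 - 2 * (x * y) by ring.
  have y2 : (x + y) ^+ 2 = x ^+ 2 + y ^+ 2 + 2 * (x * y) by ring.
  by rewrite ler_norml; lra.
have k2 : `|(h2 - m2) * x ^+ 2| <= eta * x ^+ 2 by apply: normM_le => //; rewrite ger0_norm.
have k0 : `|(h0 - m0) * y ^+ 2| <= eta * y ^+ 2 by apply: normM_le => //; rewrite ger0_norm.
have k1 := normM_le d1 hZ.
have k1' : `|2 * ((h1 - m1) * (x * y))| <= 2 * (eta * ((x ^+ 2 + y ^+ 2) / 2)).
  by rewrite normrM ger0_norm// ler_wpM2l.
apply: (le_trans (normD_le (normD_le k2 k1') k0)).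
by rewrite le_eqVlt; apply/orP; left; apply/eqP; field.
Qed.

(** The objective in the rescaled coordinates, once theta' is minimised out and the constant is
    dropped ([Qn_split]). *)
Definition red_obj (al mu r u v b1 b2 h2 h1 h0 x y : R) : R :=
  - (2 * (b1 * x + b2 * y)) + qform h2 h1 h0 x y + prof u v (al + r * x) (mu + r * y).

Lemma continuous_red_obj al mu r u v b1 b2 h2 h1 h0 :
  continuous (fun p : R * R => red_obj al mu r u v b1 b2 h2 h1 h0 p.1 p.2).
Proof.
move=> p; rewrite /red_obj /qform /prof /resid.
have csq (f : R * R -> R) (l : R) : f @ p --> l -> (fun q => f q ^+ 2) @ p --> l ^+ 2.
  by move=> h; rewrite expr2; apply: cvgM.
have cx : (fun q : R * R => q.1) @ p --> p.1 by exact: cvg_fst.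
have cy : (fun q : R * R => q.2) @ p --> p.2 by exact: cvg_snd.
have ca : (fun q : R * R => al + r * q.1) @ p --> al + r * p.1.
  by apply: cvgD; [exact: cvg_cst|apply: cvgM; [exact: cvg_cst|exact: cx]].
have cm : (fun q : R * R => mu + r * q.2) @ p --> mu + r * p.2.
  by apply: cvgD; [exact: cvg_cst|apply: cvgM; [exact: cvg_cst|exact: cy]].
have cr : (fun q : R * R => resid u v (al + r * q.1) (mu + r * q.2)) @ p
    --> resid u v (al + r * p.1) (mu + r * p.2).
  apply: cvgB.
    by apply: cvgB; [exact: cvg_cst|apply: cvgM; [exact: csq|exact: cvg_cst]].
  by apply: cvgM => //; apply: cvgD => //; exact: cvg_cst.
apply: cvgD.
  apply: cvgD.
    apply: cvgN; apply: cvgM; first exact: cvg_cst.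
    by apply: cvgD; apply: cvgM => //; exact: cvg_cst.
  apply: cvgD; first apply: cvgD.
  - by apply: cvgM; [exact: cvg_cst|exact: csq].
  - by apply: cvgM => //; apply: cvgM => //; exact: cvg_cst.
  - by apply: cvgM; [exact: cvg_cst|exact: csq].
apply: cvgM; first exact: csq.
apply: cvgV; first by rewrite gt_eqF// onesqr_gt0.
by apply: cvgD; [exact: cvg_cst|exact: csq].
Qed.

Lemma le_max_sqr (S x : R) : x ^+ 2 <= S -> `|x| <= 1 + S.
Proof.
move=> xS; have S0 : 0 <= S := le_trans (sqr_ge0 x) xS.
have := sqr_ge0 (`|x| - 1); have := normr_ge0 x.
have : `|x| ^+ 2 = x ^+ 2 by rewrite real_normK// num_real.
have -> : (`|x| - 1) ^+ 2 = `|x| ^+ 2 - 2 * `|x| + 1 by ring.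
lra.
Qed.

Lemma absorb_linear (lam K b x : R) : 0 < lam -> `|b| <= K ->
  - (lam / 2 * x ^+ 2 + 2 * K ^+ 2 / lam) <= - (2 * (b * x)).
Proof.
move=> lam0 hb; have h := normM_le hb (lexx `|x|).
have x2 : `|x| ^+ 2 = x ^+ 2 by rewrite real_normK// num_real.
have := ler_norm (b * x).
have : (lam * `|x| - 2 * K) ^+ 2 / (2 * lam) = lam / 2 * x ^+ 2 + 2 * K ^+ 2 / lam - 2 * (K * `|x|).
  by rewrite -x2; field; lra.
have : 0 <= (lam * `|x| - 2 * K) ^+ 2 / (2 * lam) by rewrite divr_ge0 ?sqr_ge0// mulr_ge0// ltW.
lra.
Qed.

(* [(b1, b2)] is the normalised score and [[h2, h1], [h1, h0]] the normalised Hessian;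
   [r = 1 / sqrt n]. *)
Lemma red_obj_argmin (al mu m2 m1 K e : R) : 0 < m2 - m1 ^+ 2 -> 0 <= K -> 0 < e ->
  exists eta : R, 0 < eta /\ forall r u v b1 b2 h2 h1 h0 : R, 0 < r -> r <= eta ->
    `|u| <= K -> `|v| <= K -> `|b1| <= K -> `|b2| <= K ->
    `|h2 - m2| <= eta -> `|h1 - m1| <= eta -> `|h0 - 1| <= eta ->
    let F := red_obj al mu r u v b1 b2 h2 h1 h0 in
    exists x y, [/\ (forall x' y', F x y <= F x' y'),
      (forall x' y', F x' y' <= F x y -> x' = x /\ y' = y),
      `|x - (b1 - m1 * b2) / (m2 - m1 ^+ 2)| <= e &
      `|y - (m2 * b2 - m1 * b1) / (m2 - m1 ^+ 2)| <= e].
Proof.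
move=> dpos K0 e0; set dl := m2 - m1 ^+ 2 in dpos *.
have m20 : 0 < m2 by have := sqr_ge0 m1; rewrite /dl in dpos; lra.
(* Half the coercivity constant of M; it survives a perturbation of the entries by lam / 2. *)
pose lam : R := dl / (m2 + 1) / 2.
have lam0 : 0 < lam by rewrite divr_gt0// divr_gt0//; lra.
have lamE : dl / (m2 + 1) = 2 * lam by rewrite /lam; field; lra.
pose C0 : R := (K + al ^+ 2 * K + `|1 + al| * `|mu|) ^+ 2.
(* C0 bounds the objective at the origin, and S bounds x^2 + y^2 on the sublevel set of that value;
   the box of half-width L contains this set and the candidate minimiser. *)
pose S : R := 2 / lam * (4 * K ^+ 2 / lam + C0).
have C00 : 0 <= C0 by exact: sqr_ge0.
have SE : (4 * K ^+ 2 / lam + C0) / (lam / 2) = S by rewrite /S; field; lra.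
have S0 : 0 <= S.
  apply: mulr_ge0; first by rewrite divr_ge0// ltW.
  by apply: addr_ge0 => //; apply: divr_ge0; [rewrite mulr_ge0 ?sqr_ge0|exact: ltW].
pose G1 : R := K * (1 + `|m1|) / dl.
pose G2 : R := K * (m2 + `|m1|) / dl.
have G10 : 0 <= G1 by rewrite divr_ge0 ?(ltW dpos)// mulr_ge0// addr_ge0.
have G20 : 0 <= G2 by rewrite divr_ge0 ?(ltW dpos)// mulr_ge0// addr_ge0// ltW.
pose L : R := 1 + S + K + `|al| + `|mu| + G1 + G2.
have al0 := normr_ge0 al; have mu0 := normr_ge0 mu.
have L1 : 1 <= L by rewrite /L; lra.
have L0 : 0 < L by lra.
have LK : K <= L by rewrite /L; lra.
have LS : 1 + S <= L by rewrite /L; lra.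
have Lal : `|al| <= L by rewrite /L; lra.
have Lmu : `|mu| <= L by rewrite /L; lra.
have LG1 : G1 <= L by rewrite /L; lra.
have LG2 : G2 <= L by rewrite /L; lra.
have G1E : G1 = K * (1 + `|m1|) / dl by [].
have G2E : G2 = K * (m2 + `|m1|) / dl by [].
clearbody L G1 G2.
have L6 : 0 < L ^+ 6 by rewrite exprn_gt0.
have L8 : 0 < L ^+ 8 by rewrite exprn_gt0.
(* eU makes the semiconvexity defect 55 L^6 eU equal to lam / 8. eC makes 1372 L^8 eC equal to 2 lam
   e^2, where 1372 = 1364 + 2 * 4: the variation of [prof] plus the change of the form at two
   points. *)
pose eU : R := lam / (440 * L ^+ 6).
pose eC : R := lam * e ^+ 2 / (686 * L ^+ 8).
have h440 : 0 < 440 * L ^+ 6 by lra.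
have h686 : 0 < 686 * L ^+ 8 by lra.
have eU0 : 0 < eU by exact: divr_gt0.
have eC0 : 0 < eC by apply: divr_gt0 => //; apply: mulr_gt0 => //; exact: exprn_gt0.
exists (Num.min (Num.min (lam / 2) 1) (Num.min eU eC)); split.
  by rewrite !lt_min eU0 eC0 ltr01 divr_gt0.
move=> r u v b1 b2 h2 h1 h0 r0 rle hu hv hb1 hb2 d2 d1 d0 F.
set eta := Num.min _ _ in rle d2 d1 d0.
have et1 : eta <= lam / 2 by rewrite /eta !ge_min lexx.
have et2 : eta <= 1 by rewrite /eta !ge_min lexx orbT.
have et3 : eta <= eU by rewrite /eta !ge_min lexx !orbT.
have et4 : eta <= eC by rewrite /eta !ge_min lexx !orbT.
clearbody eta.
have eta0 : 0 <= eta by exact: le_trans (ltW r0) rle.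
have r1 : r <= 1 by exact: le_trans rle et2.
have hcoer x y : lam * (x ^+ 2 + y ^+ 2) <= qform h2 h1 h0 x y.
  have X0 : 0 <= x ^+ 2 + y ^+ 2 by rewrite addr_ge0// sqr_ge0.
  have := qform_near x y d2 d1 d0; have := qform_coercive x y dpos.
  rewrite lamE; have : 2 * eta * (x ^+ 2 + y ^+ 2) <= lam * (x ^+ 2 + y ^+ 2).
    by rewrite ler_wpM2r//; clear -et1; lra.
  by rewrite ler_norml => q1 q2 /andP[q3 q4]; clear -q1 q2 q3 q4; lra.
have Flow x y : lam / 2 * (x ^+ 2 + y ^+ 2) - 4 * K ^+ 2 / lam <= F x y.
  rewrite /F /red_obj.
  have k1 := absorb_linear x lam0 hb1; have k2 := absorb_linear y lam0 hb2; have k3 := hcoer x y.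
  have k4 := prof_ge0 u v (al + r * x) (mu + r * y).
  have -> : 4 * K ^+ 2 / lam = 2 * K ^+ 2 / lam + 2 * K ^+ 2 / lam by field; clear -lam0; lra.
  by clear -k1 k2 k3 k4; lra.
have F00 : F 0 0 <= C0.
  rewrite /F /red_obj /qform !expr0n /= !(mulr0, addr0) oppr0 add0r.
  apply: (le_trans (prof_le _ _ _ _)).
  have k1 : `|resid u v al mu| <= K + al ^+ 2 * K + `|1 + al| * `|mu|.
    apply: normB_le; last by rewrite normrM.
    by apply: normB_le => //; rewrite normrM ger0_norm ?sqr_ge0// ler_wpM2l// sqr_ge0.
  by rewrite -(ger0_norm (sqr_ge0 (resid _ _ _ _))); exact: normX_le.
have inbox x y : F x y <= F 0 0 -> `|x| <= L /\ `|y| <= L.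
  move=> h; have h' := Flow x y; have X0 := sqr_ge0 x; have Y0 := sqr_ge0 y.
  have hS : x ^+ 2 + y ^+ 2 <= S.
    rewrite -SE ler_pdivlMr; last by clear -lam0; lra.
    by clear -h h' F00; lra.
  by split; (apply: le_trans LS; apply: le_max_sqr); clear -hS X0 Y0; lra.
have [[x y] xyL xymin] : exists2 c : R * R, c \in `[- L, L] `*` `[- L, L] &
    forall p : R * R, p \in `[- L, L] `*` `[- L, L] -> F c.1 c.2 <= F p.1 p.2.
  apply: (@compact_EVT_min _ R (fun p : R * R => F p.1 p.2)).
  - by exists (0, 0); split => /=; rewrite in_itv /=; clear -L0; lra.
  - by apply: compact_setX; exact: segment_compact.
  - by apply: continuous_subspaceT; exact: continuous_red_obj.
have L00 : ((0, 0) : R * R) \in `[- L, L] `*` `[- L, L].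
  by rewrite inE; split => /=; rewrite in_itv /=; clear -L0; lra.
have gmin x' y' : F x y <= F x' y'.
  have [h|h] := leP (F x' y') (F 0 0); last exact: le_trans (xymin _ L00) (ltW h).
  have [hx hy] := inbox _ _ h.
  have : ((x', y') : R * R) \in `[- L, L] `*` `[- L, L].
    by rewrite inE; split => /=; rewrite in_itv /= -ler_norml.
  exact: xymin.
have [xL yL] := inbox _ _ (gmin 0 0).
have arg_bd c z : `|c| <= L -> `|z| <= L -> `|c + r * z| <= 2 * L.
  move=> hc hz; have : `|r * z| <= 1 * L by apply: normM_le => //; rewrite gtr0_norm.
  by move=> h; apply: le_trans (normD_le hc h) _; clear; lra.
have huL := le_trans hu LK; have hvL := le_trans hv LK.
have uniq x' y' : F x' y' <= F x y -> x' = x /\ y' = y.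
  move=> h; have [hx' hy'] := inbox _ _ (le_trans h (gmin 0 0)).
  have := gmin ((x + x') / 2) ((y + y') / 2).
  have := prof_midpoint L1 huL hvL (arg_bd _ _ Lal xL) (arg_bd _ _ Lmu yL)
    (arg_bd _ _ Lal hx') (arg_bd _ _ Lmu hy').
  have := hcoer (x - x') (y - y').
  have -> : (al + r * x + (al + r * x')) / 2 = al + r * ((x + x') / 2) by field.
  have -> : (mu + r * y + (mu + r * y')) / 2 = mu + r * ((y + y') / 2) by field.
  have -> : (al + r * x - (al + r * x')) ^+ 2 + (mu + r * y - (mu + r * y')) ^+ 2
    = r ^+ 2 * ((x - x') ^+ 2 + (y - y') ^+ 2) by ring.
  set D := _ ^+ 2 + _ ^+ 2 => k1 k2 k3.
  have D0 : 0 <= D by rewrite addr_ge0// sqr_ge0.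
  have k4 : 55 * L ^+ 6 * (r ^+ 2 * D) <= lam / 8 * D.
    rewrite mulrA ler_wpM2r//.
    have -> : lam / 8 = 55 * L ^+ 6 * eU by rewrite /eU; field; rewrite gt_eqF.
    have h55 : 0 <= 55 * L ^+ 6 by lra.
    apply: (ler_wpM2l h55).
    by rewrite expr2 (le_trans _ (le_trans rle et3))// ler_piMl// ltW.
  (* Parallelogram identity: at the midpoint the form gains at least lam D / 4, more than the loss
     lam D / 8 caused by [prof], so two minimisers coincide. *)
  have k5 : qform h2 h1 h0 ((x + x') / 2) ((y + y') / 2) = (qform h2 h1 h0 x y + qform h2 h1 h0 x' y') / 2
     - qform h2 h1 h0 (x - x') (y - y') / 4 by rewrite /qform; field.
  have k6 : D <= 0.
    have l8 : 0 < lam / 8 by rewrite divr_gt0.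
    rewrite -(ler_pM2l l8) mulr0.
    move: h k3; rewrite /F /red_obj k5.
    have -> : b1 * ((x + x') / 2) + b2 * ((y + y') / 2) =
      (b1 * x + b2 * y) / 2 + (b1 * x' + b2 * y') / 2 by field.
    by move=> h k3; clear -h k1 k2 k3 k4; lra.
  have X0 := sqr_ge0 (x - x'); have Y0 := sqr_ge0 (y - y').
  have /eqP : (x - x') ^+ 2 = 0 by rewrite /D in k6; clear -k6 X0 Y0; lra.
  have /eqP : (y - y') ^+ 2 = 0 by rewrite /D in k6; clear -k6 X0 Y0; lra.
  by rewrite !sqrf_eq0 !subr_eq0 => /eqP-> /eqP->.
set gx := (b1 - m1 * b2) / dl; set gy := (m2 * b2 - m1 * b1) / dl.
have gxL : `|gx| <= L.
  apply: le_trans LG1; rewrite /gx G1E normrM normfV (gtr0_norm dpos) ler_wpM2r ?invr_ge0 ?(ltW dpos)//.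
  have -> : K * (1 + `|m1|) = K + `|m1| * K by ring.
  by apply: normB_le => //; exact: normM_le.
have gyL : `|gy| <= L.
  apply: le_trans LG2; rewrite /gy G2E normrM normfV (gtr0_norm dpos) ler_wpM2r ?invr_ge0 ?(ltW dpos)//.
  have -> : K * (m2 + `|m1|) = m2 * K + `|m1| * K by ring.
  by apply: normB_le; apply: normM_le => //; rewrite gtr0_norm.
(* (gx, gy) solves M g = b, so the unperturbed objective exceeds its minimum by the form at (x - gx,
   y - gy). Minimality of (x, y) bounds this excess by the perturbations. *)
have close : (x - gx) ^+ 2 + (y - gy) ^+ 2 <= e ^+ 2.
  have E0 := qform_coercive (x - gx) (y - gy) dpos; rewrite lamE in E0.
  have E1 : qform m2 m1 1 (x - gx) (y - gy) =
     (- (2 * (b1 * x + b2 * y)) + qform m2 m1 1 x y)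
     - (- (2 * (b1 * gx + b2 * gy)) + qform m2 m1 1 gx gy).
    have q1 : b1 = m2 * gx + m1 * gy by rewrite /gx /gy /dl; field; rewrite gt_eqF.
    have q2 : b2 = m1 * gx + gy by rewrite /gx /gy /dl; field; rewrite gt_eqF.
    by rewrite q1 q2 /qform; ring.
  have E2 := gmin gx gy; rewrite /F /red_obj in E2.
  have E3 : prof u v (al + r * gx) (mu + r * gy) - prof u v (al + r * x) (mu + r * y) <= 1364 * r * L ^+ 8.
    have dz z z' c : `|z| <= L -> `|z'| <= L -> `|c + r * z - (c + r * z')| <= 2 * r * L.
      move=> hz hz'; have -> : c + r * z - (c + r * z') = r * (z - z') by ring.
      rewrite normrM gtr0_norm//; have -> : 2 * r * L = r * (L + L) by ring.
      by rewrite ler_wpM2l ?(ltW r0)// normB_le.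
    by apply: prof_lip => //; rewrite ?(ltW r0)//; [exact: arg_bd..|exact: dz|exact: dz].
  have sq2 z : `|z| <= L -> z ^+ 2 <= L ^+ 8.
    move=> hz; apply: (@le_trans _ _ (L ^+ 2)); last exact: le_expL.
    by rewrite -(ger0_norm (sqr_ge0 z)); exact: normX_le.
  have nb z z' : `|z| <= L -> `|z'| <= L ->
      `|qform h2 h1 h0 z z' - qform m2 m1 1 z z'| <= 4 * (eta * L ^+ 8).
    move=> hz hz'; apply: (le_trans (qform_near z z' d2 d1 d0)).
    have -> : 4 * (eta * L ^+ 8) = 2 * eta * (L ^+ 8 + L ^+ 8) by ring.
    by rewrite ler_wpM2l ?mulr_ge0// lerD// sq2.
  have := nb _ _ xL yL; have := nb _ _ gxL gyL; rewrite !ler_norml => /andP[_ n1] /andP[n2 _].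
  have E4 : 1364 * r * L ^+ 8 <= 1364 * (eta * L ^+ 8).
    by rewrite -mulrA (ler_wpM2l (ler0n _ _))// ler_wpM2r// ltW.
  have E5 : 1372 * (eta * L ^+ 8) <= 2 * lam * e ^+ 2.
    have -> : 2 * lam * e ^+ 2 = 1372 * (eC * L ^+ 8) by rewrite /eC; field; rewrite gt_eqF.
    by rewrite (ler_wpM2l (ler0n _ _))// ler_wpM2r// ltW.
  have l2 : 0 < 2 * lam by rewrite mulr_gt0.
  rewrite -(ler_pM2l l2).
  move: (eta * L ^+ 8) (1364 * r * L ^+ 8) n1 n2 E3 E4 E5 => w1 w2 n1 n2 E3 E4 E5.
  by clear -n1 n2 E0 E1 E2 E3 E4 E5; lra.
have X0 := sqr_ge0 (x - gx); have Y0 := sqr_ge0 (y - gy).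
exists x, y; split => //.
  by rewrite -(@ler_pXn2r _ 2) ?nnegrE ?(ltW e0)// real_normK ?num_real//; clear -close X0 Y0; lra.
by rewrite -(@ler_pXn2r _ 2) ?nnegrE ?(ltW e0)// real_normK ?num_real//; clear -close X0 Y0; lra.
Qed.

End LeastSquares.

(** * Expansion of the least-squares estimator on given data *)

Section OutlierEstimate.
Context {R : realType}.

(** The minimiser of [Qn] in theta' for fixed (a, m), with w = y_{s-1} + y_{s+1}. *)
Definition theta_opt (ys w a m : R) : R :=
  ys - a / (1 + a ^+ 2) * w - (1 - a) / (1 + a ^+ 2) * m.

(** [d1] and [d2] are the partial derivatives of [theta_opt] in a and m. *)
Definition d1 (a m w : R) : R :=
  ((a ^+ 2 - 1) * w + (2 * a + 1 - a ^+ 2) * m) / (1 + a ^+ 2) ^+ 2.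

Definition d2 (a : R) : R := - ((1 - a) / (1 + a ^+ 2)).

Lemma norm_div_onesqr (x a b A : R) : `|x| <= A -> `|x / ((1 + a ^+ 2) * (1 + b ^+ 2) ^+ 2)| <= A.
Proof.
move=> h; apply: le_trans h; have a1 := onesqr_ge1 a; have b1 := onesqr_ge1 b.
have D1 : 1 <= (1 + a ^+ 2) * (1 + b ^+ 2) ^+ 2 by rewrite mulr_ege1// expr2 mulr_ege1.
have D0 : 0 < (1 + a ^+ 2) * (1 + b ^+ 2) ^+ 2 by exact: lt_le_trans D1.
by rewrite normrM normfV (gtr0_norm D0) ler_pdivrMr// ler_peMr.
Qed.

(** The exact second-order remainder. All its fractions are over a denominator at least one, so
    bounds on the numerators suffice ([norm_div_onesqr]). *)
Lemma theta_optE (ys w al mu r x y : R) (a := al + r * x) :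
  theta_opt ys w a (mu + r * y) - theta_opt ys w al mu - r * (d1 al mu w * x + d2 al * y) =
  r ^+ 2 * (x * (x * (- w * ((al ^+ 2 * a - a - 2 * al) / ((1 + a ^+ 2) * (1 + al ^+ 2) ^+ 2))
     - mu * (((2 * al + 1 - al ^+ 2) * a + (al ^+ 2 + 2 * al - 1)) / ((1 + a ^+ 2) * (1 + al ^+ 2) ^+ 2)))
     - y * ((a * al - a - al - 1) * (1 + al ^+ 2) / ((1 + a ^+ 2) * (1 + al ^+ 2) ^+ 2)))).
Proof.
have a0 : 1 + a ^+ 2 != 0 by rewrite gt_eqF// onesqr_gt0.
have b0 : 1 + al ^+ 2 != 0 by rewrite gt_eqF// onesqr_gt0.
rewrite /theta_opt /d1 /d2 /a in a0 *; field.
by apply/andP; split => //; move: a0; congr (_ != _); ring.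
Qed.

Lemma theta_opt_linear (al mu L : R) : 0 <= L -> exists C : R, 0 <= C /\
  forall ys w r x y : R, 0 <= r -> r <= 1 -> `|w| <= L -> `|x| <= L -> `|y| <= L ->
  `|theta_opt ys w (al + r * x) (mu + r * y) - theta_opt ys w al mu
    - r * (d1 al mu w * x + d2 al * y)| <= C * r ^+ 2.
Proof.
move=> L0; pose A : R := `|al| + L.
pose B1 : R := `|al| ^+ 2 * A + A + 2 * `|al|.
pose B2 : R := (2 * `|al| + 1 + `|al| ^+ 2) * A + (`|al| ^+ 2 + 2 * `|al| + 1).
pose B3 : R := (A * `|al| + A + `|al| + 1) * (1 + `|al| ^+ 2).
have A0 : 0 <= A by rewrite addr_ge0.
exists (L * (L * (L * B1 + `|mu| * B2) + L * B3)); split.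
  have [n1 n2] := (normr_ge0 al, normr_ge0 mu).
  by rewrite /B1 /B2 /B3; do ?[apply: addr_ge0 | apply: mulr_ge0 => // | apply: exprn_ge0].
move=> ys w r x y r0 r1 hw hx hy; rewrite theta_optE.
set a := al + r * x.
have ha : `|a| <= A.
  apply: normD_le => //; rewrite -[leRHS]mul1r; apply: normM_le => //; by rewrite ger0_norm.
rewrite normrM ger0_norm ?sqr_ge0// mulrC ler_wpM2r ?sqr_ge0//.
apply: normM_le => //; apply: normB_le; last first.
  apply: normM_le => //; apply: norm_div_onesqr; apply: normM_le.
    apply: normB_le; last by rewrite normr1.
    by apply: normB_le => //; apply: normB_le => //; exact: normM_le.
  by apply: normD_le; rewrite ?normr1 ?normrX.
apply: normM_le => //; apply: normB_le; apply: normM_le; rewrite ?normrN//; apply: norm_div_onesqr.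
  apply: normB_le; last by rewrite normrM ger0_norm.
  by apply: normB_le => //; apply: normM_le => //; rewrite normrX.
apply: normD_le.
  apply: normM_le => //; apply: normB_le; last by rewrite normrX.
  by apply: normD_le; rewrite ?normr1// normrM ger0_norm.
apply: normB_le; last by rewrite normr1.
by apply: normD_le; rewrite ?normrX// normrM ger0_norm.
Qed.

Lemma norm_d1_le (al mu w L : R) : `|w| <= L ->
  `|d1 al mu w| <= (`|al| ^+ 2 + 1) * L + (2 * `|al| + 1 + `|al| ^+ 2) * `|mu|.
Proof.
(* The factor 1 + 0^2 brings the fraction into the form of [norm_div_onesqr]. *)
move=> wL; have -> : d1 al mu w = ((al ^+ 2 - 1) * w + (2 * al + 1 - al ^+ 2) * mu) /
    ((1 + 0 ^+ 2) * (1 + al ^+ 2) ^+ 2) by rewrite /d1 expr0n addr0 mul1r.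
apply: norm_div_onesqr; apply: normD_le; apply: normM_le => //.
  by apply: normB_le; rewrite ?normr1 ?normrX.
apply: normB_le; last by rewrite normrX.
by apply: normD_le; rewrite ?normr1// normrM ger0_norm.
Qed.

Section Statistics.
Variables (n s : nat) (y : nat -> R) (al mu : R).

Definition lsum (f : nat -> R) : R := \sum_(1 <= k < n.+1 | (k != s) && (k != s.+1)) f k.
Definition innov (k : nat) : R := y k - al * y k.-1 - mu.
Definition rootn : R := (Num.sqrt n%:R)^-1.

(** The square is completed in th; its coefficient 1 + a^2 is positive, so the minimisation
    decouples. *)
Lemma Qn_split (x z th : R) (a := al + rootn * x) (m := mu + rootn * z) : (0 < n)%N ->
  Qn n s y a m th =
  lsum (fun k => innov k ^+ 2)
  + red_obj al mu rootn (y s.+1) (y s.-1)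
      (rootn * lsum (fun k => innov k * y k.-1)) (rootn * lsum innov)
      (n%:R^-1 * lsum (fun k => y k.-1 ^+ 2)) (n%:R^-1 * lsum (fun k => y k.-1))
      (n%:R^-1 * lsum (fun=> 1)) x z
  + (1 + a ^+ 2) * (th - theta_opt (y s) (y s.-1 + y s.+1) a m) ^+ 2.
Proof.
move=> n0; have r2 : n%:R^-1 = rootn ^+ 2 by rewrite /rootn exprVn sqr_sqrtr.
have e1 : (y s - a * y s.-1 - m - th) ^+ 2 + (y s.+1 - a * y s + a * th - m) ^+ 2
  = prof (y s.+1) (y s.-1) a m + (1 + a ^+ 2) * (th - theta_opt (y s) (y s.-1 + y s.+1) a m) ^+ 2.
  by rewrite /prof /resid /theta_opt; field; rewrite gt_eqF// onesqr_gt0.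
have e2 : lsum (fun k => (y k - a * y k.-1 - m) ^+ 2) = lsum (fun k => innov k ^+ 2)
  - (2 * (rootn * lsum (fun k => innov k * y k.-1) * x + rootn * lsum innov * z))
  + qform (n%:R^-1 * lsum (fun k => y k.-1 ^+ 2)) (n%:R^-1 * lsum (fun k => y k.-1))
      (n%:R^-1 * lsum (fun=> 1)) x z.
  rewrite r2 /qform /lsum !(mulr_sumr, mulr_suml) -!big_split /= mulr_sumr -sumrB -big_split/=.
  by apply: eq_bigr => k _; rewrite /innov /a /m; ring.
rewrite /Qn -addrA e1 -/(lsum (fun k => (y k - a * y k.-1 - m) ^+ 2)) e2 /red_obj -/a -/m; ring.
Qed.

End Statistics.

(** Deterministic: it holds for every data sequence with bounded score and neighbours of the
    outlier, and Hessian close to M. Probability enters only in showing that such data are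
    typical. *)
Lemma cls_est_expansion (al mu m2 m1 K e : R) (s : nat) :
  0 < m2 - m1 ^+ 2 -> 0 <= K -> 0 < e ->
  exists eta : R, 0 < eta /\ forall (n : nat) (y : nat -> R), (0 < n)%N -> rootn n <= eta ->
    let b1 := rootn n * lsum n s (fun k => innov y al mu k * y k.-1) in
    let b2 := rootn n * lsum n s (innov y al mu) in
    `|y s.+1| <= K -> `|y s.-1| <= K -> `|b1| <= K -> `|b2| <= K ->
    `|n%:R^-1 * lsum n s (fun k => y k.-1 ^+ 2) - m2| <= eta ->
    `|n%:R^-1 * lsum n s (fun k => y k.-1) - m1| <= eta ->
    `|n%:R^-1 * lsum n s (fun=> 1) - 1| <= eta ->
    let w := y s.-1 + y s.+1 in
    let gx := (b1 - m1 * b2) / (m2 - m1 ^+ 2) in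
    let gy := (m2 * b2 - m1 * b1) / (m2 - m1 ^+ 2) in
    let est := cls_est n s y in
    [/\ `|Num.sqrt n%:R * (est.1.1 - al) - gx| <= e,
        `|Num.sqrt n%:R * (est.1.2 - mu) - gy| <= e &
        `|Num.sqrt n%:R * (est.2 - theta_opt (y s) w al mu) - (d1 al mu w * gx + d2 al * gy)| <= e].
Proof.
move=> dpos K0 e0; set dl := m2 - m1 ^+ 2 in dpos *.
(* G bounds gx and gy with a slack of one, which accommodates their distance to (x, z). *)
pose G : R := (K + `|m1| * K + `|m2| * K) / dl + 1.
pose L : R := G + 2 * K.
have G0 : 0 <= G by rewrite addr_ge0// divr_ge0 ?(ltW dpos)// !addr_ge0// mulr_ge0.
have L0 : 0 <= L by rewrite addr_ge0// mulr_ge0.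
have [C [C0 hC]] := theta_opt_linear al mu L0.
pose D : R := ((`|al| ^+ 2 + 1) * L + (2 * `|al| + 1 + `|al| ^+ 2) * `|mu|) + 1.
have D0 : 0 < D by rewrite ltr_wpDl// !addr_ge0// mulr_ge0// !addr_ge0// ?mulr_ge0// sqr_ge0.
pose D2 : R := `|d2 al| + 1.
have D20 : 0 < D2 by rewrite ltr_wpDl.
pose e' : R := Num.min (Num.min e 1) (e / 2 / (D + D2)).
have e20 : 0 < e / 2 by rewrite divr_gt0.
have eD0 : 0 < e / 2 / (D + D2) by apply: divr_gt0 => //; exact: addr_gt0.
have eC0 : 0 < e / 2 / (C + 1) by apply: divr_gt0 => //; exact: ltr_wpDl.
have e'0 : 0 < e' by rewrite !lt_min e0 ltr01.
have e'1 : e' <= e by rewrite !ge_min lexx.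
have e'2 : e' <= 1 by rewrite !ge_min lexx orbT.
have e'3 : e' <= e / 2 / (D + D2) by rewrite !ge_min lexx orbT.
have [eta [eta0 heta]] := red_obj_argmin al mu dpos K0 e'0.
exists (Num.min eta (Num.min 1 (e / 2 / (C + 1)))); split.
  by rewrite !lt_min eta0 ltr01.
move=> n y n0; move Er : (rootn n) => r; rewrite !le_min => /andP[rl1 /andP[rl2 rl3]] b1 b2 hu hv hb1 hb2.
move=> /andP[h2 _] /andP[h1 _] /andP[h0 _] w gx gy est.
have r0 : 0 < r by rewrite -Er invr_gt0 sqrtr_gt0 ltr0n.
have rV : Num.sqrt n%:R = r^-1 :> R by rewrite -Er /rootn invrK.
have [x [z [xzmin xzuniq hx hz]]] := heta r _ _ b1 b2 _ _ _ r0 rl1 hu hv hb1 hb2 h2 h1 h0.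
set F := red_obj _ _ _ _ _ _ _ _ _ _ in xzmin xzuniq.
pose E0 := lsum n s (fun k => innov y al mu k ^+ 2).
have QE x' z' th : Qn n s y (al + r * x') (mu + r * z') th = E0 + F x' z' +
    (1 + (al + r * x') ^+ 2) * (th - theta_opt (y s) w (al + r * x') (mu + r * z')) ^+ 2.
  by rewrite /F /b1 /b2 -Er; exact: Qn_split.
pose p0 : R * R * R := (al + r * x, mu + r * z, theta_opt (y s) w (al + r * x) (mu + r * z)).
have Q0 : Qn n s y p0.1.1 p0.1.2 p0.2 = E0 + F x z.
  by rewrite /p0 /= QE subrr expr0n mulr0 addr0.
have Qq (q : R * R * R) : Qn n s y q.1.1 q.1.2 q.2 = E0 + F ((q.1.1 - al) / r) ((q.1.2 - mu) / r)
   + (1 + q.1.1 ^+ 2) * (q.2 - theta_opt (y s) w q.1.1 q.1.2) ^+ 2.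
  have e1 : al + r * ((q.1.1 - al) / r) = q.1.1 by field; rewrite gt_eqF.
  have e2 : mu + r * ((q.1.2 - mu) / r) = q.1.2 by field; rewrite gt_eqF.
  by have := QE ((q.1.1 - al) / r) ((q.1.2 - mu) / r) q.2; rewrite e1 e2.
have p0min : Qmin_set n s y p0.
  move=> q; rewrite Q0 Qq ler_wpDr//; first by rewrite mulr_ge0 ?sqr_ge0// ltW// onesqr_gt0.
  by rewrite lerD2l.
have p0uniq q : Qmin_set n s y q -> p0 = q.
  move=> /(_ p0); rewrite Q0 Qq => h.
  have s0 : 0 <= (1 + q.1.1 ^+ 2) * (q.2 - theta_opt (y s) w q.1.1 q.1.2) ^+ 2.
    by rewrite mulr_ge0 ?sqr_ge0// ltW// onesqr_gt0.
  have f1 := xzmin ((q.1.1 - al) / r) ((q.1.2 - mu) / r).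
  have f2 : F ((q.1.1 - al) / r) ((q.1.2 - mu) / r) <= F x z by clear -h s0; lra.
  have [q1 q2] := xzuniq _ _ f2.
  have f3 : (1 + q.1.1 ^+ 2) * (q.2 - theta_opt (y s) w q.1.1 q.1.2) ^+ 2 = 0.
    by apply/eqP; rewrite eq_le s0 andbT; clear -h f1; lra.
  move/eqP: f3; rewrite mulf_eq0 gt_eqF ?onesqr_gt0//= sqrf_eq0 subr_eq0 => /eqP q3.
  have k1 : q.1.1 = al + r * x by rewrite -q1; field; rewrite gt_eqF.
  have k2 : q.1.2 = mu + r * z by rewrite -q2; field; rewrite gt_eqF.
  rewrite /p0 -k1 -k2 -q3; by case: (q) => [[? ?] ?].
have estE : est = p0.
  (* Uniqueness excludes the default (0, 0, 0) and determines what [xget] returns. *)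
  rewrite /est /cls_est asboolT; last by exists p0; split => // q /p0uniq.
  apply/esym/p0uniq; apply: (@xgetPex _ (0, 0, 0) (Qmin_set n s y)); by exists p0.
have gxG : `|gx| <= G - 1.
  rewrite /gx /G addrK normrM normfV (gtr0_norm dpos) ler_wpM2r ?invr_ge0 ?(ltW dpos)//.
  apply: (@le_trans _ _ (K + `|m1| * K)); last by rewrite lerDl mulr_ge0.
  by apply: normB_le => //; exact: normM_le.
have gyG : `|gy| <= G - 1.
  rewrite /gy /G addrK normrM normfV (gtr0_norm dpos) ler_wpM2r ?invr_ge0 ?(ltW dpos)//.
  apply: (@le_trans _ _ (`|m2| * K + `|m1| * K)); last by clear -K0; lra.
  by apply: normB_le; exact: normM_le.
have xL : `|x| <= L.
  have -> : x = gx + (x - gx) by ring.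
  by apply: le_trans (normD_le gxG hx) _; rewrite /L; clear -e'2 K0; lra.
have zL : `|z| <= L.
  have -> : z = gy + (z - gy) by ring.
  by apply: le_trans (normD_le gyG hz) _; rewrite /L; clear -e'2 K0; lra.
have wL : `|w| <= L by apply: le_trans (normD_le hv hu) _; rewrite /L; clear -G0; lra.
rewrite estE /p0 /= rV; split.
- by rewrite (_ : r^-1 * _ = x) ?(le_trans hx)//; field; rewrite gt_eqF.
- by rewrite (_ : r^-1 * _ = z) ?(le_trans hz)//; field; rewrite gt_eqF.
have hT := hC (y s) w r x z (ltW r0) rl2 wL xL zL.
set T1 := theta_opt _ _ _ _ in hT *; set T0 := theta_opt _ _ _ _ in hT *.
have -> : r^-1 * (T1 - T0) - (d1 al mu w * gx + d2 al * gy) =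
  r^-1 * (T1 - T0 - r * (d1 al mu w * x + d2 al * z)) + (d1 al mu w * (x - gx) + d2 al * (z - gy)).
  by field; rewrite gt_eqF.
have k1 : `|r^-1 * (T1 - T0 - r * (d1 al mu w * x + d2 al * z))| <= e / 2.
  rewrite normrM gtr0_norm ?invr_gt0// ler_pdivrMl// (le_trans hT)//.
  apply: (@le_trans _ _ (r * (r * (C + 1)))).
    have -> : r * (r * (C + 1)) = C * r ^+ 2 + r ^+ 2 by ring.
    by rewrite lerDl sqr_ge0.
  by rewrite ler_wpM2l ?(ltW r0)// -ler_pdivlMr// ltr_wpDl.
have d1D : `|d1 al mu w| <= D by rewrite /D -[leLHS]addr0; apply: lerD => //; exact: norm_d1_le.
have k2 : `|d1 al mu w * (x - gx) + d2 al * (z - gy)| <= e / 2.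
  apply: (le_trans (normD_le (normM_le d1D hx) (normM_le (A := D2) _ hz))); first by rewrite /D2 lerDl.
  by rewrite -mulrDl mulrC -ler_pdivlMr// addr_gt0.
by apply: le_trans (normD_le k1 k2) _; rewrite -splitr.
Qed.

End OutlierEstimate.

(** * From cosines to bounded continuous functions *)

Section Bernstein.
Context {R : realType}.
Implicit Types (a : R) (f : nat -> R) (x : R * R).

Lemma thin_dist a N : (0 < N)%N -> thin a N (fun i => (i%:R / N%:R - a) ^+ 2) = a * (1 - a) / N%:R.
Proof.
move=> N0; have NR : N%:R != 0 :> R by rewrite pnatr_eq0 -lt0n.
rewrite (@eq_thin _ _ _ _ (fun i => N%:R ^- 2 * i%:R ^+ 2 + ((- (2 * a / N%:R)) * i%:R + a ^+ 2))); last first.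
  by move=> i; field.
by rewrite !thinD !thinZ thin_cst thin_id thin_sqr; field.
Qed.

Definition halfsin (t : R) : R := (1 + sin t) / 2.

Lemma halfsin01 t : 0 <= halfsin t <= 1.
Proof. by rewrite /halfsin; have := sin_max t; rewrite ler_norml; lra. Qed.

(* The bivariate Bernstein polynomial with nodal values [F], at a point of the square
   parametrised by sines. *)
Definition trig2 (N : nat) (lam : R) (F : nat -> nat -> R) (x : R * R) : R :=
  thin (halfsin (lam * x.1)) N (fun i => thin (halfsin (lam * x.2)) N (F i)).

Lemma trig2_bound N lam F M : (forall i j, `|F i j| <= M) -> forall x, `|trig2 N lam F x| <= M.
Proof.
move=> FM x; rewrite -(thin_cst (halfsin (lam * x.1)) N M).
apply: ler_norm_thin => [|i]; first exact: halfsin01.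
rewrite -[leRHS](thin_cst (halfsin (lam * x.2)) N M).
by apply: ler_norm_thin => //; exact: halfsin01.
Qed.

(** The derivative of the sine is at least cos 1 on [-1, 1]. *)
Lemma sin_expand (x y : R) : -1 <= x <= 1 -> -1 <= y <= 1 ->
  cos 1 * `|x - y| <= `|sin x - sin y|.
Proof.
wlog xy : x y / y <= x.
  move=> h hx hy; have [|/ltW yx] := leP y x; first by move=> yx; exact: h.
  by rewrite distrC [leRHS]distrC; exact: h.
move=> hx hy; move: xy; rewrite le_eqVlt => /orP[/eqP->|xy]; first by rewrite !subrr normr0 mulr0.
have [|c] := @MVT R sin cos y x xy (fun z _ => is_derive_sin z).
  by apply: continuous_subspaceT => z; exact: continuous_sin.
rewrite in_itv /= => /andP[yc cx] ->.
rewrite normrM ler_wpM2r//; apply: le_trans (ler_norm _).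
have c1 : `|c| <= 1 by rewrite ler_norml; lra.
have -> : cos c = cos `|c| by case: (ger0P c) => // _; rewrite cosN.
move: c1; rewrite le_eqVlt => /orP[/eqP->//|c1].
have p2 := @pi_ge2 R; apply/ltW; rewrite ltr_cos// in_itv /=; last lra.
by rewrite normr_ge0; lra.
Qed.

(** A Bernstein node may lie outside the range of the sine on [-1, 1]; it is projected there before
    inverting, which does not increase its distance to values in that range. *)
Definition clampsin (z : R) : R := asin (Num.max (- sin 1) (Num.min z (sin 1))).

Lemma sin1_gt0 : 0 < sin 1 :> R.
Proof. by apply: sin2_gt0; rewrite ltr01 ltr1n. Qed.

Lemma clampsin_mem z : -1 <= clampsin z <= 1 /\
  forall b, -1 <= b <= 1 -> `|sin (clampsin z) - sin b| <= `|z - sin b|.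
Proof.
have s0 := sin1_gt0; have s1 : sin 1 <= 1 :> R by exact: sin_le1.
have p1 := @pihalf_ge1 R.
have one_in : (1 : R) \in `[- (pi / 2), pi / 2] by rewrite in_itv /=; lra.
have mone_in : (-1 : R) \in `[- (pi / 2), pi / 2] by rewrite in_itv /=; lra.
set w := Num.max (- sin 1) (Num.min z (sin 1)).
have w1 : - sin 1 <= w by rewrite le_max lexx.
have w2 : w <= sin 1 by rewrite ge_max ge_min lexx orbT; lra.
have [h1 h2] := @asin_def R w ltac:(lra).
have win : asin w \in `[- (pi / 2), pi / 2] by rewrite in_itv.
split; rewrite /clampsin -/w.
  apply/andP; split; rewrite leNgt; apply/negP => h.
    have : sin (asin w) < sin (-1) by rewrite ltr_sin.
    by rewrite sinN h2; lra.
  have : sin 1 < sin (asin w) by rewrite ltr_sin.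
  by rewrite h2; lra.
move=> b hb; have bin : b \in `[- (pi / 2), pi / 2] by rewrite in_itv /=; lra.
have b1 : sin b <= sin 1.
  by rewrite leNgt; apply/negP; rewrite ltr_sin//; lra.
have b2 : - sin 1 <= sin b.
  by rewrite -sinN leNgt; apply/negP; rewrite ltr_sin//; lra.
rewrite h2 /w; have [z1|z1] := leP z (sin 1); last first.
  have [z2|z2] := leP (- sin 1) (sin 1); last by lra.
  by rewrite !ger0_norm; lra.
have [z2|z2] := leP (- sin 1) z => //.
by rewrite !ler0_norm; lra.
Qed.

Lemma halfsin_expand (K x y : R) : 0 < K -> `|x| <= K ->
  `|K * clampsin (2 * y - 1) - x| <= 2 * K / cos 1 * `|y - halfsin (K^-1 * x)|.
Proof.
move=> K0 xK; have [c1 c2] := clampsin_mem (2 * y - 1).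
set b := K^-1 * x.
have b1 : -1 <= b <= 1 by rewrite -ler_norml normrM gtr0_norm ?invr_gt0// ler_pdivrMl ?mulr1.
have h1 := sin_expand c1 b1; have h2 := c2 _ b1.
have -> : K * clampsin (2 * y - 1) - x = K * (clampsin (2 * y - 1) - b).
  by rewrite /b; field; rewrite gt_eqF.
rewrite normrM gtr0_norm// -!mulrA mulrCA ler_wpM2l ?(ltW K0)//.
rewrite mulrCA ler_pdivlMl ?cos1_gt0// (le_trans h1)// (le_trans h2)//.
have -> : 2 * y - 1 - sin b = 2 * (y - halfsin b) by rewrite /halfsin; field.
by rewrite normrM ger0_norm.
Qed.

Lemma box_uniform_continuity (f : R * R -> R) (K e : R) : continuous f -> 0 < e ->
  exists2 d : R, 0 < d & forall x y : R * R, `|x.1| <= K -> `|x.2| <= K ->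
    `|y.1 - x.1| < d -> `|y.2 - x.2| < d -> `|f y - f x| <= e.
Proof.
move=> cf e0.
have cB : compact (`[- K, K]%classic `*` `[- K, K]%classic : set (R * R)).
  by apply: compact_setX; exact: segment_compact.
pose PP (d : R) (x : R * R) := forall y : R * R,
  `|y.1 - x.1| < d -> `|y.2 - x.2| < d -> `|f y - f x| <= e.
have key : forall x, (`[- K, K]%classic `*` `[- K, K]%classic) x ->
    \forall x' \near x & d \near 0^'+, PP d x'.
  move=> x _; have e20 : 0 < e / 2 by rewrite divr_gt0.
  have /cvgrPdist_lt /(_ _ e20) := cf x.
  rewrite near_simpl => /nbhs_ballP[r /= r0 hr].
  have near1 : \forall x' \near x, ball x (r / 2) x'.
    by apply: nbhsx_ballx; rewrite divr_gt0.
  have near2 : \forall d \near (0:R)^'+, d < r / 2.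
    by apply: nbhs_right_lt; rewrite divr_gt0.
  exists (ball x (r / 2), [set d | d < r / 2]) => // -[x' d] [/= bx' dr] y y1 y2.
  have bb z : ball x r z -> `|f x - f z| < e / 2 by move=> h; exact: hr.
  have bx : ball x r x' by apply: le_ball bx'; lra.
  have by_ : ball x r y.
    rewrite [r]splitr; apply: ball_triangle bx' _; split.
      by rewrite /ball /= distrC; lra.
    by rewrite /ball /= distrC; lra.
  have := bb _ bx; have := bb _ by_; rewrite !ltr_norml ler_norml => /andP[? ?] /andP[? ?].
  by apply/andP; split; lra.
have [d [d0 hd]] : exists d : R, 0 < d /\ forall x, (`[- K, K]%classic `*` `[- K, K]%classic) x -> PP d x.
  have FR : Filter (0:R)^'+ by exact: filter_filter.
  have near0 : \forall d \near (0:R)^'+, 0 < d by exact: nbhs_right_gt.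
  have H := (@compact_near_coveringP _ _).1 cB _ (0:R)^'+ PP FR key.
  by have [d []] := filter_ex (filterI near0 H); exists d.
exists d => // x y x1 x2 y1 y2; apply: hd => //; split => /=; rewrite in_itv /= -ler_norml//.
Qed.

(** Bernstein's argument: close nodes are handled by uniform continuity, distant ones by Chebyshev,
    since 2 M <= D z^2 there and the mean of z^2 is y (1 - y) / N. The frequency 1 / K keeps the
    sine injective on the box. *)
Lemma trig2_approx (f : R * R -> R) (M K e : R) : continuous f -> (forall x, `|f x| <= M) ->
  0 < K -> 0 < e -> exists N lam F, (forall i j, `|F i j| <= M) /\
    forall x, `|x.1| <= K -> `|x.2| <= K -> `|trig2 N lam F x - f x| <= e.
Proof.
move=> cf fM K0 e0; have e20 : 0 < e / 2 by rewrite divr_gt0.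
have [d d0 hd] := box_uniform_continuity K cf e20.
have M0 : 0 <= M by exact: le_trans (normr_ge0 _) (fM (0, 0)).
pose C : R := 2 * K / cos 1.
have C0 : 0 < C by rewrite divr_gt0 ?cos1_gt0// mulr_gt0.
pose D : R := 2 * M * (C / d) ^+ 2.
have D0 : 0 <= D by rewrite mulr_ge0 ?sqr_ge0// mulr_ge0.
pose N := (Num.truncn (2 * D / (e / 2))).+1.
have NR : 0 < N%:R :> R by rewrite ltr0n.
have ND : 2 * D / N%:R <= e / 2.
  by rewrite ler_pdivrMr// -ler_pdivrMl// mulrC ltW// truncnS_gt.
pose kap (i : nat) : R := K * clampsin (2 * (i%:R / N%:R) - 1).
exists N, K^-1, (fun i j => f (kap i, kap j)); split => // x x1 x2.
set y1 := halfsin (K^-1 * x.1); set y2 := halfsin (K^-1 * x.2).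
have Y1 : 0 <= y1 <= 1 := halfsin01 _; have Y2 : 0 <= y2 <= 1 := halfsin01 _.
have pw i j : `|f (kap i, kap j) - f x| <= (e / 2 + D * (i%:R / N%:R - y1) ^+ 2) + D * (j%:R / N%:R - y2) ^+ 2.
  have D1 z : 0 <= D * z ^+ 2 by rewrite mulr_ge0// sqr_ge0.
  have far (z z' x0 : R) : `|z - x0| <= C * `|z'| -> d <= `|z - x0| -> 2 * M <= D * z' ^+ 2.
    move=> h1 h2; have h3 : 1 <= C / d * `|z'|.
      by rewrite mulrAC ler_pdivlMr// mul1r; exact: le_trans h2 h1.
    rewrite /D -mulrA ler_peMr// ?mulr_ge0//.
    have -> : (C / d) ^+ 2 * z' ^+ 2 = (C / d * `|z'|) ^+ 2.
      by rewrite [RHS]exprMn real_normK// num_real.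
    by rewrite exprn_ege1.
  have le2M : `|f (kap i, kap j) - f x| <= 2 * M.
    by apply: le_trans (ler_normB _ _) _; have := fM (kap i, kap j); have := fM x; lra.
  have h1 := halfsin_expand (i%:R / N%:R) K0 x1; have h2 := halfsin_expand (j%:R / N%:R) K0 x2.
  rewrite -/y1 -/(kap i) -/C in h1; rewrite -/y2 -/(kap j) -/C in h2.
  have q1 := D1 (i%:R / N%:R - y1); have q2 := D1 (j%:R / N%:R - y2).
  have [g1|g1] := ltP `|kap i - x.1| d; last first.
    by have := far _ _ _ h1 g1; lra.
  have [g2|g2] := ltP `|kap j - x.2| d; last first.
    by have := far _ _ _ h2 g2; lra.
  by have := hd x (kap i, kap j) x1 x2 g1 g2; lra.
have -> : trig2 N K^-1 (fun i j => f (kap i, kap j)) x - f x =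
    thin y1 N (fun i => thin y2 N (fun j => f (kap i, kap j) - f x)).
  rewrite /trig2 -/y1 -/y2.
  rewrite (@eq_thin _ y1 N (fun i => thin y2 N (fun j => f (kap i, kap j) - f x))
    (fun i => thin y2 N (fun j => f (kap i, kap j)) + - f x)); last first.
    by move=> i; rewrite thinD thin_cst.
  by rewrite thinD thin_cst.
have step i : `|thin y2 N (fun j => f (kap i, kap j) - f x)| <=
   (e / 2 + D * (y2 * (1 - y2) / N%:R)) + D * (i%:R / N%:R - y1) ^+ 2.
  apply: (le_trans (@ler_norm_thin _ y2 N _ _ Y2 (pw i))).
  by rewrite thinD thin_cst thinZ thin_dist//; lra.
apply: (le_trans (@ler_norm_thin _ y1 N _ _ Y1 step)).
rewrite thinD thin_cst thinZ thin_dist//.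
have v (y : R) : 0 <= y <= 1 -> D * (y * (1 - y) / N%:R) <= D / N%:R :> R.
  move=> hy; rewrite ler_wpM2l// ler_pdivrMr// mulVf ?gt_eqF//.
  by rewrite -[leRHS]mulr1; apply: ler_pM; lra.
have := v _ Y1; have := v _ Y2.
have {}ND : 2 * (D / N%:R) <= e / 2 by rewrite mulrA.
move: (D * (y1 * _ / _)) (D * (y2 * _ / _)) (D / N%:R) ND => *; lra.
Qed.

End Bernstein.

(** * Fourier convergence of positive linear functionals *)

Section PositiveFunctionals.
Context {R : realType}.
Implicit Types (f g h : R * R -> R) (a : R).

Definition bmeas h := measurable_fun setT h /\ exists M : R, forall x, `|h x| <= M.

Lemma bmeas_cst a : bmeas (fun=> a).
Proof. by split; [exact: measurable_cst|exists `|a|]. Qed.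

Lemma bmeasM g h : bmeas g -> bmeas h -> bmeas (fun x => g x * h x).
Proof.
move=> [mg [A gA]] [mh [B hB]]; split; first exact: measurable_funM.
by exists (A * B) => x; exact: normM_le.
Qed.

Lemma bmeasD g h : bmeas g -> bmeas h -> bmeas (fun x => g x + h x).
Proof.
move=> [mg [A gA]] [mh [B hB]]; split; first exact: measurable_funD.
by exists (A + B) => x; exact: normD_le.
Qed.

Lemma bmeasZ a h : bmeas h -> bmeas (fun x => a * h x).
Proof. by move=> bh; apply: bmeasM => //; exact: bmeas_cst. Qed.

Lemma bmeasB g h : bmeas g -> bmeas h -> bmeas (fun x => g x - h x).
Proof.
move=> bg bh; rewrite (_ : (fun x => _) = (fun x => g x + -1 * h x)).
  by apply: bmeasD => //; exact: bmeasZ.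
by apply/funext => x; rewrite mulN1r.
Qed.

Definition cosf (c1 c2 phi : R) (x : R * R) : R := cos (c1 * x.1 + c2 * x.2 + phi).

Lemma bmeas_cosf c1 c2 phi : bmeas (cosf c1 c2 phi).
Proof.
split; last by exists 1 => x; exact: cos_max.
apply: (measurableT_comp (f := cos)).
  by apply: continuous_measurable_fun; exact: continuous_cos.
apply: measurable_funD; last exact: measurable_cst.
apply: measurable_funD; (apply: measurable_funM; first exact: measurable_cst).
  exact: measurable_fst.
exact: measurable_snd.
Qed.

Definition offbox (K : R) (x : R * R) : R := \1_(~` (`[- K, K] `*` `[- K, K])) x.

Lemma offboxE K x : offbox K x = if (`|x.1| <= K) && (`|x.2| <= K) then 0 else 1.
Proof.
rewrite /offbox indicE; case: ifPn => h.
  rewrite memNset// => nb; apply: nb; split; rewrite /= in_itv /= -ler_norml.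
  - by case/andP: h.
  - by case/andP: h.
rewrite mem_set// => -[] /=; rewrite !in_itv /= -!ler_norml => h1 h2.
by move: h; rewrite h1 h2.
Qed.

Lemma offbox_ge0 K x : 0 <= offbox K x.
Proof. by rewrite offboxE; case: ifP. Qed.

Lemma bmeas_offbox K : bmeas (offbox K).
Proof.
split; last by exists 1 => x; rewrite offboxE; case: ifP; rewrite ?normr0 ?normr1.
by apply: measurable_indic; apply: measurableC; apply: measurableX; exact: measurable_itv.
Qed.

(** Functionals instead of measures: expectations weighted by an indicator and Lebesgue integrals
    weighted by a density are treated alike, without normalisation. *)
Definition poslin (J : (R * R -> R) -> R) :=
  (forall a h g, bmeas h -> bmeas g -> J (fun x => a * h x + g x) = a * J h + J g) /\
  (forall h, bmeas h -> (forall x, 0 <= h x) -> 0 <= J h).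

Section PoslinTheory.
Variables (J : (R * R -> R) -> R) (pJ : poslin J).

Lemma poslinZ a h : bmeas h -> J (fun x => a * h x) = a * J h.
Proof.
move=> bh; have b0 := bmeas_cst 0.
have J0 : J (fun=> 0) = 0.
  have := pJ.1 1 _ _ b0 b0; rewrite (_ : (fun x => _) = (fun=> 0)); first lra.
  by apply/funext => x; rewrite mulr0 addr0.
rewrite (_ : (fun x => _) = (fun x => a * h x + (fun=> 0) x)); last first.
  by apply/funext => x; rewrite addr0.
by rewrite pJ.1// J0 addr0.
Qed.

Lemma poslinB h g : bmeas h -> bmeas g -> J (fun x => h x - g x) = J h - J g.
Proof.
move=> bh bg; have := pJ.1 (-1) _ _ bg bh; rewrite mulN1r [_ + J h]addrC => <-.
by congr J; apply/funext => x; rewrite mulN1r addrC.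
Qed.

Lemma poslin_le h g : bmeas h -> bmeas g -> (forall x, h x <= g x) -> J h <= J g.
Proof.
move=> bh bg hg; rewrite -subr_ge0 -poslinB//; apply: pJ.2; first exact: bmeasB.
by move=> x; rewrite subr_ge0.
Qed.

Lemma poslin_norm_le h g : bmeas h -> bmeas g -> (forall x, `|h x| <= g x) -> `|J h| <= J g.
Proof.
move=> bh bg hg; rewrite ler_norml; apply/andP; split.
  rewrite -mulN1r -poslinZ//; apply: poslin_le => //; first exact: bmeasZ.
  by move=> x; have := hg x; rewrite ler_norml => /andP[]; lra.
by apply: poslin_le => // x; apply: le_trans (ler_norm _) (hg x).
Qed.

End PoslinTheory.

(** Measurability for the product sigma-algebra: f is a pointwise limit of [trig2] functions, with
    error 1 / (k + 1) on boxes of half-width k + 1. *)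
Lemma measurable_continuous2 f : continuous f -> (exists M : R, forall x, `|f x| <= M) -> bmeas f.
Proof.
move=> cf [M fM]; split; last by exists M.
have inv0 k : 0 < (k.+1%:R : R)^-1 by rewrite invr_gt0.
have /choice[h hP] : forall k, exists g : R * R -> R, measurable_fun setT g /\
    forall x, `|x.1| <= k.+1%:R -> `|x.2| <= k.+1%:R -> `|g x - f x| <= (k.+1%:R)^-1.
  move=> k; have [N [lam [F [FM H]]]] := trig2_approx cf fM (ltr0Sn R k) (inv0 k).
  exists (trig2 N lam F); split => //.
  have msin (p : R * R -> R) : measurable_fun setT p -> measurable_fun setT (fun x => halfsin (lam * p x)).
    move=> mp; apply: measurable_funM => //; apply: measurable_funD => //.
    apply: (measurableT_comp (f := sin)).
      by apply: continuous_measurable_fun; exact: continuous_sin.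
    by apply: measurable_funM.
  have mthin (p : R * R -> R) n (G : nat -> R * R -> R) : measurable_fun setT p ->
      (forall i, measurable_fun setT (G i)) ->
      measurable_fun setT (fun x => thin (halfsin (lam * p x)) n (fun i => G i x)).
    move=> mp; elim: n G => [|n IH] G mG /=; first exact: mG.
    apply: measurable_funD; apply: measurable_funM.
    - exact: msin.
    - by apply: (IH (fun i => G i.+1)).
    - by apply: measurable_funB => //; exact: msin.
    - exact: IH.
  exact: (mthin fst N (fun i x => thin (halfsin (lam * x.2)) N (F i)) measurable_fst
    (fun i => mthin snd N (fun j _ => F i j) measurable_snd (fun j => measurable_cst _))).
apply: (@measurable_fun_cvg _ _ _ _ h) => [k|x _]; first by case: (hP k).
apply/cvgrPdist_le => e e0.
have [N hN] := eventually_nat (Num.max `|x.1| (Num.max `|x.2| e^-1)) (@ltr01 R).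
exists N => // k /= Nk; rewrite distrC.
have := hN _ (leq_trans Nk (leqnSn k)); rewrite mul1r !ge_max => /and3P[k1 k2 k3].
apply: (le_trans ((hP k).2 x k1 k2)).
by rewrite invf_ple ?posrE.
Qed.

Section LevyContinuity.
Variables (J_ : nat -> (R * R -> R) -> R) (J : (R * R -> R) -> R).
Hypothesis pJn : forall n, poslin (J_ n).
Hypothesis pJ : poslin J.
Hypothesis cvg_cosf : forall c1 c2 phi, (fun n => J_ n (cosf c1 c2 phi)) @ \oo --> J (cosf c1 c2 phi).
Hypothesis tight_n : forall e, 0 < e -> exists K N, forall n, (N <= n)%N -> J_ n (offbox K) <= e.
Hypothesis tight : forall e, 0 < e -> exists K, J (offbox K) <= e.

(** Testing h against all cosines makes the class stable under multiplication by sines, as the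
    recursion of [thin] requires. *)
Definition fourier_cvg h := bmeas h /\ forall c1 c2 phi,
  (fun n => J_ n (fun x => h x * cosf c1 c2 phi x)) @ \oo --> J (fun x => h x * cosf c1 c2 phi x).

Lemma fourier_cvg_cst a : fourier_cvg (fun=> a).
Proof.
split; first exact: bmeas_cst.
move=> c1 c2 phi; have bc := bmeas_cosf c1 c2 phi; rewrite poslinZ//.
rewrite (_ : (fun n => _) = (fun n => a * J_ n (cosf c1 c2 phi))); last first.
  by apply/funext => n; rewrite poslinZ.
by apply: cvgM => //; exact: cvg_cst.
Qed.

Lemma fourier_cvg_lin a h g : fourier_cvg h -> fourier_cvg g -> fourier_cvg (fun x => a * h x + g x).
Proof.
move=> [bh ch] [bg cg]; split; first by apply: bmeasD => //; exact: bmeasZ.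
move=> c1 c2 phi; have bc := bmeas_cosf c1 c2 phi.
have e : (fun x => (a * h x + g x) * cosf c1 c2 phi x) =
    (fun x => a * (h x * cosf c1 c2 phi x) + g x * cosf c1 c2 phi x).
  by apply/funext => x; ring.
rewrite e pJ.1; [|exact: bmeasM|exact: bmeasM].
rewrite (_ : (fun n => _) = (fun n => a * J_ n (fun x => h x * cosf c1 c2 phi x)
    + J_ n (fun x => g x * cosf c1 c2 phi x))); last first.
  by apply/funext => n; rewrite (pJn n).1//; exact: bmeasM.
by apply: cvgD => //; apply: cvgM => //; exact: cvg_cst.
Qed.

Lemma fourier_cvg_sin h l1 l2 : fourier_cvg h ->
  fourier_cvg (fun x => h x * sin (l1 * x.1 + l2 * x.2)).
Proof.
move=> [bh ch].
have sE (x : R * R) : sin (l1 * x.1 + l2 * x.2) = cosf l1 l2 (- (pi / 2)) x.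
  by rewrite /cosf cosBpihalf.
split.
  rewrite (_ : (fun x => _) = (fun x => h x * cosf l1 l2 (- (pi / 2)) x)).
    by apply: bmeasM => //; exact: bmeas_cosf.
  by apply/funext => x; rewrite sE.
move=> c1 c2 phi.
pose p x := h x * cosf (c1 + l1) (c2 + l2) (phi - pi / 2) x.
pose q x := h x * cosf (c1 - l1) (c2 - l2) (phi - pi / 2) x.
have bp : bmeas p by apply: bmeasM => //; exact: bmeas_cosf.
have bq : bmeas q by apply: bmeasM => //; exact: bmeas_cosf.
have e : (fun x => h x * sin (l1 * x.1 + l2 * x.2) * cosf c1 c2 phi x) =
    (fun x => 2^-1 * p x + (- 2^-1) * q x).
  apply/funext => x; rewrite /p /q /cosf.
  have -> : (c1 + l1) * x.1 + (c2 + l2) * x.2 + (phi - pi / 2) =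
    (c1 * x.1 + c2 * x.2 + phi) + (l1 * x.1 + l2 * x.2) - pi / 2 by ring.
  have -> : (c1 - l1) * x.1 + (c2 - l2) * x.2 + (phi - pi / 2) =
    (c1 * x.1 + c2 * x.2 + phi) - (l1 * x.1 + l2 * x.2) - pi / 2 by ring.
  move: (c1 * _ + _ + _) (l1 * _ + _) => A B.
  by rewrite !cosBpihalf sinD sinB; field.
rewrite e pJ.1 ?poslinZ//; last exact: bmeasZ.
rewrite (_ : (fun n => _) = (fun n => 2^-1 * J_ n p + (- 2^-1) * J_ n q)); last first.
  by apply/funext => n; rewrite (pJn n).1 ?poslinZ//; exact: bmeasZ.
by apply: cvgD; apply: cvgM; [exact: cvg_cst|exact: ch|exact: cvg_cst|exact: ch].
Qed.

Lemma fourier_cvg_thin N l1 l2 (F : nat -> R * R -> R) : (forall i, fourier_cvg (F i)) ->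
  fourier_cvg (fun x => thin (halfsin (l1 * x.1 + l2 * x.2)) N (fun i => F i x)).
Proof.
elim: N F => [|N IH] F gF /=; first exact: gF.
pose A x := thin (halfsin (l1 * x.1 + l2 * x.2)) N (fun i => F i.+1 x).
pose B x := thin (halfsin (l1 * x.1 + l2 * x.2)) N (fun i => F i x).
have gA : fourier_cvg A by apply: (IH (fun i => F i.+1)).
have gB : fourier_cvg B by exact: IH.
pose s (x : R * R) := sin (l1 * x.1 + l2 * x.2).
have gAs : fourier_cvg (fun x => A x * s x) by exact: fourier_cvg_sin.
have gBs : fourier_cvg (fun x => B x * s x) by exact: fourier_cvg_sin.
have g0 := fourier_cvg_cst 0.
have := fourier_cvg_lin 2^-1 gA (fourier_cvg_lin 2^-1 gB
  (fourier_cvg_lin 2^-1 gAs (fourier_cvg_lin (- 2^-1) gBs g0))).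
congr fourier_cvg; apply/funext => x; rewrite -/(A x) -/(B x) /s /halfsin; by field.
Qed.

(** On a large box f is within e' of a function h in the class; outside it both are bounded by M and
    tightness makes the mass small. The total mass of [J_ n] is not fixed; it converges as the case
    of the zero frequency. *)
Lemma levy_continuity f : continuous f -> (exists M : R, forall x, `|f x| <= M) ->
  (fun n => J_ n f) @ \oo --> J f.
Proof.
move=> cf bf; have bmf := measurable_continuous2 cf bf; have [M fM] := bf.
have M0 : 0 <= M by exact: le_trans (normr_ge0 _) (fM (0, 0)).
have b1 := bmeas_cst 1.
have J10 := pJ.2 _ b1 (fun=> ler01).
have cvg1 : (fun n => J_ n (fun=> 1)) @ \oo --> J (fun=> 1).
  have := @cvg_cosf 0 0 0; rewrite (_ : cosf 0 0 0 = fun=> 1)//.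
  by apply/funext => x; rewrite /cosf !mul0r !addr0 cos0.
apply/cvgrPdist_le => e e0.
pose D : R := 4 * M + 2 * (J (fun=> 1) + 1) + 2.
have D0 : 0 < D by rewrite /D; lra.
pose e' : R := Num.min (e / D) 1.
have e'0 : 0 < e' by rewrite lt_min ltr01 divr_gt0.
have e'1 : e' <= 1 by rewrite ge_min lexx orbT.
have e'D : e' * D <= e by rewrite -ler_pdivlMr// ge_min lexx.
have [K1 [N1 hN1]] := tight_n e'0; have [K2 hK2] := tight e'0.
pose K : R := Num.max 1 (Num.max K1 K2).
have K0 : 0 < K by rewrite lt_max ltr01.
have KK1 : K1 <= K by rewrite !le_max lexx orbT.
have KK2 : K2 <= K by rewrite !le_max lexx !orbT.
have off_le k : k <= K -> forall x, offbox K x <= offbox k x.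
  move=> kK x; rewrite !offboxE; case: ifPn => [_|]; first by case: ifP.
  move=> h; case: ifPn => // /andP[h1 h2].
  by rewrite (le_trans h1 kK) (le_trans h2 kK) in h.
have [N [lam [F [FM hap]]]] := trig2_approx cf fM K0 e'0.
set h := trig2 N lam F in hap.
have hM := trig2_bound N lam FM; rewrite -/h in hM.
have [bh ch] : fourier_cvg h.
  have gi i : fourier_cvg (fun x => thin (halfsin (lam * x.2)) N (F i)).
    have := @fourier_cvg_thin N 0 lam (fun j _ => F i j) (fun j => fourier_cvg_cst _).
    by congr fourier_cvg; apply/funext => x; rewrite mul0r add0r.
  have := @fourier_cvg_thin N lam 0 (fun i x => thin (halfsin (lam * x.2)) N (F i)) gi.
  by congr fourier_cvg; apply/funext => x; rewrite mul0r addr0.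
have cvgh : (fun n => J_ n h) @ \oo --> J h.
  have := ch 0 0 0; have e1 : (fun x => h x * cosf 0 0 0 x) = h.
    by apply/funext => x; rewrite /cosf !mul0r !addr0 cos0 mulr1.
  by rewrite e1.
have bo k := bmeas_offbox k.
have bg : bmeas (fun x => e' * 1 + 2 * M * offbox K x).
  by apply: bmeasD; [exact: bmeas_cst|exact: bmeasZ].
have diff (I : (R * R -> R) -> R) : poslin I -> I (offbox K) <= e' ->
    `|I f - I h| <= e' * I (fun=> 1) + 2 * M * e'.
  move=> pI hI; rewrite -poslinB//.
  apply: (@le_trans _ _ (I (fun x => e' * 1 + 2 * M * offbox K x))).
    apply: poslin_norm_le => //; first exact: bmeasB.
    move=> x; rewrite mulr1 offboxE; case: ifPn => [/andP[x1 x2]|_].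
      by rewrite mulr0 addr0 distrC; exact: hap.
    have := ler_normB (f x) (h x); have := fM x; have := hM x; lra.
  rewrite pI.1 ?poslinZ//; last exact: bmeasZ.
  by rewrite lerD2l ler_wpM2l// mulr_ge0.
have d0 : `|J f - J h| <= e' * J (fun=> 1) + 2 * M * e'.
  apply: diff => //; apply: le_trans hK2; apply: poslin_le => //; exact: off_le.
have /cvgrPdist_le /(_ _ e'0) [N2 _ hN2] := cvgh.
have /cvgrPdist_le /(_ _ ltr01) [N3 _ hN3] := cvg1.
exists (maxn N1 (maxn N2 N3)) => // n /=; rewrite !geq_max => /and3P[n1 n2 n3].
have d1 : `|J_ n f - J_ n h| <= e' * J_ n (fun=> 1) + 2 * M * e'.
  apply: diff => //; apply: le_trans (hN1 n n1); apply: poslin_le => //; exact: off_le.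
have d2 := hN2 n n2; have d3 := hN3 n n3.
have d4 : e' * J_ n (fun=> 1) <= e' * (J (fun=> 1) + 1).
  by rewrite ler_wpM2l ?(ltW e'0)//; move: d3; rewrite ler_norml => /andP[]; lra.
apply: le_trans e'D.
have -> : J f - J_ n f = (J f - J h) - (J_ n f - J_ n h) + (J h - J_ n h) by ring.
apply: (le_trans (normD_le (normB_le d0 d1) d2)).
have -> : e' * D = 4 * (M * e') + 2 * (e' * (J (fun=> 1) + 1)) + 2 * e' by rewrite /D; ring.
have -> : 2 * M * e' = 2 * (M * e') by ring.
by move: d4; rewrite !mulrDr mulr1; lra.
Qed.

End LevyContinuity.

End PositiveFunctionals.

(** * Integrals with a nonnegative weight as positive functionals *)

Section WeightedIntegral.
Context {R : realType} {d : measure_display} {T : measurableType d}.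
Variables (mu : {measure set T -> \bar R}) (w : T -> R) (Z : T -> R * R).
Hypothesis w0 : forall t, 0 <= w t.
Hypothesis iw : mu.-integrable setT (EFin \o w).
Hypothesis mZ : measurable_fun setT Z.

Definition wint (h : R * R -> R) : R := \int[mu]_t (w t * h (Z t)).

Lemma integrable_wint h : bmeas h -> mu.-integrable setT (EFin \o (fun t => w t * h (Z t))).
Proof.
move=> [mh [M hM]]; have M0 : 0 <= M by exact: le_trans (normr_ge0 _) (hM (0, 0)).
have mw : measurable_fun setT w by apply/measurable_EFinP; exact: measurable_int iw.
apply: (@le_integrable _ _ _ mu setT measurableT _ (fun t => (M%:E * (w t)%:E)%E)).
- by apply/measurable_EFinP; apply: measurable_funM => //; exact: measurableT_comp.
- move=> t _ /=; rewrite lee_fin !normrM mulrC ler_wpM2r//; exact: le_trans (hM _) (ler_norm _).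
- exact: (@integrableZl _ _ _ mu setT measurableT M _ iw).
Qed.

Lemma poslin_wint : poslin wint.
Proof.
split => [a h g bh bg|h bh h0]; last by apply: Rintegral_ge0 => t _; rewrite mulr_ge0.
have ih := integrable_wint bh; have ig := integrable_wint bg.
have ia : mu.-integrable setT (EFin \o (fun t => a * (w t * h (Z t)))).
  exact: (@integrableZl _ _ _ mu setT measurableT a _ ih).
rewrite /wint -RintegralZl// -RintegralD//.
by apply: eq_Rintegral => t _; ring.
Qed.

Lemma wint_tight e : 0 < e -> exists K, wint (offbox K) <= e.
Proof.
move=> e0; have mw : measurable_fun setT w by apply/measurable_EFinP; exact: measurable_int iw.
have cv : (fun k : nat => (\int[mu]_t (w t * offbox k%:R (Z t))%:E)%E) @ \oo --> (\int[mu]_t 0%:E)%E.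
  apply: (@dominated_cvg _ _ _ mu setT measurableT _ _ (EFin \o w)) => //.
  - move=> k; apply/measurable_EFinP; apply: measurable_funM => //.
    by apply: (measurableT_comp (f := offbox _)) => //; case: (bmeas_offbox (k%:R : R)).
  - move=> t _; apply/cvg_EFin; first exact: nearW.
    apply/cvgrPdist_le => r r0.
    have [N hN] := eventually_nat (Num.max `|(Z t).1| `|(Z t).2|) (@ltr01 R).
    exists N => // k /= Nk; have := hN k Nk; rewrite mul1r ge_max => hk.
    by rewrite /= offboxE hk mulr0 subr0 normr0 ltW.
  - move=> k t _ /=; rewrite lee_fin ger0_norm ?mulr_ge0 ?offbox_ge0// ler_piMr//.
    by rewrite offboxE; case: ifP.
rewrite integral0 in cv; move/fine_cvgP: cv => [_ /cvgrPdist_le /(_ _ e0) [N _ hN]].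
exists N%:R; have := hN N (leqnn N); rewrite /= sub0r normrN; apply: le_trans.
exact: ler_norm.
Qed.

End WeightedIntegral.

(** * Gaussian integrals of cosines *)

Section GaussianCharacteristic.
Context {R : realType}.
Variables (m s : R).
Hypothesis s0 : 0 < s.
Local Notation mu := (@lebesgue_measure R).
Local Notation g := (normal_fun m s).

Lemma is_derive_normal_fun (x : R) : is_derive x 1 g (- ((x - m) / s ^+ 2 * g x)).
Proof.
have dq : is_derive x 1 (fun y : R => - (y - m) ^+ 2 / (s ^+ 2 *+ 2)) (- ((x - m) / s ^+ 2)).
  apply: is_derive_eq; rewrite /GRing.scale /=.
  rewrite -[_ *+ 2]mulr_natl; field; rewrite gt_eqF//.
have h := @is_derive1_comp R expR _ x _ _ (is_derive_expR _) dq.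
by apply: (is_derive_eq h); rewrite /normal_fun /GRing.scale /=; ring.
Qed.

Lemma is_derive_normal_sin (t psi x : R) : is_derive x 1 (fun y => g y * sin (t * (y - m) + psi))
   (t * (g x * cos (t * (x - m) + psi)) - (s ^+ 2)^-1 * ((x - m) * (g x * sin (t * (x - m) + psi)))).
Proof.
have dl : is_derive x 1 (fun y : R => t * (y - m) + psi) t.
  by apply: is_derive_eq; rewrite /GRing.scale /=; ring.
have ds := @is_derive1_comp R sin _ x _ _ (is_derive_sin _) dl.
have dg := is_derive_normal_fun x.
have h := is_deriveM dg ds.
by apply: (is_derive_eq h); rewrite /GRing.scale /=; ring.
Qed.

(** Half of the exponent absorbs the linear factor, as |u| exp(- u^2 / 4) <= 1; the other half is a
    Gaussian with deviation sqrt 2 s. *)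
Lemma normal_fun_moment_le (x : R) : `|x - m| * g x <= s * normal_fun m (Num.sqrt 2 * s) x.
Proof.
rewrite /normal_fun; set u := (x - m) / s.
have e1 : - (x - m) ^+ 2 / (s ^+ 2 *+ 2) = - (u ^+ 2 / 4) - u ^+ 2 / 4.
  by rewrite /u -[_ *+ 2]mulr_natl; field; rewrite gt_eqF.
have e2 : - (x - m) ^+ 2 / ((Num.sqrt 2 * s) ^+ 2 *+ 2) = - (u ^+ 2 / 4).
  by rewrite /u -[_ *+ 2]mulr_natl exprMn sqr_sqrtr//; field; rewrite gt_eqF.
have e3 : `|x - m| = s * `|u| by rewrite /u normrM normfV (gtr0_norm s0) mulrC mulfVK// gt_eqF.
rewrite e1 e2 e3 expRD mulrACA ler_piMr// ?mulr_ge0 ?expR_ge0 ?(ltW s0)//.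
have h : `|u| * expR (- (u ^+ 2 / 4)) <= 1.
  rewrite expRN ler_pdivrMr ?expR_gt0// mul1r; apply: le_trans (expR_ge1Dx _).
  have := sqr_ge0 (`|u| - 2); rewrite sqrrB real_normK ?num_real//; lra.
exact: h.
Qed.

Lemma integrable_normal_fun (c : R) : 0 < c -> mu.-integrable setT (EFin \o normal_fun m c).
Proof.
move=> c0; have p0 := @normal_peak_gt0 R c (lt0r_neq0 c0).
rewrite (_ : EFin \o _ = (fun x => ((normal_peak c)^-1)%:E * (normal_pdf m c x)%:E)%E).
  by apply: integrableZl => //; exact: integrable_normal_pdf.
apply/funext => x /=; rewrite normal_pdfE ?lt0r_neq0// -EFinM mulrA mulVf ?mul1r//.
by rewrite gt_eqF.
Qed.

Lemma measurable_affine (t psi : R) : measurable_fun setT (fun x : R => t * (x - m) + psi).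
Proof. by do ![apply: measurable_funD => //|apply: measurable_funM => //|apply: measurable_funB => //]. Qed.

Lemma measurable_cos_affine (t psi : R) : measurable_fun setT (fun x : R => cos (t * (x - m) + psi)).
Proof.
apply: (measurableT_comp (f := cos)); last exact: measurable_affine.
by apply: continuous_measurable_fun; exact: continuous_cos.
Qed.

Lemma measurable_sin_affine (t psi : R) : measurable_fun setT (fun x : R => sin (t * (x - m) + psi)).
Proof.
apply: (measurableT_comp (f := sin)); last exact: measurable_affine.
by apply: continuous_measurable_fun; exact: continuous_sin.
Qed.

Lemma integrable_normal_moment : mu.-integrable setT (EFin \o (fun x => `|x - m| * g x)).
Proof.
apply: (@le_integrable _ _ _ mu setT measurableT _ (fun x => (s%:E * (normal_fun m (Num.sqrt 2 * s) x)%:E)%E)).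
- apply/measurable_EFinP; apply: measurable_funM; last exact: measurable_normal_fun.
  by apply: measurableT_comp => //; apply: measurable_funB.
- move=> x _ /=; rewrite lee_fin normrM normr_id (ger0_norm (normal_fun_ge0 m s x)).
  by apply: le_trans (normal_fun_moment_le x) _; exact: ler_norm.
- apply: (@integrableZl _ _ _ mu setT measurableT s (EFin \o normal_fun m (Num.sqrt 2 * s))).
  by apply: integrable_normal_fun; rewrite mulr_gt0// sqrtr_gt0.
Qed.

Lemma integrable_normal_cos (t psi : R) :
  mu.-integrable setT (EFin \o (fun x => g x * cos (t * (x - m) + psi))).
Proof.
apply: (le_integrable _ _ _ (integrable_normal_fun s0)) => //.
- apply/measurable_EFinP; apply: measurable_funM; [exact: measurable_normal_fun|exact: measurable_cos_affine].
- move=> x _ /=; rewrite lee_fin normrM [leRHS]ger0_norm ?expR_ge0// ger0_norm ?expR_ge0//.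
  by rewrite ler_piMr ?expR_ge0// cos_max.
Qed.

Lemma integrable_normal_moment_sin (t psi : R) :
  mu.-integrable setT (EFin \o (fun x => (x - m) * (g x * sin (t * (x - m) + psi)))).
Proof.
apply: (le_integrable _ _ _ integrable_normal_moment) => //.
- apply/measurable_EFinP; apply: measurable_funM; first exact: measurable_funB.
  by apply: measurable_funM; [exact: measurable_normal_fun|exact: measurable_sin_affine].
- move=> x _ /=; rewrite lee_fin !normrM normr_id ler_wpM2l//.
  by rewrite ler_piMr// sin_max.
Qed.

Lemma normal_fun_vanish (e : R) : 0 < e -> exists N : nat, forall x : R, N%:R <= `|x - m| -> g x <= e.
Proof.
move=> e0; have [N hN] := eventually_nat s e0.
exists N.+1 => x hx; have x0 : 0 < `|x - m| by apply: lt_le_trans hx; rewrite ltr0n.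
rewrite -(ler_pM2l x0); apply: (le_trans (normal_fun_moment_le x)).
apply: (@le_trans _ _ s).
  rewrite ler_piMr ?(ltW s0)// -[leRHS]expR0 ler_expR mulNr oppr_le0.
  by rewrite divr_ge0 ?sqr_ge0// mulrn_wge0// sqr_ge0.
apply: (le_trans (hN N.+1 (leqnSn N))); rewrite mulrC ler_wpM2r ?(ltW e0)//.
Qed.

(** The derivative of g(x) sin(t (x - m) + psi) is integrated over [-n, n]; the boundary terms
    vanish with g, and dominated convergence gives the whole line. *)
Lemma normal_by_parts (t psi : R) :
  \int[mu]_x ((x - m) * (g x * sin (t * (x - m) + psi))) =
  s ^+ 2 * t * \int[mu]_x (g x * cos (t * (x - m) + psi)).
Proof.
pose G x := g x * sin (t * (x - m) + psi).
pose K x := t * (g x * cos (t * (x - m) + psi)) - (s ^+ 2)^-1 * ((x - m) * G x).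
have dG (x : R) : is_derive x 1 G (K x) by exact: is_derive_normal_sin.
have i1 := integrable_normal_cos t psi; have i2 := integrable_normal_moment_sin t psi.
have i1' : mu.-integrable setT (EFin \o (fun x => t * (g x * cos (t * (x - m) + psi)))).
  exact: (@integrableZl _ _ _ mu setT measurableT t _ i1).
have i2' : mu.-integrable setT (EFin \o (fun x => (s ^+ 2)^-1 * ((x - m) * G x))).
  exact: (@integrableZl _ _ _ mu setT measurableT (s ^+ 2)^-1 _ i2).
have iK : mu.-integrable setT (EFin \o K).
  exact: (@integrableB _ _ _ mu setT measurableT _ _ i1' i2').
have cK : continuous K.
  have ca : continuous (fun x : R => t * (x - m) + psi).
    move=> x; apply: cvgD; last exact: cvg_cst.
    by apply: cvgM; [exact: cvg_cst|apply: cvgB; [exact: cvg_id|exact: cvg_cst]].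
  have cg : continuous g.
    by move=> x; apply/differentiable_continuous/derivable1_diffP; case: (is_derive_normal_fun x).
  move=> x; apply: cvgB; apply: cvgM; try exact: cvg_cst.
    apply: cvgM; first exact: cg.
    by apply: (continuous_comp (ca x)); exact: continuous_cos.
  apply: cvgM; first by apply: cvgB; [exact: cvg_id|exact: cvg_cst].
  apply: cvgM; first exact: cg.
  by apply: (continuous_comp (ca x)); exact: continuous_sin.
have cG : continuous G.
  by move=> x; apply/differentiable_continuous/derivable1_diffP; case: (dG x).
have K0 : \int[mu]_x K x = 0.
  pose I (n : nat) (x : R) : R := K x * \1_`[- n%:R, n%:R]%classic x.
  have cv : (fun n : nat => (\int[mu]_x (I n x)%:E)%E) @ \oo --> (\int[mu]_x (K x)%:E)%E.
    apply: (@dominated_cvg _ _ _ mu setT measurableT (fun n x => (I n x)%:E) _ (fun x => `|(K x)%:E|)%E) => //.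
    - move=> n; apply/measurable_EFinP; apply: measurable_funM.
        exact: continuous_measurable_fun.
      exact: measurable_indic.
    - move=> x _; apply/cvg_EFin; first exact: nearW.
      apply/cvgrPdist_le => r r0.
      have [N hN] := eventually_nat `|x| (@ltr01 R).
      exists N => // n /= Nn; have := hN n Nn; rewrite mul1r ler_norml => hn.
      by rewrite /I indicE mem_set ?mulr1 ?subrr ?normr0 ?ltW// /= in_itv.
    - exact: integrable_abse.
    - move=> n x _ /=; rewrite lee_fin /I normrM ler_piMr// indicE.
      by case: (_ \in _); rewrite ?normr0 ?normr1.
  have IE n : (\int[mu]_x (I n.+1 x)%:E)%E = (G n.+1%:R - G (- n.+1%:R))%:E.
    pose A : set R := `[- n.+1%:R, n.+1%:R]%classic.
    transitivity (\int[mu]_(x in A) (K x)%:E)%E.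
      rewrite [RHS]integral_mkcond; apply: eq_integral => x _.
      by rewrite /I /= patchE indicE; case: ifP; rewrite ?mulr1 ?mulr0.
    rewrite (@continuous_FTC2 R K G) ?EFinB//.
    - by rewrite gtrN// ltr0n.
    - exact: continuous_subspaceT.
    - split=> [x _||].
      + by case: (dG x).
      + by apply: cvg_at_right_filter; exact: cG.
      + by apply: cvg_at_left_filter; exact: cG.
    - by move=> x _; rewrite derive1E; case: (dG x).
  have cv0 : (fun n : nat => (\int[mu]_x (I n.+1 x)%:E)%E) @ \oo --> (0 : R)%:E.
    rewrite (_ : (fun n => _) = EFin \o (fun n : nat => G n.+1%:R - G (- n.+1%:R))); last exact/funext.
    apply/cvg_EFin; first exact: nearW.
    apply/cvgrPdist_le => e e0; have e20 : 0 < e / 2 by rewrite divr_gt0.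
    have [N hN] := normal_fun_vanish e20.
    have [N' hN'] := eventually_nat (N%:R + `|m|) (@ltr01 R).
    exists N' => // n /= Nn.
    have GE x : `|G x| <= g x.
      by rewrite normrM (ger0_norm (normal_fun_ge0 m s x)) ler_piMr ?normal_fun_ge0// sin_max.
    have := hN' n.+1 (leqW Nn); rewrite mul1r => hn.
    have mm := ler_norm m; have mm' := ler_norm (- m); rewrite normrN in mm'.
    rewrite sub0r normrN [e]splitr; apply: normB_le; apply: (le_trans (GE _)); apply: hN.
      by rewrite (le_trans _ (ler_norm _))//; lra.
    by rewrite -normrN (le_trans _ (ler_norm _))//; lra.
  have cv1 : (fun n : nat => (\int[mu]_x (I n.+1 x)%:E)%E) @ \oo --> (\int[mu]_x (K x)%:E)%E.
    by rewrite (cvg_shiftS (fun n : nat => (\int[mu]_x (I n x)%:E)%E)).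
  by rewrite /Rintegral -(cvg_unique _ cv0 cv1).
have : t * (\int[mu]_x (g x * cos (t * (x - m) + psi))) = (s ^+ 2)^-1 * \int[mu]_x ((x - m) * G x).
  apply/eqP; rewrite -subr_eq0 -!RintegralZl// -RintegralB//; apply/eqP; exact: K0.
by rewrite /G => h; rewrite -mulrA h mulVKf// gt_eqF// exprn_gt0.
Qed.

(** Differentiation under the integral, dominated by |x - m| g(x), and integration by parts give the
    equation F' = - s^2 t F, solved in [normal_fun_cf]. *)
Lemma is_derive_normal_cf (t psi : R) :
  is_derive t 1 (fun t => \int[mu]_x (g x * cos (t * (x - m) + psi)))
   (- (s ^+ 2 * t * \int[mu]_x (g x * cos (t * (x - m) + psi)))).
Proof.
pose f (t x : R) := g x * cos (t * (x - m) + psi).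
have df (u x : R) : is_derive u 1 (f ^~ x) (- ((x - m) * (g x * sin (u * (x - m) + psi)))).
  have dl : is_derive u 1 (fun v : R => v * (x - m) + psi) (x - m).
    by apply: is_derive_eq; rewrite /GRing.scale /=; ring.
  have dc := @is_derive1_comp R cos _ u _ _ (is_derive_cos _) dl.
  have h := @is_deriveZ _ _ _ _ (g x) _ _ _ dc.
  by apply: (is_derive_eq h); rewrite /GRing.scale /=; ring.
have dfE u x : partial1of2 f u x = - ((x - m) * (g x * sin (u * (x - m) + psi))).
  by rewrite partial1of2E; case: (df u x).
have tI : `]t - 1, t + 1[%classic t by rewrite /= in_itv /=; lra.
have hyp1 : forall u, `]t - 1, t + 1[%classic u -> mu.-integrable setT (EFin \o f u).
  by move=> u _; exact: integrable_normal_cos.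
have hyp2 : forall u x, `]t - 1, t + 1[%classic u -> setT x -> derivable (f ^~ x) u 1.
  by move=> u x _ _; case: (df u x).
have hyp3 : forall u x, `]t - 1, t + 1[%classic u -> setT x -> `|partial1of2 f u x| <= `|x - m| * g x.
  move=> u x _ _; rewrite dfE normrN !normrM ler_wpM2l// (ger0_norm (normal_fun_ge0 m s x)).
  by rewrite ler_piMr ?normal_fun_ge0// sin_max.
have G0 : forall x : R, 0 <= `|x - m| * g x by move=> x; rewrite mulr_ge0 ?normal_fun_ge0.
apply: DeriveDef.
  exact: (derivable_under_integral measurableT tI hyp1 hyp2 G0 integrable_normal_moment hyp3).
rewrite -derive1E (differentiation_under_integral measurableT tI hyp1 hyp2 G0 integrable_normal_moment hyp3).
rewrite -normal_by_parts -mulN1r -RintegralZl//; last exact: integrable_normal_moment_sin.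
by apply: eq_Rintegral => x _; rewrite mulN1r dfE.
Qed.

Lemma normal_fun_cf (t psi : R) : \int[mu]_x (g x * cos (t * (x - m) + psi)) =
  expR (- (s ^+ 2 * t ^+ 2 / 2)) * ((normal_peak s)^-1 * cos psi).
Proof.
pose F t := \int[mu]_x (g x * cos (t * (x - m) + psi)).
have dE (u : R) : is_derive u 1 (fun v : R => expR (s ^+ 2 * v ^+ 2 / 2)) (s ^+ 2 * u * expR (s ^+ 2 * u ^+ 2 / 2)).
  have dq : is_derive u 1 (fun v : R => s ^+ 2 * v ^+ 2 / 2) (s ^+ 2 * u).
    by apply: is_derive_eq; rewrite /GRing.scale /=; field.
  have h := @is_derive1_comp R expR _ u _ _ (is_derive_expR _) dq.
  by apply: (is_derive_eq h); rewrite mulrC.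
have dP (u : R) : is_derive u 1 (fun v : R => expR (s ^+ 2 * v ^+ 2 / 2) * F v) 0.
  have h := is_deriveM (dE u) (is_derive_normal_cf u psi).
  by apply: (is_derive_eq h); rewrite /GRing.scale /=; ring.
have cst := is_derive_0_is_cst t 0 dP.
have F0 : F 0 = (normal_peak s)^-1 * cos psi.
  have p0 := @normal_peak_gt0 R s (lt0r_neq0 s0).
  transitivity (\int[mu]_x ((normal_peak s)^-1 * cos psi * normal_pdf m s x)).
    apply: eq_Rintegral => x _; rewrite mul0r add0r normal_pdfE ?lt0r_neq0//; field.
    by rewrite lt0r_neq0.
  rewrite RintegralZl//; last exact: integrable_normal_pdf.
  by rewrite /Rintegral integral_normal_pdf mulr1.
move: cst; rewrite expr0n /= mulr0 mul0r expR0 mul1r F0 => h.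
by rewrite -h mulrA -expRD addNr expR0 mul1r.
Qed.

Lemma normal_cf (t phi : R) : \int[mu]_x (normal_pdf m s x * cos (t * x + phi)) =
  expR (- (s ^+ 2 * t ^+ 2 / 2)) * cos (t * m + phi).
Proof.
have p0 := @normal_peak_gt0 R s (lt0r_neq0 s0).
transitivity (\int[mu]_x (normal_peak s * (g x * cos (t * (x - m) + (t * m + phi))))).
  apply: eq_Rintegral => x _.
  rewrite normal_pdfE ?lt0r_neq0// -mulrA; congr (_ * (_ * cos _)); ring.
rewrite RintegralZl//; last exact: integrable_normal_cos.
by rewrite normal_fun_cf; field; rewrite lt0r_neq0.
Qed.

End GaussianCharacteristic.

Section NormalProbability.
Context {R : realType}.
Local Notation mu := (@lebesgue_measure R).

Lemma integral_normal_prob (m s : R) (f : R -> \bar R) : (normal_prob m s).-integrable setT f ->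
  (\int[normal_prob m s]_x f x = \int[mu]_x (f x * (normal_pdf m s x)%:E))%E.
Proof.
move=> fi; have mf := measurable_int _ fi.
have dom := @normal_prob_dominates R m s.
rewrite -(Radon_Nikodym_change_of_variables dom)//=.
apply: ae_eq_integral => //.
- by apply: emeasurable_funM => //; apply: (measurable_int mu).
- by apply: emeasurable_funM => //=; apply/measurable_EFinP; exact: measurable_normal_pdf.
- apply: ae_eqe_mul2l => /=.
  rewrite Radon_NikodymE//=.
  case: cid => /= h [h1 h2 h3].
  apply: integral_ae_eq => //=.
  + by apply/measurable_EFinP; exact: measurable_normal_pdf.
  + by move=> E E01 mE; rewrite -h3.
Qed.

End NormalProbability.

(** * Bivariate Gaussian densities and their characteristic function *)

Section BivariateGaussian.
Context {R : realType}.
Local Notation mu := (@lebesgue_measure R).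

Lemma mx2M (a b c e a' b' c' e' : R) : mx2 a b c e *m mx2 a' b' c' e' =
  mx2 (a * a' + b * c') (a * b' + b * e') (c * a' + e * c') (c * b' + e * e').
Proof.
apply/matrixP => i j; rewrite !mxE !big_ord_recl big_ord0 /= !mxE /= addr0.
by case: i => [[|[|]]]//= ?; case: j => [[|[|]]]//= ?.
Qed.

Lemma mx2_1 : 1%:M = mx2 1 0 0 1 :> 'M[R]_2.
Proof.
apply/matrixP => i j; rewrite !mxE.
by case: i => [[|[|]]]//= ?; case: j => [[|[|]]]//= ?.
Qed.

Lemma det_mx2 (a b c e : R) : \det (mx2 a b c e) = a * e - b * c.
Proof.
rewrite (expand_det_row _ ord0) !big_ord_recl big_ord0 /cofactor !det_mx11 !mxE /=.
by rewrite /bump /= !expr0 expr1; ring.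
Qed.

Lemma invmx_mx2 (a b c e : R) : a * e - b * c != 0 -> invmx (mx2 a b c e) =
  mx2 (e / (a * e - b * c)) (- b / (a * e - b * c)) (- c / (a * e - b * c)) (a / (a * e - b * c)).
Proof.
move=> D0; have U : mx2 a b c e \in unitmx by rewrite unitmxE det_mx2 unitfE.
rewrite -[RHS](mulKmx U) mx2M -[LHS]mulmx1 mx2_1; congr (_ *m mx2 _ _ _ _); by field.
Qed.

Lemma mx2_form (a b c e x1 x2 : R) :
  ((colv (x1, x2))^T *m mx2 a b c e *m colv (x1, x2)) ord0 ord0 =
  a * x1 ^+ 2 + (b + c) * (x1 * x2) + e * x2 ^+ 2.
Proof.
by rewrite !mxE !big_ord_recl big_ord0 /= !mxE !big_ord_recl !big_ord0 /= !mxE /=; ring.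
Qed.

Variables (p q r : R).
Hypothesis r0 : 0 < r.
Hypothesis D0 : 0 < p * r - q ^+ 2.
Let D := p * r - q ^+ 2.
Let s1 := Num.sqrt (D / r).
Let s2 := Num.sqrt r.
Let s10 : 0 < s1. Proof. by rewrite sqrtr_gt0 divr_gt0. Qed.
Let s20 : 0 < s2. Proof. by rewrite sqrtr_gt0. Qed.
Local Notation w := (gauss2_pdf (mx2 p q q r)).

(** Disintegration: the second coordinate has variance r, and given it the first is normal with mean
    (q / r) x.2 and variance D / r. *)
Lemma gauss2_pdfE (x : R * R) : w x = normal_pdf (q / r * x.2) s1 x.1 * normal_pdf 0 s2 x.2.
Proof.
have dE : p * r - q * q = D by rewrite /D expr2.
have D00 : D != 0 by rewrite gt_eqF. have r00 : r != 0 by rewrite gt_eqF.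
rewrite !normal_pdfE ?gt_eqF// /normal_peak /normal_fun mulrACA -expRD.
rewrite /gauss2_pdf invmx_mx2 dE// det_mx2 dE; case: x => x1 x2; rewrite mx2_form /=.
rewrite !sqr_sqrtr ?(ltW r0) ?divr_ge0 ?(ltW r0) ?(ltW D0)//.
rewrite mulrC; congr (_ * expR _); last first.
  rewrite -[_ *+ 2]mulr_natl -[r *+ 2]mulr_natl /D; field.
  by rewrite r00 D00.
rewrite -invfM -sqrtrM; last by rewrite mulrn_wge0// mulr_ge0 ?pi_ge0// divr_ge0 ?(ltW r0) ?(ltW D0).
congr (_^-1).
rewrite (_ : D / r * pi *+ 2 * (r * pi *+ 2) = (2 * pi) ^+ 2 * D); last first.
  by rewrite -[(_ * pi) *+ 2]mulr_natl -[(r * _) *+ 2]mulr_natl; field.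
by rewrite sqrtrM ?sqr_ge0// sqrtr_sqr ger0_norm// mulr_ge0// pi_ge0.
Qed.

Lemma gauss2_pdf_ge0 x : 0 <= w x.
Proof. by rewrite gauss2_pdfE mulr_ge0 ?normal_pdf_ge0. Qed.

Lemma bmeas_gauss2_pdf : bmeas w.
Proof.
have s1n := lt0r_neq0 s10; have s2n := lt0r_neq0 s20.
apply: measurable_continuous2; last first.
  exists (normal_peak s1 * normal_peak s2) => x; rewrite ger0_norm ?gauss2_pdf_ge0//.
  by rewrite gauss2_pdfE; apply: ler_pM; rewrite ?normal_pdf_ge0 ?normal_pdf_ub.
(* Moving the conditional mean into the argument reduces joint continuity to that of a fixed
   density. *)
rewrite (_ : w = fun x => normal_pdf 0 s1 (x.1 - q / r * x.2) * normal_pdf 0 s2 x.2); last first.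
  apply/funext => x; rewrite gauss2_pdfE; congr (_ * _).
  by rewrite !normal_pdfE// /normal_fun subr0.
move=> x; have cx : (fun q : R * R => q.1) @ x --> x.1 by exact: cvg_fst.
have cy : (fun q : R * R => q.2) @ x --> x.2 by exact: cvg_snd.
have ca : (fun y : R * R => y.1 - q / r * y.2) @ x --> x.1 - q / r * x.2.
  by apply: cvgB => //; apply: cvgM => //; exact: cvg_cst.
apply: cvgM.
  by apply: (continuous_cvg _ _ ca); exact: continuous_normal_pdf.
by apply: (continuous_cvg _ _ cy); exact: continuous_normal_pdf.
Qed.

Lemma integrable_gauss2_pdf : (mu \x mu)%E.-integrable setT (EFin \o w).
Proof.
have mw : measurable_fun setT (EFin \o w) by apply/measurable_EFinP; case: bmeas_gauss2_pdf.
apply/(integrable21ltyP mu mu mw).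
suff -> : (\int[mu]_y \int[mu]_x `|(EFin \o w) (x, y)| = \int[mu]_y (normal_pdf 0 s2 y)%:E)%E.
  by rewrite integral_normal_pdf ltry.
apply: eq_integral => y _; transitivity (\int[mu]_x ((normal_pdf 0 s2 y)%:E * (normal_pdf (q / r * y) s1 x)%:E))%E.
  apply: eq_integral => x _ /=.
  by rewrite ger0_norm ?gauss2_pdf_ge0// gauss2_pdfE mulrC EFinM.
rewrite integralZl//; last exact: integrable_normal_pdf.
by rewrite integral_normal_pdf mule1.
Qed.

Lemma gauss2_cf (c1 c2 phi : R) : \int[(mu \x mu)%E]_x (w x * cosf c1 c2 phi x) =
  expR (- ((p * c1 ^+ 2 + 2 * q * c1 * c2 + r * c2 ^+ 2) / 2)) * cos phi.
Proof.
have id_mf : measurable_fun setT (@id (R * R)) by exact: measurable_id.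
have iw := integrable_wint integrable_gauss2_pdf id_mf (bmeas_cosf c1 c2 phi).
rewrite /Rintegral -(integral21_prod_meas1 iw).
transitivity (\int[mu]_y (expR (- (s1 ^+ 2 * c1 ^+ 2 / 2)) *
    (normal_pdf 0 s2 y * cos ((c1 * (q / r) + c2) * y + phi)))).
  rewrite /Rintegral; congr fine; apply: eq_integral => y _; rewrite /fubini_G.
  transitivity (\int[mu]_x ((normal_pdf 0 s2 y)%:E * (normal_pdf (q / r * y) s1 x * cos (c1 * x + (c2 * y + phi)))%:E))%E.
    apply: eq_integral => x _ /=; rewrite gauss2_pdfE -EFinM /cosf /= -addrA; congr (_%:E); ring.
  have ic : mu.-integrable setT (EFin \o (fun x => normal_pdf (q / r * y) s1 x * cos (c1 * x + (c2 * y + phi)))).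
    apply: (le_integrable _ _ _ (integrable_normal_pdf (q / r * y) s1)) => //.
    - apply/measurable_EFinP; apply: measurable_funM; first exact: measurable_normal_pdf.
      have := measurable_cos_affine 0 c1 (c2 * y + phi).
      by congr measurable_fun; apply/funext => x; rewrite subr0.
    - by move=> x _ /=; rewrite lee_fin normrM ler_piMr// cos_max.
  rewrite integralZl// -[X in (_ * X)%E]fineK; last exact: (@integrable_fin_num _ _ _ _ _ _ (EFin \o _) ic).
  rewrite -EFinM; congr (_%:E); rewrite -[fine _]/(\int[mu]_x (normal_pdf (q / r * y) s1 x * cos (c1 * x + (c2 * y + phi)))).
  rewrite normal_cf// mulrCA; congr (_ * (_ * cos _)); ring.
rewrite RintegralZl//; last first.
  apply: (le_integrable _ _ _ (integrable_normal_pdf 0 s2)) => //.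
  - apply/measurable_EFinP; apply: measurable_funM; first exact: measurable_normal_pdf.
    have := measurable_cos_affine 0 (c1 * (q / r) + c2) phi.
    by congr measurable_fun; apply/funext => x; rewrite subr0.
  - by move=> x _ /=; rewrite lee_fin normrM ler_piMr// cos_max.
rewrite normal_cf// mulrA -expRD mulr0 add0r; congr (expR _ * _).
rewrite !sqr_sqrtr ?(ltW r0) ?divr_ge0 ?(ltW r0) ?(ltW D0)// /D; field.
by rewrite gt_eqF.
Qed.

End BivariateGaussian.

(** * Linearisation of the estimators *)

Section Vanishing.
Context {R : realType} {d : measure_display} {T : measurableType d} (P : probability T R).
Context (alpha : R) (X0 : T -> nat) (eps : nat -> T -> nat) (xi : nat -> nat -> T -> nat).
Hypothesis H : inar_assumptions P alpha X0 eps xi.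
Hypothesis H3X : (\int[P]_t (((X0 t)%:R : R) ^+ 3)%:E < +oo)%E.
Hypothesis H3e : (\int[P]_t (((eps 1%N t)%:R : R) ^+ 3)%:E < +oo)%E.

Local Notation int := (int P).
Local Notation X := (Xproc X0 eps xi).
Local Notation adapted := (adapted X).

Definition Pr (A : set T) : R := \int[P]_t (\1_A t : R).

Let amf (f : T -> R) k : adapted k f -> measurable_fun setT f.
Proof. exact: (adapted_mfun H). Qed.

Lemma adapted_indic k (A : set T) : adapted k A -> adapted k (fun t => \1_A t : R).
Proof. by move=> aA t t' h; rewrite !indicE /in_mem /mem /= /in_set (aA t t' h). Qed.

Lemma norm_indic (A : set T) t : `|(\1_A t : R)| <= 1.
Proof. by rewrite indicE; case: (_ \in _); rewrite ?normr1 ?normr0. Qed.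

Lemma int_indic k (A : set T) : adapted k A -> int (fun t => \1_A t : R).
Proof.
move=> aA; apply: (le_int (amf (adapted_indic aA)) (int_cst P 1)) => t; exact: norm_indic.
Qed.

(** A set is adapted as a Prop-valued function; one implication suffices because agreement of paths
    is symmetric. *)
Lemma adapted_setP k (A : set T) :
  (forall t t', (forall i, (i <= k)%N -> X i t = X i t') -> A t -> A t') -> adapted k A.
Proof.
move=> h t t' e; apply: propext; split; apply: h => // i ik; by rewrite e.
Qed.

Lemma measurable_adapted k (A : set T) : adapted k A -> measurable A.
Proof.
move=> aA; rewrite -[A]setTI -(_ : (fun t => \1_A t : R) @^-1` [set 1] = A).
  exact: (amf (adapted_indic aA)).
apply/seteqP; split => t /=; rewrite indicE; first by case: (boolP (t \in A)) => [/set_mem//|_ /eqP]; rewrite eq_sym oner_eq0.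
by move=> At; rewrite mem_set.
Qed.

Lemma PrE k (A : set T) : adapted k A -> P A = (Pr A)%:E.
Proof.
move=> aA; rewrite /Pr -EFin_Rint; last exact: int_indic aA.
by rewrite integral_indic ?setIT//; exact: measurable_adapted aA.
Qed.

Lemma Pr_cover k1 k2 k3 (A B C : set T) : adapted k1 A -> adapted k2 B -> adapted k3 C ->
  C `<=` A `|` B -> Pr C <= Pr A + Pr B.
Proof.
move=> aA aB aC CAB; have iA := int_indic aA; have iB := int_indic aB; have iC := int_indic aC.
rewrite /Pr -RintD//; apply: le_Rint => //; first exact: intD.
move=> t; rewrite !indicE; have [/set_mem/CAB tC|_] := boolP (t \in C); last by rewrite addr_ge0.
by case: tC => /mem_set ->; rewrite ?lerDl ?lerDr.
Qed.

Lemma adapted_pred U k (f : T -> U) (Q : U -> Prop) : adapted k f -> adapted k [set t | Q (f t)].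
Proof. by move=> af; apply: adapted_setP => t t' h /=; rewrite (af t t' h). Qed.

Lemma Pr_markov k (U : T -> R) (K : R) : adapted k U -> int U -> 0 < K ->
  Pr [set t | K <= `|U t|] <= (\int[P]_t `|U t|) / K.
Proof.
move=> aU iU K0; rewrite ler_pdivlMr// mulrC.
have aA : adapted k [set t | K <= `|U t|] by apply: (adapted_pred (fun x : R => K <= `|x|) aU).
rewrite /Pr -RintZ; last exact: int_indic aA.
apply: le_Rint; [exact: intZ (int_indic aA)|exact: int_norm|] => t.
rewrite indicE; have [/set_mem /= h|_] := boolP (t \in _); first by rewrite mulr1.
by rewrite mulr0.
Qed.

(** Convergence to zero in probability, written on bad events; the first clause makes them
    measurable. *)
Definition vanishing (B : nat -> set T) :=
  (forall n, exists k, adapted k (B n)) /\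
  forall e, 0 < e -> exists N, forall n, (N <= n)%N -> Pr (B n) <= e.

Lemma vanishing_cover (A B C : nat -> set T) : vanishing A -> vanishing B ->
  (forall n, exists k, adapted k (C n)) ->
  (exists N, forall n, (N <= n)%N -> C n `<=` A n `|` B n) -> vanishing C.
Proof.
move=> [aA vA] [aB vB] aC [N hN]; split => // e e0; have e20 : 0 < e / 2 by rewrite divr_gt0.
have [NA hA] := vA _ e20; have [NB hB] := vB _ e20.
exists (maxn N (maxn NA NB)) => n; rewrite !geq_max => /and3P[n0 n1 n2].
have [kA adA] := aA n; have [kB adB] := aB n; have [kC adC] := aC n.
by rewrite [e]splitr; apply: (le_trans (Pr_cover adA adB adC (hN n n0))); rewrite lerD ?hA ?hB.
Qed.

Lemma vanishing_sub (A C : nat -> set T) : vanishing A -> (forall n, exists k, adapted k (C n)) ->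
  (exists N, forall n, (N <= n)%N -> C n `<=` A n) -> vanishing C.
Proof.
move=> vA aC [N hN]; apply: (vanishing_cover vA vA aC).
by exists N => n n0 t /(hN n n0); left.
Qed.

Lemma vanishing_fixed k (U : T -> R) (a : nat -> R) : adapted k U -> int U ->
  (forall c, exists N, forall n, (N <= n)%N -> c <= a n) -> vanishing (fun n => [set t | a n <= `|U t|]).
Proof.
move=> aU iU ha; split.
  by move=> n; exists k; apply: (adapted_pred (fun x : R => a n <= `|x|) aU).
move=> e e0; have [N hN] := ha (Num.max 1 ((\int[P]_t `|U t|) / e)); exists N => n Nn.
have := hN n Nn; rewrite ge_max => /andP[a1 a2].
have a0 : 0 < a n by lra.
apply: (le_trans (Pr_markov aU iU a0)).
by rewrite ler_pdivrMr// mulrC -ler_pdivrMr.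
Qed.

Section PartialSums.
Variables (c1 c2 : R).
Local Notation dS := (dS P alpha X0 eps xi c1 c2).
Local Notation pS := (pS P alpha X0 eps xi c1 c2).

Let apS k0 k : adapted k (pS k0 k). Proof. exact: adapted_pS. Qed.

Lemma int_pS k0 n : int (pS k0 n).
Proof.
rewrite /pS; elim: n => [|n IH].
  by rewrite (_ : (fun t => _) = fun=> 0); [exact: int_cst|apply/funext => t; rewrite big_geq].
have [k0n|k0n] := leqP k0 n.
  rewrite (_ : (fun t => _) = fun t => \sum_(k0 <= i < n) dS i t + dS n t).
    by apply: intD => //; exact: (int_dS H H3X H3e).
  by apply/funext => t; rewrite big_nat_recr.
by rewrite (_ : (fun t => _) = fun=> 0); [exact: int_cst|apply/funext => t; rewrite big_geq].
Qed.

(* Uniform L1 bound: [sq1] has bounded derivative, so the martingale increments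
   only contribute through their second moments. *)
Lemma pS_L1_bound k0 : exists C : R, 0 <= C /\ forall n, (0 < n)%N ->
  \int[P]_t `|rootn n * pS k0 n t| <= C.
Proof.
have [Cv [Cv0 hCv]] := cvS_le P alpha eps c1 c2.
have [C [C1 hC]] := bounded_cube_moments H H3X H3e.
pose Q := Cv * (1 + C).
have Q0 : 0 <= Q by rewrite mulr_ge0//; lra.
have idS2 k := int_dS_sq H H3X H3e c1 c2 k.
have QdS k : \int[P]_t (dS k t ^+ 2) <= Q.
  have a1 : adapted k (fun _ : T => 1 : R) by [].
  have b1 (t : T) : `|1 : R| <= 1 by rewrite normr1.
  have [i1] := markov_dS_sq H H3X H3e c1 c2 a1 b1.
  rewrite (@eq_Rintegral _ _ _ _ _ (fun t => dS k t ^+ 2)); last by move=> t _; rewrite mul1r.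
  move=> ->; apply: (@le_trans _ _ (\int[P]_t (Cv * (1 + (X k t)%:R ^+ 3)))).
    apply: le_Rint.
    - rewrite (_ : (fun t => _) = fun t => cvS P alpha eps c1 c2 (X k t)).
        exact: int_cvS H H3X H3e c1 c2 k.
      by apply/funext => t; rewrite mul1r.
    - by apply: intZ; apply: intD; [exact: int_cst|case: (hC k)].
    - by move=> t; rewrite mul1r.
  rewrite RintZ; last by apply: intD; [exact: int_cst|case: (hC k)].
  rewrite RintD ?Rint_cst; [|exact: int_cst|by case: (hC k)].
  by rewrite ler_wpM2l// lerD2l; case: (hC k).
exists (1 + Q); split; first by lra.
move=> n n0; set r := rootn n.
have nR : 0 < n%:R :> R by rewrite ltr0n.
have r2 : r ^+ 2 = n%:R^-1 by rewrite /r /rootn exprVn sqr_sqrtr// ltW.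
pose A k t := r * pS k0 k t.
have aA k : adapted k (A k) by move=> t t' h; rewrite /A (apS k0 h).
have iA k : int (A k) by apply: intZ; exact: int_pS.
have isq k : int (fun t => sq1 (A k t)).
  apply: (le_int _ (intD (int_cst P 1) (int_norm (iA k)))).
    by apply: (@amf _ k) => t t' h; rewrite (aA k t t').
  by move=> t; rewrite ger0_norm ?sq1_le// (le_trans ler01)// sq1_ge1.
have step k : \int[P]_t sq1 (A k.+1 t) <= \int[P]_t sq1 (A k t) + r ^+ 2 * Q.
  have [k0k|k0k] := leqP k0 k; last first.
    rewrite (@eq_Rintegral _ _ _ _ _ (fun t => sq1 (A k t))); last first.
      by move=> t _; rewrite /A /pS !big_geq// ltnW.
    by rewrite lerDl mulr_ge0// sqr_ge0.
  have AS t : A k.+1 t = A k t + r * dS k t by rewrite /A /pS big_nat_recr//= mulrDr.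
  pose w t := A k t / sq1 (A k t).
  have w1 t : `|w t| <= 1.
    have s0 : 0 < sq1 (A k t) by apply: lt_le_trans (sq1_ge1 _).
    by rewrite normrM normfV (gtr0_norm s0) ler_pdivrMr// mul1r sq1_ge.
  have aw : adapted k w by move=> t t' h; rewrite /w (aA k t t').
  have [iw w0] := markov_dS H H3X H3e c1 c2 aw w1.
  apply: (@le_trans _ _ (\int[P]_t (sq1 (A k t) + (r * (w t * dS k t) + r ^+ 2 * dS k t ^+ 2)))).
    apply: le_Rint => //.
      by apply: intD => //; apply: intD; exact: intZ.
    move=> t; rewrite AS; have [t1 _] := sq1_taylor (A k t) (r * dS k t).
    apply: (le_trans t1); rewrite le_eqVlt; apply/orP; left; apply/eqP; rewrite /w; ring.
  rewrite RintD//; last by apply: intD; exact: intZ.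
  rewrite RintD; [|exact: intZ|exact: intZ].
  by rewrite !RintZ// w0 mulr0 add0r lerD2l ler_wpM2l// sqr_ge0.
have tot k : \int[P]_t sq1 (A k t) <= 1 + k%:R * (r ^+ 2 * Q).
  elim: k => [|k IH].
    rewrite (@eq_Rintegral _ _ _ _ _ (fun=> 1)) ?Rint_cst ?mul0r ?addr0// => t _.
    by rewrite /A /pS big_geq// mulr0 /sq1 expr0n addr0 sqrtr1.
  by apply: (le_trans (step k)); rewrite -natr1; lra.
apply: (@le_trans _ _ (\int[P]_t sq1 (A n t))).
  by apply: (le_Rint (int_norm (iA n)) (isq n)) => t; exact: sq1_ge.
by apply: (le_trans (tot n)); rewrite r2 mulrA mulfV ?mul1r// gt_eqF.
Qed.

Lemma pS_tight k0 e : 0 < e -> exists K : R, 0 < K /\ forall n, (0 < n)%N ->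
  Pr [set t | K <= `|rootn n * pS k0 n t|] <= e.
Proof.
move=> e0; have [C [C0 hC]] := pS_L1_bound k0.
have K0 : 0 < (C + 1) / e by rewrite divr_gt0// ltr_wpDl.
exists ((C + 1) / e); split => // n n0.
apply: (le_trans (Pr_markov (k := n) _ _ K0)).
- by move=> t t' h; rewrite (apS k0 h).
- by apply: intZ; exact: int_pS.
rewrite ler_pdivrMr// mulrC divfK ?gt_eqF//.
by apply: (le_trans (hC n n0)); rewrite lerDl.
Qed.

End PartialSums.

Section CosineApproximation.
Variables (k : nat) (u : T -> R) (V W : nat -> T -> R).
Hypothesis au : adapted k u.
Hypothesis u1 : forall t, `|u t| <= 1.
Hypothesis aV : forall n, exists j, adapted j (V n).
Hypothesis aW : forall n, exists j, adapted j (W n).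
Hypothesis VW : forall e, 0 < e -> vanishing (fun n => [set t | u t != 0 /\ ~ `|V n t - W n t| <= e]).

(** Slutsky's argument for cosines, which are bounded and 1-Lipschitz. V and W are compared only
    where u is nonzero, which in the conditional case is where Y_{s-1} and Y_{s+1} have the
    prescribed values. *)
Lemma cvg_cos_approx (phi l : R) : (fun n => \int[P]_t (u t * cos (W n t + phi))) @ \oo --> l ->
  (fun n => \int[P]_t (u t * cos (V n t + phi))) @ \oo --> l.
Proof.
have ad (Z : nat -> T -> R) n j : adapted j (Z n) -> int (fun t => u t * cos (Z n t + phi)).
  move=> aZ; apply: (le_int _ (int_cst P 1)).
    apply: (@amf _ (maxn k j)) => t t' h; rewrite (au (t' := t')) ?(aZ t t')// => i ik.
      by apply: h; rewrite leq_max ik orbT.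
    by apply: h; rewrite leq_max ik.
  by move=> t; rewrite normrM mulr_ile1// cos_max.
move=> cW.
suff: (fun n => \int[P]_t (u t * cos (V n t + phi)) - \int[P]_t (u t * cos (W n t + phi))) @ \oo --> (0 : R).
  move=> h; rewrite -[l]add0r.
  rewrite (_ : (fun n => \int[P]_t (u t * cos (V n t + phi))) = (fun n => (\int[P]_t (u t * cos (V n t + phi))
    - \int[P]_t (u t * cos (W n t + phi))) + \int[P]_t (u t * cos (W n t + phi)))); first exact: cvgD.
  by apply/funext => n; rewrite subrK.
apply/cvgrPdist_le => e e0; have e20 : 0 < e / 2 by rewrite divr_gt0.
have e40 : 0 < e / 4 by rewrite divr_gt0.
have [aB vB] := VW e20; have [N hN] := vB _ e40.
exists N => // n /= Nn; rewrite sub0r normrN.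
have [j aVn] := aV n; have [j' aWn] := aW n.
have iV := ad _ _ _ aVn; have iW := ad _ _ _ aWn.
have [kB aBn] := aB n; have iB := int_indic aBn.
rewrite -RintB//.
apply: (@le_trans _ _ (\int[P]_t (e / 2 + 2 * \1_[set t | u t != 0 /\ ~ `|V n t - W n t| <= e / 2] t))).
  apply: ler_norm_Rint.
  - exact: intB.
  - by apply: intD; [exact: int_cst|exact: intZ].
  move=> t; rewrite -mulrBr normrM indicE.
  have [/eqP ->|u0] := boolP (u t == 0).
    by rewrite normr0 mul0r addr_ge0 ?(ltW e20)// mulr_ge0.
  have b1 := u1 t.
  have [h|h] := boolP (`|V n t - W n t| <= e / 2).
    apply: (@le_trans _ _ (e / 2)); last by rewrite lerDl mulr_ge0.
    rewrite -[leRHS]mul1r; apply: ler_pM => //; apply: le_trans (cos_lip _ _) _.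
    by rewrite (_ : _ - _ = V n t - W n t)//; ring.
  rewrite mem_set; last by split => //; exact/negP.
  rewrite mulr1 ler_wpDl ?(ltW e20)// -[leRHS]mul1r; apply: ler_pM => //.
  by apply: le_trans (ler_normB _ _) _; have := cos_max (V n t + phi); have := cos_max (W n t + phi); lra.
rewrite (RintD (int_cst P _) (intZ _ iB)) (RintZ _ iB) Rint_cst.
by have := hN n Nn; rewrite /Pr; lra.
Qed.

End CosineApproximation.

End Vanishing.

Lemma sum4_le (R : realType) (a b c e p : R) : a <= p / 8 -> b <= p / 8 -> c <= p / 8 -> e <= p / 8 ->
  (a + b) + (c + e) <= p / 2.
Proof. by move=> *; lra. Qed.

(** * The estimation errors as linear functions of the score *)

Section Linearization.
Context {R : realType} {d : measure_display} {T : measurableType d} (P : probability T R).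
Context (alpha : R) (X0 : T -> nat) (eps : nat -> T -> nat) (xi : nat -> nat -> T -> nat).
Context (pi_ : nat -> R) (s theta : nat).
Hypothesis H : inar_assumptions P alpha X0 eps xi.
Hypothesis H3X : (\int[P]_t (((X0 t)%:R : R) ^+ 3)%:E < +oo)%E.
Hypothesis H3e : (\int[P]_t (((eps 1%N t)%:R : R) ^+ 3)%:E < +oo)%E.
Hypothesis Hpi : stationary_dist alpha (eps_pmf P eps) pi_.
Hypothesis s0 : (0 < s)%N.

Local Notation int := (int P).
Local Notation X := (Xproc X0 eps xi).
Local Notation adapted := (adapted X).
Local Notation m_ := (moment pi_).
Local Notation mu := (mu_eps P eps).
Local Notation dS := (dS P alpha X0 eps xi).
Local Notation pS := (pS P alpha X0 eps xi).
Local Notation vanishing := (vanishing P X0 eps xi).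
Local Notation Pr := (Pr P).

Lemma sum_outlier_split (n : nat) (g : nat -> R) : (s < n)%N -> \sum_(0 <= i < n) g i =
  (\sum_(0 <= i < s.-1) g i + \sum_(s.+1 <= i < n) g i) + (g s.-1 + g s).
Proof.
case: s s0 => // s' _ sn; rewrite [s'.+1.-1]/=.
rewrite (@big_cat_nat _ _ _ s') //=; last by rewrite ltnW// ltnW.
rewrite (@big_cat_nat _ _ _ s'.+2 s') //=; last by rewrite leqW// leqW.
by rewrite (@big_nat_recr _ _ _ s'.+1)//= big_nat1; ring.
Qed.

(** The residual at k belongs to the transition from k - 1, so omitting k = s, s+1 omits the
    transitions from s-1 and s. The remaining block starts at s+1, the time by which Y_{s-1} and
    Y_{s+1} are decided. *)
Lemma lsum_shift (n : nat) (f g : nat -> R) : (s < n)%N ->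
  (forall k, k.+1 != s -> k.+1 != s.+1 -> f k.+1 = g k) ->
  lsum n s f = \sum_(0 <= i < s.-1) g i + \sum_(s.+1 <= i < n) g i.
Proof.
move=> sn fg; pose h k := if (k.+1 != s) && (k.+1 != s.+1) then g k else 0.
have -> : lsum n s f = \sum_(0 <= i < n) h i.
  rewrite /lsum big_add1 big_mkcond /=; apply: eq_bigr => k _.
  by rewrite /h; case: ifP => // /andP[k1 k2]; exact: fg.
rewrite sum_outlier_split// /h.
rewrite prednK// !eqxx /= andbF !addr0; congr (_ + _).
  apply: eq_big_nat => i /andP[_ i1].
  have i2 : (i.+1 < s)%N by rewrite -ltn_predRL.
  by rewrite !neq_ltn i2 (ltn_trans i2 (ltnSn s)).
apply: eq_big_nat => i /andP[i1 _].
have i2 : (s < i.+1)%N by exact: leqW.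
have i3 : (s.+1 < i.+1)%N by [].
by rewrite !neq_ltn i2 i3 !orbT.
Qed.

Let y (t : T) (k : nat) : R := (Yproc X0 eps xi s theta k t)%:R.

Lemma adapted_y k j : (k <= j)%N -> adapted j (y ^~ k).
Proof. by move=> kj t t' h; rewrite /y /Yproc h. Qed.

Lemma y_neq t k : k != s -> y t k = (X k t)%:R.
Proof. by move=> /negbTE ks; rewrite /y /Yproc ks mul0n addn0. Qed.

(** For k other than s and s+1 neither y_k nor y_{k-1} is contaminated, so the outlier drops out of
    the score. *)
Lemma lsum_innov (n : nat) (c1 c2 : R) t : (s < n)%N ->
  lsum n s (fun k => innov (y t) alpha mu k * (c1 * y t k.-1 + c2)) =
  \sum_(0 <= i < s.-1) dS c1 c2 i t + pS c1 c2 s.+1 n t.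
Proof.
move=> sn; apply: lsum_shift => // k k1 k2.
by rewrite /innov /= !y_neq// /dS /vlin; ring.
Qed.

Lemma lsum_power (n j : nat) t : (s < n)%N -> lsum n s (fun k => y t k.-1 ^+ j) =
  \sum_(0 <= i < n) (X i t)%:R ^+ j - ((X s.-1 t)%:R ^+ j + (X s t)%:R ^+ j).
Proof.
move=> sn; rewrite (sum_outlier_split _ sn) addrK; apply: lsum_shift => // k k1 k2.
by rewrite /= y_neq.
Qed.

Lemma lsum_eq n (f g : nat -> R) : (forall k, (0 < k <= n)%N -> f k = g k) -> lsum n s f = lsum n s g.
Proof.
move=> fg; rewrite /lsum big_mkcond [RHS]big_mkcond; apply: eq_big_nat => k kn.
by case: ifP => // _; exact: fg.
Qed.

(** The estimator is defined by choice; its measurability comes from its reading finitely many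
    observations. *)
Definition depends_upto (U : Type) (N : nat) (F : (nat -> R) -> U) :=
  forall z z' : nat -> R, (forall k, (k <= N)%N -> z k = z' k) -> F z = F z'.

Lemma adapted_depends (U : Type) N (F : (nat -> R) -> U) : depends_upto N F -> adapted N (fun t => F (y t)).
Proof. by move=> dF t t' h; apply: dF => k kN; exact: adapted_y h. Qed.

(** The maximum is there because [Qn] reads y s.+1 even when n <= s. *)
Lemma depends_est n : depends_upto (maxn n s.+1) (cls_est n s).
Proof.
move=> z z' h.
have Qe : Qn n s z = Qn n s z'.
  apply/funext => a; apply/funext => m; apply/funext => th; rewrite /Qn.
  have h1 k : (k <= s.+1)%N -> z k = z' k by move=> ks; apply: h; rewrite leq_max ks orbT.
  rewrite !h1 ?leqnSn ?(leq_trans (leq_pred s))//; congr (_ + _ + _).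
  apply: lsum_eq => k /andP[_ kn].
  by rewrite !h// leq_max ?kn// (leq_trans (leq_pred k) kn).
by rewrite /cls_est /Qmin_set Qe.
Qed.

Lemma vanishing_power (j : nat) (eta : R) : (j <= 2)%N -> 0 < eta -> (0 < j)%N ->
  vanishing (fun n => [set t | eta < `|n%:R^-1 * lsum n s (fun k => y t k.-1 ^+ j) - m_ j|]).
Proof.
move=> j2 eta0 j0.
have eta20 : 0 < eta / 2 by rewrite divr_gt0.
pose g1 : R := (j == 1)%:R; pose g2 : R := (j == 2)%:R.
have devE k t : dev X0 eps xi pi_ g1 g2 0 k t = (X k t)%:R ^+ j - m_ j.
  rewrite /dev /poly3 /g1 /g2; case: j j2 j0 {g1 g2} => [|[|[|]]]// _ _ /=; ring.
have v1 : vanishing (fun n => [set t | eta / 2 * n%:R <= `|\sum_(k < n) dev X0 eps xi pi_ g1 g2 0 k t|]).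
  have ad n : adapted n [set t | eta / 2 * n%:R <= `|\sum_(k < n) dev X0 eps xi pi_ g1 g2 0 k t|].
    by apply: (adapted_pred (fun x : R => eta / 2 * n%:R <= `|x|)); exact: adapted_sum_dev.
  split; first by move=> n; exists n.
  move=> e e0; have [N hN] := law_of_large_numbers H H3X H3e Hpi g1 g2 0 eta20 e0.
  by exists N => n /hN; rewrite (PrE H (ad n)) lee_fin.
pose U t : R := (X s.-1 t)%:R ^+ j + (X s t)%:R ^+ j.
have aU : adapted s U by move=> t t' h; rewrite /U !h// leq_pred.
have iU : int U by apply: intD; apply: (int_XX H H3X H3e); rewrite leqW.
have v2 : vanishing (fun n => [set t | eta / 2 * n%:R <= `|U t|]).
  by apply: (vanishing_fixed H aU iU) => c; exact: eventually_nat.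
apply: (vanishing_cover H v1 v2).
  move=> n; exists n; apply: (adapted_pred (fun x : R => eta < `|n%:R^-1 * x - m_ j|)).
  apply: (@adapted_depends _ n (fun z => lsum n s (fun k => z k.-1 ^+ j))) => z z' h.
  by apply: lsum_eq => k /andP[_ kn]; rewrite h// (leq_trans (leq_pred k) kn).
exists s.+1 => n sn t /=; rewrite lsum_power//.
have nR : 0 < n%:R :> R by rewrite ltr0n (leq_trans _ sn).
have -> : \sum_(k < n) dev X0 eps xi pi_ g1 g2 0 k t = \sum_(0 <= i < n) (X i t)%:R ^+ j - n%:R * m_ j.
  under eq_bigr => k _ do rewrite devE.
  by rewrite sumrB sumr_const card_ord big_mkord mulr_natl.
set S := \sum_(0 <= i < n) _ => h.
have [k1|k1] := leP (eta / 2 * n%:R) `|S - n%:R * m_ j|; first by left.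
have [k2|k2] := leP (eta / 2 * n%:R) `|U t|; first by right.
exfalso; move: h; apply/negP; rewrite -leNgt.
have -> : n%:R^-1 * (S - ((X s.-1 t)%:R ^+ j + (X s t)%:R ^+ j)) - m_ j = ((S - n%:R * m_ j) - U t) / n%:R.
  by rewrite /U; field; rewrite gt_eqF.
rewrite normrM normfV (gtr0_norm nR) ler_pdivrMr//.
apply: (le_trans (normB_le (ltW k1) (ltW k2))).
by rewrite -mulrDl -splitr.
Qed.

Lemma pS_lin c1 c2 k0 n t : pS c1 c2 k0 n t = c1 * pS 1 0 k0 n t + c2 * pS 0 1 k0 n t.
Proof.
rewrite /pS !mulr_sumr -big_split; apply: eq_bigr => i _.
by rewrite /dS /vlin /=; ring.
Qed.

Lemma lsum_const (n : nat) : (s < n)%N -> lsum n s (fun=> 1 : R) = n%:R - 2.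
Proof.
move=> sn; rewrite (@lsum_shift n _ (fun=> 1))//.
have := @sum_outlier_split n (fun=> 1) sn; rewrite sumr_const_nat subn0 => ->; ring.
Qed.

Lemma fixed_tight k (U : T -> R) e : adapted k U -> int U -> 0 < e ->
  exists K : R, 0 < K /\ Pr [set t | K <= `|U t|] <= e.
Proof.
move=> aU iU e0; have I0 : 0 <= \int[P]_t `|U t| by apply: Rintegral_ge0.
have K0 : 0 < (\int[P]_t `|U t| + 1) / e by rewrite divr_gt0// ltr_wpDl.
exists ((\int[P]_t `|U t| + 1) / e); split => //.
apply: (le_trans (Pr_markov H aU iU K0)).
by rewrite ler_pdivrMr// mulrC divfK ?gt_eqF// lerDl.
Qed.

Let m1 := m_ 1.
Let m2 := m_ 2.
Let dl := m2 - m1 ^+ 2.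
Let dl0 : 0 < dl. Proof. exact: var_moment_gt0 H H3e Hpi. Qed.

(** [lin_x] and [lin_y] are the coordinates of M^-1 applied to the normalised score from time s+1
    on. The score is linear in its direction, so each coordinate is a single martingale in the
    direction of a row of M^-1. *)
Definition lin_x (n : nat) (t : T) : R := rootn n * pS dl^-1 (- m1 / dl) s.+1 n t.
Definition lin_y (n : nat) (t : T) : R := rootn n * pS (- m1 / dl) (m2 / dl) s.+1 n t.
Let est n t := cls_est n s (y t).
Definition err_x n t : R := Num.sqrt n%:R * ((est n t).1.1 - alpha).
Definition err_y n t : R := Num.sqrt n%:R * ((est n t).1.2 - mu).
Definition err_theta n t : R :=
  Num.sqrt n%:R * ((est n t).2 - theta_opt (y t s) (y t s.-1 + y t s.+1) alpha mu).
Let slope t := d1 alpha mu (y t s.-1 + y t s.+1).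

Definition nonlinear e n : set T := [set t | ~ [/\ `|err_x n t - lin_x n t| <= e,
  `|err_y n t - lin_y n t| <= e &
  `|err_theta n t - (slope t * lin_x n t + d2 alpha * lin_y n t)| <= e]].

Let apS c1 c2 k0 k : adapted k (pS c1 c2 k0 k). Proof. exact: adapted_pS. Qed.

Lemma adapted_lin_x n : adapted n (lin_x n).
Proof. by move=> t t' h; rewrite /lin_x (apS _ _ _ h). Qed.

Lemma adapted_lin_y n : adapted n (lin_y n).
Proof. by move=> t t' h; rewrite /lin_y (apS _ _ _ h). Qed.

Lemma adapted_est n : adapted (maxn n s.+1) (est n).
Proof. exact: (@adapted_depends _ _ (cls_est n s) (@depends_est n)). Qed.

Lemma adapted_err_x n : adapted (maxn n s.+1) (err_x n).
Proof. by move=> t t' h; rewrite /err_x (adapted_est h). Qed.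

Lemma adapted_err_y n : adapted (maxn n s.+1) (err_y n).
Proof. by move=> t t' h; rewrite /err_y (adapted_est h). Qed.

Let y_local n k t t' : (k <= s.+1)%N -> (forall i, (i <= maxn n s.+1)%N -> X i t = X i t') -> y t k = y t' k.
Proof. by move=> ks h; apply: (@adapted_y k s.+1 ks) => i i1; apply: h; rewrite leq_max i1 orbT. Qed.

Lemma adapted_err_theta n : adapted (maxn n s.+1) (err_theta n).
Proof.
move=> t t' h; rewrite /err_theta (adapted_est h).
by rewrite !(y_local _ h) ?leqnSn// (leq_trans (leq_pred s)).
Qed.

Lemma adapted_nonlinear e n : adapted (maxn n s.+1) (nonlinear e n).
Proof.
apply: adapted_setP => t t' h; rewrite /nonlinear /= -(adapted_err_x h) -(adapted_err_y h) -(adapted_err_theta h).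
have hn i : (i <= n)%N -> X i t = X i t' by move=> ni; apply: h; rewrite leq_max ni.
rewrite -(adapted_lin_x hn) -(adapted_lin_y hn) /slope.
by rewrite !(y_local _ h) ?leqnSn// (leq_trans (leq_pred s)).
Qed.

(** Outside eight events of probability at most p / 8 each, the data satisfy the hypotheses of
    [cls_est_expansion], and replacing the full score by its second block changes the linear part
    little. *)
Lemma estimator_linear (e : R) : 0 < e -> vanishing (nonlinear e).
Proof.
move=> e0; split; first by move=> n; exists (maxn n s.+1); exact: adapted_nonlinear.
move=> p p0; have p80 : 0 < p / 8 by rewrite divr_gt0.
have iy k : int (y ^~ k).
  apply: (adapted_int3 H H3X H3e (k := k) (i := k) (c := theta%:R + 1)); first exact: adapted_y.
  move=> t; rewrite ger0_norm// /y /Yproc natrD.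
  have x3 : ((X k t)%:R : R) <= 1 + (X k t)%:R ^+ 3 by have := @le_natX3 R (X k t) 1 isT; rewrite expr1.
  have x0 : 0 <= ((X k t)%:R : R) by [].
  have x30 : 0 <= ((X k t)%:R : R) ^+ 3 by rewrite exprn_ge0.
  have th : ((k == s) * theta)%:R <= theta%:R :> R by rewrite ler_nat; case: (k == s); rewrite ?mul1n ?mul0n.
  have th0 : 0 <= theta%:R :> R by [].
  have : theta%:R <= theta%:R * (1 + (X k t)%:R ^+ 3) :> R by rewrite ler_peMr// lerDl.
  by move: th; set q := _%:R => th; rewrite mulrDl mul1r; lra.
have [K1 [K10 hK1]] := fixed_tight (adapted_y (leq_pred s)) (iy s.-1) p80.
have [K2 [K20 hK2]] := fixed_tight (adapted_y (leqnn s.+1)) (iy s.+1) p80.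
have [K3 [K30 hK3]] := pS_tight H H3X H3e 1 0 s.+1 p80.
have [K4 [K40 hK4]] := pS_tight H H3X H3e 0 1 s.+1 p80.
pose K := K1 + K2 + K3 + K4 + 1.
have K0 : 0 <= K by rewrite /K; lra.
have KKt1 : K1 <= K by rewrite /K; lra.
have KKt2 : K2 <= K by rewrite /K; lra.
have KKt3 (z : R) : z <= 1 -> z + K3 <= K by rewrite /K; lra.
have KKt4 (z : R) : z <= 1 -> z + K4 <= K by rewrite /K; lra.
have e20 : 0 < e / 2 by rewrite divr_gt0.
have [eta [eta0 heta]] := cls_est_expansion alpha mu s dl0 K0 e20.
(* Gam dominates the absolute row sums of M^-1, and D the derivatives of [theta_opt]; eta3 is the
   size allowed for the first block of the normalised score. *)
pose Gam : R := (1 + `|m1| + `|m2|) / dl.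
have Gam0 : 0 <= Gam by rewrite divr_ge0 ?(ltW dl0)// !addr_ge0.
pose D : R := (`|alpha| ^+ 2 + 1) * (2 * K) + (2 * `|alpha| + 1 + `|alpha| ^+ 2) * `|mu| + `|d2 alpha| + 1.
have D0 : 1 <= D by rewrite lerDr !addr_ge0// mulr_ge0 ?addr_ge0 ?mulr_ge0.
pose eta3 : R := Num.min 1 (e / 2 / D / (Gam + 1)).
have eta30 : 0 < eta3 by rewrite lt_min ltr01 !divr_gt0//; lra.
have eta31 : eta3 <= 1 by rewrite ge_min lexx.
have eta32 : D * (eta3 * Gam) <= e / 2.
  apply: (@le_trans _ _ (D * (e / 2 / D / (Gam + 1) * (Gam + 1)))).
    rewrite ler_wpM2l//; first lra.
    apply: ler_pM => //; rewrite ?(ltW eta30) ?ge_min ?lexx ?orbT//; lra.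
  rewrite divfK; last by rewrite gt_eqF//; lra.
  by rewrite mulrC divfK// gt_eqF//; lra.
(* The part of the score before the outlier: fixed integrable variables, killed by 1 / sqrt n. *)
pose B1 t := pS 1 0 0 s.-1 t; pose B2 t := pS 0 1 0 s.-1 t.
have eta3n c : exists N, forall n, (N <= n)%N -> c <= eta3 * Num.sqrt n%:R.
  have [N [N0 hN]] := eventually_sqrt (normr_ge0 c) eta30.
  exists N => n Nn; apply: le_trans (ler_norm c) _.
  by rewrite -ler_pdivrMr ?hN// sqrtr_gt0 ltr0n (leq_trans N0).
have vB1 : vanishing (fun n => [set t | eta3 * Num.sqrt n%:R <= `|B1 t|]).
  by apply: (vanishing_fixed H (k := s.-1)) => //; [exact: apS|exact: (int_pS H H3X H3e)].
have vB2 : vanishing (fun n => [set t | eta3 * Num.sqrt n%:R <= `|B2 t|]).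
  by apply: (vanishing_fixed H (k := s.-1)) => //; [exact: apS|exact: (int_pS H H3X H3e)].
have vH2 := @vanishing_power 2 eta isT eta0 isT.
have vH1 := @vanishing_power 1 eta isT eta0 isT.
have [Nr [_ hNr]] := eventually_sqrt ler01 eta0.
have [N2 hN2] := eventually_nat 2 eta0.
have p160 : 0 < p / 8 by [].
have [NB1 hB1] := vB1.2 _ p80; have [NB2 hB2] := vB2.2 _ p80.
have [NH1 hH1] := vH1.2 _ p80; have [NH2 hH2] := vH2.2 _ p80.
exists (maxn (maxn (maxn Nr N2) (maxn s.+1 1)) (maxn (maxn NB1 NB2) (maxn NH1 NH2))) => n.
rewrite !geq_max => /andP[/andP[/andP[n1 n2] /andP[sn n0]] /andP[/andP[nB1 nB2] /andP[nH1 nH2]]].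
pose S1 := [set t | K1 <= `|y t s.-1|]; pose S2 := [set t | K2 <= `|y t s.+1|].
pose S3 := [set t | K3 <= `|rootn n * pS 1 0 s.+1 n t|].
pose S4 := [set t | K4 <= `|rootn n * pS 0 1 s.+1 n t|].
pose S5 := [set t | eta3 * Num.sqrt n%:R <= `|B1 t|].
pose S6 := [set t | eta3 * Num.sqrt n%:R <= `|B2 t|].
pose S7 := [set t | eta < `|n%:R^-1 * lsum n s (fun k => y t k.-1 ^+ 1) - m_ 1|].
pose S8 := [set t | eta < `|n%:R^-1 * lsum n s (fun k => y t k.-1 ^+ 2) - m_ 2|].
have aS1 : adapted (maxn n s.+1) S1.
  by apply: adapted_setP => t t' h; rewrite /S1 /= (y_local _ h)// (leq_trans (leq_pred s)).
have aS2 : adapted (maxn n s.+1) S2 by apply: adapted_setP => t t' h; rewrite /S2 /= (y_local _ h).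
have hn t t' : (forall i, (i <= maxn n s.+1)%N -> X i t = X i t') -> forall i, (i <= n)%N -> X i t = X i t'.
  by move=> h i ni; apply: h; rewrite leq_max ni.
have hs t t' : (forall i, (i <= maxn n s.+1)%N -> X i t = X i t') -> forall i, (i <= s.-1)%N -> X i t = X i t'.
  by move=> h i ni; apply: h; rewrite leq_max orbC (leq_trans ni)// (leq_trans (leq_pred s)).
have aS3 : adapted (maxn n s.+1) S3 by apply: adapted_setP => t t' h; rewrite /S3 /= (apS _ _ _ (hn _ _ h)).
have aS4 : adapted (maxn n s.+1) S4 by apply: adapted_setP => t t' h; rewrite /S4 /= (apS _ _ _ (hn _ _ h)).
have aS5 : adapted (maxn n s.+1) S5 by apply: adapted_setP => t t' h; rewrite /S5 /B1 /= (apS _ _ _ (hs _ _ h)).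
have aS6 : adapted (maxn n s.+1) S6 by apply: adapted_setP => t t' h; rewrite /S6 /B2 /= (apS _ _ _ (hs _ _ h)).
have aS78 j (Q : R -> Prop) : adapted (maxn n s.+1) [set t | Q (lsum n s (fun k => y t k.-1 ^+ j))].
  apply: (adapted_pred Q); apply: (@adapted_depends _ _ (fun z => lsum n s (fun k => z k.-1 ^+ j))) => z z' h.
  by apply: lsum_eq => k /andP[_ kn]; rewrite h// leq_max (leq_trans (leq_pred k) kn).
have aS7 : adapted (maxn n s.+1) S7 by exact: (aS78 1 (fun x => eta < `|n%:R^-1 * x - m_ 1|)).
have aS8 : adapted (maxn n s.+1) S8 by exact: (aS78 2 (fun x => eta < `|n%:R^-1 * x - m_ 2|)).
have aU (A B : set T) : adapted (maxn n s.+1) A -> adapted (maxn n s.+1) B -> adapted (maxn n s.+1) (A `|` B).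
  by move=> aA aB t t' h; rewrite /setU /= (aA t t' h) (aB t t' h).
have PU (A B : set T) : adapted (maxn n s.+1) A -> adapted (maxn n s.+1) B -> Pr (A `|` B) <= Pr A + Pr B.
  by move=> aA aB; exact: (Pr_cover H aA aB (aU _ _ aA aB)).
(* TT collects the failures of tightness, for the neighbours of the outlier and for the score; VV
   collects the first block and the failures of the law of large numbers. *)
pose TT := (S1 `|` S2) `|` (S3 `|` S4); pose VV := (S5 `|` S6) `|` (S7 `|` S8).
have sub : nonlinear e n `<=` TT `|` VV.
  move=> t bad; apply: contrapT => hh; apply: bad.
  have nS (A B : set T) : ~ (A `|` B) t -> ~ A t /\ ~ B t.
    by move=> h; split => h'; apply: h; [left|right].
  have [/nS[/nS[t1 t2] /nS[t3 t4]] /nS[/nS[t5 t6] /nS[t7 t8]]] := nS _ _ hh.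
  move: t1 t2 t3 t4 t5 t6 t7 t8 => /negP + /negP + /negP + /negP + /negP + /negP + /negP + /negP.
  rewrite -!ltNge -!leNgt => t1 t2 t3 t4 t5 t6 t7 t8.
  have sq0 : 0 < Num.sqrt n%:R :> R by rewrite sqrtr_gt0 ltr0n.
  have r0 : 0 < rootn n :> R by rewrite invr_gt0.
  have rB b : `|b| < eta3 * Num.sqrt n%:R -> `|rootn n * b| <= eta3.
    move=> hb; rewrite normrM gtr0_norm// /rootn ler_pdivrMl// mulrC; exact: ltW.
  have q5 := rB _ t5; have q6 := rB _ t6.
  have b1E : rootn n * lsum n s (fun k => innov (y t) alpha mu k * y t k.-1) = rootn n * B1 t + rootn n * pS 1 0 s.+1 n t.
    rewrite -mulrDr -lsum_innov//; congr (_ * _); apply: lsum_eq => k _; ring.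
  have b2E : rootn n * lsum n s (innov (y t) alpha mu) = rootn n * B2 t + rootn n * pS 0 1 s.+1 n t.
    rewrite -mulrDr -lsum_innov//; congr (_ * _); apply: lsum_eq => k _; ring.
  have [||||||||] := heta n (y t) n0; rewrite ?b1E ?b2E.
  - by rewrite /rootn -div1r; exact: hNr.
  - by apply: (le_trans (ltW t2)); exact: KKt2.
  - by apply: (le_trans (ltW t1)); exact: KKt1.
  - by apply: (le_trans (normD_le q5 (ltW t3))); exact: KKt3 eta31.
  - by apply: (le_trans (normD_le q6 (ltW t4))); exact: KKt4 eta31.
  - exact: t8.
  - by move: t7; congr (`|_ * _ - _| <= _); apply: lsum_eq => k _; rewrite expr1.
  - rewrite lsum_const//; have nR : 0 < n%:R :> R by rewrite ltr0n.
    have -> : n%:R^-1 * (n%:R - 2) - 1 = - (2 / n%:R) :> R by field; rewrite gt_eqF.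
    rewrite normrN ger0_norm; last by rewrite divr_ge0// ltW.
    by rewrite ler_pdivrMr//; exact: hN2.
  rewrite -/(est n t) -/(err_x n t) -/(err_y n t) -/(err_theta n t) -/(slope t).
  rewrite -[m2 - m1 ^+ 2]/dl.
  set gx := (_ - m1 * _) / dl; set gy := (m2 * _ - m1 * _) / dl => f1 f2 f3.
  have gxE : gx - lin_x n t = (rootn n * B1 t - m1 * (rootn n * B2 t)) / dl.
    by rewrite /gx /lin_x (pS_lin dl^-1); field; rewrite gt_eqF.
  have gyE : gy - lin_y n t = (m2 * (rootn n * B2 t) - m1 * (rootn n * B1 t)) / dl.
    by rewrite /gy /lin_y (pS_lin (- m1 / dl)); field; rewrite gt_eqF.
  have dlN (x c : R) : `|x| <= c -> `|x / dl| <= c / dl.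
    by move=> h; rewrite normrM normfV (gtr0_norm dl0) ler_wpM2r// invr_ge0 ltW.
  have gxl : `|gx - lin_x n t| <= eta3 * Gam.
    rewrite gxE /Gam [leRHS]mulrA; apply: dlN; apply: le_trans (normB_le q5 (normM_le (lexx `|m1|) q6)) _.
    have h : 0 <= eta3 * `|m2| by rewrite mulr_ge0// ltW.
    by rewrite (_ : eta3 * _ = eta3 + `|m1| * eta3 + eta3 * `|m2|) ?lerDl//; ring.
  have gyl : `|gy - lin_y n t| <= eta3 * Gam.
    rewrite gyE /Gam [leRHS]mulrA; apply: dlN.
    apply: le_trans (normB_le (normM_le (lexx `|m2|) q6) (normM_le (lexx `|m1|) q5)) _.
    by rewrite (_ : eta3 * _ = eta3 + (`|m2| * eta3 + `|m1| * eta3)) ?lerDr ?(ltW eta30)//; ring.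
  have small : eta3 * Gam <= e / 2.
    by apply: le_trans eta32; rewrite ler_peMl// mulr_ge0// ltW.
  split.
  - have -> : err_x n t - lin_x n t = (err_x n t - gx) + (gx - lin_x n t) by ring.
    by rewrite [e]splitr; apply: normD_le => //; exact: le_trans gxl small.
  - have -> : err_y n t - lin_y n t = (err_y n t - gy) + (gy - lin_y n t) by ring.
    by rewrite [e]splitr; apply: normD_le => //; exact: le_trans gyl small.
  have -> : err_theta n t - (slope t * lin_x n t + d2 alpha * lin_y n t) =
    (err_theta n t - (slope t * gx + d2 alpha * gy)) +
    (slope t * (gx - lin_x n t) + d2 alpha * (gy - lin_y n t)) by ring.
  rewrite [e]splitr; apply: normD_le => //; apply: le_trans eta32.
  have sl : `|slope t| <= D - `|d2 alpha|.
    apply: (@le_trans _ _ (D - `|d2 alpha| - 1)); last by rewrite lerBlDr lerDl.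
    have -> : D - `|d2 alpha| - 1 = (`|alpha| ^+ 2 + 1) * (2 * K) + (2 * `|alpha| + 1 + `|alpha| ^+ 2) * `|mu|.
      by rewrite /D; ring.
    by apply: norm_d1_le; apply: le_trans (normD_le (ltW t1) (ltW t2)) _; rewrite mulr2n mulrDl mul1r lerD.
  apply: le_trans (normD_le (normM_le sl gxl) (normM_le (lexx `|d2 alpha|) gyl)) _.
  by rewrite -mulrDl subrK.
have h0 : Pr (nonlinear e n) <= Pr TT + Pr VV.
  have aT := aU _ _ (aU _ _ aS1 aS2) (aU _ _ aS3 aS4).
  have aV := aU _ _ (aU _ _ aS5 aS6) (aU _ _ aS7 aS8).
  exact: (Pr_cover H aT aV (@adapted_nonlinear e n) sub).
apply: (le_trans h0).
rewrite [p]splitr; apply: lerD.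
  apply: le_trans (PU _ _ (aU _ _ aS1 aS2) (aU _ _ aS3 aS4)) _.
  apply: le_trans (lerD (PU _ _ aS1 aS2) (PU _ _ aS3 aS4)) _.
  exact: (sum4_le hK1 hK2 (hK3 n n0) (hK4 n n0)).
apply: le_trans (PU _ _ (aU _ _ aS5 aS6) (aU _ _ aS7 aS8)) _.
apply: le_trans (lerD (PU _ _ aS5 aS6) (PU _ _ aS7 aS8)) _.
exact: (sum4_le (hB1 n nB1) (hB2 n nB2) (hH1 n nH1) (hH2 n nH2)).
Qed.

End Linearization.

(** * Convergence in distribution *)

Section Assembly.
Context {R : realType} {d : measure_display} {T : measurableType d} (P : probability T R).
Context (alpha : R) (X0 : T -> nat) (eps : nat -> T -> nat) (xi : nat -> nat -> T -> nat).
Context (pi_ : nat -> R) (s theta : nat).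
Hypothesis H : inar_assumptions P alpha X0 eps xi.
Hypothesis H3X : (\int[P]_t (((X0 t)%:R : R) ^+ 3)%:E < +oo)%E.
Hypothesis H3e : (\int[P]_t (((eps 1%N t)%:R : R) ^+ 3)%:E < +oo)%E.
Hypothesis Hpi : stationary_dist alpha (eps_pmf P eps) pi_.
Hypothesis s0 : (0 < s)%N.

Local Notation int := (int P).
Local Notation X := (Xproc X0 eps xi).
Local Notation adapted := (adapted X).
Local Notation m_ := (moment pi_).
Local Notation mu := (mu_eps P eps).
Local Notation sigma2 := (sigma2_eps P eps).
Local Notation pS := (pS P alpha X0 eps xi).
Local Notation vanishing := (vanishing P X0 eps xi).
Local Notation Pr := (Pr P).
Local Notation limvar := (limvar P alpha eps pi_).
Local Notation lin_x := (lin_x P alpha X0 eps xi pi_ s).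
Local Notation lin_y := (lin_y P alpha X0 eps xi pi_ s).
Local Notation err_x := (err_x alpha X0 eps xi s theta).
Local Notation err_y := (err_y P X0 eps xi s theta).
Local Notation err_theta := (err_theta P alpha X0 eps xi s theta).
Local Notation nonlinear := (nonlinear P alpha X0 eps xi pi_ s theta).

Let dl := m_ 2 - m_ 1 ^+ 2.
Let dl0 : 0 < dl. Proof. exact: var_moment_gt0 H H3e Hpi. Qed.
Let amf (f : T -> R) k : adapted k f -> measurable_fun setT f.
Proof. exact: (adapted_mfun H). Qed.

(** i1, i2, i3 are the entries of M^-1, Aa, Ab, Ac those of A, and Bp, Bq, Br those of B = M^-1 A
    M^-1. *)
Let i1 : R := dl^-1.
Let i2 : R := - m_ 1 / dl.
Let i3 : R := m_ 2 / dl.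
Let Aa : R := alpha * (1 - alpha) * m_ 3 + sigma2 * m_ 2.
Let Ab : R := alpha * (1 - alpha) * m_ 2 + sigma2 * m_ 1.
Let Ac : R := alpha * (1 - alpha) * m_ 1 + sigma2.
Let Bp : R := i1 ^+ 2 * Aa + 2 * i1 * i2 * Ab + i2 ^+ 2 * Ac.
Let Bq : R := i1 * i2 * Aa + (i1 * i3 + i2 ^+ 2) * Ab + i2 * i3 * Ac.
Let Br : R := i2 ^+ 2 * Aa + 2 * i2 * i3 * Ab + i3 ^+ 2 * Ac.
Let form (c1 c2 : R) : R := Bp * c1 ^+ 2 + 2 * Bq * c1 * c2 + Br * c2 ^+ 2.

Lemma BmatE : Bmat alpha sigma2 pi_ = mx2 Bp Bq Bq Br.
Proof.
have e0 : m_ 2 * 1 - m_ 1 * m_ 1 = dl by rewrite /dl; ring.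
have AE : Amat alpha sigma2 pi_ = mx2 Aa Ab Ab Ac.
  apply/matrixP => i j; rewrite !mxE.
  case: i => [[|[|]]]//= ?; case: j => [[|[|]]]//= ?; rewrite /Aa /Ab /Ac; ring.
rewrite /Bmat AE invmx_mx2 e0 ?gt_eqF// !mx2M /Bp /Bq /Br /i1 /i2 /i3.
by congr mx2; field; rewrite gt_eqF.
Qed.

Lemma limvar_form c1 c2 : limvar (c1 * i1 + c2 * i2) (c1 * i2 + c2 * i3) = form c1 c2.
Proof. by rewrite /limvar /form /Bp /Bq /Br -/Aa -/Ab -/Ac; ring. Qed.

(** c^T A c = alpha (1 - alpha) E X (c1 X + c2)^2 + sigma^2 E (c1 X + c2)^2; the thinning part alone
    is positive, even for deterministic innovations. *)
Lemma limvar_gt0 c1 c2 : (c1 != 0) || (c2 != 0) -> 0 < limvar c1 c2.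
Proof.
move=> c0; have q0 := quad_moment_gt0 H H3X H3e Hpi c0.
have [al0 al1] := andP (alpha_bounds H).
have -> : limvar c1 c2 = alpha * (1 - alpha) * (c1 ^+ 2 * m_ 3 + 2 * c1 * c2 * m_ 2 + c2 ^+ 2 * m_ 1)
    + sigma2 * ((c1 * m_ 1 + c2) ^+ 2 + c1 ^+ 2 * dl) by rewrite /limvar /dl; ring.
rewrite ltr_wpDr//; last by rewrite mulr_gt0// mulr_gt0// subr_gt0.
by rewrite mulr_ge0 ?sigma2_ge0// addr_ge0 ?sqr_ge0// mulr_ge0 ?sqr_ge0// ltW.
Qed.

Lemma limvar_ge0 c1 c2 : 0 <= limvar c1 c2.
Proof.
have [c0|] := boolP ((c1 != 0) || (c2 != 0)); first exact: ltW (limvar_gt0 c0).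
by rewrite negb_or !negbK => /andP[/eqP-> /eqP->]; rewrite /limvar !expr0n /= !(mul0r, mulr0, addr0).
Qed.

Lemma form_gt0 c1 c2 : (c1 != 0) || (c2 != 0) -> 0 < form c1 c2.
Proof.
move=> c0; rewrite -limvar_form; apply: limvar_gt0; move: c0; apply: contraTT.
rewrite !negb_or !negbK => /andP[/eqP h1 /eqP h2].
have dn : dl != 0 by rewrite gt_eqF.
have c1E : c1 = m_ 2 * (c1 * i1 + c2 * i2) + m_ 1 * (c1 * i2 + c2 * i3).
  by rewrite /i1 /i2 /i3; move: dn; rewrite /dl => dn; field.
have c2E : c2 = m_ 1 * (c1 * i1 + c2 * i2) + (c1 * i2 + c2 * i3).
  by rewrite /i1 /i2 /i3; move: dn; rewrite /dl => dn; field.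
rewrite h1 h2 !mulr0 addr0 in c1E c2E.
by rewrite c1E c2E eqxx.
Qed.

Lemma Br_gt0 : 0 < Br.
Proof.
have := @form_gt0 0 1; rewrite oner_eq0 orbT => /(_ isT).
by rewrite /form expr0n expr1n /= !(mulr0, mul0r, mulr1) !add0r.
Qed.

(** The form at (Br, - Bq) is Br times the determinant. *)
Lemma Bdet_gt0 : 0 < Bp * Br - Bq ^+ 2.
Proof.
have r0 := Br_gt0; have := @form_gt0 Br (- Bq); rewrite (gt_eqF r0) => /(_ isT).
have -> : form Br (- Bq) = Br * (Bp * Br - Bq ^+ 2) by rewrite /form; ring.
by rewrite pmulr_rgt0.
Qed.

(** Cramer-Wold: a combination of [lin_x] and [lin_y] is the score in the direction M^-1 c, to which
    [clt_cos] applies with starting time s+1. *)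
Lemma linear_cf (u : T -> R) (c1 c2 phi : R) : adapted s.+1 u -> (forall t, `|u t| <= 1) ->
  (fun n : nat => \int[P]_t (u t * cos (c1 * lin_x n t + c2 * lin_y n t + phi))) @ \oo -->
  (\int[P]_t u t) * (expR (- (form c1 c2 / 2)) * cos phi).
Proof.
move=> au u1; rewrite -limvar_form.
rewrite (_ : (fun n => _) = (fun n : nat => \int[P]_t (u t *
    cos ((Num.sqrt n%:R)^-1 * pS (c1 * i1 + c2 * i2) (c1 * i2 + c2 * i3) s.+1 n t + phi)))).
  by apply: (clt_cos H H3X H3e Hpi) => //; exact: limvar_ge0.
apply/funext => n; apply: eq_Rintegral => t _; congr (_ * cos (_ + _)).
rewrite /lin_x /lin_y (pS_lin _ _ _ _ _ (m_ 2 - _)^-1) (pS_lin _ _ _ _ _ (- m_ 1 / _)) [in RHS]pS_lin.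
rewrite /rootn -/dl /i1 /i2 /i3; ring.
Qed.

Lemma lin_tight e : 0 < e -> exists K : R, 0 < K /\ forall n, (0 < n)%N ->
  Pr [set t | K <= `|lin_x n t|] <= e /\ Pr [set t | K <= `|lin_y n t|] <= e.
Proof.
move=> e0; have [K1 [K10 h1]] := pS_tight H H3X H3e i1 i2 s.+1 e0.
have [K2 [K20 h2]] := pS_tight H H3X H3e i2 i3 s.+1 e0.
have alx n : adapted n (lin_x n) by exact: adapted_lin_x.
have aly n : adapted n (lin_y n) by exact: adapted_lin_y.
have mono (f : T -> R) n (K K' : R) : adapted n f -> K <= K' ->
    Pr [set t | K' <= `|f t|] <= Pr [set t | K <= `|f t|].
  move=> af KK; have ad c : adapted n [set t | c <= `|f t|].
    by apply: (adapted_pred (fun x : R => c <= `|x|)).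
  apply: le_Rint; [exact: (int_indic H (ad K'))|exact: (int_indic H (ad K))|] => t.
  rewrite !indicE; have [/set_mem /= h|_] := boolP (t \in [set t0 | K' <= `|f t0|]); last by [].
  by rewrite mem_set//=; exact: le_trans h.
exists (K1 + K2); split; first exact: addr_gt0.
move=> n n0; split.
  by apply: le_trans (h1 n n0); apply: mono => //; rewrite lerDl ltW.
by apply: le_trans (h2 n n0); apply: mono => //; rewrite lerDr ltW.
Qed.

Let iN e n : int (fun t => \1_(nonlinear e n) t : R).
Proof. by apply: (int_indic H (k := maxn n s.+1)); exact: adapted_nonlinear. Qed.

Let iLx K n : int (fun t => \1_[set t | K <= `|lin_x n t|] t : R).
Proof.
by apply: (int_indic H (k := n)); apply: (adapted_pred (fun x : R => K <= `|x|)); exact: adapted_lin_x.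
Qed.

Let iLy K n : int (fun t => \1_[set t | K <= `|lin_y n t|] t : R).
Proof.
by apply: (int_indic H (k := n)); apply: (adapted_pred (fun x : R => K <= `|x|)); exact: adapted_lin_y.
Qed.

(** Where u is nonzero and three bad events of probability at most e / 4 are avoided, Z is bounded
    by the linear part plus one. *)
Lemma tight_of_linear (u : T -> R) (Z : nat -> T -> R * R) (C : R) : 0 <= C ->
  (forall t, 0 <= u t <= 1) -> int u ->
  (forall n, measurable_fun setT (Z n)) ->
  (forall (K : R) n t, 0 <= K -> u t != 0 -> ~ nonlinear 1 n t -> `|lin_x n t| <= K -> `|lin_y n t| <= K ->
     `|(Z n t).1| <= C * K + 1 /\ `|(Z n t).2| <= C * K + 1) ->
  forall e : R, 0 < e -> exists (K : R) N, forall n, (N <= n)%N -> wint P u (Z n) (offbox K) <= e.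
Proof.
move=> C0 u01 iu mZ hZ e e0.
have e40 : 0 < e / 4 by rewrite divr_gt0.
have [K [K0 hK]] := lin_tight e40.
have [aN vN] := estimator_linear theta H H3X H3e Hpi s0 (@ltr01 R).
have [N hN] := vN _ e40.
exists (C * K + 1), (maxn N 1) => n; rewrite geq_max => /andP[Nn n0].
have [hx hy] := hK n n0; have hn := hN n Nn.
apply: (@le_trans _ _ (\int[P]_t (\1_(nonlinear 1 n) t + (\1_[set t | K <= `|lin_x n t|] t +
   \1_[set t | K <= `|lin_y n t|] t)))).
  apply: le_Rint.
  - exact: (integrable_wint iu (mZ n) (bmeas_offbox _)).
  - by apply: intD; [exact: iN|apply: intD; [exact: iLx|exact: iLy]].
  move=> t; have [/eqP ->|ut] := boolP (u t == 0); first by rewrite mul0r !addr_ge0.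
  have /andP[u0 u1] := u01 t.
  have bd : u t * offbox (C * K + 1) (Z n t) <= 1.
    by rewrite mulr_ile1// ?offbox_ge0// offboxE; case: ifP.
  rewrite !indicE; have [_|/negP nb] := boolP (t \in nonlinear 1 n).
    by rewrite (le_trans bd)// lerDl addr_ge0.
  have [_|/negP nx] := boolP (t \in [set t | K <= `|lin_x n t|]).
    by rewrite (le_trans bd)// add0r lerDl.
  have [_|/negP ny] := boolP (t \in [set t | K <= `|lin_y n t|]).
    by rewrite (le_trans bd)// !add0r.
  have tn : ~ nonlinear 1 n t by move=> h; apply: nb; rewrite mem_set.
  have tx : `|lin_x n t| <= K by rewrite leNgt; apply/negP => h; apply: nx; rewrite mem_set//; exact: ltW.
  have ty : `|lin_y n t| <= K by rewrite leNgt; apply/negP => h; apply: ny; rewrite mem_set//; exact: ltW.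
  have [z1 z2] := hZ K n t (ltW K0) ut tn tx ty.
  by rewrite offboxE z1 z2 mulr0 !add0r.
rewrite RintD; [|exact: iN|by apply: intD; [exact: iLx|exact: iLy]].
rewrite RintD; [|exact: iLx|exact: iLy].
by move: hx hy hn; rewrite /Pr => hx hy hn; lra.
Qed.

Let notnonlinear e n t : ~ nonlinear e n t -> [/\ `|err_x n t - lin_x n t| <= e,
  `|err_y n t - lin_y n t| <= e &
  `|err_theta n t - (d1 alpha mu ((Yproc X0 eps xi s theta s.-1 t)%:R + (Yproc X0 eps xi s theta s.+1 t)%:R) * lin_x n t
     + d2 alpha * lin_y n t)| <= e].
Proof. exact: contrapT. Qed.

Let aex n : adapted (maxn n s.+1) (err_x n). Proof. exact: adapted_err_x. Qed.
Let aey n : adapted (maxn n s.+1) (err_y n). Proof. exact: adapted_err_y. Qed.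
Let aet n : adapted (maxn n s.+1) (err_theta n). Proof. exact: adapted_err_theta. Qed.
Let alx n : adapted (maxn n s.+1) (lin_x n).
Proof. by apply: adaptedW (@adapted_lin_x _ _ _ _ _ _ _ _ _ _ n); rewrite leq_maxl. Qed.
Let aly n : adapted (maxn n s.+1) (lin_y n).
Proof. by apply: adaptedW (@adapted_lin_y _ _ _ _ _ _ _ _ _ _ n); rewrite leq_maxl. Qed.

Lemma vanishing_linear (V : nat -> T -> R) (u : T -> R) (C : R) : 0 <= C -> adapted s.+1 u ->
  (forall n, adapted (maxn n s.+1) (V n)) ->
  (forall e n t, u t != 0 -> ~ nonlinear e n t -> `|V n t| <= C * e) ->
  forall e, 0 < e -> vanishing (fun n => [set t | u t != 0 /\ ~ `|V n t| <= e]).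
Proof.
move=> C0 au aV hV e e0.
have e10 : 0 < e / (C + 1) by rewrite divr_gt0// ltr_wpDl.
have vN := estimator_linear theta H H3X H3e Hpi s0 e10.
apply: (vanishing_sub H vN).
  move=> n; exists (maxn n s.+1); apply: adapted_setP => t t' h /=.
  have h' i : (i <= s.+1)%N -> X i t = X i t' by move=> is1; apply: h; rewrite leq_max is1 orbT.
  by rewrite (au t t' h') (aV n t t' h).
exists 0%N => n _ t /= [ut nV]; apply: contrapT => hn; apply: nV.
apply: le_trans (hV _ _ _ ut hn) _.
rewrite mulrC -mulrA ler_piMr ?(ltW e0)// mulrC ler_pdivrMr ?mul1r ?lerDl// ltr_wpDl//.
Qed.

Lemma errors_cvg_normal : cvg_dist_normal2 P (fun n t => (err_x n t, err_y n t)) (Bmat alpha sigma2 pi_).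
Proof.
move=> f [cf [M fM]]; rewrite BmatE.
have r0 := Br_gt0; have D0 := Bdet_gt0.
pose Z n t := (err_x n t, err_y n t).
have mZ n : measurable_fun setT (Z n).
  by apply: measurable_fun_pair; [exact: amf (@aex n)|exact: amf (@aey n)].
have idm : measurable_fun setT (@id (R * R)) by exact: measurable_id.
have i1_ : int (fun=> 1) by exact: int_cst.
have iw := integrable_gauss2_pdf r0 D0.
have w0 x := gauss2_pdf_ge0 r0 D0 x.
pose J_ n := wint P (fun=> 1) (Z n).
pose J := wint (@lebesgue_measure R \x @lebesgue_measure R)%E (gauss2_pdf (mx2 Bp Bq Bq Br)) id.
have pJn n : poslin (J_ n) by exact: (poslin_wint (fun=> ler01) i1_ (mZ n)).
have pJ : poslin J.
  apply: poslin_wint.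
  exact: w0.
  exact: iw.
  exact: idm.
have one_adapted k : adapted k (fun=> 1 : R) by [].
have cvc c1 c2 phi : (fun n => J_ n (cosf c1 c2 phi)) @ \oo --> J (cosf c1 c2 phi).
  rewrite /J /wint gauss2_cf//.
  have lim : (\int[P]_t (fun=> 1) t) * (expR (- (form c1 c2 / 2)) * cos phi) =
    expR (- ((Bp * c1 ^+ 2 + 2 * Bq * c1 * c2 + Br * c2 ^+ 2) / 2)) * cos phi.
    by rewrite Rint_cst mul1r.
  rewrite -lim; apply: (@cvg_cos_approx _ _ _ P alpha X0 eps xi H s.+1 (fun=> 1)
    (fun n t => c1 * err_x n t + c2 * err_y n t) (fun n t => c1 * lin_x n t + c2 * lin_y n t)).
  - exact: one_adapted.
  - by move=> t; rewrite normr1.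
  - by move=> n; exists (maxn n s.+1) => t t' h; rewrite (aex h) (aey h).
  - by move=> n; exists (maxn n s.+1) => t t' h; rewrite (alx h) (aly h).
  - have C0 : 0 <= `|c1| + `|c2| by rewrite addr_ge0.
    apply: (@vanishing_linear (fun n t => c1 * err_x n t + c2 * err_y n t - (c1 * lin_x n t + c2 * lin_y n t)) (fun=> 1) _ C0) => //.
      by move=> n t t' h; rewrite (aex h) (aey h) (alx h) (aly h).
    move=> e n t _ /notnonlinear[h1 h2 _].
    have -> : c1 * err_x n t + c2 * err_y n t - (c1 * lin_x n t + c2 * lin_y n t) =
      c1 * (err_x n t - lin_x n t) + c2 * (err_y n t - lin_y n t) by ring.
    by rewrite mulrDl; apply: normD_le; exact: normM_le.
  - by apply: linear_cf => // t; rewrite normr1.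
have tn e : 0 < e -> exists K N, forall n, (N <= n)%N -> J_ n (offbox K) <= e.
  apply: (@tight_of_linear (fun=> 1) Z 1) => //; first by move=> t; rewrite ler01 lexx.
  move=> K n t K0 _ /notnonlinear[h1 h2 _] hx hy; rewrite mul1r /Z /=; split.
    have -> : err_x n t = lin_x n t + (err_x n t - lin_x n t) by ring.
    exact: normD_le.
  have -> : err_y n t = lin_y n t + (err_y n t - lin_y n t) by ring.
  exact: normD_le.
have tl e : 0 < e -> exists K, J (offbox K) <= e.
  by apply: wint_tight; [exact: w0|exact: iw|exact: idm].
have bf : exists M, forall x, `|f x| <= M by exists M.
have key := levy_continuity pJn pJ cvc tn tl cf bf.
have bmf := measurable_continuous2 cf bf.
rewrite (_ : (fun n => _) = EFin \o (fun n => J_ n f)); last first.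
  apply/funext => n /=; rewrite /J_ /wint -EFin_Rint; last exact: (integrable_wint i1_ (mZ n) bmf).
  by apply: eq_integral => t _; rewrite mul1r.
rewrite [X in _ --> X](_ : _ = (J f)%:E).
  by apply/cvg_EFin; [exact: nearW|exact: key].
rewrite /J /wint /Rintegral fineK; last exact: (integrable_fin_num measurableT (integrable_wint iw idm bmf)).
by apply: eq_integral => x _; rewrite mulrC.
Qed.

(** * The outlier size, given its two neighbours *)

Section Conditional.
Variables (k1 k2 : nat).
Let E : set T := [set t | Yproc X0 eps xi s theta s.-1 t = k1 /\ Yproc X0 eps xi s theta s.+1 t = k2].
Hypothesis PE0 : (0 < P E)%E.
Let D1 : R := d1 alpha mu (k1%:R + k2%:R).
Let D2 : R := d2 alpha.
Let v : R := form D1 D2.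

(** D2 is nonzero since alpha < 1, so the limiting normal law is nondegenerate. *)
Let v0 : 0 < v.
Proof.
apply: form_gt0; apply/orP; right; rewrite /D2 /d2 oppr_eq0 mulf_neq0 ?invr_eq0 ?gt_eqF ?onesqr_gt0//.
by have /andP[_ al1] := alpha_bounds H; rewrite subr_gt0.
Qed.

Let aE : adapted s.+1 E.
Proof.
apply: adapted_setP => t t' h; rewrite /E /= /Yproc !h//.
by rewrite (leq_trans (leq_pred s)).
Qed.

Lemma theta_error_cvg_normal : cond_cvg_dist_normal P E err_theta v.
Proof.
move=> g [cg [M gM]].
have mE : measurable E := measurable_adapted H aE.
pose u (t : T) : R := \1_E t.
pose pE := fine (P E).
have PEfin : P E = pE%:E by rewrite fineK// fin_num_measure.
have pE0 : 0 < pE by rewrite -lte_fin -PEfin.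
have iu : int u := int_indic H aE.
have Iu : \int[P]_t u t = pE by rewrite /Rintegral /u integral_indic// setIT.
have au : adapted s.+1 u := adapted_indic aE.
have u0 t : 0 <= u t by rewrite /u indicE.
have u01 t : 0 <= u t <= 1 by rewrite u0 -[leLHS]ger0_norm// norm_indic.
have uE t : u t != 0 -> E t.
  by rewrite /u indicE; have [/set_mem//|] := boolP (t \in E); rewrite eqxx.
pose sd := Num.sqrt v.
have sd0 : 0 < sd by rewrite sqrtr_gt0.
(* The line is embedded in the plane with second coordinate zero, so that the continuity theorem of
   the plane applies. *)
pose Z n t : R * R := (err_theta n t, 0).
have mZ n : measurable_fun setT (Z n) by apply: measurable_fun_pair => //; exact: amf (@aet n).
(* The limit carries the mass of the conditioning event; both sides are divided by it at the end. *)
pose w (x : R) : R := pE * normal_pdf 0 sd x.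
have w0 x : 0 <= w x by rewrite mulr_ge0 ?(ltW pE0)// normal_pdf_ge0.
have iw : (@lebesgue_measure R).-integrable setT (EFin \o w).
  exact: (@integrableZl _ _ _ _ setT measurableT pE _ (integrable_normal_pdf 0 sd)).
pose Z' (x : R) : R * R := (x, 0).
have mZ' : measurable_fun setT Z' by apply: measurable_fun_pair.
pose J_ n := wint P u (Z n).
pose J := wint (@lebesgue_measure R) w Z'.
have pJn n : poslin (J_ n) by exact: (poslin_wint u0 iu (mZ n)).
have pJ : poslin J.
  apply: poslin_wint.
  exact: w0.
  exact: iw.
  exact: mZ'.
have cvc c1 c2 phi : (fun n => J_ n (cosf c1 c2 phi)) @ \oo --> J (cosf c1 c2 phi).
  have -> : J (cosf c1 c2 phi) = (\int[P]_t u t) * (expR (- (form (c1 * D1) (c1 * D2) / 2)) * cos phi).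
    rewrite Iu /J /wint.
    transitivity (\int[@lebesgue_measure R]_x (pE * (normal_pdf 0 sd x * cos (c1 * x + phi)))).
      by apply: eq_Rintegral => x _; rewrite /w /cosf /= mulr0 addr0 mulrA.
    rewrite RintegralZl//; last first.
      apply: (le_integrable _ _ _ (integrable_normal_pdf 0 sd)) => //.
      - apply/measurable_EFinP; apply: measurable_funM; first exact: measurable_normal_pdf.
        have := measurable_cos_affine 0 c1 phi.
        by congr measurable_fun; apply/funext => x; rewrite subr0.
      - by move=> x _ /=; rewrite lee_fin normrM ler_piMr// cos_max.
    have sv : sd ^+ 2 = v by rewrite sqr_sqrtr// ltW.
    rewrite normal_cf// sv mulr0 add0r.
    have -> : form (c1 * D1) (c1 * D2) = v * c1 ^+ 2 by rewrite /v /form; ring.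
    by [].
  have e1 n : J_ n (cosf c1 c2 phi) = \int[P]_t (u t * cos (c1 * err_theta n t + phi)).
    by apply: eq_Rintegral => t _; rewrite /cosf /= mulr0 addr0.
  under eq_fun do rewrite e1.
  apply: (@cvg_cos_approx _ _ _ P alpha X0 eps xi H s.+1 u
    (fun n t => c1 * err_theta n t) (fun n t => c1 * D1 * lin_x n t + c1 * D2 * lin_y n t)) => //.
  - by move=> t; exact: norm_indic.
  - by move=> n; exists (maxn n s.+1) => t t' h; rewrite (aet h).
  - by move=> n; exists (maxn n s.+1) => t t' h; rewrite (alx h) (aly h).
  - apply: (@vanishing_linear (fun n t => c1 * err_theta n t - (c1 * D1 * lin_x n t + c1 * D2 * lin_y n t)) u _ (normr_ge0 c1)) => //.
      by move=> n t t' h; rewrite (aet h) (alx h) (aly h).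
    move=> e n t /uE[y1 y2] /notnonlinear[_ _]; rewrite y1 y2 -/D1 -/D2 => h.
    have -> : c1 * err_theta n t - (c1 * D1 * lin_x n t + c1 * D2 * lin_y n t) =
      c1 * (err_theta n t - (D1 * lin_x n t + D2 * lin_y n t)) by ring.
    exact: normM_le.
  - by apply: linear_cf => // t; exact: norm_indic.
have tn e : 0 < e -> exists K N, forall n, (N <= n)%N -> J_ n (offbox K) <= e.
  have C0 : 0 <= `|D1| + `|D2| by rewrite addr_ge0.
  apply: (@tight_of_linear u Z _ C0) => //.
  move=> K n t K0 /uE[y1 y2] /notnonlinear[_ _]; rewrite y1 y2 -/D1 -/D2 => h hx hy; split; rewrite /Z /=.
    have -> : err_theta n t = (D1 * lin_x n t + D2 * lin_y n t) + (err_theta n t - (D1 * lin_x n t + D2 * lin_y n t)) by ring.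
    by apply: normD_le => //; rewrite mulrDl; apply: normD_le; exact: normM_le.
  by rewrite normr0 addr_ge0// mulr_ge0.
have tl e : 0 < e -> exists K, J (offbox K) <= e.
  by apply: wint_tight; [exact: w0|exact: iw|exact: mZ'].
pose f (x : R * R) : R := g x.1.
have cf : continuous f.
  move=> x; have cx : (fun q : R * R => q.1) @ x --> x.1 by exact: cvg_fst.
  exact: (continuous_cvg _ (cg x.1) cx).
have bf : exists M, forall x, `|f x| <= M by exists M => x; exact: gM.
have key := levy_continuity pJn pJ cvc tn tl cf bf.
have bmf := measurable_continuous2 cf bf.
have mg : measurable_fun setT g by exact: continuous_measurable_fun.
rewrite (_ : (fun n => _) = EFin \o (fun n => J_ n f * pE^-1)); last first.
  apply/funext => n /=; rewrite EFinM; congr (_ * _)%E.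
  rewrite /J_ /wint -EFin_Rint; last exact: (integrable_wint iu (mZ n) bmf).
  rewrite integral_mkcond; apply: eq_integral => t _.
  by rewrite patchE /u indicE /f /Z /=; case: ifP => _; rewrite ?mul1r ?mul0r.
rewrite [X in _ --> X](_ : _ = (J f * pE^-1)%:E).
  by apply/cvg_EFin; [exact: nearW|apply: cvgM; [exact: key|exact: cvg_cst]].
have ig : (normal_prob 0 sd).-integrable setT (EFin \o g).
  apply: (@le_integrable _ _ _ (normal_prob 0 sd) setT measurableT _ (EFin \o cst M)).
  - exact/measurable_EFinP.
  - by move=> x _ /=; rewrite lee_fin; apply: le_trans (gM x) _; exact: ler_norm.
  - exact: finite_measure_integrable_cst.
rewrite -/sd (integral_normal_prob ig).
have ign : (@lebesgue_measure R).-integrable setT (EFin \o (fun x => normal_pdf 0 sd x * g x)).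
  apply: (le_integrable measurableT _ _ (@integrableZl _ _ _ _ setT measurableT M _ (integrable_normal_pdf 0 sd))).
    by apply/measurable_EFinP; apply: measurable_funM => //; exact: measurable_normal_pdf.
  move=> x _ /=; rewrite lee_fin !normrM mulrC ler_wpM2r//.
  by apply: le_trans (gM x) _; exact: ler_norm.
have -> : J f * pE^-1 = \int[@lebesgue_measure R]_x (normal_pdf 0 sd x * g x).
  rewrite /J /wint.
  transitivity ((\int[@lebesgue_measure R]_x (pE * (normal_pdf 0 sd x * g x))) * pE^-1).
    by congr (_ * _); apply: eq_Rintegral => x _; rewrite /w /f /Z' mulrA.
  by rewrite RintegralZl// mulrC mulKf// gt_eqF.
rewrite /Rintegral fineK; last exact: (integrable_fin_num measurableT ign).
by apply: eq_integral => x _; rewrite mulrC EFinM.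
Qed.

Let dv : 'cV[R]_2 := ((1 + alpha ^+ 2) ^+ 2)^-1 *:
  colv ((alpha ^+ 2 - 1) * (k1%:R + k2%:R) + (2 * alpha + 1 - alpha ^+ 2) * mu,
        - ((1 + alpha ^+ 2) * (1 - alpha))).

Lemma slope_form : (dv^T *m Bmat alpha sigma2 pi_ *m dv) ord0 ord0 = v.
Proof.
have a0 : 1 + alpha ^+ 2 != 0 by rewrite gt_eqF// onesqr_gt0.
have -> : dv = colv (D1, D2).
  apply/matrixP => i j; rewrite !mxE /=; case: i => [[|[|]]]//= _; rewrite /D1 /d1 /D2 /d2.
    by rewrite mulrC.
  by field.
by rewrite BmatE mx2_form /v /form; ring.
Qed.

End Conditional.

End Assembly.

Theorem theorem3p3p2 (R : realType) (d : measure_display) (T : measurableType d)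
  (P : probability T R) (alpha : R) (X0 : T -> nat) (eps : nat -> T -> nat)
  (xi : nat -> nat -> T -> nat) (s theta : nat) (pi_ : nat -> R) :
  inar_assumptions P alpha X0 eps xi ->
  (\int[P]_t (((X0 t)%:R : R) ^+ 3)%:E < +oo)%E ->
  (\int[P]_t (((eps 1%N t)%:R : R) ^+ 3)%:E < +oo)%E ->
  (0 < s)%N -> (0 < theta)%N ->
  stationary_dist alpha (eps_pmf P eps) pi_ ->
  let mu := mu_eps P eps in
  let B := Bmat alpha (sigma2_eps P eps) pi_ in
  let Y (k : nat) (t : T) : R := (Yproc X0 eps xi s theta k t)%:R in
  let est (n : nat) (t : T) : R * R * R := cls_est n s (fun k => Y k t) in
  cvg_dist_normal2 P
    (fun n t => (Num.sqrt (n%:R) * ((est n t).1.1 - alpha),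
                 Num.sqrt (n%:R) * ((est n t).1.2 - mu))) B
  /\
  (forall m1 m2 : nat,
     let E := [set t | Yproc X0 eps xi s theta s.-1 t = m1 /\
                       Yproc X0 eps xi s theta s.+1 t = m2] in
     (0 < P E)%E ->
     let dv : 'cV[R]_2 :=
       ((1 + alpha ^+ 2) ^+ 2)^-1 *:
       colv ((alpha ^+ 2 - 1) * (m1%:R + m2%:R) + (2 * alpha + 1 - alpha ^+ 2) * mu,
             - ((1 + alpha ^+ 2) * (1 - alpha))) in
     cond_cvg_dist_normal P E
       (fun n t => Num.sqrt (n%:R) *
          ((est n t).2 - (Y s t - alpha / (1 + alpha ^+ 2) * (Y s.-1 t + Y s.+1 t)
                          - (1 - alpha) / (1 + alpha ^+ 2) * mu)))
       ((dv^T *m B *m dv) ord0 ord0)).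
Proof.
move=> H H3X H3e s0 _ Hpi mu B Y est; split.
  exact: (errors_cvg_normal theta H H3X H3e Hpi s0).
move=> m1 m2 E PE dv; rewrite (slope_form H H3e Hpi).
exact: (theta_error_cvg_normal H H3X H3e Hpi s0 PE).
Qed.
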